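(* Let $\{U_n\}_{n\in\mathbb{Z}}$ be functions on $\mathbb{R}^2$ satisfying the linearized equation $$\frac14\Delta U_{n}=e^{Q_{n-1}-Q_{n}}\left(U_{n-1}-U_{n}\right)-e^{Q_{n}-Q_{n+1}}\left(U_{n}-U_{n+1}\right)\quad\text{in }\mathbb{R}^2,\ n\in\mathbb{Z}.$$ Suppose that $U_{n+1}(x,y)=U_{n}\left(x+\frac{1}{2\sqrt{2}},y\right)$ for all $n$ and $(x,y)$, and that $$U_{n}(x,y)\to 0\quad\text{as }x^{2}+y^{2}\to+\infty.$$ Then there are constants $c_1,c_2$ such that $$U_{n}=c_{1}\,\partial_{x}Q_{n}+c_{2}\,\partial_{y}Q_{n}\quad\text{for all } n\in\mathbb{Z}.$$
   Context: $\Delta=\partial_x^2+\partial_y^2$ on $\mathbb{R}^2$. For $n\in\mathbb{Z}$, $$Q_{n}(x,y)=\ln\frac{\frac14+(n-1+2\sqrt2x)^2+4y^2}{\frac14+(n+2\sqrt2x)^2+4y^2},$$ which is a solution of the $2+1$ Toda lattice $\frac14\Delta q_n=e^{q_{n-1}-q_n}-e^{q_n-q_{n+1}}$, $n\in\mathbb{Z}$, with $Q_{n+1}(x,y)=Q_n(x+\frac{1}{2\sqrt2},y)$. *)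

(* Defs.v *)
From Stdlib Require Import Reals ZArith.
From Coquelicot Require Import Coquelicot.

Open Scope R_scope.

Definition Q (n : Z) (x y : R) : R :=
  ln ((1 / 4 + (IZR n - 1 + 2 * sqrt 2 * x) ^ 2 + 4 * y ^ 2) /
      (1 / 4 + (IZR n + 2 * sqrt 2 * x) ^ 2 + 4 * y ^ 2)).

(* [Derive] is a junk value where the derivative does not exist, so these
   operators are meant for functions with enough regularity. *)
Definition d_x (f : R -> R -> R) : R -> R -> R := partial_derive 1 0 f.
Definition d_y (f : R -> R -> R) : R -> R -> R := partial_derive 0 1 f.
Definition Laplacian (f : R -> R -> R) (x y : R) : R :=
  partial_derive 2 0 f x y + partial_derive 0 2 f x y.

(* Coquelicot's [ex_diff_n f 2] at a point asks that [f], its first and its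
   second iterated partial derivatives exist and are jointly continuous there;
   required at every point, this is C^2 regularity on the plane. *)
Definition is_C2 (f : R -> R -> R) : Prop := forall x y : R, ex_diff_n f 2 x y.

(* A classical (C^2) solution, so that [Laplacian] is meaningful. *)
Definition linearized_Toda_solution (U : Z -> R -> R -> R) : Prop :=
  (forall n : Z, is_C2 (U n)) /\
  forall (n : Z) (x y : R),
    1 / 4 * Laplacian (U n) x y =
      exp (Q (n - 1) x y - Q n x y) * (U (n - 1)%Z x y - U n x y) -
      exp (Q n x y - Q (n + 1) x y) * (U n x y - U (n + 1)%Z x y).

(* The filter "x^2 + y^2 -> +oo" on the plane. *)
Definition plane_infty : (R * R -> Prop) -> Prop :=
  fun P => exists M : R,
    forall x y : R, M < x ^ 2 + y ^ 2 -> P (x, y).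

Definition vanishes_at_infty (f : R -> R -> R) : Prop :=
  filterlim (fun p : R * R => f (fst p) (snd p)) plane_infty (locally 0).

(* Main.v *)
(* Put s = 2 sqrt 2 x, t = 2 y, tau = 1/4 + s^2 + t^2, V = tau(s+1,t) tau(s-1,t) / tau^2, and let T be
   the shift s -> s + 1. The family U_n is a single function u(s,t) with
     2 u_ss + u_tt = (1 - T^-1) (V (T - 1) u).

   Caccioppoli's inequality on boxes of size comparable to the distance r from the origin, iterated
   until the nonlocal error is exhausted, together with Sobolev and Landau inequalities, upgrades
   u = o(1) to D^alpha u = o(r^-|alpha|). Summing over translates gives b with u = (T^-1 - 1) b and
   2 b_ss + b_tt = V del^2 b, where del = T^(1/2) - T^(-1/2).

   For eta = tau b this equation becomes HH eta = 0, an operator whose coefficients are quadratic in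
   (s,t). With L0 = 2 d_s^2 + d_t^2 - del^2, mu = (T^(1/2) + T^(-1/2)) / 2 and CC = d_s mu - del, one has
     L0 HH = tau L0^2 - 2 (del^2 d_t^2 + 8 CC^2).
   Multiplying tau L0^2 eta = 2 (del^2 d_t^2 + 8 CC^2) eta by L0^2 eta and integrating by parts over large
   squares yields a sum of squares that dominates the integral of t^2 (L0^2 eta)^2; hence L0^2 eta = 0.
   A Liouville theorem for L0 makes the fourth derivatives of eta vanish, and the cubic polynomials in
   the kernel of HH are tau (affine) + c1 s + c2 t. The decay of u leaves
   u = (T^-1 - 1) ((c1 s + c2 t) / tau), which is the span of the derivatives of Q. *)

Require Import Defs.
From Stdlib Require Import Reals ZArith Lra Lia FunctionalExtensionality.
From Coquelicot Require Import Coquelicot.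

Open Scope R_scope.

(** * Smooth functions of two variables *)

(** With [s = n + 2 sqrt 2 x] and [t = 2 y], [Q n] is [(T^-1 - 1) ln tau]; so [b] plays the part of
    a variation of [ln tau], and [eta] that of a variation of [tau]. [HH] is the linearization at
    [f = tau] of the bilinear form [2 (f f_ss - f_s^2) + f f_tt - f_t^2 - (T f) (T^-1 f) + f^2]; its
    coefficients are polynomials because [tau] is one, which makes the commutator with [L0]
    computable. Two obstacles shape the estimates. The energy identity is critical: with [u = o(1)]
    and one power of [r] gained per derivative, the worst flux is just o(1/r) through a boundary of
    length O(r), and O in place of o would not close it. Moreover, second derivatives of [b] of size
    o(1/r) still allow a logarithmic drift of [dT b]. Therefore [b] is renormalized at each scale
    [r] by a function [a + c t], and the symbol classes concern families indexed by [r]. The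
    renormalization is harmless: [tau (a + c t)] is annihilated by [HH], by [L0 L0] and by all
    fourth derivatives. *)

Definition dS (f : R -> R -> R) : R -> R -> R := fun s t => Derive (fun z => f z t) s.
Definition dT (f : R -> R -> R) : R -> R -> R := fun s t => Derive (fun z => f s z) t.
Definition C0 (f : R -> R -> R) : Prop := forall s t, continuity_2d_pt f s t.
Definition diffS (f : R -> R -> R) : Prop := forall s t, ex_derive (fun z => f z t) s.
Definition diffT (f : R -> R -> R) : Prop := forall s t, ex_derive (fun z => f s z) t.

(** Modelled on Coquelicot's [ex_diff_n] required at every point, with global predicates instead of
    pointwise ones, so that closure under sums, products, inverses and shifts is a plain induction
    on [n]. *)
Fixpoint Ck (n : nat) (f : R -> R -> R) : Prop :=
  C0 f /\
  match n with
  | O => True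
  | S m => diffS f /\ diffT f /\ Ck m (dS f) /\ Ck m (dT f)
  end.

Definition smooth (f : R -> R -> R) : Prop := forall n, Ck n f.

Definition sh (c : R) (f : R -> R -> R) : R -> R -> R := fun s t => f (s + c) t.

Lemma fun2_ext (f g : R -> R -> R) : (forall s t, f s t = g s t) -> f = g.
Proof. intros H; do 2 (apply functional_extensionality; intro); apply H. Qed.

Lemma Ck_C0 n f : Ck n f -> C0 f.
Proof. destruct n; intros H; apply H. Qed.

Lemma Ck_pred n f : Ck (S n) f -> Ck n f.
Proof.
  revert f; induction n as [|n IH]; intros f H.
  - split; [apply H | exact I].
  - destruct H as (H0 & H1 & H2 & H3 & H4).
    split; [exact H0|]. repeat split; auto.
Qed.

Lemma Ck_le n m f : (m <= n)%nat -> Ck n f -> Ck m f.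
Proof. intros H; induction H; auto. intros; apply IHle, Ck_pred; auto. Qed.

Lemma smooth_C0 f : smooth f -> C0 f.
Proof. intros H; apply (Ck_C0 0), H. Qed.
Lemma smooth_diffS f : smooth f -> diffS f.
Proof. intros H; apply (H 1%nat). Qed.
Lemma smooth_diffT f : smooth f -> diffT f.
Proof. intros H; apply (H 1%nat). Qed.
Lemma smooth_dS f : smooth f -> smooth (dS f).
Proof. intros H n; apply (H (S n)). Qed.
Lemma smooth_dT f : smooth f -> smooth (dT f).
Proof. intros H n; apply (H (S n)). Qed.
#[global] Hint Resolve smooth_C0 smooth_diffS smooth_diffT smooth_dS smooth_dT : sm.

Lemma is_derive_dS f s t : diffS f -> is_derive (fun z => f z t) s (dS f s t).
Proof. intros H; apply Derive_correct, H. Qed.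
Lemma is_derive_dT f s t : diffT f -> is_derive (fun z => f s z) t (dT f s t).
Proof. intros H; apply Derive_correct, H. Qed.

Lemma dS_unique f g : (forall s t, is_derive (fun z => f z t) s (g s t)) -> dS f = g.
Proof. intros H; apply fun2_ext; intros; apply is_derive_unique, H. Qed.
Lemma dT_unique f g : (forall s t, is_derive (fun z => f s z) t (g s t)) -> dT f = g.
Proof. intros H; apply fun2_ext; intros; apply is_derive_unique, H. Qed.
Lemma diffS_intro f g : (forall s t, is_derive (fun z => f z t) s (g s t)) -> diffS f.
Proof. intros H s t; eexists; apply H. Qed.
Lemma diffT_intro f g : (forall s t, is_derive (fun z => f s z) t (g s t)) -> diffT f.
Proof. intros H s t; eexists; apply H. Qed.

Lemma isS_plus f g s t : diffS f -> diffS g ->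
  is_derive (fun z => f z t + g z t) s (dS f s t + dS g s t).
Proof. intros; apply (is_derive_plus (fun z => f z t) (fun z => g z t)); apply is_derive_dS; auto. Qed.
Lemma isT_plus f g s t : diffT f -> diffT g ->
  is_derive (fun z => f s z + g s z) t (dT f s t + dT g s t).
Proof. intros; apply (is_derive_plus (fun z => f s z) (fun z => g s z)); apply is_derive_dT; auto. Qed.
Lemma isS_mult f g s t : diffS f -> diffS g ->
  is_derive (fun z => f z t * g z t) s (dS f s t * g s t + f s t * dS g s t).
Proof.
  intros; apply (is_derive_mult (fun z => f z t) (fun z => g z t));
  try (apply is_derive_dS; auto). intros; apply Rmult_comm.
Qed.
Lemma isT_mult f g s t : diffT f -> diffT g ->
  is_derive (fun z => f s z * g s z) t (dT f s t * g s t + f s t * dT g s t).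
Proof.
  intros; apply (is_derive_mult (fun z => f s z) (fun z => g s z));
  try (apply is_derive_dT; auto). intros; apply Rmult_comm.
Qed.
Lemma isS_inv f s t : diffS f -> f s t <> 0 ->
  is_derive (fun z => / f z t) s (- dS f s t * / f s t * / f s t).
Proof.
  intros H H0; evar_last.
  - apply is_derive_inv; [apply is_derive_dS; auto|auto].
  - simpl; field; auto.
Qed.
Lemma isT_inv f s t : diffT f -> f s t <> 0 ->
  is_derive (fun z => / f s z) t (- dT f s t * / f s t * / f s t).
Proof.
  intros H H0; evar_last.
  - apply (is_derive_inv (fun z => f s z)); [apply is_derive_dT; auto|auto].
  - simpl; field; auto.
Qed.
Lemma isS_sh f c s t : diffS f -> is_derive (fun z => sh c f z t) s (sh c (dS f) s t).
Proof.
  intros H; unfold sh. evar_last.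
  - apply (is_derive_comp (fun z => f z t) (fun z => z + c)).
    + apply is_derive_dS; auto.
    + apply (is_derive_plus (fun z => z) (fun _ => c)); [apply is_derive_id | apply (is_derive_const c)].
  - unfold scal, plus, one, zero; simpl; unfold mult; simpl; ring.
Qed.
Lemma isT_sh f c s t : diffT f -> is_derive (fun z => sh c f s z) t (sh c (dT f) s t).
Proof. intros H; unfold sh. apply (is_derive_dT f (s + c)); auto. Qed.

Lemma dS_plus f g : diffS f -> diffS g ->
  dS (fun s t => f s t + g s t) = fun s t => dS f s t + dS g s t.
Proof. intros; apply dS_unique; intros; apply isS_plus; auto. Qed.
Lemma dT_plus f g : diffT f -> diffT g ->
  dT (fun s t => f s t + g s t) = fun s t => dT f s t + dT g s t.
Proof. intros; apply dT_unique; intros; apply isT_plus; auto. Qed.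
Lemma dS_mult f g : diffS f -> diffS g ->
  dS (fun s t => f s t * g s t) = fun s t => dS f s t * g s t + f s t * dS g s t.
Proof. intros; apply dS_unique; intros; apply isS_mult; auto. Qed.
Lemma dT_mult f g : diffT f -> diffT g ->
  dT (fun s t => f s t * g s t) = fun s t => dT f s t * g s t + f s t * dT g s t.
Proof. intros; apply dT_unique; intros; apply isT_mult; auto. Qed.
Lemma dS_sh c f : diffS f -> dS (sh c f) = sh c (dS f).
Proof. intros; apply dS_unique; intros; apply isS_sh; auto. Qed.
Lemma dT_sh c f : diffT f -> dT (sh c f) = sh c (dT f).
Proof. intros; apply dT_unique; intros; apply isT_sh; auto. Qed.
Lemma dS_const c : dS (fun _ _ => c) = fun _ _ => 0.
Proof. apply dS_unique; intros; apply (is_derive_const c). Qed.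
Lemma dT_const c : dT (fun _ _ => c) = fun _ _ => 0.
Proof. apply dT_unique; intros; apply (is_derive_const c). Qed.

Lemma C0_sh c f : C0 f -> C0 (sh c f).
Proof.
  intros H s t eps. destruct (H (s + c) t eps) as [d Hd].
  exists d; intros u v Hu Hv. unfold sh. apply Hd; auto.
  replace (u + c - (s + c)) with (u - s) by ring; auto.
Qed.

Lemma Ck_const n c : Ck n (fun _ _ => c).
Proof.
  revert c; induction n; intros c.
  - split; [intros s t; apply continuity_2d_pt_const | exact I].
  - split; [intros s t; apply continuity_2d_pt_const|].
    repeat split.
    + intros s t; apply (ex_derive_const c).
    + intros s t; apply (ex_derive_const c).
    + rewrite dS_const; auto.
    + rewrite dT_const; auto.
Qed.

Lemma Ck_plus n f g : Ck n f -> Ck n g -> Ck n (fun s t => f s t + g s t).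
Proof.
  revert f g; induction n; intros f g Hf Hg.
  - split; [|exact I]. intros s t; apply continuity_2d_pt_plus; [apply Hf | apply Hg].
  - destruct Hf as (f0 & f1 & f2 & f3 & f4), Hg as (g0 & g1 & g2 & g3 & g4).
    split; [|repeat split].
    + intros s t; apply continuity_2d_pt_plus; auto.
    + eapply diffS_intro; intros; apply isS_plus; auto.
    + eapply diffT_intro; intros; apply isT_plus; auto.
    + rewrite dS_plus; auto.
    + rewrite dT_plus; auto.
Qed.

Lemma Ck_mult n f g : Ck n f -> Ck n g -> Ck n (fun s t => f s t * g s t).
Proof.
  revert f g; induction n; intros f g Hf Hg.
  - split; [|exact I]. intros s t; apply continuity_2d_pt_mult; [apply Hf | apply Hg].
  - pose proof (Ck_pred _ _ Hf) as Pf. pose proof (Ck_pred _ _ Hg) as Pg.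
    destruct Hf as (f0 & f1 & f2 & f3 & f4), Hg as (g0 & g1 & g2 & g3 & g4).
    split; [|repeat split].
    + intros s t; apply continuity_2d_pt_mult; auto.
    + eapply diffS_intro; intros; apply isS_mult; auto.
    + eapply diffT_intro; intros; apply isT_mult; auto.
    + rewrite dS_mult; auto. apply Ck_plus; apply IHn; auto.
    + rewrite dT_mult; auto. apply Ck_plus; apply IHn; auto.
Qed.

Lemma Ck_sh n c f : Ck n f -> Ck n (sh c f).
Proof.
  revert f; induction n; intros f Hf.
  - split; [apply C0_sh, Hf | exact I].
  - destruct Hf as (f0 & f1 & f2 & f3 & f4).
    split; [|repeat split].
    + apply C0_sh; auto.
    + eapply diffS_intro; intros; apply isS_sh; auto.
    + eapply diffT_intro; intros; apply isT_sh; auto.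
    + rewrite dS_sh; auto.
    + rewrite dT_sh; auto.
Qed.

Lemma Ck_inv n f : Ck n f -> (forall s t, f s t <> 0) -> Ck n (fun s t => / f s t).
Proof.
  revert f; induction n; intros f Hf Hn.
  - split; [|exact I]. intros s t; apply continuity_2d_pt_inv; auto; apply Hf.
  - pose proof (Ck_pred _ _ Hf) as Pf.
    destruct Hf as (f0 & f1 & f2 & f3 & f4).
    assert (Hc : forall g, Ck n g -> Ck n (fun s t => - g s t * / f s t * / f s t)).
    { intros g Hg.
      replace (fun s t => - g s t * / f s t * / f s t)
        with (fun s t => (((-1) * g s t) * / f s t) * / f s t)
        by (apply fun2_ext; intros; ring).
      assert (Hi := IHn f Pf Hn).
      apply (Ck_mult n (fun s t => ((-1) * g s t) * / f s t)); auto.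
      apply (Ck_mult n (fun s t => (-1) * g s t)); auto.
      apply (Ck_mult n (fun _ _ => -1)); auto. apply Ck_const. }
    split; [|repeat split].
    + intros s t; apply continuity_2d_pt_inv; auto.
    + eapply diffS_intro; intros; apply isS_inv; auto.
    + eapply diffT_intro; intros; apply isT_inv; auto.
    + erewrite dS_unique by (intros; apply isS_inv; auto). auto.
    + erewrite dT_unique by (intros; apply isT_inv; auto). auto.
Qed.

Lemma is_derive_lin1 (z : R) : is_derive (fun z : R => z) z 1.
Proof. auto_derive; auto. Qed.

Lemma dS_s : dS (fun s _ : R => s) = fun _ _ : R => 1.
Proof. apply dS_unique; intros; apply is_derive_lin1. Qed.
Lemma dT_s : dT (fun s _ : R => s) = fun _ _ : R => 0.
Proof. apply dT_unique; intros; apply (is_derive_const s). Qed.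
Lemma dS_t : dS (fun _ t : R => t) = fun _ _ : R => 0.
Proof. apply dS_unique; intros; apply (is_derive_const t). Qed.
Lemma dT_t : dT (fun _ t : R => t) = fun _ _ : R => 1.
Proof. apply dT_unique; intros; apply is_derive_lin1. Qed.

Lemma smooth_s : smooth (fun s _ : R => s).
Proof.
  intros [|n]; (split; [intros s t; apply continuity_2d_pt_id1|]); [exact I|].
  repeat split.
  - intros s t; eexists; apply is_derive_lin1.
  - intros s t; apply (ex_derive_const s).
  - rewrite dS_s; apply Ck_const.
  - rewrite dT_s; apply Ck_const.
Qed.
Lemma smooth_t : smooth (fun _ t : R => t).
Proof.
  intros [|n]; (split; [intros s t; apply continuity_2d_pt_id2|]); [exact I|].
  repeat split.
  - intros s t; apply (ex_derive_const t).
  - intros s t; eexists; apply is_derive_lin1.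
  - rewrite dS_t; apply Ck_const.
  - rewrite dT_t; apply Ck_const.
Qed.
Lemma smooth_const c : smooth (fun _ _ => c).
Proof. intros n; apply Ck_const. Qed.
Lemma smooth_plus f g : smooth f -> smooth g -> smooth (fun s t => f s t + g s t).
Proof. intros Hf Hg n; apply Ck_plus; auto. Qed.
Lemma smooth_mult f g : smooth f -> smooth g -> smooth (fun s t => f s t * g s t).
Proof. intros Hf Hg n; apply Ck_mult; auto. Qed.
Lemma smooth_opp f : smooth f -> smooth (fun s t => - f s t).
Proof.
  intros Hf. replace (fun s t => - f s t) with (fun s t => (-1) * f s t).
  - apply smooth_mult; auto. apply smooth_const.
  - apply fun2_ext; intros; ring.
Qed.
Lemma smooth_minus f g : smooth f -> smooth g -> smooth (fun s t => f s t - g s t).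
Proof. intros Hf Hg. apply (smooth_plus f (fun s t => - g s t)); auto. apply smooth_opp; auto. Qed.
Lemma smooth_sh c f : smooth f -> smooth (sh c f).
Proof. intros Hf n; apply Ck_sh; auto. Qed.
Lemma smooth_inv f : smooth f -> (forall s t, f s t <> 0) -> smooth (fun s t => / f s t).
Proof. intros Hf H n; apply Ck_inv; auto. Qed.
Lemma smooth_pow f n : smooth f -> smooth (fun s t => f s t ^ n).
Proof.
  intros Hf; induction n; simpl.
  - apply smooth_const.
  - apply smooth_mult; auto.
Qed.
#[global] Hint Resolve smooth_s smooth_t smooth_const smooth_plus smooth_mult smooth_opp
  smooth_minus smooth_sh smooth_pow : sm.

Lemma dS_opp f : diffS f -> dS (fun s t => - f s t) = fun s t => - dS f s t.
Proof. intros; apply dS_unique; intros; apply (is_derive_opp (fun z => f z t)); apply is_derive_dS; auto. Qed.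
Lemma dT_opp f : diffT f -> dT (fun s t => - f s t) = fun s t => - dT f s t.
Proof. intros; apply dT_unique; intros; apply (is_derive_opp (fun z => f s z)); apply is_derive_dT; auto. Qed.
Lemma dS_minus f g : diffS f -> diffS g ->
  dS (fun s t => f s t - g s t) = fun s t => dS f s t - dS g s t.
Proof.
  intros; apply dS_unique; intros; apply (is_derive_minus (fun z => f z t) (fun z => g z t));
  apply is_derive_dS; auto.
Qed.
Lemma dT_minus f g : diffT f -> diffT g ->
  dT (fun s t => f s t - g s t) = fun s t => dT f s t - dT g s t.
Proof.
  intros; apply dT_unique; intros; apply (is_derive_minus (fun z => f s z) (fun z => g s z));
  apply is_derive_dT; auto.
Qed.
Lemma dS_dT f : Ck 2 f -> dS (dT f) = dT (dS f).
Proof.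
  intros (H0 & H1 & H2 & (A0 & A1 & A2 & A3 & A4) & (B0 & B1 & B2 & B3 & B4)).
  apply fun2_ext; intros s t.
  apply (Schwarz f s t).
  - exists (mkposreal 1 Rlt_0_1); intros u v _ _. repeat split.
    + apply H1. + apply H2. + apply B1. + apply A2.
  - apply (Ck_C0 _ _ B3).
  - apply (Ck_C0 _ _ A4).
Qed.
Lemma smooth_dS_dT f : smooth f -> dS (dT f) = dT (dS f).
Proof. intros H; apply dS_dT, H. Qed.

Lemma ex_diff_n_Ck n f : (forall s t, ex_diff_n f n s t) -> Ck n f.
Proof.
  revert f; induction n; intros f H.
  - split; [intros s t; apply H | exact I].
  - split; [intros s t; apply H|]. repeat split.
    + intros s t; apply (H s t).
    + intros s t; apply (H s t).
    + apply IHn; intros s t; apply (H s t).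
    + apply IHn; intros s t; apply (H s t).
Qed.

(** * Double integrals *)

Ltac eqR := match goal with |- @eq _ ?a ?b => change (@eq R a b) end.

Lemma continuous_intro (f : R -> R) x :
  (forall eps : posreal, exists d : posreal, forall y, Rabs (y - x) < d -> Rabs (f y - f x) < eps) ->
  continuous f x.
Proof.
  intros H. apply filterlim_locally. intros eps. destruct (H eps) as [d Hd].
  exists d. intros y Hy. apply Hd, Hy.
Qed.

Lemma C0_contS f s t : C0 f -> continuous (fun z => f z t) s.
Proof.
  intros H; apply continuous_intro; intros eps. destruct (H s t eps) as [d Hd].
  exists d; intros y Hy; apply Hd; auto. rewrite Rminus_diag, Rabs_R0; apply cond_pos.
Qed.
Lemma C0_contT f s t : C0 f -> continuous (fun z => f s z) t.
Proof.
  intros H; apply continuous_intro; intros eps. destruct (H s t eps) as [d Hd].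
  exists d; intros y Hy; apply Hd; auto. rewrite Rminus_diag, Rabs_R0; apply cond_pos.
Qed.
Lemma ex_RInt_C (f : R -> R) a b : (forall x, continuous f x) -> ex_RInt f a b.
Proof. intros H; apply (ex_RInt_continuous (V := R_CompleteNormedModule)); auto. Qed.
Lemma ex_RInt_S f t a b : C0 f -> ex_RInt (fun s => f s t) a b.
Proof. intros H; apply ex_RInt_C; intros; apply C0_contS; auto. Qed.

Lemma RInt_plusR (f g : R -> R) a b : (forall x, continuous f x) -> (forall x, continuous g x) ->
  RInt (fun x => f x + g x) a b = RInt f a b + RInt g a b.
Proof. intros; apply (RInt_plus (V := R_CompleteNormedModule)); apply ex_RInt_C; auto. Qed.
Lemma RInt_minusR (f g : R -> R) a b : (forall x, continuous f x) -> (forall x, continuous g x) ->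
  RInt (fun x => f x - g x) a b = RInt f a b - RInt g a b.
Proof. intros; apply (RInt_minus (V := R_CompleteNormedModule)); apply ex_RInt_C; auto. Qed.
Lemma RInt_scalR (f : R -> R) c a b : (forall x, continuous f x) ->
  RInt (fun x => c * f x) a b = c * RInt f a b.
Proof. intros; apply (RInt_scal (V := R_CompleteNormedModule)); apply ex_RInt_C; auto. Qed.
Lemma RInt_oppR (f : R -> R) a b : (forall x, continuous f x) ->
  RInt (fun x => - f x) a b = - RInt f a b.
Proof. intros; apply (RInt_opp (V := R_CompleteNormedModule)); apply ex_RInt_C; auto. Qed.
Lemma RInt_constR c a b : RInt (fun _ => c) a b = (b - a) * c.
Proof. apply (RInt_const (V := R_CompleteNormedModule)). Qed.

Lemma RInt_param_cont f a b : C0 f -> forall t, continuous (fun t => RInt (fun s => f s t) a b) t.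
Proof.
  intros H t; apply continuous_intro; intros eps.
  set (m := Rmin a b); set (M := Rmax a b).
  assert (Hm : m <= M) by (apply Rle_trans with a; [apply Rmin_l | apply Rmax_l]).
  (* The added 1 also covers the case [a = b]. *)
  assert (He : 0 < eps / (M - m + 1)).
  { apply Rdiv_lt_0_compat; [apply cond_pos | lra]. }
  destruct (uniform_continuity_2d f m M (t - 1) (t + 1) (fun x y _ _ => H x y) (mkposreal _ He)) as [d Hd].
  assert (Hd1 : 0 < Rmin d 1) by (apply Rmin_pos; [apply cond_pos | lra]).
  exists (mkposreal _ Hd1); simpl; intros y Hy.
  assert (Hy1 := Rlt_le_trans _ _ _ Hy (Rmin_l _ _)).
  assert (Hy2 := Rlt_le_trans _ _ _ Hy (Rmin_r _ _)).
  apply Rabs_def2 in Hy2.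
  assert (E : RInt (fun s => f s y) a b - RInt (fun s => f s t) a b
              = RInt (fun s => f s y - f s t) a b).
  { symmetry. apply (RInt_minus (V := R_CompleteNormedModule)); apply ex_RInt_S; auto. }
  rewrite E.
  assert (Ex : ex_RInt (fun s => f s y - f s t) a b).
  { apply (ex_RInt_minus (V := R_NormedModule)); apply ex_RInt_S; auto. }
  apply Rle_lt_trans with (Rabs (b - a) * (eps / (M - m + 1))).
  - apply (norm_RInt_le_const_abs (fun s => f s y - f s t) a b).
    + intros x Hx. apply Rlt_le, Hd; try lra; try (unfold m, M; lra).
      rewrite Rminus_diag, Rabs_R0; apply cond_pos.
    + apply (RInt_correct (V := R_CompleteNormedModule)); auto.
  - assert (Rabs (b - a) = M - m).
    { unfold M, m, Rmax, Rmin, Rabs; destruct (Rle_dec a b); destruct (Rcase_abs (b - a)); lra. }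
    rewrite H0. apply Rmult_lt_reg_r with (M - m + 1); [lra|].
    replace ((M - m) * (eps / (M - m + 1)) * (M - m + 1)) with ((M - m) * eps) by (field; lra).
    assert (0 < eps) by apply cond_pos. nra.
Qed.

Lemma ex_RInt_param f a b c d : C0 f -> ex_RInt (fun t => RInt (fun s => f s t) a b) c d.
Proof. intros; apply ex_RInt_C; intros; apply RInt_param_cont; auto. Qed.

Definition I2 (f : R -> R -> R) (a b c d : R) : R := RInt (fun t => RInt (fun s => f s t) a b) c d.

Lemma C0_plus f g : C0 f -> C0 g -> C0 (fun s t => f s t + g s t).
Proof. intros ? ? s t; apply continuity_2d_pt_plus; auto. Qed.
Lemma C0_minus f g : C0 f -> C0 g -> C0 (fun s t => f s t - g s t).
Proof. intros ? ? s t; apply continuity_2d_pt_minus; auto. Qed.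
Lemma C0_mult f g : C0 f -> C0 g -> C0 (fun s t => f s t * g s t).
Proof. intros ? ? s t; apply continuity_2d_pt_mult; auto. Qed.
Lemma C0_opp f : C0 f -> C0 (fun s t => - f s t).
Proof. intros ? s t; apply continuity_2d_pt_opp; auto. Qed.
Lemma C0_const c : C0 (fun _ _ => c).
Proof. intros s t; apply continuity_2d_pt_const; auto. Qed.
Lemma C0_s : C0 (fun s _ : R => s).
Proof. intros s t; apply continuity_2d_pt_id1. Qed.
Lemma C0_t : C0 (fun _ t : R => t).
Proof. intros s t; apply continuity_2d_pt_id2. Qed.
Lemma C0_pow f n : C0 f -> C0 (fun s t => f s t ^ n).
Proof. intros H; induction n; simpl; [apply C0_const | apply C0_mult; auto]. Qed.
#[global] Hint Resolve C0_plus C0_minus C0_mult C0_opp C0_const C0_sh C0_s C0_t C0_pow : c0.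
#[global] Hint Extern 3 (C0 _) => (apply smooth_C0; solve [auto 12 with sm]) : c0.

Lemma I2_ext f g a b c d : (forall s t, f s t = g s t) -> I2 f a b c d = I2 g a b c d.
Proof. intros H. replace g with f; auto. apply fun2_ext; auto. Qed.

Lemma I2_plus f g a b c d : C0 f -> C0 g ->
  I2 (fun s t => f s t + g s t) a b c d = I2 f a b c d + I2 g a b c d.
Proof.
  intros Hf Hg. unfold I2.
  rewrite (RInt_ext _ (fun t => plus (RInt (fun s => f s t) a b) (RInt (fun s => g s t) a b))).
  - apply (RInt_plus (V := R_CompleteNormedModule)); apply ex_RInt_param; auto.
  - intros t _. apply (RInt_plus (V := R_CompleteNormedModule)); apply ex_RInt_S; auto.
Qed.
Lemma I2_scal k f a b c d : C0 f ->
  I2 (fun s t => k * f s t) a b c d = k * I2 f a b c d.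
Proof.
  intros Hf. unfold I2.
  rewrite (RInt_ext _ (fun t => scal k (RInt (fun s => f s t) a b))).
  - apply (RInt_scal (V := R_CompleteNormedModule)); apply ex_RInt_param; auto.
  - intros t _. apply (RInt_scal (V := R_CompleteNormedModule)); apply ex_RInt_S; auto.
Qed.
Lemma I2_opp f a b c d : C0 f -> I2 (fun s t => - f s t) a b c d = - I2 f a b c d.
Proof.
  intros. replace (- I2 f a b c d) with ((-1) * I2 f a b c d) by ring.
  rewrite <- I2_scal; auto. apply I2_ext; intros; ring.
Qed.
Lemma I2_minus f g a b c d : C0 f -> C0 g ->
  I2 (fun s t => f s t - g s t) a b c d = I2 f a b c d - I2 g a b c d.
Proof.
  intros. unfold Rminus. rewrite <- I2_opp; auto. apply I2_plus; auto. apply C0_opp; auto.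
Qed.
Lemma RInt_nonneg (f : R -> R) a b : a <= b -> (forall x, continuous f x) ->
  (forall x, a <= x <= b -> 0 <= f x) -> 0 <= RInt f a b.
Proof.
  intros Hab Hc H. replace 0 with (RInt (fun _ => 0) a b).
  - apply RInt_le; auto.
    + apply ex_RInt_const.
    + apply ex_RInt_C; auto.
    + intros; apply H; lra.
  - rewrite RInt_const. unfold scal; simpl; unfold mult; simpl; ring.
Qed.
Lemma I2_nonneg f a b c d : a <= b -> c <= d -> C0 f ->
  (forall s t, a <= s <= b -> c <= t <= d -> 0 <= f s t) -> 0 <= I2 f a b c d.
Proof.
  intros Hab Hcd Hf H. apply RInt_nonneg; auto.
  - intros; apply RInt_param_cont; auto.
  - intros t Ht. apply RInt_nonneg; auto. intros; apply C0_contS; auto.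
Qed.
Lemma I2_le f g a b c d : a <= b -> c <= d -> C0 f -> C0 g ->
  (forall s t, a <= s <= b -> c <= t <= d -> f s t <= g s t) -> I2 f a b c d <= I2 g a b c d.
Proof.
  intros Hab Hcd Hf Hg H.
  assert (0 <= I2 (fun s t => g s t - f s t) a b c d).
  { apply I2_nonneg; auto with c0. intros s t Hs Ht. specialize (H s t Hs Ht); lra. }
  rewrite I2_minus in H0; auto; lra.
Qed.
Lemma I2_const k a b c d : I2 (fun _ _ => k) a b c d = k * (b - a) * (d - c).
Proof.
  unfold I2. rewrite RInt_const. rewrite RInt_const. unfold scal; simpl; unfold mult; simpl; ring.
Qed.
Lemma I2_le_const f k a b c d : a <= b -> c <= d -> C0 f ->
  (forall s t, a <= s <= b -> c <= t <= d -> f s t <= k) -> I2 f a b c d <= k * (b - a) * (d - c).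
Proof. intros. rewrite <- I2_const. apply I2_le; auto with c0. Qed.
Lemma RInt_abs_const (f : R -> R) a b M : a <= b -> (forall x, continuous f x) ->
  (forall x, a <= x <= b -> Rabs (f x) <= M) -> Rabs (RInt f a b) <= (b - a) * M.
Proof. intros; apply abs_RInt_le_const; auto. apply ex_RInt_C; auto. Qed.

Lemma RInt_D (f g : R -> R) a b : (forall x, is_derive f x (g x)) -> (forall x, continuous g x) ->
  RInt g a b = f b - f a.
Proof.
  intros H H0. apply is_RInt_unique. apply (is_RInt_derive (V := R_CompleteNormedModule)); auto.
Qed.

Lemma I2_dS f a b c d : diffS f -> C0 (dS f) ->
  I2 (dS f) a b c d = RInt (fun t => f b t - f a t) c d.
Proof.
  intros H1 H2. unfold I2. apply RInt_ext. intros t _.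
  apply (RInt_D (fun z => f z t)).
  - intros; apply is_derive_dS; auto.
  - intros; apply (C0_contS (dS f)); auto.
Qed.

Lemma is_derive_RInt_T f a b t : C0 f -> diffT f -> C0 (dT f) ->
  is_derive (fun t => RInt (fun s => f s t) a b) t (RInt (fun s => dT f s t) a b).
Proof.
  intros H0 H1 H2.
  apply (is_derive_RInt_param (fun t s => f s t)).
  - exists (mkposreal 1 Rlt_0_1). intros; apply H1.
  - intros s _ eps. destruct (H2 s t eps) as [d Hd]. exists d. intros u v Hu Hv. apply Hd; auto.
  - exists (mkposreal 1 Rlt_0_1). intros; apply ex_RInt_S; auto.
Qed.
Lemma I2_dT f a b c d : C0 f -> diffT f -> C0 (dT f) ->
  I2 (dT f) a b c d = RInt (fun s => f s d) a b - RInt (fun s => f s c) a b.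
Proof.
  intros H0 H1 H2. unfold I2.
  apply (RInt_D (fun t => RInt (fun s => f s t) a b)).
  - intros; apply is_derive_RInt_T; auto.
  - intros; apply RInt_param_cont; auto.
Qed.

Lemma RInt_shift (f : R -> R) k a b : (forall x, continuous f x) ->
  RInt (fun x => f (x + k)) a b = RInt f (a + k) (b + k).
Proof.
  intros H. assert (E := RInt_comp_lin f 1 k a b).
  rewrite <- (Rmult_1_l a), <- (Rmult_1_l b) at 2. rewrite <- E.
  - apply RInt_ext. intros. unfold scal; simpl; unfold mult; simpl. rewrite !Rmult_1_l; auto.
  - apply ex_RInt_C; auto.
Qed.
Lemma I2_sh k f a b c d : C0 f -> I2 (sh k f) a b c d = I2 f (a + k) (b + k) c d.
Proof.
  intros H; unfold I2; apply RInt_ext; intros t _. unfold sh.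
  apply (RInt_shift (fun s => f s t)). intros; apply C0_contS; auto.
Qed.

Lemma RInt_split (f : R -> R) a b c : (forall x, continuous f x) -> RInt f a b + RInt f b c = RInt f a c.
Proof. intros; apply (RInt_Chasles (V := R_CompleteNormedModule)); apply ex_RInt_C; auto. Qed.
Lemma RInt_mono_dom (f : R -> R) a b a' b' : a' <= a -> a <= b -> b <= b' -> (forall x, continuous f x) ->
  (forall x, a' <= x <= b' -> 0 <= f x) -> RInt f a b <= RInt f a' b'.
Proof.
  intros. rewrite <- (RInt_split f a' a b'), <- (RInt_split f a b b'); auto.
  assert (0 <= RInt f a' a) by (apply RInt_nonneg; auto; intros; apply H3; lra).
  assert (0 <= RInt f b b') by (apply RInt_nonneg; auto; intros; apply H3; lra). lra.
Qed.
Lemma I2_mono_dom f a b c d a' b' c' d' : a' <= a -> a <= b -> b <= b' -> c' <= c -> c <= d -> d <= d' ->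
  C0 f -> (forall s t, a' <= s <= b' -> c' <= t <= d' -> 0 <= f s t) ->
  I2 f a b c d <= I2 f a' b' c' d'.
Proof.
  intros. apply Rle_trans with (I2 f a' b' c d).
  - apply RInt_le; auto; try (apply ex_RInt_param; auto).
    intros t Ht. apply RInt_mono_dom; auto. intros; apply C0_contS; auto.
    intros; apply H6; lra.
  - apply RInt_mono_dom; auto. intros; apply RInt_param_cont; auto.
    intros t Ht. apply RInt_nonneg; auto; try lra. intros; apply C0_contS; auto.
Qed.

(** All [dS] stand outside all [dT]. Taking a [dT] off the inside or a [dS] off the outside is then
    a matter of unfolding; the other two directions, [pd_S] and [pd_Tl], rest on Schwarz'
    theorem. *)
Definition pd (i j : nat) (f : R -> R -> R) : R -> R -> R := Nat.iter i dS (Nat.iter j dT f).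

Lemma smooth_iterT j f : smooth f -> smooth (Nat.iter j dT f).
Proof. intros; induction j; simpl; auto with sm. Qed.
Lemma smooth_pd i j f : smooth f -> smooth (pd i j f).
Proof. intros; unfold pd; induction i; simpl; auto with sm. apply smooth_iterT; auto. Qed.
#[global] Hint Resolve smooth_pd : sm.
Lemma pd_S i j f : smooth f -> pd (S i) j f = pd i j (dS f).
Proof.
  intros H. unfold pd. rewrite Nat.iter_succ_r. f_equal.
  induction j; simpl; auto. rewrite <- IHj. apply smooth_dS_dT, smooth_iterT; auto.
Qed.
Lemma pd_T i j f : pd i (S j) f = pd i j (dT f).
Proof. unfold pd. rewrite (Nat.iter_succ_r j). auto. Qed.
Lemma pd_Sl i j f : pd (S i) j f = dS (pd i j f).
Proof. reflexivity. Qed.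
Lemma pd_Tl i j f : smooth f -> pd i (S j) f = dT (pd i j f).
Proof.
  intros H. induction i; [reflexivity|].
  rewrite !pd_Sl, IHi. apply smooth_dS_dT, smooth_pd; auto.
Qed.

Lemma pd_plus i j f g : smooth f -> smooth g ->
  pd i j (fun s t => f s t + g s t) = fun s t => pd i j f s t + pd i j g s t.
Proof.
  revert f g; induction i; intros f g Hf Hg.
  - revert f g Hf Hg; induction j; intros f g Hf Hg; auto.
    rewrite !pd_T. rewrite dT_plus; auto with sm.
  - rewrite !pd_S; auto with sm. rewrite dS_plus; auto with sm.
Qed.
Lemma pd_opp i j f : smooth f -> pd i j (fun s t => - f s t) = fun s t => - pd i j f s t.
Proof.
  revert f; induction i; intros f Hf.
  - revert f Hf; induction j; intros f Hf; auto.
    rewrite !pd_T. rewrite dT_opp; auto with sm.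
  - rewrite !pd_S; auto with sm. rewrite dS_opp; auto with sm.
Qed.
Lemma pd_minus i j f g : smooth f -> smooth g ->
  pd i j (fun s t => f s t - g s t) = fun s t => pd i j f s t - pd i j g s t.
Proof.
  intros. unfold Rminus. rewrite (pd_plus i j f (fun s t => - g s t)); auto with sm.
  rewrite pd_opp; auto.
Qed.
Lemma dS_scal k f : diffS f -> dS (fun s t => k * f s t) = fun s t => k * dS f s t.
Proof.
  intros H. apply dS_unique; intros. apply (is_derive_scal (fun z => f z t)). apply is_derive_dS; auto.
Qed.
Lemma dT_scal k f : diffT f -> dT (fun s t => k * f s t) = fun s t => k * dT f s t.
Proof.
  intros H. apply dT_unique; intros. apply (is_derive_scal (fun z => f s z)). apply is_derive_dT; auto.
Qed.
Lemma smooth_scal k f : smooth f -> smooth (fun s t => k * f s t).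
Proof. intros; apply smooth_mult; auto with sm. Qed.
#[global] Hint Resolve smooth_scal : sm.
Lemma pd_scal i j k f : smooth f -> pd i j (fun s t => k * f s t) = fun s t => k * pd i j f s t.
Proof.
  revert f; induction i; intros f Hf.
  - revert f Hf; induction j; intros f Hf; auto.
    rewrite !pd_T. rewrite dT_scal; auto with sm.
  - rewrite !pd_S; auto with sm. rewrite dS_scal; auto with sm.
Qed.
Lemma pd_sh i j c f : smooth f -> pd i j (sh c f) = sh c (pd i j f).
Proof.
  revert f; induction i; intros f Hf.
  - revert f Hf; induction j; intros f Hf; auto.
    rewrite !pd_T. rewrite dT_sh; auto with sm.
  - rewrite !pd_S; auto with sm. rewrite dS_sh; auto with sm.
Qed.

(** * Symbol classes *)

(* A family [F : R -> (R -> R -> R)] is indexed by a scale [r]; its member [F r] is only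
   measured on the ring of sup-norm radius about [r]. *)
Definition nb (k r s t : R) : Prop := r - k <= Rmax (Rabs s) (Rabs t) <= r + k.

(** [LO m] is o(r^m) and [BO m] is O(r^m), uniformly on rings of every fixed width [k]. The free
    width makes both classes stable under shifts and under passing to an intermediate point of the
    mean value theorem. *)
Definition LO (m : Z) (F : R -> R -> R -> R) : Prop :=
  forall k e, 0 < e -> exists r0, 1 <= r0 /\
    forall r s t, r0 <= r -> nb k r s t -> Rabs (F r s t) <= e * powerRZ r m.
Definition BO (m : Z) (F : R -> R -> R -> R) : Prop :=
  forall k, exists C r0, 0 < C /\ 1 <= r0 /\
    forall r s t, r0 <= r -> nb k r s t -> Rabs (F r s t) <= C * powerRZ r m.

Lemma powerRZ_pos r m : 1 <= r -> 0 < powerRZ r m.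
Proof. intros; apply powerRZ_lt; lra. Qed.
Lemma powerRZ_plus r m n : 1 <= r -> powerRZ r (m + n) = powerRZ r m * powerRZ r n.
Proof. intros; apply powerRZ_add; lra. Qed.

Lemma LO_BO m F : LO m F -> BO m F.
Proof. intros H k. destruct (H k 1 Rlt_0_1) as (r0 & H0 & H1). exists 1, r0; repeat split; auto; lra. Qed.

Lemma LO_plus m F G : LO m F -> LO m G -> LO m (fun r s t => F r s t + G r s t).
Proof.
  intros HF HG k e He.
  destruct (HF k (e / 2)) as (r1 & A1 & B1); [lra|].
  destruct (HG k (e / 2)) as (r2 & A2 & B2); [lra|].
  exists (Rmax r1 r2); split; [apply Rle_trans with r1; auto; apply Rmax_l|].
  intros r s t Hr Hn.
  assert (r1 <= r) by (eapply Rle_trans; [apply Rmax_l | eauto]).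
  assert (r2 <= r) by (eapply Rle_trans; [apply Rmax_r | eauto]).
  eapply Rle_trans; [apply Rabs_triang|].
  specialize (B1 r s t H Hn). specialize (B2 r s t H0 Hn). lra.
Qed.
Lemma BO_plus m F G : BO m F -> BO m G -> BO m (fun r s t => F r s t + G r s t).
Proof.
  intros HF HG k.
  destruct (HF k) as (c1 & r1 & P1 & A1 & B1).
  destruct (HG k) as (c2 & r2 & P2 & A2 & B2).
  exists (c1 + c2), (Rmax r1 r2); split; [lra|split; [apply Rle_trans with r1; auto; apply Rmax_l|]].
  intros r s t Hr Hn.
  assert (r1 <= r) by (eapply Rle_trans; [apply Rmax_l | eauto]).
  assert (r2 <= r) by (eapply Rle_trans; [apply Rmax_r | eauto]).
  eapply Rle_trans; [apply Rabs_triang|].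
  specialize (B1 r s t H Hn). specialize (B2 r s t H0 Hn). lra.
Qed.
Lemma LO_mult m n F G : BO m F -> LO n G -> LO (m + n) (fun r s t => F r s t * G r s t).
Proof.
  intros HF HG k e He.
  destruct (HF k) as (c1 & r1 & P1 & A1 & B1).
  destruct (HG k (e / c1)) as (r2 & A2 & B2); [apply Rdiv_lt_0_compat; auto|].
  exists (Rmax r1 r2); split; [apply Rle_trans with r1; auto; apply Rmax_l|].
  intros r s t Hr Hn.
  assert (r1 <= r) by (eapply Rle_trans; [apply Rmax_l | eauto]).
  assert (r2 <= r) by (eapply Rle_trans; [apply Rmax_r | eauto]).
  rewrite Rabs_mult, powerRZ_plus by lra.
  specialize (B1 r s t H Hn). specialize (B2 r s t H0 Hn).
  replace (e * (powerRZ r m * powerRZ r n)) with ((c1 * powerRZ r m) * (e / c1 * powerRZ r n)) by (field; lra).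
  apply Rmult_le_compat; auto using Rabs_pos.
Qed.
Lemma BO_mult m n F G : BO m F -> BO n G -> BO (m + n) (fun r s t => F r s t * G r s t).
Proof.
  intros HF HG k.
  destruct (HF k) as (c1 & r1 & P1 & A1 & B1).
  destruct (HG k) as (c2 & r2 & P2 & A2 & B2).
  exists (c1 * c2), (Rmax r1 r2); split; [apply Rmult_lt_0_compat; auto|split; [apply Rle_trans with r1; auto; apply Rmax_l|]].
  intros r s t Hr Hn.
  assert (r1 <= r) by (eapply Rle_trans; [apply Rmax_l | eauto]).
  assert (r2 <= r) by (eapply Rle_trans; [apply Rmax_r | eauto]).
  rewrite Rabs_mult, powerRZ_plus by lra.
  specialize (B1 r s t H Hn). specialize (B2 r s t H0 Hn).
  replace (c1 * c2 * (powerRZ r m * powerRZ r n)) with ((c1 * powerRZ r m) * (c2 * powerRZ r n)) by ring.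
  apply Rmult_le_compat; auto using Rabs_pos.
Qed.
Lemma nb_sh k c r s t : nb k r s t -> nb (k + Rabs c) r (s + c) t.
Proof.
  unfold nb. intros [H1 H2].
  assert (A1 := Rabs_triang s c). assert (A2 := Rabs_triang (s + c) (- c)).
  replace (s + c + - c) with s in A2 by ring. rewrite Rabs_Ropp in A2.
  unfold Rmax in *. destruct (Rle_dec (Rabs s) (Rabs t)), (Rle_dec (Rabs (s + c)) (Rabs t)); lra.
Qed.
Lemma LO_sh m c F : LO m F -> LO m (fun r => sh c (F r)).
Proof.
  intros H k e He. destruct (H (k + Rabs c) e He) as (r0 & A & B).
  exists r0; split; auto. intros; unfold sh; apply B; auto. apply nb_sh; auto.
Qed.
Lemma BO_sh m c F : BO m F -> BO m (fun r => sh c (F r)).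
Proof.
  intros H k. destruct (H (k + Rabs c)) as (C & r0 & P & A & B).
  exists C, r0; repeat split; auto. intros; unfold sh; apply B; auto. apply nb_sh; auto.
Qed.
Lemma BO_const c : BO 0 (fun _ _ _ => c).
Proof.
  intros k. exists (Rabs c + 1), 1. assert (H := Rabs_pos c). repeat split; try lra. intros; simpl; lra.
Qed.
Lemma LO_zero m : LO m (fun _ _ _ => 0).
Proof.
  intros k e He. exists 1; split; [lra|]. intros. rewrite Rabs_R0.
  apply Rmult_le_pos; [lra|]. apply Rlt_le, powerRZ_pos; lra.
Qed.
Lemma LO_ext m F G : (forall r s t, F r s t = G r s t) -> LO m F -> LO m G.
Proof. intros H HF k e He. destruct (HF k e He) as (r0 & A & B). exists r0; split; auto. intros; rewrite <- H; auto. Qed.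
Lemma BO_le m n F : (m <= n)%Z -> BO m F -> BO n F.
Proof.
  intros H HF k. destruct (HF k) as (C & r0 & P & A & B). exists C, r0; repeat split; auto.
  intros r s t Hr Hn. eapply Rle_trans; [apply B; auto|]. apply Rmult_le_compat_l; [lra|].
  replace n with (m + (n - m))%Z by lia. rewrite powerRZ_plus by lra.
  rewrite <- (Rmult_1_r (powerRZ r m)) at 1. apply Rmult_le_compat_l; [apply Rlt_le, powerRZ_pos; lra|].
  replace (n - m)%Z with (Z.of_nat (Z.to_nat (n - m))) by lia. rewrite <- pow_powerRZ. apply pow_R1_Rle; lra.
Qed.
Lemma LO_le m n F : (m <= n)%Z -> LO m F -> LO n F.
Proof.
  intros H HF k e He. destruct (HF k e He) as (r0 & A & B). exists r0; repeat split; auto.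
  intros r s t Hr Hn. eapply Rle_trans; [apply B; auto|]. apply Rmult_le_compat_l; [lra|].
  replace n with (m + (n - m))%Z by lia. rewrite powerRZ_plus by lra.
  rewrite <- (Rmult_1_r (powerRZ r m)) at 1. apply Rmult_le_compat_l; [apply Rlt_le, powerRZ_pos; lra|].
  replace (n - m)%Z with (Z.of_nat (Z.to_nat (n - m))) by lia. rewrite <- pow_powerRZ. apply pow_R1_Rle; lra.
Qed.

(** As for symbols of pseudodifferential operators, each derivative lowers the order by one. *)
Definition Sym (B : Z -> (R -> R -> R -> R) -> Prop) (m : Z) (F : R -> R -> R -> R) : Prop :=
  (forall r, smooth (F r)) /\
  forall i j, B (m - Z.of_nat i - Z.of_nat j)%Z (fun r => pd i j (F r)).
Notation SO := (Sym LO).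
Notation SB := (Sym BO).

Section ProdLemma.
Variables A B : Z -> (R -> R -> R -> R) -> Prop.
Hypothesis Bplus : forall m F G, B m F -> B m G -> B m (fun r s t => F r s t + G r s t).
Hypothesis Bmult : forall m n F G, A m F -> B n G -> B (m + n) (fun r s t => F r s t * G r s t).

(** Leibniz' rule by induction on [i + j]. Only derivatives up to [(i, j)] are assumed to be
    controlled, so that the lemma can serve inside inductions on the order; [A] and [B] stay
    abstract because it is also applied to mean-square classes. *)
Lemma pd_mult_class m n F G i j : (forall r, smooth (F r)) -> (forall r, smooth (G r)) ->
  (forall i' j', (i' <= i)%nat -> (j' <= j)%nat -> A (m - Z.of_nat i' - Z.of_nat j') (fun r => pd i' j' (F r))) ->
  (forall i' j', (i' <= i)%nat -> (j' <= j)%nat -> B (n - Z.of_nat i' - Z.of_nat j') (fun r => pd i' j' (G r))) ->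
  B (m + n - Z.of_nat i - Z.of_nat j) (fun r => pd i j (fun s t => F r s t * G r s t)).
Proof.
  revert m n F G. remember (i + j)%nat as N eqn:EN. revert i j EN.
  induction N as [N IH] using lt_wf_ind. intros i j EN m n F G SF SG HF HG.
  destruct i as [|i]; [destruct j as [|j]|].
  - replace (m + n - Z.of_nat 0 - Z.of_nat 0)%Z with (m + n)%Z by lia.
    apply (Bmult m n (fun r => F r) (fun r => G r)).
    + generalize (HF 0 0 (le_n _) (le_n _))%nat. replace (m - Z.of_nat 0 - Z.of_nat 0)%Z with m by lia. auto.
    + generalize (HG 0 0 (le_n _) (le_n _))%nat. replace (n - Z.of_nat 0 - Z.of_nat 0)%Z with n by lia. auto.
  - assert (E : (fun r => pd 0 (S j) (fun s t => F r s t * G r s t)) =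
      fun r s t => pd 0 j (fun s t => dT (F r) s t * G r s t) s t + pd 0 j (fun s t => F r s t * dT (G r) s t) s t).
    { apply functional_extensionality; intro r. rewrite pd_T, dT_mult; auto with sm.
      rewrite (pd_plus 0 j (fun s t => dT (F r) s t * G r s t) (fun s t => F r s t * dT (G r) s t)); auto with sm. }
    rewrite E. apply Bplus.
    + replace (m + n - Z.of_nat 0 - Z.of_nat (S j))%Z with ((m - 1) + n - Z.of_nat 0 - Z.of_nat j)%Z by lia.
      apply (IH (0 + j)%nat) with (F := fun r => dT (F r)) (G := G); auto with sm; try lia.
      * intros i' j' Hi Hj. generalize (HF i' (S j') ltac:(lia) ltac:(lia)).
        replace (m - Z.of_nat i' - Z.of_nat (S j'))%Z with (m - 1 - Z.of_nat i' - Z.of_nat j')%Z by lia.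
        intros H'. replace (fun r => pd i' j' (dT (F r))) with (fun r => pd i' (S j') (F r)); auto.
        apply functional_extensionality; intro; apply pd_T.
    + replace (m + n - Z.of_nat 0 - Z.of_nat (S j))%Z with (m + (n - 1) - Z.of_nat 0 - Z.of_nat j)%Z by lia.
      apply (IH (0 + j)%nat) with (F := F) (G := fun r => dT (G r)); auto with sm; try lia.
      * intros i' j' Hi Hj. generalize (HG i' (S j') ltac:(lia) ltac:(lia)).
        replace (n - Z.of_nat i' - Z.of_nat (S j'))%Z with (n - 1 - Z.of_nat i' - Z.of_nat j')%Z by lia.
        intros H'. replace (fun r => pd i' j' (dT (G r))) with (fun r => pd i' (S j') (G r)); auto.
        apply functional_extensionality; intro; apply pd_T.
  - assert (E : (fun r => pd (S i) j (fun s t => F r s t * G r s t)) =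
      fun r s t => pd i j (fun s t => dS (F r) s t * G r s t) s t + pd i j (fun s t => F r s t * dS (G r) s t) s t).
    { apply functional_extensionality; intro r. rewrite pd_S, dS_mult; auto with sm.
      rewrite (pd_plus i j (fun s t => dS (F r) s t * G r s t) (fun s t => F r s t * dS (G r) s t)); auto with sm. }
    rewrite E. apply Bplus.
    + replace (m + n - Z.of_nat (S i) - Z.of_nat j)%Z with ((m - 1) + n - Z.of_nat i - Z.of_nat j)%Z by lia.
      apply (IH (i + j)%nat) with (F := fun r => dS (F r)) (G := G); auto with sm; try lia.
      * intros i' j' Hi Hj. generalize (HF (S i') j' ltac:(lia) ltac:(lia)).
        replace (m - Z.of_nat (S i') - Z.of_nat j')%Z with (m - 1 - Z.of_nat i' - Z.of_nat j')%Z by lia.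
        intros H'. replace (fun r => pd i' j' (dS (F r))) with (fun r => pd (S i') j' (F r)); auto.
        apply functional_extensionality; intro; apply pd_S; auto.
    + replace (m + n - Z.of_nat (S i) - Z.of_nat j)%Z with (m + (n - 1) - Z.of_nat i - Z.of_nat j)%Z by lia.
      apply (IH (i + j)%nat) with (F := F) (G := fun r => dS (G r)); auto with sm; try lia.
      * intros i' j' Hi Hj. generalize (HG (S i') j' ltac:(lia) ltac:(lia)).
        replace (n - Z.of_nat (S i') - Z.of_nat j')%Z with (n - 1 - Z.of_nat i' - Z.of_nat j')%Z by lia.
        intros H'. replace (fun r => pd i' j' (dS (G r))) with (fun r => pd (S i') j' (G r)); auto.
        apply functional_extensionality; intro; apply pd_S; auto.
Qed.

Lemma Sym_mult m n F G : Sym A m F -> Sym B n G -> Sym B (m + n) (fun r s t => F r s t * G r s t).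
Proof.
  intros [SF HF] [SG HG]. split; [auto with sm|].
  intros i j. apply pd_mult_class; auto.
Qed.
Lemma Sym_plus m F G : Sym B m F -> Sym B m G -> Sym B m (fun r s t => F r s t + G r s t).
Proof.
  intros [SF HF] [SG HG]. split; [auto with sm|].
  intros i j. replace (fun r => pd i j (fun s t => F r s t + G r s t)) with
    (fun r s t => pd i j (F r) s t + pd i j (G r) s t); auto.
  apply functional_extensionality; intro r. rewrite pd_plus; auto.
Qed.
Lemma Sym_dS m F : Sym B m F -> Sym B (m - 1) (fun r => dS (F r)).
Proof.
  intros [SF HF]. split; [auto with sm|]. intros i j.
  generalize (HF (S i) j). replace (m - Z.of_nat (S i) - Z.of_nat j)%Z with (m - 1 - Z.of_nat i - Z.of_nat j)%Z by lia.
  intros H'. replace (fun r => pd i j (dS (F r))) with (fun r => pd (S i) j (F r)); auto.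
  apply functional_extensionality; intro; apply pd_S; auto.
Qed.
Lemma Sym_dT m F : Sym B m F -> Sym B (m - 1) (fun r => dT (F r)).
Proof.
  intros [SF HF]. split; [auto with sm|]. intros i j.
  generalize (HF i (S j)). replace (m - Z.of_nat i - Z.of_nat (S j))%Z with (m - 1 - Z.of_nat i - Z.of_nat j)%Z by lia.
  intros H'. replace (fun r => pd i j (dT (F r))) with (fun r => pd i (S j) (F r)); auto.
  apply functional_extensionality; intro; apply pd_T; auto.
Qed.
(** Reduces a symbol bound to the size of the function and the classes of its two first derivatives,
    which for coordinates and constants are already known. *)
Lemma Sym_step m F : (forall r, smooth (F r)) -> B m F -> Sym B (m - 1) (fun r => dS (F r)) ->
  Sym B (m - 1) (fun r => dT (F r)) -> Sym B m F.
Proof.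
  intros SF H0 [_ H1] [_ H2]. split; auto. intros [|i] [|j].
  - replace (m - Z.of_nat 0 - Z.of_nat 0)%Z with m by lia; auto.
  - generalize (H2 0%nat j). replace (m - 1 - Z.of_nat 0 - Z.of_nat j)%Z with (m - Z.of_nat 0 - Z.of_nat (S j))%Z by lia.
    intros H'. replace (fun r => pd 0 (S j) (F r)) with (fun r => pd 0 j (dT (F r))); auto.
    apply functional_extensionality; intro; symmetry; apply pd_T.
  - generalize (H1 i 0%nat). replace (m - 1 - Z.of_nat i - Z.of_nat 0)%Z with (m - Z.of_nat (S i) - Z.of_nat 0)%Z by lia.
    intros H'. replace (fun r => pd (S i) 0 (F r)) with (fun r => pd i 0 (dS (F r))); auto.
    apply functional_extensionality; intro; symmetry; apply pd_S; auto.
  - generalize (H1 i (S j)). replace (m - 1 - Z.of_nat i - Z.of_nat (S j))%Z with (m - Z.of_nat (S i) - Z.of_nat (S j))%Z by lia.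
    intros H'. replace (fun r => pd (S i) (S j) (F r)) with (fun r => pd i (S j) (dS (F r))); auto.
    apply functional_extensionality; intro; symmetry; apply pd_S; auto.
Qed.
End ProdLemma.

Lemma Sym_B B m F : Sym B m F -> B m F.
Proof. intros [_ H]. generalize (H 0%nat 0%nat). replace (m - Z.of_nat 0 - Z.of_nat 0)%Z with m by lia; auto. Qed.
Lemma SO_SB m F : SO m F -> SB m F.
Proof. intros [H1 H2]; split; auto; intros; apply LO_BO, H2. Qed.
Lemma SO_sm m F : SO m F -> forall r, smooth (F r).
Proof. intros [H _]; auto. Qed.

Lemma SO_mult m n F G : SB m F -> SO n G -> SO (m + n) (fun r s t => F r s t * G r s t).
Proof. apply Sym_mult; [apply LO_plus | apply LO_mult]. Qed.
Lemma SB_mult m n F G : SB m F -> SB n G -> SB (m + n) (fun r s t => F r s t * G r s t).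
Proof. apply Sym_mult; [apply BO_plus | apply BO_mult]. Qed.
Lemma SO_plus m F G : SO m F -> SO m G -> SO m (fun r s t => F r s t + G r s t).
Proof. apply Sym_plus; apply LO_plus. Qed.
Lemma SB_plus m F G : SB m F -> SB m G -> SB m (fun r s t => F r s t + G r s t).
Proof. apply Sym_plus; apply BO_plus. Qed.

Lemma pd_zero i j : pd i j (fun _ _ => 0) = fun _ _ => 0.
Proof.
  induction i.
  - induction j; auto. rewrite pd_T, dT_const; auto.
  - rewrite pd_S by auto with sm. rewrite dS_const; auto.
Qed.
Lemma SO_zero m : SO m (fun _ _ _ => 0).
Proof.
  split; [auto with sm|]. intros i j. eapply LO_ext; [|apply LO_zero]. intros; simpl; rewrite pd_zero; auto.
Qed.
Lemma SB_const c : SB 0 (fun _ _ _ => c).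
Proof.
  apply Sym_step; auto with sm.
  - apply BO_const.
  - rewrite dS_const. apply SO_SB, SO_zero.
  - rewrite dT_const. apply SO_SB, SO_zero.
Qed.
Lemma nb_bound k r s t : nb k r s t -> Rabs s <= r + k /\ Rabs t <= r + k.
Proof. intros [_ H]; split; (eapply Rle_trans; [|apply H]); [apply Rmax_l | apply Rmax_r]. Qed.
Lemma SB_s : SB 1 (fun _ s _ => s).
Proof.
  apply Sym_step; auto with sm.
  - intros k. exists 2, (Rmax 1 k). split; [lra|split; [apply Rmax_l|]].
    intros r s t Hr Hn. apply nb_bound in Hn. assert (k <= r) by (eapply Rle_trans; [apply Rmax_r|eauto]).
    simpl; lra.
  - rewrite dS_s. apply SB_const.
  - rewrite dT_s. apply SO_SB, SO_zero.
Qed.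
Lemma SB_t : SB 1 (fun _ _ t => t).
Proof.
  apply Sym_step; auto with sm.
  - intros k. exists 2, (Rmax 1 k). split; [lra|split; [apply Rmax_l|]].
    intros r s t Hr Hn. apply nb_bound in Hn. assert (k <= r) by (eapply Rle_trans; [apply Rmax_r|eauto]).
    simpl; lra.
  - rewrite dS_t. apply SO_SB, SO_zero.
  - rewrite dT_t. apply SB_const.
Qed.
Lemma Sym_le B m n F : (forall m n F, (m <= n)%Z -> B m F -> B n F) -> (m <= n)%Z -> Sym B m F -> Sym B n F.
Proof. intros HB H [H1 H2]; split; auto. intros i j. eapply HB; [|apply H2]. lia. Qed.
Lemma SB_le m n F : (m <= n)%Z -> SB m F -> SB n F.
Proof. apply Sym_le. apply BO_le. Qed.
Lemma SO_sh m c F : SO m F -> SO m (fun r => sh c (F r)).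
Proof.
  intros [H1 H2]; split; [auto with sm|]. intros i j.
  replace (fun r => pd i j (sh c (F r))) with (fun r => sh c (pd i j (F r))); [apply LO_sh, H2|].
  apply functional_extensionality; intro; symmetry; apply pd_sh; auto.
Qed.
Lemma SO_scal m c F : SO m F -> SO m (fun r s t => c * F r s t).
Proof. intros H. apply (SO_mult 0 m (fun _ _ _ => c)); auto. apply SB_const. Qed.
Lemma SB_scal m c F : SB m F -> SB m (fun r s t => c * F r s t).
Proof. intros H. apply (SB_mult 0 m (fun _ _ _ => c)); auto. apply SB_const. Qed.
Lemma Sym_ext B m F G : (forall r s t, F r s t = G r s t) -> Sym B m F -> Sym B m G.
Proof. intros H. replace G with F; auto. apply functional_extensionality; intro; apply fun2_ext; auto. Qed.
Lemma SO_opp m F : SO m F -> SO m (fun r s t => - F r s t).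
Proof. intros H. eapply Sym_ext; [|apply (SO_scal m (-1) F H)]. intros; simpl; ring. Qed.
Lemma SB_opp m F : SB m F -> SB m (fun r s t => - F r s t).
Proof. intros H. eapply Sym_ext; [|apply (SB_scal m (-1) F H)]. intros; simpl; ring. Qed.
Lemma SO_minus m F G : SO m F -> SO m G -> SO m (fun r s t => F r s t - G r s t).
Proof. intros; apply SO_plus; auto. apply SO_opp; auto. Qed.
Lemma SB_minus m F G : SB m F -> SB m G -> SB m (fun r s t => F r s t - G r s t).
Proof. intros; apply SB_plus; auto. apply SB_opp; auto. Qed.
Lemma SO_dS m F : SO m F -> SO (m - 1) (fun r => dS (F r)).
Proof. apply Sym_dS. Qed.
Lemma SO_dT m F : SO m F -> SO (m - 1) (fun r => dT (F r)).
Proof. apply Sym_dT. Qed.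

(** * The difference operators del, mu, L0, CC *)

(** Jensen's inequality on a unit interval: the variance of [f'] there is nonnegative. *)
Lemma RInt_sq_diff (f f' : R -> R) s : (forall x, is_derive f x (f' x)) -> (forall x, continuous f' x) ->
  (f (s + 1) - f s) ^ 2 <= RInt (fun x => f' x ^ 2) s (s + 1).
Proof.
  intros H Hc. set (c := f (s + 1) - f s).
  assert (Hc2 : forall x, continuous (fun x => f' x ^ 2) x).
  { intros x. simpl. apply (continuous_mult (K := R_AbsRing)); auto.
    apply (continuous_mult (K := R_AbsRing)); auto. apply continuous_const. }
  assert (E : RInt (fun x => (f' x - c) ^ 2) s (s + 1) = RInt (fun x => f' x ^ 2) s (s + 1) - c ^ 2).
  { assert (I1 : is_RInt (fun x => f' x ^ 2) s (s + 1) (RInt (fun x => f' x ^ 2) s (s + 1))).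
    { apply (RInt_correct (V := R_CompleteNormedModule)), ex_RInt_C; auto. }
    assert (I2 : is_RInt f' s (s + 1) c).
    { apply (is_RInt_derive (V := R_CompleteNormedModule)); auto. }
    assert (I3 : is_RInt (fun _ => c ^ 2) s (s + 1) (c ^ 2)).
    { evar_last; [apply (is_RInt_const (V := R_NormedModule)) |].
      unfold scal; simpl; unfold mult; simpl; ring. }
    apply is_RInt_unique.
    assert (I4 := is_RInt_plus _ _ _ _ _ _ (is_RInt_minus _ _ _ _ _ _ I1 (is_RInt_scal _ _ _ (2 * c) _ I2)) I3).
    replace (RInt (fun x => f' x ^ 2) s (s + 1) - c ^ 2) with
      (plus (minus (RInt (fun x => f' x ^ 2) s (s + 1)) (scal (2 * c) c)) (c ^ 2)).
    - eapply is_RInt_ext; [|apply I4]. intros x _.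
      unfold plus, minus, scal, opp, mult; simpl; unfold plus, mult, opp; simpl; ring.
    - unfold plus, minus, scal, opp, mult; simpl; unfold plus, mult, opp; simpl; ring. }
  assert (0 <= RInt (fun x => (f' x - c) ^ 2) s (s + 1)).
  { apply RInt_nonneg; [lra| |intros; apply pow2_ge_0].
    intros x. simpl.
    assert (continuous (fun x => f' x - c) x).
    { apply (continuous_minus (V := R_NormedModule)); auto. apply continuous_const. }
    apply (continuous_mult (K := R_AbsRing)); auto.
    apply (continuous_mult (K := R_AbsRing)); auto. apply continuous_const. }
  lra.
Qed.

(** Controls the nonlocal difference by the derivative without losing a constant. With [P] the
    primitive of [om' f'^2] that vanishes at [a], Jensen's inequality bounds the integrand by
    [P (s + 1) - P s], whose integral only sees [P] near the two ends. *)
Lemma RInt_avg_diff (f f' om om' : R -> R) a b : a <= b ->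
  (forall x, is_derive f x (f' x)) -> (forall x, continuous f' x) ->
  (forall x, continuous om x) -> (forall x, continuous om' x) ->
  (forall x, 0 <= om' x) -> (forall s x, s <= x <= s + 1 -> om s <= om' x) ->
  RInt (fun s => om s * (f (s + 1) - f s) ^ 2) a b <= RInt (fun x => om' x * f' x ^ 2) a (b + 1).
Proof.
  intros Hab Hd Hc Ho Ho' Hp Hle.
  assert (Cf : forall x, continuous f x).
  { intros x. apply (ex_derive_continuous (K := R_AbsRing) (V := R_NormedModule)). eexists; apply Hd. }
  assert (Hc2 : forall x, continuous (fun x => f' x ^ 2) x).
  { intros x. simpl. apply (continuous_mult (K := R_AbsRing)); auto.
    apply (continuous_mult (K := R_AbsRing)); auto. apply continuous_const. }
  assert (Hc3 : forall x, continuous (fun x => om' x * f' x ^ 2) x).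
  { intros x. apply (continuous_mult (K := R_AbsRing)); auto. }
  set (P := fun x => RInt (fun x => om' x * f' x ^ 2) a x).
  assert (CP : forall x, continuous P x).
  { intros x. apply (ex_derive_continuous (K := R_AbsRing) (V := R_NormedModule)). eexists.
    apply (is_derive_RInt (V := R_CompleteNormedModule) (fun x => om' x * f' x ^ 2) P a x).
    - exists (mkposreal 1 Rlt_0_1). intros y _.
      apply (RInt_correct (V := R_CompleteNormedModule)), ex_RInt_C; auto.
    - auto. }
  assert (Mono : forall x y, x <= y -> P x <= P y).
  { intros x y Hxy. unfold P. rewrite <- (RInt_split (fun x => om' x * f' x ^ 2) a x y); auto.
    assert (0 <= RInt (fun x => om' x * f' x ^ 2) x y); [|lra].
    apply RInt_nonneg; auto. intros z _. apply Rmult_le_pos; auto. apply pow2_ge_0. }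
  assert (P0 : P a = 0).
  { unfold P. rewrite RInt_point. reflexivity. }
  assert (Csh : forall g : R -> R, (forall x, continuous g x) -> forall x, continuous (fun s => g (s + 1)) x).
  { intros g Hg x. apply (continuous_comp (fun s => s + 1) g); auto.
    apply (continuous_plus (V := R_NormedModule)); [apply continuous_id | apply continuous_const]. }
  apply Rle_trans with (RInt (fun s => P (s + 1) - P s) a b).
  - apply RInt_le; auto.
    + apply ex_RInt_C. intros x. apply (continuous_mult (K := R_AbsRing)); auto.
      assert (continuous (fun s => f (s + 1) - f s) x).
      { apply (continuous_minus (V := R_NormedModule)); auto. }
      simpl. apply (continuous_mult (K := R_AbsRing)); auto.
      apply (continuous_mult (K := R_AbsRing)); auto. apply continuous_const.
    + apply ex_RInt_C. intros x. apply (continuous_minus (V := R_NormedModule)); auto.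
    + intros s Hs.
      destruct (Rle_lt_dec (om s) 0) as [Hneg|Hpos].
      * apply Rle_trans with 0.
        { assert (0 <= (f (s + 1) - f s) ^ 2) by apply pow2_ge_0. nra. }
        assert (P s <= P (s + 1)) by (apply Mono; lra). lra.
      * apply Rle_trans with (om s * RInt (fun x => f' x ^ 2) s (s + 1)).
        { apply Rmult_le_compat_l; [lra|]. apply RInt_sq_diff; auto. }
        unfold P. rewrite <- (RInt_split (fun x => om' x * f' x ^ 2) a s (s + 1)); auto.
        ring_simplify.
        replace (om s * RInt (fun x => f' x ^ 2) s (s + 1)) with (RInt (fun x => om s * f' x ^ 2) s (s + 1)).
        { apply RInt_le; try lra; try (apply ex_RInt_C; auto).
          - intros x. apply (continuous_mult (K := R_AbsRing)); auto. apply continuous_const.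
          - intros x Hx. apply Rmult_le_compat_r; [apply pow2_ge_0|]. apply Hle; lra. }
        apply (RInt_scal (V := R_CompleteNormedModule) (fun x => f' x ^ 2)). apply ex_RInt_C; auto.
  - replace (RInt (fun s => P (s + 1) - P s) a b) with (RInt (fun s => P (s + 1)) a b - RInt P a b).
    2:{ symmetry. apply (RInt_minus (V := R_CompleteNormedModule)); apply ex_RInt_C; auto. }
    rewrite (RInt_shift P); auto.
    (* The overlap of the two intervals cancels. Near [a] the increasing [P] is nonnegative, and
       near [b] its mean is at most [P (b + 1)]. *)
    replace (RInt P (a + 1) (b + 1) - RInt P a b) with (RInt P b (b + 1) - RInt P a (a + 1)).
    2:{ assert (E1 := RInt_split P a (a + 1) (b + 1) CP). assert (E2 := RInt_split P a b (b + 1) CP). lra. }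
    assert (0 <= RInt P a (a + 1)).
    { apply RInt_nonneg; auto; try lra. intros x Hx. rewrite <- P0. apply Mono; lra. }
    assert (RInt P b (b + 1) <= P (b + 1)).
    { apply Rle_trans with (RInt (fun _ => P (b + 1)) b (b + 1)).
      - apply RInt_le; try lra; try (apply ex_RInt_C; auto).
        + intros; apply continuous_const.
        + intros x Hx; apply Mono; lra.
      - rewrite RInt_const. unfold scal; simpl; unfold mult; simpl. lra. }
    unfold P in *. lra.
Qed.

Definition del (f : R -> R -> R) : R -> R -> R := fun s t => sh (/ 2) f s t - sh (- / 2) f s t.
Definition mu (f : R -> R -> R) : R -> R -> R := fun s t => / 2 * (sh (/ 2) f s t + sh (- / 2) f s t).
Definition L0 (f : R -> R -> R) : R -> R -> R :=
  fun s t => 2 * dS (dS f) s t + dT (dT f) s t - del (del f) s t.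
(* Symbol [i (xi cos (xi/2) - 2 sin (xi/2))], of third order at low frequency. *)
Definition CC (f : R -> R -> R) : R -> R -> R := fun s t => dS (mu f) s t - del f s t.

Lemma smooth_del f : smooth f -> smooth (del f).
Proof. intros; unfold del; auto with sm. Qed.
Lemma smooth_mu f : smooth f -> smooth (mu f).
Proof. intros; unfold mu; auto with sm. Qed.
#[global] Hint Resolve smooth_del smooth_mu : sm.
Lemma smooth_L0 f : smooth f -> smooth (L0 f).
Proof. intros; unfold L0; auto 10 with sm. Qed.
Lemma smooth_CC f : smooth f -> smooth (CC f).
Proof. intros; unfold CC; auto with sm. Qed.
#[global] Hint Resolve smooth_L0 smooth_CC : sm.

Lemma dS_del f : smooth f -> dS (del f) = del (dS f).
Proof. intros; unfold del. rewrite dS_minus, !dS_sh; auto with sm. Qed.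
Lemma dT_del f : smooth f -> dT (del f) = del (dT f).
Proof. intros; unfold del. rewrite dT_minus, !dT_sh; auto with sm. Qed.
Lemma dS_mu f : smooth f -> dS (mu f) = mu (dS f).
Proof.
  intros; unfold mu. rewrite (dS_scal (/ 2) (fun s t => sh (/ 2) f s t + sh (- / 2) f s t)); auto with sm.
  rewrite dS_plus, !dS_sh; auto with sm.
Qed.
Lemma del_mu f : del (mu f) = mu (del f).
Proof.
  apply fun2_ext; intros. unfold del, mu, sh.
  replace (s + / 2 + - / 2) with s by lra. replace (s + - / 2 + / 2) with s by lra. ring.
Qed.
Lemma del_plus f g : del (fun s t => f s t + g s t) = fun s t => del f s t + del g s t.
Proof. apply fun2_ext; intros; unfold del, sh; ring. Qed.
Lemma del_minus f g : del (fun s t => f s t - g s t) = fun s t => del f s t - del g s t.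
Proof. apply fun2_ext; intros; unfold del, sh; ring. Qed.
Lemma del_scal c f : del (fun s t => c * f s t) = fun s t => c * del f s t.
Proof. apply fun2_ext; intros; unfold del, sh; ring. Qed.
(** The discrete Leibniz rule; its correction is a mean value instead of [f], which is how [mu]
    enters the energy estimate. *)
Lemma del_smul f : del (fun s t => s * f s t) = fun s t => s * del f s t + mu f s t.
Proof. apply fun2_ext; intros; unfold del, mu, sh; field. Qed.
Lemma del_CC f : smooth f -> del (CC f) = fun s t => dS (mu (del f)) s t - del (del f) s t.
Proof.
  intros H. unfold CC. rewrite del_minus, <- dS_del by auto with sm. rewrite del_mu. auto.
Qed.

Lemma MVT_R (f g : R -> R) a b : a <= b -> (forall x, is_derive f x (g x)) ->
  exists c, a <= c <= b /\ f b - f a = g c * (b - a).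
Proof.
  intros H Hd. destruct (MVT_gen f a b g) as [c [Hc1 Hc2]].
  - intros; apply Hd.
  - intros x _. apply derivable_continuous_pt. exists (g x). apply is_derive_Reals, Hd.
  - rewrite Rmin_left, Rmax_right in Hc1 by auto. exists c; auto.
Qed.

Lemma del_MVT f s t : diffS f -> exists x, s - / 2 <= x <= s + / 2 /\ del f s t = dS f x t.
Proof.
  intros H. destruct (MVT_R (fun z => f z t) (fun z => dS f z t) (s + - / 2) (s + / 2)) as [x [H1 H2]].
  - lra.
  - intros; apply is_derive_dS; auto.
  - exists x. split; [lra|]. unfold del, sh. rewrite H2. lra.
Qed.

Lemma nb_near k r s t x : nb k r s t -> s - 1 <= x <= s + 1 -> nb (k + 1) r x t.
Proof.
  intros H Hx. replace x with (s + (x - s)) by ring.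
  assert (H1 := nb_sh k (x - s) r s t H). unfold nb in *.
  assert (Rabs (x - s) <= 1) by (apply Rabs_le; lra). lra.
Qed.

Lemma LO_del m F : (forall r, smooth (F r)) -> LO m (fun r => dS (F r)) -> LO m (fun r => del (F r)).
Proof.
  intros SF H k e He. destruct (H (k + 1) e He) as (r0 & A & B). exists r0; split; auto.
  intros r s t Hr Hn. destruct (del_MVT (F r) s t) as [x [H1 H2]]; auto with sm.
  rewrite H2. apply B; auto. apply nb_near with s; auto. lra.
Qed.

(** [CC f] is the error of the trapezoidal rule for the integral of [dS f] over the unit interval
    centred at [s], hence governed by the third derivative. The function [psi] lets the half-length
    of the interval grow from 0 to 1/2; its derivative is again a difference, so the mean value
    theorem applies twice. *)
Lemma CC_MVT f s t : smooth f -> exists x, s - 1 <= x <= s + 1 /\ Rabs (CC f s t) <= Rabs (dS (dS (dS f)) x t).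
Proof.
  intros H.
  set (psi := fun x => x * (dS f (s + x) t + dS f (s - x) t) - (f (s + x) t - f (s - x) t)).
  set (psi' := fun x => x * (dS (dS f) (s + x) t - dS (dS f) (s - x) t)).
  assert (D : forall x, is_derive psi x (psi' x)).
  { intros x. unfold psi, psi'.
    assert (D1 : forall g, smooth g -> is_derive (fun x => g (s + x) t) x (dS g (s + x) t)).
    { intros g Hg. evar_last.
      - apply (is_derive_comp (fun z => g z t) (fun z => s + z)); [apply is_derive_dS; auto with sm|].
        apply (is_derive_plus (fun _ => s) (fun z => z)); [apply (is_derive_const s) | apply is_derive_lin1].
      - unfold scal, plus, zero; simpl; unfold mult; simpl; ring. }
    assert (D2 : forall g, smooth g -> is_derive (fun x => g (s - x) t) x (- dS g (s - x) t)).
    { intros g Hg. evar_last.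
      - apply (is_derive_comp (fun z => g z t) (fun z => s - z)); [apply is_derive_dS; auto with sm|].
        apply (is_derive_minus (fun _ => s) (fun z => z)); [apply (is_derive_const s) | apply is_derive_lin1].
      - unfold scal, minus, plus, opp, zero; simpl; unfold mult; simpl; ring. }
    evar_last.
    - apply (is_derive_minus (fun x => x * (dS f (s + x) t + dS f (s - x) t)) (fun x => f (s + x) t - f (s - x) t)).
      + apply (is_derive_mult (fun x => x) (fun x => dS f (s + x) t + dS f (s - x) t)).
        * apply is_derive_lin1.
        * apply (is_derive_plus (fun x => dS f (s + x) t) (fun x => dS f (s - x) t)); [apply D1 | apply D2]; auto with sm.
        * intros; apply Rmult_comm.
      + apply (is_derive_minus (fun x => f (s + x) t) (fun x => f (s - x) t)); [apply D1 | apply D2]; auto with sm.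
    - unfold minus, plus, opp; simpl; unfold mult; simpl; unfold mult; simpl; ring. }
  destruct (MVT_R psi psi' 0 (/ 2)) as [x [Hx E]]; auto; [lra|].
  destruct (MVT_R (fun z => dS (dS f) z t) (fun z => dS (dS (dS f)) z t) (s - x) (s + x)) as [y [Hy E2]].
  { lra. } { intros; apply is_derive_dS; auto with sm. }
  exists y. split; [lra|].
  replace (CC f s t) with (psi (/ 2) - psi 0).
  2:{ unfold psi, CC. rewrite dS_mu by auto. unfold mu, del, sh.
      replace (s - / 2) with (s + - / 2) by ring. replace (s - 0) with (s + 0) by ring. ring. }
  rewrite E. unfold psi'. rewrite E2.
  replace (x * (dS (dS (dS f)) y t * (s + x - (s - x))) * (/ 2 - 0)) with ((x * x) * dS (dS (dS f)) y t) by field.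
  rewrite Rabs_mult. rewrite <- (Rmult_1_l (Rabs (dS (dS (dS f)) y t))) at 2.
  apply Rmult_le_compat_r; [apply Rabs_pos|]. rewrite Rabs_pos_eq; nra.
Qed.

Lemma LO_CC m F : (forall r, smooth (F r)) -> LO m (fun r => dS (dS (dS (F r)))) -> LO m (fun r => CC (F r)).
Proof.
  intros SF H k e He. destruct (H (k + 1) e He) as (r0 & A & B). exists r0; split; auto.
  intros r s t Hr Hn. destruct (CC_MVT (F r) s t) as [x [H1 H2]]; auto with sm.
  eapply Rle_trans; [apply H2|]. apply B; auto. apply nb_near with s; auto.
Qed.

Lemma pd_del i j f : smooth f -> pd i j (del f) = del (pd i j f).
Proof. intros. unfold del. rewrite pd_minus, !pd_sh; auto with sm. Qed.
Lemma pd_mu i j f : smooth f -> pd i j (mu f) = mu (pd i j f).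
Proof.
  intros. unfold mu. rewrite (pd_scal i j (/ 2) (fun s t => sh (/ 2) f s t + sh (- / 2) f s t)); auto with sm.
  rewrite pd_plus, !pd_sh; auto with sm.
Qed.
Lemma pd_CC i j f : smooth f -> pd i j (CC f) = CC (pd i j f).
Proof.
  intros. unfold CC. rewrite pd_minus, pd_del; auto with sm.
  rewrite <- pd_S, pd_Sl, pd_mu; auto with sm.
Qed.

Lemma SO_del m F : SO m F -> SO (m - 1) (fun r => del (F r)).
Proof.
  intros [H1 H2]. split; [auto with sm|]. intros i j.
  replace (fun r => pd i j (del (F r))) with (fun r => del (pd i j (F r))).
  2:{ apply functional_extensionality; intro; symmetry; apply pd_del; auto. }
  apply LO_del; auto with sm.
  generalize (H2 (S i) j). replace (m - Z.of_nat (S i) - Z.of_nat j)%Z with (m - 1 - Z.of_nat i - Z.of_nat j)%Z by lia. auto.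
Qed.
Lemma SO_mu m F : SO m F -> SO m (fun r => mu (F r)).
Proof. intros H. unfold mu. apply SO_scal. apply SO_plus; apply SO_sh; auto. Qed.
Lemma SO_CC m F : SO m F -> SO (m - 3) (fun r => CC (F r)).
Proof.
  intros [H1 H2]. split; [auto with sm|]. intros i j.
  replace (fun r => pd i j (CC (F r))) with (fun r => CC (pd i j (F r))).
  2:{ apply functional_extensionality; intro; symmetry; apply pd_CC; auto. }
  apply LO_CC; auto with sm.
  generalize (H2 (S (S (S i))) j).
  replace (m - Z.of_nat (S (S (S i))) - Z.of_nat j)%Z with (m - 3 - Z.of_nat i - Z.of_nat j)%Z by lia. auto.
Qed.
Lemma SO_L0 m F : SO m F -> SO (m - 2) (fun r => L0 (F r)).
Proof.
  intros H. replace (m - 2)%Z with (m - 1 - 1)%Z by lia. unfold L0.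
  apply (SO_minus _ (fun r s t => 2 * dS (dS (F r)) s t + dT (dT (F r)) s t) (fun r => del (del (F r)))).
  - apply SO_plus; [apply SO_scal|]; [apply (SO_dS (m - 1) (fun r => dS (F r))), SO_dS | apply (SO_dT (m - 1) (fun r => dT (F r))), SO_dT]; auto.
  - apply (SO_del (m - 1) (fun r => del (F r))), SO_del; auto.
Qed.

(** * Integration by parts modulo negligible terms *)

Definition Isq (f : R -> R -> R) (r : R) : R := I2 f (- r) r (- r) r.

(** Integrands are compared modulo this class: integrations by parts are stored as members of it and
    combined linearly, which leaves pointwise algebra only. *)
Definition nul (A : R -> R -> R -> R) : Prop :=
  (forall r, C0 (A r)) /\
  forall e, 0 < e -> exists r0, 1 <= r0 /\ forall r, r0 <= r -> Rabs (Isq (A r) r) <= e.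

Lemma nul_ext A B : (forall r s t, A r s t = B r s t) -> nul A -> nul B.
Proof. intros H. replace B with A; auto. apply functional_extensionality; intro; apply fun2_ext; auto. Qed.
Lemma nul_plus A B : nul A -> nul B -> nul (fun r s t => A r s t + B r s t).
Proof.
  intros [CA HA] [CB HB]. split; [auto with c0|]. intros e He.
  destruct (HA (e / 2)) as (r1 & A1 & B1); [lra|].
  destruct (HB (e / 2)) as (r2 & A2 & B2); [lra|].
  exists (Rmax r1 r2); split; [apply Rle_trans with r1; auto; apply Rmax_l|].
  intros r Hr.
  assert (r1 <= r) by (eapply Rle_trans; [apply Rmax_l | eauto]).
  assert (r2 <= r) by (eapply Rle_trans; [apply Rmax_r | eauto]).
  unfold Isq. rewrite I2_plus; auto. eapply Rle_trans; [apply Rabs_triang|].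
  specialize (B1 r H). specialize (B2 r H0). unfold Isq in *. lra.
Qed.
Lemma nul_scal c A : nul A -> nul (fun r s t => c * A r s t).
Proof.
  intros [CA HA]. split; [auto with c0|]. intros e He.
  assert (Hc := Rabs_pos c).
  destruct (HA (e / (Rabs c + 1))) as (r1 & A1 & B1); [apply Rdiv_lt_0_compat; lra|].
  exists r1; split; auto. intros r Hr. unfold Isq. rewrite I2_scal; auto. rewrite Rabs_mult.
  specialize (B1 r Hr). unfold Isq in B1.
  apply Rle_trans with (Rabs c * (e / (Rabs c + 1))).
  - apply Rmult_le_compat_l; auto.
  - apply Rmult_le_reg_r with (Rabs c + 1); [lra|].
    replace (Rabs c * (e / (Rabs c + 1)) * (Rabs c + 1)) with (Rabs c * e) by (field; lra). nra.
Qed.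
Lemma nul_opp A : nul A -> nul (fun r s t => - A r s t).
Proof. intros H. eapply nul_ext; [|apply (nul_scal (-1) _ H)]. intros; simpl; ring. Qed.
Lemma nul_minus A B : nul A -> nul B -> nul (fun r s t => A r s t - B r s t).
Proof. intros; apply nul_plus; auto. apply nul_opp; auto. Qed.

Lemma powerRZ_m1 r : powerRZ r (-1) = / r.
Proof. simpl. rewrite Rmult_1_r; auto. Qed.

Lemma nb_S r s t : Rabs s = r -> Rabs t <= r -> nb 0 r s t.
Proof. intros H1 H2. unfold nb. rewrite Rmax_left; lra. Qed.
Lemma nb_T r s t : Rabs t = r -> Rabs s <= r -> nb 0 r s t.
Proof. intros H1 H2. unfold nb. rewrite Rmax_right; lra. Qed.
Lemma Rabs_neg r : 0 <= r -> Rabs (- r) = r.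
Proof. intros; rewrite Rabs_Ropp; apply Rabs_pos_eq; auto. Qed.

Lemma nul_dS F : (forall r, smooth (F r)) -> LO (-1) F -> nul (fun r => dS (F r)).
Proof.
  intros SF H. split; [auto 12 with c0 sm|]. intros e He.
  destruct (H 0 (e / 4)) as (r0 & A & B); [lra|].
  exists r0; split; auto. intros r Hr. unfold Isq. rewrite I2_dS; auto with sm.
  apply Rle_trans with ((r - (- r)) * (2 * (e / 4 * / r))).
  - apply RInt_abs_const; [lra| |].
    + intros x. apply (continuous_minus (V := R_NormedModule)); apply C0_contT; auto with sm.
    + intros t Ht. assert (Rabs t <= r) by (apply Rabs_le; lra).
      eapply Rle_trans; [apply Rabs_triang|]. rewrite Rabs_Ropp.
      assert (B1 := B r r t Hr). assert (B2 := B r (- r) t Hr). rewrite powerRZ_m1 in *.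
      assert (Rabs (F r r t) <= e / 4 * / r) by (apply B1, nb_S; auto; apply Rabs_pos_eq; lra).
      assert (Rabs (F r (- r) t) <= e / 4 * / r) by (apply B2, nb_S; auto; apply Rabs_neg; lra). lra.
  - right; field; lra.
Qed.
Lemma nul_dT F : (forall r, smooth (F r)) -> LO (-1) F -> nul (fun r => dT (F r)).
Proof.
  intros SF H. split; [auto 12 with c0 sm|]. intros e He.
  destruct (H 0 (e / 4)) as (r0 & A & B); [lra|].
  exists r0; split; auto. intros r Hr. unfold Isq. rewrite I2_dT; auto with sm.
  assert (K : forall x, Rabs x = r -> Rabs (RInt (fun s => F r s x) (- r) r) <= (r - - r) * (e / 4 * / r)).
  { intros x Hx. apply RInt_abs_const; [lra| |].
    - intros y. apply C0_contS; auto with sm.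
    - intros y Hy. rewrite <- powerRZ_m1. apply B; auto. apply nb_T; auto. apply Rabs_le; lra. }
  assert (K1 := K r ltac:(apply Rabs_pos_eq; lra)). assert (K2 := K (- r) ltac:(apply Rabs_neg; lra)).
  eapply Rle_trans; [apply Rabs_triang|]. rewrite Rabs_Ropp.
  replace ((r - - r) * (e / 4 * / r)) with (e / 2) in * by (field; lra). lra.
Qed.
(** The shifted and the original square differ by two strips of width [Rabs c] along the vertical
    sides, of area O(r), where the integrand is o(1/r). *)
Lemma nul_shd c F : Rabs c <= 1 -> (forall r, smooth (F r)) -> LO (-1) F ->
  nul (fun r s t => sh c (F r) s t - F r s t).
Proof.
  intros Hc SF H. split; [auto 12 with c0 sm|]. intros e He.
  destruct (H 1 (e / 4)) as (r0 & A & B); [lra|].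
  exists r0; split; auto. intros r Hr. unfold Isq.
  rewrite I2_minus; auto 12 with c0 sm.
  rewrite I2_sh; auto with sm.
  assert (E : I2 (F r) (- r + c) (r + c) (- r) r - I2 (F r) (- r) r (- r) r =
     RInt (fun t => RInt (fun s => F r s t) r (r + c) - RInt (fun s => F r s t) (- r) (- r + c)) (- r) r).
  { unfold I2. rewrite <- (RInt_minus (V := R_CompleteNormedModule)) by (apply ex_RInt_param; auto with sm).
    apply RInt_ext. intros t _. unfold minus, plus, opp; simpl.
    assert (CC : forall x, continuous (fun s => F r s t) x) by (intros; apply C0_contS; auto with sm).
    assert (E1 := RInt_split (fun s => F r s t) (- r) (- r + c) (r + c) CC).
    assert (E2 := RInt_split (fun s => F r s t) (- r) r (r + c) CC). lra. }
  rewrite E.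
  assert (K : forall a t, Rabs a = r -> Rabs t <= r -> Rabs (RInt (fun s => F r s t) a (a + c)) <= e / 4 * / r).
  { intros a t Ha Ht. apply Rle_trans with (Rabs (a + c - a) * (e / 4 * / r)).
    - apply (norm_RInt_le_const_abs (fun s => F r s t) a (a + c)).
      + intros x Hx. rewrite <- powerRZ_m1. apply B; auto.
        assert (Rabs (x - a) <= 1).
        { apply Rle_trans with (Rabs c); auto. unfold Rmin, Rmax, Rabs in *.
          destruct (Rle_dec a (a + c)), (Rcase_abs (x - a)), (Rcase_abs c); lra. }
        replace x with (a + (x - a)) by ring.
        assert (N := nb_sh 0 (x - a) r a t (nb_S _ _ _ Ha Ht)). unfold nb in *; lra.
      + apply (RInt_correct (V := R_CompleteNormedModule)). apply ex_RInt_S; auto with sm.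
    - replace (a + c - a) with c by ring.
      rewrite <- (Rmult_1_l (e / 4 * / r)) at 2. apply Rmult_le_compat_r; auto.
      apply Rmult_le_pos; [lra|]. apply Rlt_le, Rinv_0_lt_compat; lra. }
  apply Rle_trans with ((r - (- r)) * (2 * (e / 4 * / r))).
  - apply RInt_abs_const; [lra| |].
    + intros x. apply (continuous_minus (V := R_NormedModule)); apply RInt_param_cont; auto with sm.
    + intros t Ht. assert (Rabs t <= r) by (apply Rabs_le; lra).
      eapply Rle_trans; [apply Rabs_triang|]. rewrite Rabs_Ropp.
      assert (K1 := K r t ltac:(apply Rabs_pos_eq; lra) H0). assert (K2 := K (- r) t ltac:(apply Rabs_neg; lra) H0). lra.
  - right; field; lra.
Qed.

(* A flux of size [o(1/r)] through a boundary of length [O(r)] is negligible, so integration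
   by parts is exact modulo [nul]. *)
Lemma SO_flux a b F G : (a + b <= -1)%Z -> SO a F -> SO b G -> LO (-1) (fun r s t => F r s t * G r s t).
Proof.
  intros H HF HG. apply (LO_le (a + b)); auto. apply LO_mult; [apply LO_BO|]; apply Sym_B; auto.
Qed.
Lemma SO_sm2 a b F G : SO a F -> SO b G -> forall r, smooth (fun s t => F r s t * G r s t).
Proof. intros [H _] [H' _]; auto with sm. Qed.

(** Modulo [nul], the operators [dS], [dT], [del] and [CC] are skew-symmetric, while [mu] and [L0]
    are symmetric. The condition on the orders is the one that makes the flux o(1/r). *)
Lemma move_S a b F G : (a + b <= -1)%Z -> SO a F -> SO b G ->
  nul (fun r s t => dS (F r) s t * G r s t + F r s t * dS (G r) s t).
Proof.
  intros H HF HG. assert (SF := SO_sm _ _ HF). assert (SG := SO_sm _ _ HG).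
  eapply nul_ext; [|apply (nul_dS (fun r s t => F r s t * G r s t))]; auto with sm.
  - intros r s t; simpl. rewrite dS_mult; auto with sm.
  - eapply SO_flux; eauto.
Qed.
Lemma move_T a b F G : (a + b <= -1)%Z -> SO a F -> SO b G ->
  nul (fun r s t => dT (F r) s t * G r s t + F r s t * dT (G r) s t).
Proof.
  intros H HF HG. assert (SF := SO_sm _ _ HF). assert (SG := SO_sm _ _ HG).
  eapply nul_ext; [|apply (nul_dT (fun r s t => F r s t * G r s t))]; auto with sm.
  - intros r s t; simpl. rewrite dT_mult; auto with sm.
  - eapply SO_flux; eauto.
Qed.
Lemma half_le1 : Rabs (/ 2) <= 1.
Proof. rewrite Rabs_pos_eq; lra. Qed.
Lemma mhalf_le1 : Rabs (- / 2) <= 1.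
Proof. rewrite Rabs_Ropp; apply half_le1. Qed.
Lemma move_sh a b F G : (a + b <= -1)%Z -> SO a F -> SO b G ->
  nul (fun r s t => sh (/ 2) (F r) s t * G r s t - F r s t * sh (- / 2) (G r) s t).
Proof.
  intros H HF HG. assert (SF := SO_sm _ _ HF). assert (SG := SO_sm _ _ HG).
  eapply nul_ext; [|apply (nul_shd (/ 2) (fun r s t => F r s t * sh (- / 2) (G r) s t))].
  - intros r s t; simpl. unfold sh. replace (s + / 2 + - / 2) with s by lra. ring.
  - apply half_le1.
  - auto with sm.
  - apply (SO_flux a b F (fun r => sh (- / 2) (G r))); auto. apply SO_sh; auto.
Qed.
Lemma move_sh' a b F G : (a + b <= -1)%Z -> SO a F -> SO b G ->
  nul (fun r s t => F r s t * sh (/ 2) (G r) s t - sh (- / 2) (F r) s t * G r s t).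
Proof.
  intros H HF HG. eapply nul_ext; [|apply (move_sh b a G F); auto; lia]. intros; simpl; ring.
Qed.
Lemma move_del a b F G : (a + b <= -1)%Z -> SO a F -> SO b G ->
  nul (fun r s t => del (F r) s t * G r s t + F r s t * del (G r) s t).
Proof.
  intros H HF HG. eapply nul_ext; [|apply (nul_plus _ _ (move_sh a b F G H HF HG) (move_sh' a b F G H HF HG))].
  intros; simpl; unfold del; ring.
Qed.
Lemma move_mu a b F G : (a + b <= -1)%Z -> SO a F -> SO b G ->
  nul (fun r s t => mu (F r) s t * G r s t - F r s t * mu (G r) s t).
Proof.
  intros H HF HG.
  eapply nul_ext; [|apply (nul_scal (/ 2) _ (nul_minus _ _ (move_sh a b F G H HF HG) (move_sh' a b F G H HF HG)))].
  intros; simpl; unfold mu; ring.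
Qed.
Lemma move_CC a b F G : (a + b <= -1)%Z -> SO a F -> SO b G ->
  nul (fun r s t => CC (F r) s t * G r s t + F r s t * CC (G r) s t).
Proof.
  intros H HF HG.
  assert (SG := SO_sm _ _ HG).
  assert (N1 := move_S a b (fun r => mu (F r)) G H (SO_mu _ _ HF) HG).
  assert (N2 := move_mu a (b - 1) F (fun r => dS (G r)) ltac:(lia) HF (SO_dS _ _ HG)).
  assert (N3 := move_del a b F G H HF HG).
  eapply nul_ext; [|apply (nul_minus _ _ (nul_minus _ _ N1 N2) N3)].
  intros r s t; simpl; unfold CC. rewrite (dS_mu (G r)) by auto. ring.
Qed.
Lemma move_L0 a b F G : (a + b <= 0)%Z -> SO a F -> SO b G ->
  nul (fun r s t => L0 (F r) s t * G r s t - F r s t * L0 (G r) s t).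
Proof.
  intros H HF HG.
  assert (N1 := move_S (a - 1) b (fun r => dS (F r)) G ltac:(lia) (SO_dS _ _ HF) HG).
  assert (N2 := move_S a (b - 1) F (fun r => dS (G r)) ltac:(lia) HF (SO_dS _ _ HG)).
  assert (N3 := move_T (a - 1) b (fun r => dT (F r)) G ltac:(lia) (SO_dT _ _ HF) HG).
  assert (N4 := move_T a (b - 1) F (fun r => dT (G r)) ltac:(lia) HF (SO_dT _ _ HG)).
  assert (N5 := move_del (a - 1) b (fun r => del (F r)) G ltac:(lia) (SO_del _ _ HF) HG).
  assert (N6 := move_del a (b - 1) F (fun r => del (G r)) ltac:(lia) HF (SO_del _ _ HG)).
  eapply nul_ext; [|apply (nul_plus _ _ (nul_plus _ _ (nul_scal 2 _ (nul_minus _ _ N1 N2)) (nul_minus _ _ N3 N4)) (nul_minus _ _ N6 N5))].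
  intros r s t; simpl; unfold L0. ring.
Qed.

(* On the Fourier side in [s] this is [4 sin^2 (xi/2) <= xi^2]. *)
Lemma del_energy F : (forall r, smooth (F r)) -> LO (-1) (fun r => dS (F r)) ->
  forall e, 0 < e -> exists r0, 1 <= r0 /\ forall r, r0 <= r ->
    Isq (fun s t => del (F r) s t ^ 2) r <= Isq (fun s t => dS (F r) s t ^ 2) r + e.
Proof.
  intros SF H e He.
  (* Keeping the constant below 1 bounds the square of [m / r] by [m / r] itself, so that the two
     overhanging strips of width 1/2 contribute at most [e]. *)
  destruct (H 1 (Rmin 1 (e / 2))) as (r0 & A & B); [apply Rmin_pos; lra|].
  exists r0; split; auto. intros r Hr.
  assert (Hm1 : Rmin 1 (e / 2) <= 1) by apply Rmin_l.
  assert (Hm2 : Rmin 1 (e / 2) <= e / 2) by apply Rmin_r.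
  assert (Hm0 : 0 < Rmin 1 (e / 2)) by (apply Rmin_pos; lra).
  set (m := Rmin 1 (e / 2)) in *.
  assert (P1 : forall t, RInt (fun s => del (F r) s t ^ 2) (- r) r <=
     RInt (fun s => dS (F r) s t ^ 2) (- r - / 2) (r + / 2)).
  { intros t.
    assert (K := RInt_avg_diff (fun z => F r z t) (fun z => dS (F r) z t) (fun _ => 1) (fun _ => 1) (- r - / 2) (r - / 2)).
    replace (r - / 2 + 1) with (r + / 2) in K by lra.
    rewrite (RInt_ext (fun x => 1 * dS (F r) x t ^ 2) (fun x => dS (F r) x t ^ 2)) in K by (intros; apply Rmult_1_l).
    eapply Rle_trans; [|apply K]; clear K; try (intros; apply continuous_const); try (intros; lra); auto.
    - replace (- r - / 2) with (- r + - / 2) by lra. replace (r - / 2) with (r + - / 2) by lra.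
      rewrite <- (RInt_shift (fun s => 1 * (F r (s + 1) t - F r s t) ^ 2)).
      + right. apply RInt_ext. intros x _. unfold del, sh. replace (x + - / 2 + 1) with (x + / 2) by lra. eqR. ring.
      + intros x. apply (C0_contS (fun s t => 1 * (sh 1 (F r) s t - F r s t) ^ 2)). auto 12 with c0 sm.
    - intros; apply is_derive_dS; auto with sm.
    - intros; apply C0_contS; auto with sm. }
  assert (CD : forall t x, continuous (fun s => dS (F r) s t ^ 2) x).
  { intros. apply (C0_contS (fun s t => dS (F r) s t ^ 2)). auto 12 with c0 sm. }
  apply Rle_trans with (RInt (fun t => RInt (fun s => dS (F r) s t ^ 2) (- r - / 2) (r + / 2)) (- r) r).
  { unfold Isq, I2. apply RInt_le; [lra| | |].
    - apply ex_RInt_param. auto 12 with c0 sm.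
    - apply ex_RInt_param. auto 12 with c0 sm.
    - intros; apply P1. }
  assert (P2 : forall t, Rabs t <= r -> RInt (fun s => dS (F r) s t ^ 2) (- r - / 2) (r + / 2) <=
    RInt (fun s => dS (F r) s t ^ 2) (- r) r + e / (2 * r)).
  { intros t Ht.
    assert (E1 := RInt_split (fun s : R => dS (F r) s t ^ 2) (- r - / 2) (- r) (r + / 2) (CD t)).
    assert (E2 := RInt_split (fun s : R => dS (F r) s t ^ 2) (- r) r (r + / 2) (CD t)).
    assert (Hb : forall s, r - 1 <= Rabs s <= r + 1 -> dS (F r) s t ^ 2 <= e / (2 * r)).
    { intros s Hs. assert (N : nb 1 r s t).
      { unfold nb, Rmax. destruct (Rle_dec (Rabs s) (Rabs t)); lra. }
      assert (B' := B r s t Hr N). rewrite powerRZ_m1 in B'.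
      rewrite <- (pow2_abs (dS (F r) s t)).
      apply Rle_trans with ((m * / r) ^ 2).
      - apply pow_incr. split; auto. apply Rabs_pos.
      - assert (Hri : / r <= 1) by (rewrite <- Rinv_1; apply Rinv_le_contravar; lra).
        assert (Hri0 : 0 < / r) by (apply Rinv_0_lt_compat; lra).
        apply Rle_trans with (m * / r).
        + assert (m * / r <= 1) by nra. assert (0 <= m * / r) by nra. simpl. nra.
        + replace (e / (2 * r)) with (e / 2 * / r) by (field; lra). nra. }
    assert (Hq : forall a b, a <= b <= a + / 2 -> (forall s, a <= s <= b -> r - 1 <= Rabs s <= r + 1) ->
       RInt (fun s => dS (F r) s t ^ 2) a b <= / 2 * (e / (2 * r))).
    { intros a b Hab Hs. apply Rle_trans with (RInt (fun _ => e / (2 * r)) a b).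
      - apply RInt_le; try lra; try (apply ex_RInt_C; auto).
        + intros; apply continuous_const.
        + intros x Hx. apply Hb, Hs. lra.
      - rewrite RInt_const. unfold scal; simpl; unfold mult; simpl.
        apply Rmult_le_compat_r; [|lra]. apply Rlt_le, Rdiv_lt_0_compat; lra. }
    assert (Q1 := Hq (- r - / 2) (- r) ltac:(lra)). assert (Q2 := Hq r (r + / 2) ltac:(lra)).
    assert (RInt (fun s => dS (F r) s t ^ 2) (- r - / 2) (- r) <= / 2 * (e / (2 * r))).
    { apply Q1. intros s Hs. rewrite Rabs_left; lra. }
    assert (RInt (fun s => dS (F r) s t ^ 2) r (r + / 2) <= / 2 * (e / (2 * r))).
    { apply Q2. intros s Hs. rewrite Rabs_pos_eq; lra. }
    lra. }
  unfold Isq, I2.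
  apply Rle_trans with (RInt (fun t => RInt (fun s => dS (F r) s t ^ 2) (- r) r + e / (2 * r)) (- r) r).
  - apply RInt_le; [lra| | |].
    + apply ex_RInt_param. auto 12 with c0 sm.
    + apply (ex_RInt_plus (V := R_NormedModule)). apply ex_RInt_param. auto 12 with c0 sm. apply ex_RInt_const.
    + intros t Ht. apply P2. apply Rabs_le; lra.
  - right. rewrite (RInt_plus (V := R_CompleteNormedModule) (fun t => RInt (fun s => dS (F r) s t ^ 2) (- r) r) (fun _ => e / (2 * r))).
    + rewrite RInt_const. unfold plus, scal; simpl; unfold mult; simpl. field; lra.
    + apply ex_RInt_param. auto 12 with c0 sm.
    + apply ex_RInt_const.
Qed.

(** * The energy estimate *)

Definition tau (s t : R) : R := / 4 + s ^ 2 + t ^ 2.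

Lemma smooth_tau : smooth tau.
Proof. unfold tau; auto 10 with sm. Qed.
#[global] Hint Resolve smooth_tau : sm.

Lemma L0_del f : smooth f -> L0 (del f) = del (L0 f).
Proof.
  intros H. unfold L0. rewrite del_minus, del_plus, del_scal.
  rewrite !dS_del, !dT_del; auto with sm.
Qed.
Lemma L0_dT f : smooth f -> L0 (dT f) = dT (L0 f).
Proof.
  intros H. unfold L0.
  rewrite (dT_minus (fun s t => 2 * dS (dS f) s t + dT (dT f) s t) (del (del f))) by auto 10 with sm.
  rewrite (dT_plus (fun s t => 2 * dS (dS f) s t) (dT (dT f))) by auto 10 with sm.
  rewrite dT_scal, !dT_del by auto with sm.
  rewrite !(smooth_dS_dT f), (smooth_dS_dT (dS f)) by auto with sm. auto.
Qed.
Lemma L0_dS f : smooth f -> L0 (dS f) = dS (L0 f).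
Proof.
  intros H. unfold L0.
  rewrite (dS_minus (fun s t => 2 * dS (dS f) s t + dT (dT f) s t) (del (del f))) by auto 10 with sm.
  rewrite (dS_plus (fun s t => 2 * dS (dS f) s t) (dT (dT f))) by auto 10 with sm.
  rewrite dS_scal, !dS_del by auto with sm.
  rewrite (smooth_dS_dT (dT f)), (smooth_dS_dT f) by auto with sm. auto.
Qed.
Lemma L0_sh c f : smooth f -> L0 (sh c f) = sh c (L0 f).
Proof.
  intros H. unfold L0. rewrite !dS_sh, !dT_sh by auto with sm.
  apply fun2_ext; intros; unfold del, sh.
  replace (s + / 2 + / 2 + c) with (s + c + / 2 + / 2) by ring.
  replace (s + / 2 + - / 2 + c) with (s + c + / 2 + - / 2) by ring.
  replace (s + - / 2 + / 2 + c) with (s + c + - / 2 + / 2) by ring.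
  replace (s + - / 2 + - / 2 + c) with (s + c + - / 2 + - / 2) by ring. reflexivity.
Qed.
Lemma L0_plus f g : smooth f -> smooth g -> L0 (fun s t => f s t + g s t) = fun s t => L0 f s t + L0 g s t.
Proof.
  intros. unfold L0. rewrite !dS_plus, !dT_plus, !del_plus by auto with sm. apply fun2_ext; intros; ring.
Qed.
Lemma L0_minus f g : smooth f -> smooth g -> L0 (fun s t => f s t - g s t) = fun s t => L0 f s t - L0 g s t.
Proof.
  intros. unfold L0. rewrite !dS_minus, !dT_minus, !del_minus by auto with sm. apply fun2_ext; intros; ring.
Qed.
Lemma L0_scal c f : smooth f -> L0 (fun s t => c * f s t) = fun s t => c * L0 f s t.
Proof.
  intros. unfold L0. rewrite !dS_scal, !dT_scal, !del_scal by auto with sm. apply fun2_ext; intros; ring.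
Qed.
Lemma L0_mu f : smooth f -> L0 (mu f) = mu (L0 f).
Proof.
  intros H. unfold mu. rewrite (L0_scal (/ 2) (fun s t => sh (/ 2) f s t + sh (- / 2) f s t)) by auto with sm.
  rewrite L0_plus, !L0_sh by auto with sm. auto.
Qed.
Lemma L0_CC f : smooth f -> L0 (CC f) = CC (L0 f).
Proof.
  intros H. unfold CC. rewrite L0_minus, L0_dS, L0_mu, L0_del by auto with sm. auto.
Qed.

Section Energy.
Variable eta : R -> R -> R -> R.
Hypothesis He : SO 3 eta.
Hypothesis Eq : forall r s t, tau s t * L0 (L0 (eta r)) s t =
  2 * (del (del (dT (dT (eta r)))) s t + 8 * CC (CC (eta r)) s t).

(** In these letters the energy identity is a quadratic form. [Z] has order 1, [k] has order 0, and
    [g], [a], [p], [q], [m] have order -1, so that a product of two of the latter stays admissible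
    after multiplication by [s]; [c] has order -2 because [CC] gains three orders. *)
Let Z r := L0 (eta r).
Let g r := L0 (Z r).
Let a r := dT (dT (Z r)).
Let p r := dS (dS (Z r)).
Let k r := del (Z r).
Let q r := del (del (Z r)).
Let m r := dS (mu (del (Z r))).
Let c r := CC (Z r).

Let smE r : smooth (eta r).
Proof. apply (SO_sm _ _ He). Qed.
Let smZ r : smooth (Z r).
Proof. unfold Z; auto with sm. Qed.
Let SZ : SO 1 Z.
Proof. apply (SO_L0 3); auto. Qed.
Let Sg : SO (-1) g.
Proof. apply (SO_L0 1); auto. Qed.
Let Sa : SO (-1) a.
Proof. apply (SO_dT 0 (fun r => dT (Z r))), (SO_dT 1); auto. Qed.
Let Sp : SO (-1) p.
Proof. apply (SO_dS 0 (fun r => dS (Z r))), (SO_dS 1); auto. Qed.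
Let Sk : SO 0 k.
Proof. apply (SO_del 1); auto. Qed.
Let Sq : SO (-1) q.
Proof. apply (SO_del 0 k); auto. Qed.
Let Sm : SO (-1) m.
Proof. apply (SO_dS 0 (fun r => mu (k r))), SO_mu; auto. Qed.
Let Sc : SO (-2) c.
Proof. apply (SO_CC 1); auto. Qed.
Let Sks : SO (-1) (fun r => dS (k r)).
Proof. apply (SO_dS 0); auto. Qed.
Let Skt : SO (-1) (fun r => dT (k r)).
Proof. apply (SO_dT 0); auto. Qed.
Let Sqs : SO (-2) (fun r => dS (q r)).
Proof. apply (SO_dS (-1)); auto. Qed.
Let Ss n F : SO n F -> SO (1 + n) (fun r s t => s * F r s t).
Proof. apply (SO_mult 1 n (fun _ s _ => s)), SB_s. Qed.

Let dkt r : dT (dT (k r)) = del (a r).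
Proof. unfold k, a. rewrite !dT_del by auto with sm. auto. Qed.
Let dks r : del (dS (k r)) = dS (q r).
Proof. unfold k, q. rewrite !dS_del by auto with sm. auto. Qed.
Let mks r : mu (dS (k r)) = m r.
Proof. unfold m, k. rewrite dS_mu by auto with sm. auto. Qed.
Let dpk r : del (p r) = dS (dS (k r)).
Proof. unfold k, p. rewrite !dS_del by auto with sm. auto. Qed.
Let gE r s t : g r s t = 2 * p r s t + a r s t - q r s t.
Proof. reflexivity. Qed.

(** With weight 2 this exchanges the only negative term of [n0] for the product [a q]. *)
Let n1 : nul (fun r s t => dT (k r) s t ^ 2 - a r s t * q r s t).
Proof.
  assert (N1 := move_T 0 (-1) k (fun r => dT (k r)) ltac:(lia) Sk Skt).
  assert (N2 := move_del 0 (-1) k a ltac:(lia) Sk Sa).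
  eapply nul_ext; [|apply (nul_minus _ _ N1 N2)].
  intros r s t; simpl. rewrite dkt. unfold q. fold (k r). ring.
Qed.
Let n6 : nul (fun r s t => dS (k r) s t ^ 2 - p r s t * q r s t).
Proof.
  assert (N1 := move_del 0 (-1) (fun r => dS (Z r)) (fun r => dS (k r)) ltac:(lia) (SO_dS 1 _ SZ) Sks).
  assert (N2 := move_S 0 (-1) (fun r => dS (Z r)) q ltac:(lia) (SO_dS 1 _ SZ) Sq).
  eapply nul_ext; [|apply (nul_minus _ _ N1 N2)].
  intros r s t; simpl. rewrite dks. unfold p, k. rewrite dS_del by auto with sm. ring.
Qed.
(** [n2], [n3] and [n4] are virial identities. Taken in the ratio 1 : 2 : -1 they assemble, by [gE],
    the product [s g dS q]: the cross term of a square containing [s g], through which the part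
    [s^2 g^2] of [tau g^2] is put to use. *)
Let n4 : nul (fun r s t => s * q r s t * dS (q r) s t + / 2 * q r s t ^ 2).
Proof.
  assert (N := move_S 0 (-1) (fun r s t => s * q r s t) q ltac:(lia) (Ss _ _ Sq) Sq).
  assert (Sq' := SO_sm _ _ Sq).
  eapply nul_ext; [|apply (nul_scal (/ 2) _ N)].
  intros r s t; simpl. rewrite (dS_mult (fun s _ => s) (q r)), dS_s by auto with sm. field.
Qed.
Let n2 : nul (fun r s t => s * a r s t * dS (q r) s t + / 2 * (a r s t * q r s t) + a r s t * m r s t).
Proof.
  assert (N1 := move_del 0 (-1) (fun r s t => s * a r s t) (fun r => dS (k r)) ltac:(lia) (Ss _ _ Sa) Sks).
  assert (N2 := move_T (-1) 0 (fun r => dT (k r)) (fun r s t => s * dS (k r) s t) ltac:(lia) Skt (Ss _ _ Sks)).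
  assert (N3 := move_S 0 (-1) (fun r s t => s * dT (k r) s t) (fun r => dT (k r)) ltac:(lia) (Ss _ _ Skt) Skt).
  assert (N4 := move_mu (-1) (-1) a (fun r => dS (k r)) ltac:(lia) Sa Sks).
  assert (Sk' := SO_sm _ _ Sk).
  eapply nul_ext; [|apply (nul_plus _ _ (nul_minus _ _ (nul_plus _ _ (nul_minus _ _ N1 N2) (nul_scal (/ 2) _ N3)) N4) (nul_scal (- / 2) _ n1))].
  intros r s t; simpl. rewrite del_smul, dkt, dks, mks.
  rewrite (dT_mult (fun s _ => s) (dS (k r))), dT_s by auto with sm.
  rewrite (dS_mult (fun s _ => s) (dT (k r))), dS_s by auto with sm.
  rewrite (smooth_dS_dT (k r)) by auto. field.
Qed.
Let n3 : nul (fun r s t => s * p r s t * dS (q r) s t + p r s t * m r s t - / 2 * dS (k r) s t ^ 2).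
Proof.
  assert (N1 := move_del 0 (-1) (fun r s t => s * p r s t) (fun r => dS (k r)) ltac:(lia) (Ss _ _ Sp) Sks).
  assert (N3 := move_S 0 (-1) (fun r s t => s * dS (k r) s t) (fun r => dS (k r)) ltac:(lia) (Ss _ _ Sks) Sks).
  assert (N4 := move_mu (-1) (-1) p (fun r => dS (k r)) ltac:(lia) Sp Sks).
  assert (Sk' := SO_sm _ _ Sk).
  eapply nul_ext; [|apply (nul_minus _ _ (nul_minus _ _ N1 (nul_scal (/ 2) _ N3)) N4)].
  intros r s t; simpl. rewrite del_smul, dpk, dks, mks.
  rewrite (dS_mult (fun s _ => s) (dS (k r))), dS_s by auto with sm. field.
Qed.
(** Provides the cross term between [c] and [del q], so that the positive term [16 c^2] of [n0] can
    enter a square. *)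
Let n5 : nul (fun r s t => c r s t * del (q r) s t + (m r s t - q r s t) * q r s t).
Proof.
  assert (N := move_del (-2) (-1) c q ltac:(lia) Sc Sq).
  eapply nul_ext; [|apply N]. intros r s t; simpl. unfold c. rewrite del_CC by auto.
  fold (m r s t) (q r s t). ring.
Qed.
(** The squares of a mean and of half a difference add up to the mean of the squares, whose integral
    differs from that of [dS k ^ 2] by shifts only. *)
Let n7 : nul (fun r s t => m r s t ^ 2 + / 4 * dS (q r) s t ^ 2 - dS (k r) s t ^ 2).
Proof.
  assert (SF := SO_sm _ _ Sks).
  assert (HL : LO (-1) (fun r s t => dS (k r) s t * dS (k r) s t)) by (apply (SO_flux (-1) (-1)); auto; lia).
  assert (N1 := nul_shd (/ 2) _ half_le1 (SO_sm2 _ _ _ _ Sks Sks) HL).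
  assert (N2 := nul_shd (- / 2) _ mhalf_le1 (SO_sm2 _ _ _ _ Sks Sks) HL).
  eapply nul_ext; [|apply (nul_scal (/ 2) _ (nul_plus _ _ N1 N2))].
  intros r s t; simpl. rewrite <- mks, <- dks. unfold mu, del, sh. field.
Qed.
(** The equation tested with [g]. Since [g = L0 Z] and [L0] commutes with the operators on the
    right, moving [L0] over replaces [eta] by [Z] there; skew-symmetry then turns the right-hand
    side into [2 dT k ^ 2 - 16 c ^ 2]. *)
Let n0 : nul (fun r s t => tau s t * g r s t ^ 2 - 2 * dT (k r) s t ^ 2 + 16 * c r s t ^ 2).
Proof.
  set (Y1 := fun r => del (del (dT (dT (eta r))))). set (Y2 := fun r => CC (CC (eta r))).
  assert (SY1 : SO (-1) Y1).
  { apply (SO_del 0 (fun r => del (dT (dT (eta r))))), (SO_del 1 (fun r => dT (dT (eta r)))),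
      (SO_dT 2 (fun r => dT (eta r))), (SO_dT 3); auto. }
  assert (SY2 : SO (-3) Y2) by (apply (SO_CC 0 (fun r => CC (eta r))), (SO_CC 3); auto).
  assert (N1 := move_L0 1 (-1) Z Y1 ltac:(lia) SZ SY1).
  assert (N2 := move_L0 1 (-3) Z Y2 ltac:(lia) SZ SY2).
  assert (N3 := move_del 1 (-2) Z (fun r => dT (dT (k r))) ltac:(lia) SZ (SO_dT (-1) _ Skt)).
  assert (N4 := move_T 0 (-1) k (fun r => dT (k r)) ltac:(lia) Sk Skt).
  assert (N5 := move_CC 1 (-2) Z c ltac:(lia) SZ Sc).
  eapply nul_ext; [|apply (nul_plus _ _ (nul_scal 2 _ (nul_minus _ _ (nul_plus _ _ N1 N3) N4))
      (nul_scal 16 _ (nul_plus _ _ N2 N5)))].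
  intros r s t; simpl.
  assert (E1 : L0 (Y1 r) = del (dT (dT (k r)))).
  { unfold Y1, k. rewrite !L0_del, !L0_dT by auto with sm. rewrite !dT_del by auto with sm. reflexivity. }
  assert (E2 : L0 (Y2 r) = CC (c r)).
  { unfold Y2, c. rewrite !L0_CC by auto with sm. reflexivity. }
  rewrite E1, E2. fold (k r) (c r) (g r).
  replace (tau s t * (g r s t * (g r s t * 1))) with (g r s t * (tau s t * g r s t)) by ring.
  assert (EE : tau s t * g r s t = 2 * (Y1 r s t + 8 * Y2 r s t)) by apply Eq.
  rewrite EE. ring.
Qed.

Theorem energy_tg : forall e, 0 < e -> exists r0, 1 <= r0 /\ forall r, r0 <= r ->
  Isq (fun s t => t ^ 2 * L0 (L0 (eta r)) s t ^ 2) r <= e.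
Proof.
  intros e Hpos.
  assert (smk := SO_sm _ _ Sk). assert (smq := SO_sm _ _ Sq). assert (smg := SO_sm _ _ Sg).
  assert (smc := SO_sm _ _ Sc). assert (smm := SO_sm _ _ Sm). assert (sma := SO_sm _ _ Sa). assert (smp := SO_sm _ _ Sp).
  (* [n0] and the multiplier identities [n1]-[n7] are weighted so that, up to [del_energy], the
     form becomes [t^2 g^2] plus squares; the weights were found numerically. *)
  assert (NN := nul_plus _ _ (nul_plus _ _ (nul_plus _ _ n0 (nul_scal 2 _ n1)) (nul_plus _ _ (nul_scal (4/5) _ n2) (nul_scal (8/5) _ n3)))
      (nul_plus _ _ (nul_plus _ _ (nul_scal (-4/5) _ n4) (nul_scal (-99/25) _ n5)) (nul_plus _ _ (nul_scal (16/5) _ n6) (nul_scal (41/25) _ n7)))).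
  destruct NN as [CN LN].
  destruct (LN (e / 4)) as (r1 & A1 & B1); [lra|].
  destruct (del_energy k smk (Sym_B _ _ _ Sks) (e / 4)) as (r2 & A2 & B2); [lra|].
  destruct (del_energy q smq (LO_le (-2) (-1) _ ltac:(lia) (Sym_B _ _ _ Sqs)) (e / 4)) as (r3 & A3 & B3); [lra|].
  exists (Rmax r1 (Rmax r2 r3)). split; [apply Rle_trans with r1; auto; apply Rmax_l|].
  intros r Hr.
  assert (H1 : r1 <= r) by (eapply Rle_trans; [apply Rmax_l | eauto]).
  assert (H23 : Rmax r2 r3 <= r) by (eapply Rle_trans; [apply Rmax_r | eauto]).
  assert (H2 : r2 <= r) by (eapply Rle_trans; [apply Rmax_l | eauto]).
  assert (H3 : r3 <= r) by (eapply Rle_trans; [apply Rmax_r | eauto]).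
  specialize (B1 r H1). specialize (B2 r H2). specialize (B3 r H3).
  apply Rabs_le_between in B1.
  set (N := fun s t : R => _) in B1.
  unfold Isq in *.
  (* [19/25 = 16/5 - 4/5 - 41/25] is the total weight of [dS k ^ 2] in [n6], [n3] and [n7].
     [1/4 = 41/100 - 4/25] is what [n7] leaves of [dS q ^ 2] after completing the square with
     [2/5 * dS q]. Both weights are positive, so [del_energy] may replace these squares by those of
     [del k = q] and [del q]. *)
  assert (K : I2 (fun s t => t ^ 2 * L0 (L0 (eta r)) s t ^ 2) (- r) r (- r) r <=
     I2 (fun s t => N s t - 19/25 * (dS (k r) s t ^ 2 - del (k r) s t ^ 2)
        - /4 * (dS (q r) s t ^ 2 - del (q r) s t ^ 2)) (- r) r (- r) r).
  { apply I2_le; try lra.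
    - fold (Z r) (g r). auto 12 with c0 sm.
    - apply (C0_minus (fun s t => N s t - 19/25 * (dS (k r) s t ^ 2 - del (k r) s t ^ 2))); [|auto 15 with c0 sm].
      apply C0_minus; [apply CN | auto 15 with c0 sm].
    - intros s t _ _. fold (Z r) (g r). unfold N.
      replace (del (k r) s t) with (q r s t) by reflexivity.
      unfold tau. rewrite (gE r s t).
      match goal with |- ?X <= ?Y => replace Y with (X
         + (s * (2 * p r s t + a r s t - q r s t) + 2/5 * dS (q r) s t) ^ 2
         + /4 * (a r s t + 2 * p r s t + 8/5 * m r s t - 21/5 * q r s t) ^ 2
         + (m r s t - 3/10 * q r s t) ^ 2
         + (4 * c r s t - 99/200 * del (q r) s t) ^ 2
         + 7/100 * q r s t ^ 2 + (1/4 - (99/200)^2) * del (q r) s t ^ 2) by field end.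
      assert (P := pow2_ge_0).
      assert (P1 := P (s * (2 * p r s t + a r s t - q r s t) + 2/5 * dS (q r) s t)).
      assert (P2 := P (a r s t + 2 * p r s t + 8/5 * m r s t - 21/5 * q r s t)).
      assert (P3 := P (m r s t - 3/10 * q r s t)).
      assert (P4 := P (4 * c r s t - 99/200 * del (q r) s t)).
      assert (P5 := P (q r s t)). assert (P6 := P (del (q r) s t)). nra. }
  eapply Rle_trans; [apply K|].
  assert (C1 : C0 (fun s t => dS (k r) s t ^ 2)) by auto 12 with c0 sm.
  assert (C2 : C0 (fun s t => del (k r) s t ^ 2)) by auto 12 with c0 sm.
  assert (C3 : C0 (fun s t => dS (q r) s t ^ 2)) by auto 12 with c0 sm.
  assert (C4 : C0 (fun s t => del (q r) s t ^ 2)) by auto 12 with c0 sm.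
  rewrite (I2_minus (fun s t => N s t - 19/25 * (dS (k r) s t ^ 2 - del (k r) s t ^ 2))) by (try (apply C0_minus; [apply CN|]); auto 12 with c0).
  rewrite I2_minus by (try apply CN; auto 12 with c0).
  rewrite !I2_scal by auto 12 with c0.
  rewrite !I2_minus by auto 12 with c0. lra.
Qed.
End Energy.

(** * Mean values over ellipses and interior regularity *)

Lemma MVT_gen_R (f g : R -> R) a b : (forall x, is_derive f x (g x)) ->
  exists c, Rmin a b <= c <= Rmax a b /\ f b - f a = g c * (b - a).
Proof.
  intros Hd. apply (MVT_gen f a b g).
  - intros; apply Hd.
  - intros x _. apply derivable_continuous_pt. exists (g x). apply is_derive_Reals, Hd.
Qed.

Lemma Rminmax_near a b x d : Rmin a b <= x <= Rmax a b -> Rabs (b - a) < d -> Rabs (x - a) < d.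
Proof.
  intros H1 H2. unfold Rmin, Rmax in H1. destruct (Rle_dec a b); apply Rabs_def2 in H2; apply Rabs_def1; lra.
Qed.

Lemma C1_differentiable f x y : diffS f -> diffT f -> C0 (dS f) -> C0 (dT f) ->
  differentiable_pt_lim f x y (dS f x y) (dT f x y).
Proof.
  intros H1 H2 H3 H4 eps.
  assert (He : 0 < eps / 2) by (assert (0 < eps) by apply cond_pos; lra).
  destruct (H3 x y (mkposreal _ He)) as [d1 D1]. destruct (H4 x y (mkposreal _ He)) as [d2 D2]. simpl in *.
  assert (Hd : 0 < Rmin d1 d2) by (apply Rmin_pos; apply cond_pos).
  exists (mkposreal _ Hd). simpl. intros u v Hu Hv.
  assert (Hu1 := Rlt_le_trans _ _ _ Hu (Rmin_l d1 d2)). assert (Hv1 := Rlt_le_trans _ _ _ Hv (Rmin_l d1 d2)).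
  assert (Hv2 := Rlt_le_trans _ _ _ Hv (Rmin_r d1 d2)).
  destruct (MVT_gen_R (fun z => f z v) (fun z => dS f z v) x u) as [p [P1 P2]].
  { intros; apply is_derive_dS; auto. }
  destruct (MVT_gen_R (fun z => f x z) (fun z => dT f x z) y v) as [q [Q1 Q2]].
  { intros; apply is_derive_dT; auto. }
  cbv beta in P2, Q2.
  assert (A1 := D1 p v (Rminmax_near _ _ _ _ P1 Hu1) Hv1).
  assert (A2 := D2 x q ltac:(rewrite Rminus_diag, Rabs_R0; apply cond_pos) (Rminmax_near _ _ _ _ Q1 Hv2)).
  assert (E : f u v - f x y - (dS f x y * (u - x) + dT f x y * (v - y)) =
    (dS f p v - dS f x y) * (u - x) + (dT f x q - dT f x y) * (v - y)).
  { replace (f u v - f x y) with ((f u v - f x v) + (f x v - f x y)) by ring.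
    rewrite P2, Q2. ring. }
  rewrite E.
  eapply Rle_trans; [apply Rabs_triang|]. rewrite !Rabs_mult.
  assert (Hm1 := Rmax_l (Rabs (u - x)) (Rabs (v - y))). assert (Hm2 := Rmax_r (Rabs (u - x)) (Rabs (v - y))).
  assert (B1 := Rabs_pos (u - x)). assert (B2 := Rabs_pos (v - y)).
  assert (B3 := Rabs_pos (dS f p v - dS f x y)). assert (B4 := Rabs_pos (dT f x q - dT f x y)).
  set (M := Rmax (Rabs (u - x)) (Rabs (v - y))) in *.
  assert (Rabs (dS f p v - dS f x y) * Rabs (u - x) <= eps / 2 * M) by (apply Rmult_le_compat; lra).
  assert (Rabs (dT f x q - dT f x y) * Rabs (v - y) <= eps / 2 * M) by (apply Rmult_le_compat; lra).
  lra.
Qed.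

Lemma chain2 f (X Y : R -> R) r x' y' : Ck 1 f -> is_derive X r x' -> is_derive Y r y' ->
  is_derive (fun r => f (X r) (Y r)) r (dS f (X r) (Y r) * x' + dT f (X r) (Y r) * y').
Proof.
  intros (F0 & F1 & F2 & F3 & F4) HX HY. apply is_derive_Reals. apply derivable_pt_lim_comp_2d.
  - apply C1_differentiable; auto; [apply F3 | apply F4].
  - apply is_derive_Reals; auto.
  - apply is_derive_Reals; auto.
Qed.

Lemma C0_comp2 f X Y : C0 f -> C0 X -> C0 Y -> C0 (fun r q => f (X r q) (Y r q)).
Proof.
  intros Hf HX HY r q eps. destruct (Hf (X r q) (Y r q) eps) as [d Hd].
  destruct (HX r q d) as [d1 D1]. destruct (HY r q d) as [d2 D2].
  assert (Hm : 0 < Rmin d1 d2) by (apply Rmin_pos; apply cond_pos).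
  exists (mkposreal _ Hm); simpl; intros u v Hu Hv. apply Hd.
  - apply D1; (eapply Rlt_le_trans; [eauto | apply Rmin_l]).
  - apply D2; (eapply Rlt_le_trans; [eauto | apply Rmin_r]).
Qed.
Lemma C0_1 (k : R -> R) : (forall x, continuous k x) -> C0 (fun _ q => k q).
Proof.
  intros H r q eps. destruct (proj1 (filterlim_locally k (k q)) (H q) eps) as [d Hd].
  exists d. intros u v _ Hv. apply Hd, Hv.
Qed.
Lemma C0_2 (k : R -> R) : (forall x, continuous k x) -> C0 (fun q _ => k q).
Proof.
  intros H q r eps. destruct (proj1 (filterlim_locally k (k q)) (H q) eps) as [d Hd].
  exists d. intros u v Hv _. apply Hd, Hv.
Qed.
Lemma continuous_cos x : continuous cos x.
Proof. apply (ex_derive_continuous (K := R_AbsRing) (V := R_NormedModule)). auto_derive; auto. Qed.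
Lemma continuous_sin x : continuous sin x.
Proof. apply (ex_derive_continuous (K := R_AbsRing) (V := R_NormedModule)). auto_derive; auto. Qed.
#[global] Hint Resolve continuous_cos continuous_sin C0_1 C0_2 : c0.

Definition rt2 : R := sqrt 2.
Lemma rt2_sq : rt2 * rt2 = 2.
Proof. apply sqrt_sqrt; lra. Qed.
Lemma rt2_bd : 0 < rt2 <= 2.
Proof. assert (H := rt2_sq). assert (0 < rt2) by (apply sqrt_lt_R0; lra). split; auto. nra. Qed.

(* Ellipses adapted to [2 d_s^2 + d_t^2]. *)
Definition px (s r q : R) : R := s + rt2 * r * cos q.
Definition py (t r q : R) : R := t + r * sin q.

Definition Pol (f : R -> R -> R) (k : R -> R) (s t r : R) : R :=
  RInt (fun q => f (px s r q) (py t r q) * k q) 0 (2 * PI).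

Lemma C0_polar f k s t : C0 f -> (forall x, continuous k x) -> C0 (fun q r => f (px s r q) (py t r q) * k q).
Proof.
  intros Hf Hk. apply (C0_mult (fun q r => f (px s r q) (py t r q))).
  - apply (C0_comp2 f (fun q r => px s r q) (fun q r => py t r q)); auto; unfold px, py.
    + apply C0_plus; [apply C0_const|]. apply (C0_mult (fun q r => rt2 * r) (fun q _ => cos q)); auto with c0.
    + apply C0_plus; [apply C0_const|]. apply (C0_mult (fun q r => r) (fun q _ => sin q)); auto with c0.
  - apply C0_2; auto.
Qed.

Lemma Pol_cont f k s t r : C0 f -> (forall x, continuous k x) -> continuous (Pol f k s t) r.
Proof.
  intros Hf Hk. unfold Pol.
  apply (RInt_param_cont (fun q r => f (px s r q) (py t r q) * k q)). apply C0_polar; auto.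
Qed.
Lemma Pol_ex f k s t r : C0 f -> (forall x, continuous k x) ->
  ex_RInt (fun q => f (px s r q) (py t r q) * k q) 0 (2 * PI).
Proof. intros. apply (ex_RInt_S (fun q r => f (px s r q) (py t r q) * k q)), C0_polar; auto. Qed.

Lemma Pol_add f g k l s t r : C0 f -> C0 g -> (forall x, continuous k x) -> (forall x, continuous l x) ->
  Pol f k s t r + Pol g l s t r =
  RInt (fun q => f (px s r q) (py t r q) * k q + g (px s r q) (py t r q) * l q) 0 (2 * PI).
Proof.
  intros. symmetry. apply (RInt_plus (V := R_CompleteNormedModule)); apply Pol_ex; auto.
Qed.

Lemma continuous_mulR (f g : R -> R) x : continuous f x -> continuous g x -> continuous (fun x => f x * g x) x.
Proof. apply (continuous_mult (K := R_AbsRing)). Qed.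
Lemma continuous_scalR c (g : R -> R) x : continuous g x -> continuous (fun x => c * g x) x.
Proof. intros; apply continuous_mulR; auto. apply continuous_const. Qed.
Lemma continuous_plusR (f g : R -> R) x : continuous f x -> continuous g x -> continuous (fun x => f x + g x) x.
Proof. apply (continuous_plus (V := R_NormedModule)). Qed.
Lemma continuous_minusR (f g : R -> R) x : continuous f x -> continuous g x -> continuous (fun x => f x - g x) x.
Proof. apply (continuous_minus (V := R_NormedModule)). Qed.
Lemma continuous_idR (x : R) : continuous (fun x : R => x) x.
Proof. apply continuous_id. Qed.
Lemma continuous_powR (f : R -> R) n x : continuous f x -> continuous (fun x => f x ^ n) x.
Proof. intros; induction n; simpl; [apply continuous_const | apply continuous_mulR; auto]. Qed.
#[global] Hint Resolve continuous_mulR continuous_scalR continuous_plusR continuous_minusR continuous_idR continuous_powR : c0.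

Lemma Pol_derive f k s t r : Ck 1 f -> (forall x, continuous k x) ->
  is_derive (Pol f k s t) r
    (Pol (dS f) (fun q => rt2 * cos q * k q) s t r + Pol (dT f) (fun q => sin q * k q) s t r).
Proof.
  intros Hf Hk. assert (Hf' := Hf). destruct Hf as (F0 & F1 & F2 & F3 & F4).
  apply Ck_C0 in F3. apply Ck_C0 in F4.
  assert (D : forall r q, is_derive (fun r => f (px s r q) (py t r q) * k q) r
     (dS f (px s r q) (py t r q) * (rt2 * cos q * k q) + dT f (px s r q) (py t r q) * (sin q * k q))).
  { intros r0 q. evar_last.
    - apply (is_derive_mult (fun r => f (px s r q) (py t r q)) (fun _ => k q)).
      + apply (chain2 f (fun r => px s r q) (fun r => py t r q)); auto; unfold px, py; auto_derive; auto.
      + apply (is_derive_const (k q)).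
      + intros; apply Rmult_comm.
    - unfold plus, mult, zero; simpl. ring. }
  rewrite Pol_add by auto 10 with c0.
  evar_last.
  - apply (is_derive_RInt_param (fun r q => f (px s r q) (py t r q) * k q) 0 (2 * PI) r).
    + exists (mkposreal 1 Rlt_0_1). intros y _ q _. eexists; apply D.
    + intros q _.
      apply (continuity_2d_pt_ext (fun r q => dS f (px s r q) (py t r q) * (rt2 * cos q * k q) + dT f (px s r q) (py t r q) * (sin q * k q))).
      * intros; symmetry; apply is_derive_unique, D.
      * assert (A1 := C0_polar (dS f) (fun q => rt2 * cos q * k q) s t F3 ltac:(auto 10 with c0)).
        assert (A2 := C0_polar (dT f) (fun q => sin q * k q) s t F4 ltac:(auto 10 with c0)).
        intros eps. destruct (C0_plus _ _ A1 A2 q r eps) as [d Hd]. exists d; intros u v Hu Hv. apply Hd; auto.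
    + exists (mkposreal 1 Rlt_0_1). intros y _. apply Pol_ex; auto.
  - apply RInt_ext. intros q _. apply is_derive_unique, D.
Qed.

Section Repr.
Variable w : R -> R -> R.
Hypothesis Hw : Ck 2 w.
Let f := fun s t => 2 * dS (dS w) s t + dT (dT w) s t.
(** Stands for the pairs [cos, - sin] and [sin, cos]: first Fourier modes, whose radial derivative
    at the centre is a component of the gradient. *)
Variables cs cs' : R -> R.
Hypothesis Dcs : forall q, is_derive cs q (cs' q).
Hypothesis Dcs' : forall q, is_derive cs' q (- cs q).
Hypothesis per : cs (2 * PI) = cs 0.
Hypothesis per' : cs' (2 * PI) = cs' 0.

Let Ccs x : continuous cs x.
Proof. apply (ex_derive_continuous (K := R_AbsRing) (V := R_NormedModule)). eexists; apply Dcs. Qed.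
Let Ccs' x : continuous cs' x.
Proof. apply (ex_derive_continuous (K := R_AbsRing) (V := R_NormedModule)). eexists; apply Dcs'. Qed.
Let H1 : Ck 1 w. Proof. apply Ck_pred; auto. Qed.
Let HS : Ck 1 (dS w). Proof. apply Hw. Qed.
Let HT : Ck 1 (dT w). Proof. apply Hw. Qed.
Let HSS : C0 (dS (dS w)). Proof. apply HS. Qed.
Let HST : C0 (dT (dS w)). Proof. apply HS. Qed.
Let HTS : C0 (dS (dT w)). Proof. apply HT. Qed.
Let HTT : C0 (dT (dT w)). Proof. apply HT. Qed.
Let Cw : C0 w. Proof. apply Hw. Qed.
Let CS : C0 (dS w). Proof. apply HS. Qed.
Let CT : C0 (dT w). Proof. apply HT. Qed.
Let Cf : C0 f. Proof. unfold f. auto with c0. Qed.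

Variables s t : R.
Let Phi := Pol w cs s t.
Let Phi1 r := Pol (dS w) (fun q => rt2 * cos q * cs q) s t r + Pol (dT w) (fun q => sin q * cs q) s t r.
Let Phi2 r := Pol (dS (dS w)) (fun q => rt2 * cos q * (rt2 * cos q * cs q)) s t r
    + Pol (dT (dS w)) (fun q => sin q * (rt2 * cos q * cs q)) s t r
    + (Pol (dS (dT w)) (fun q => rt2 * cos q * (sin q * cs q)) s t r
    + Pol (dT (dT w)) (fun q => sin q * (sin q * cs q)) s t r).

Let D1 r : is_derive Phi r (Phi1 r).
Proof. apply Pol_derive; auto. Qed.
Let D2 r : is_derive Phi1 r (Phi2 r).
Proof.
  apply (is_derive_plus (Pol (dS w) (fun q => rt2 * cos q * cs q) s t) (Pol (dT w) (fun q => sin q * cs q) s t));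
  apply Pol_derive; auto 10 with c0.
Qed.

(** With [A] the restriction of [w] to the ellipse of parameter [r], the integrand is
    [(A'' + A) cs], the derivative of the periodic function [A' cs - A cs']. *)
Let angular r : RInt (fun q =>
   (r ^ 2 * (2 * sin q ^ 2 * dS (dS w) (px s r q) (py t r q)
      - 2 * rt2 * (sin q * cos q) * dS (dT w) (px s r q) (py t r q) + cos q ^ 2 * dT (dT w) (px s r q) (py t r q))
    - r * (rt2 * cos q * dS w (px s r q) (py t r q) + sin q * dT w (px s r q) (py t r q))
    + w (px s r q) (py t r q)) * cs q) 0 (2 * PI) = 0.
Proof.
  set (A := fun q => w (px s r q) (py t r q)).
  set (A1 := fun q => dS w (px s r q) (py t r q) * (- rt2 * r * sin q) + dT w (px s r q) (py t r q) * (r * cos q)).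
  assert (DX : forall q, is_derive (fun q => px s r q) q (- rt2 * r * sin q)).
  { intros; unfold px; auto_derive; auto; ring. }
  assert (DY : forall q, is_derive (fun q => py t r q) q (r * cos q)).
  { intros; unfold py; auto_derive; auto; ring. }
  assert (DA : forall q, is_derive A q (A1 q)) by (intros; apply (chain2 w (fun q => px s r q) (fun q => py t r q)); auto).
  assert (DS := fun q => chain2 (dS w) (fun q => px s r q) (fun q => py t r q) q _ _ HS (DX q) (DY q)).
  assert (DT := fun q => chain2 (dT w) (fun q => px s r q) (fun q => py t r q) q _ _ HT (DX q) (DY q)).
  assert (E := RInt_D (fun q => A1 q * cs q - A q * cs' q) (fun q =>
   (r ^ 2 * (2 * sin q ^ 2 * dS (dS w) (px s r q) (py t r q)
      - 2 * rt2 * (sin q * cos q) * dS (dT w) (px s r q) (py t r q) + cos q ^ 2 * dT (dT w) (px s r q) (py t r q))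
    - r * (rt2 * cos q * dS w (px s r q) (py t r q) + sin q * dT w (px s r q) (py t r q))
    + w (px s r q) (py t r q)) * cs q) 0 (2 * PI)).
  rewrite E; clear E.
  - unfold A1, A, px, py. rewrite per, per', cos_2PI, sin_2PI, cos_0, sin_0. eqR. ring.
  - intros q. evar_last.
    + apply (is_derive_minus (fun q => A1 q * cs q) (fun q => A q * cs' q)).
      * apply (is_derive_mult A1 cs); [|apply Dcs|intros; apply Rmult_comm].
        apply (is_derive_plus (fun q => dS w (px s r q) (py t r q) * (- rt2 * r * sin q)) (fun q => dT w (px s r q) (py t r q) * (r * cos q))).
        -- apply (is_derive_mult (fun q => dS w (px s r q) (py t r q)) (fun q => - rt2 * r * sin q)); [apply DS| |intros; apply Rmult_comm].
           instantiate (1 := - rt2 * r * cos q). auto_derive; auto; ring.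
        -- apply (is_derive_mult (fun q => dT w (px s r q) (py t r q)) (fun q => r * cos q)); [apply DT| |intros; apply Rmult_comm].
           instantiate (1 := - r * sin q). auto_derive; auto; ring.
      * apply (is_derive_mult A cs'); [apply DA | apply Dcs' | intros; apply Rmult_comm].
    + unfold minus, plus, mult, opp; simpl. unfold A1, A.
      rewrite (dS_dT w) by auto. replace 2 with (rt2 * rt2) at 1 by apply rt2_sq. ring.
  - intros q. apply continuous_mulR; auto.
    assert (CC : forall g, C0 g -> continuous (fun q => g (px s r q) (py t r q)) q).
    { intros g Hg. apply (C0_contS (fun q r => g (px s r q) (py t r q)) q r).
      assert (K := C0_polar g (fun _ => 1) s t Hg ltac:(intros; apply continuous_const)).
      intros u v eps. destruct (K u v eps) as [d Hd]. exists d; intros. rewrite !Rmult_1_r in Hd.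
      specialize (Hd u0 v0 H H0). rewrite !Rmult_1_r in Hd. auto. }
    assert (CC1 := CC w Cw). assert (CC2 := CC _ CS). assert (CC3 := CC _ CT). assert (CC4 := CC _ HSS).
    assert (CC5 := CC _ HTS). assert (CC6 := CC _ HTT).
    apply continuous_plusR; auto. apply continuous_minusR.
    + apply continuous_scalR. apply continuous_plusR; [apply continuous_minusR|]; auto 12 with c0.
    + apply continuous_scalR. auto 12 with c0.
Qed.

(** In the elliptic polar coordinates [2 d_s^2 + d_t^2] is the Laplacian
    [d_r^2 + d_r / r + d_q^2 / r^2], and on a first Fourier mode [d_q^2] acts as -1: this is an
    Euler equation in [r]. *)
Let ode r : r ^ 2 * Phi2 r + r * Phi1 r - Phi r = r ^ 2 * Pol f cs s t r.
Proof.
  assert (A := angular r).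
  assert (CP : forall g k, C0 g -> (forall x, continuous k x) -> forall q, continuous (fun q => g (px s r q) (py t r q) * k q) q).
  { intros g k Hg Hk q. apply (C0_contS (fun q r => g (px s r q) (py t r q) * k q) q r), C0_polar; auto. }
  assert (L : forall (F G : R -> R) c, (forall q, continuous F q) -> (forall q, continuous G q) ->
     RInt F 0 (2 * PI) + c * RInt G 0 (2 * PI) = RInt (fun q => F q + c * G q) 0 (2 * PI)).
  { intros F G c HF HG. symmetry.
    rewrite (RInt_plusR F (fun q => c * G q)), RInt_scalR by auto with c0. reflexivity. }
  unfold Phi, Phi1, Phi2, Pol in *.
  match goal with |- _ ^ 2 * (RInt ?F1 _ _ + RInt ?F2 _ _ + (RInt ?F3 _ _ + RInt ?F4 _ _)) + _ * (RInt ?F5 _ _ + RInt ?F6 _ _) - RInt ?F7 _ _ = _ * RInt ?F8 _ _ =>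
    assert (c1 : forall q, continuous F1 q) by (apply CP; auto 12 with c0);
    assert (c2 : forall q, continuous F2 q) by (apply CP; auto 12 with c0);
    assert (c3 : forall q, continuous F3 q) by (apply CP; auto 12 with c0);
    assert (c4 : forall q, continuous F4 q) by (apply CP; auto 12 with c0);
    assert (c5 : forall q, continuous F5 q) by (apply CP; auto 12 with c0);
    assert (c6 : forall q, continuous F6 q) by (apply CP; auto 12 with c0);
    assert (c7 : forall q, continuous F7 q) by (apply CP; auto 12 with c0);
    assert (c8 : forall q, continuous F8 q) by (apply CP; auto 12 with c0);
    assert (T : (((((((0 + r ^ 2 * RInt F1 0 (2 * PI)) + r ^ 2 * RInt F2 0 (2 * PI)) + r ^ 2 * RInt F3 0 (2 * PI)) + r ^ 2 * RInt F4 0 (2 * PI))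
       + r * RInt F5 0 (2 * PI)) + r * RInt F6 0 (2 * PI)) + (-1) * RInt F7 0 (2 * PI)) + (- r ^ 2) * RInt F8 0 (2 * PI) = 0)
  end; [|lra].
  rewrite <- A at 1.
  assert (cA : forall q, continuous (fun q =>
   (r ^ 2 * (2 * sin q ^ 2 * dS (dS w) (px s r q) (py t r q)
      - 2 * rt2 * (sin q * cos q) * dS (dT w) (px s r q) (py t r q) + cos q ^ 2 * dT (dT w) (px s r q) (py t r q))
    - r * (rt2 * cos q * dS w (px s r q) (py t r q) + sin q * dT w (px s r q) (py t r q))
    + w (px s r q) (py t r q)) * cs q) q).
  { intros q. apply continuous_mulR; auto.
    assert (K : forall g, C0 g -> continuous (fun q => g (px s r q) (py t r q)) q).
    { intros g Hg. apply continuous_ext with (fun q => g (px s r q) (py t r q) * 1); [intros; eqR; ring|].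
      apply CP; auto. intros; apply continuous_const. }
    assert (CC1 := K w Cw). assert (CC2 := K _ CS). assert (CC3 := K _ CT). assert (CC4 := K _ HSS).
    assert (CC5 := K _ HTS). assert (CC6 := K _ HTT).
    apply continuous_plusR; auto. apply continuous_minusR.
    + apply continuous_scalR. apply continuous_plusR; [apply continuous_minusR|]; auto 12 with c0.
    + apply continuous_scalR. auto 12 with c0. }
  rewrite L by auto. rewrite L by auto with c0. rewrite L by auto with c0. rewrite L by auto with c0.
  rewrite L by auto 10 with c0. rewrite L by auto 12 with c0. rewrite L by auto 12 with c0. rewrite L by auto 14 with c0.
  rewrite (RInt_ext _ (fun _ => 0)).
  - rewrite RInt_const. unfold scal; simpl; unfold mult; simpl; ring.
  - intros q _. unfold f. rewrite <- (dS_dT w) by auto.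
    assert (R2 := rt2_sq). assert (S2 := sin2_cos2 q). unfold Rsqr in S2.
    match goal with |- @eq _ ?a ?b => change (@eq R a b) end.
    set (X := dS (dS w) (px s r q) (py t r q)). set (Y := dS (dT w) (px s r q) (py t r q)).
    set (V := dT (dT w) (px s r q) (py t r q)).
    replace (cos q ^ 2) with (1 - sin q * sin q) by lra.
    replace (rt2 * cos q * (rt2 * cos q * cs q)) with (rt2 * rt2 * (cos q * cos q) * cs q) by ring.
    rewrite R2. replace (cos q * cos q) with (1 - sin q * sin q) by lra. ring.
Qed.

(** The Euler equation is integrated against [h = (1 - r^2)^2 / 2]. Its adjoint sends [h] to
    [h'' - h' / r = 4 r^2], since the terms in [h / r^2] cancel; as [h] vanishes to second order at
    1, only the boundary term [Phi1 0] at the centre survives. *)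
Lemma repr_formula : Phi1 0 = RInt (fun r => 4 * r ^ 2 * Pol w cs s t r - / 2 * (1 - r ^ 2) ^ 2 * Pol f cs s t r) 0 1.
Proof.
  set (K := fun r => 4 * r ^ 2 * Pol w cs s t r - / 2 * (1 - r ^ 2) ^ 2 * Pol f cs s t r).
  assert (CPhi : forall x, continuous Phi x) by (intros; apply Pol_cont; auto).
  assert (CPhi1 : forall x, continuous Phi1 x).
  { intros; apply (ex_derive_continuous (K := R_AbsRing) (V := R_NormedModule)). eexists; apply D2. }
  assert (CPf : forall x, continuous (Pol f cs s t) x) by (intros; apply Pol_cont; auto).
  assert (Cone : forall x : R, continuous (fun _ : R => 1) x) by (intros; apply continuous_const).
  assert (CK : forall x, continuous K x).
  { intros x. unfold K. apply continuous_minusR; apply continuous_mulR; auto.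
    - auto with c0. - auto 10 with c0. }
  assert (Phi0 : Phi 0 = 0).
  { unfold Phi, Pol.
    rewrite (RInt_ext _ (fun q => w s t * cs q)).
    - rewrite RInt_scalR by auto.
      rewrite (RInt_D (fun q => - cs' q) cs); auto.
      + rewrite per'. ring.
      + intros x. evar_last; [apply (is_derive_opp cs'), Dcs'|]. unfold opp; simpl; ring.
    - intros q _. unfold px, py. rewrite Rmult_0_r, !Rmult_0_l, !Rplus_0_r. reflexivity. }
  set (I := fun x => RInt K 0 x).
  assert (CI : forall x, continuous I x).
  { intros x. apply (ex_derive_continuous (K := R_AbsRing) (V := R_NormedModule)). eexists.
    apply (is_derive_RInt (V := R_CompleteNormedModule) K I 0 x); auto.
    exists (mkposreal 1 Rlt_0_1). intros y _. apply (RInt_correct (V := R_CompleteNormedModule)), ex_RInt_C; auto. }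
  (* [Qf] is [G + I], for the [G] of [Key] below, with [Phi x / x] replaced by a value [Phi1 y]
     (mean value theorem); [G + I] is constant by [ode], and [Qf] allows [x] to tend to 0. *)
  set (Qf := fun x y => / 2 * (1 - x ^ 2) ^ 2 * Phi1 x + Phi1 y * (/ 2 + x ^ 2 - 3 / 2 * x ^ 4) + I x).
  assert (CQ : C0 Qf).
  { unfold Qf. apply C0_plus; [apply C0_plus|].
    - apply (C0_2 (fun x => / 2 * (1 - x ^ 2) ^ 2 * Phi1 x)). auto 12 with c0.
    - apply (C0_mult (fun _ y => Phi1 y) (fun x _ => / 2 + x ^ 2 - 3 / 2 * x ^ 4)); auto 10 with c0.
    - apply C0_2; auto. }
  assert (Q0 : Qf 0 0 = Phi1 0).
  { unfold Qf, I. rewrite RInt_point. unfold zero; simpl. field. }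
  assert (Key : forall x, 0 < x < 1 -> exists y, 0 <= y <= x /\ Qf x y = RInt K 0 1).
  { intros x Hx. destruct (MVT_gen_R Phi Phi1 0 x D1) as [y [Hy E]].
    rewrite Rmin_left, Rmax_right in Hy by lra. exists y; split; auto.
    set (G := fun r => / 2 * (1 - r ^ 2) ^ 2 * Phi1 r + Phi r * / r * (/ 2 + r ^ 2 - 3 / 2 * r ^ 4)).
    assert (DG : forall r, x <= r <= 1 -> is_derive G r (- K r)).
    { intros r Hr. unfold G. evar_last.
      - apply (is_derive_plus (fun r => / 2 * (1 - r ^ 2) ^ 2 * Phi1 r) (fun r => Phi r * / r * (/ 2 + r ^ 2 - 3 / 2 * r ^ 4))).
        + apply (is_derive_mult (fun r => / 2 * (1 - r ^ 2) ^ 2) Phi1); [|apply D2|intros; apply Rmult_comm].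
          instantiate (1 := - 2 * r * (1 - r ^ 2)). auto_derive; auto; field.
        + apply (is_derive_mult (fun r => Phi r * / r) (fun r => / 2 + r ^ 2 - 3 / 2 * r ^ 4)); [| |intros; apply Rmult_comm].
          * apply (is_derive_mult Phi (fun r => / r)); [apply D1| |intros; apply Rmult_comm].
            instantiate (1 := - / r ^ 2). auto_derive; [lra|field; lra].
          * instantiate (1 := 2 * r - 6 * r ^ 3). auto_derive; auto; field.
      - unfold plus, mult; simpl. unfold K. fold Phi.
        assert (O := ode r).
        replace (Pol f cs s t r) with (Phi2 r + Phi1 r * / r - Phi r * / (r * r)).
        + field; lra.
        + apply Rmult_eq_reg_l with (r ^ 2); [|apply pow_nonzero; lra]. rewrite <- O. field; lra. }
    assert (E2 : RInt (fun r => - K r) x 1 = G 1 - G x).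
    { apply is_RInt_unique. apply (is_RInt_derive (V := R_CompleteNormedModule)).
      - intros r Hr. rewrite Rmin_left, Rmax_right in Hr by lra. apply DG; auto.
      - intros r _. apply (continuous_opp (V := R_NormedModule)); auto. }
    rewrite RInt_oppR in E2 by auto.
    assert (E3 := RInt_split K 0 x 1 CK).
    assert (G1 : G 1 = 0) by (unfold G; field).
    unfold opp in E2; simpl in E2. rewrite Phi0 in E.
    unfold Qf, I. rewrite <- E3.
    assert (E4 : Phi1 y = Phi x * / x) by (apply Rmult_eq_reg_r with x; [|lra]; field_simplify; lra).
    rewrite E4. fold (G x). lra. }
  (* The value in [Key] does not depend on [x]; letting [x], and with it [y], tend to 0 identifies
     it with [Qf 0 0] by continuity. *)
  apply cond_eq. intros eps Heps.
  destruct (CQ 0 0 (mkposreal eps Heps)) as [d Hd]. simpl in Hd.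
  assert (Hdp := cond_pos d).
  assert (Hx : 0 < Rmin (d / 2) (/ 2) < 1).
  { split; [apply Rmin_pos; lra|]. eapply Rle_lt_trans; [apply Rmin_r|]; lra. }
  destruct (Key _ Hx) as [y [Hy E]].
  assert (Hxd : Rmin (d / 2) (/ 2) <= d / 2) by apply Rmin_l.
  specialize (Hd (Rmin (d / 2) (/ 2)) y). rewrite E, Q0 in Hd.
  rewrite Rabs_minus_sym. apply Hd.
  - rewrite Rminus_0_r, Rabs_pos_eq; lra.
  - rewrite Rminus_0_r, Rabs_pos_eq; lra.
Qed.
End Repr.

(** * Weighted averages over ellipses *)

Definition tr (c d : R) (f : R -> R -> R) : R -> R -> R := fun x y => f (x + c) (y + d).
Lemma C0_tr c d f : C0 f -> C0 (tr c d f).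
Proof.
  intros H. apply (C0_comp2 f (fun x _ => x + c) (fun _ y => y + d)); auto with c0.
Qed.
#[global] Hint Resolve C0_tr : c0.

Section Polar.
Variables k p : R -> R.
Hypothesis Ck_ : forall x, continuous k x.
Hypothesis Cp : forall x, continuous p x.
Hypothesis Bk : forall x, Rabs (k x) <= 1.
Hypothesis Bp : forall x, 0 <= x <= 1 -> Rabs (p x) <= 4.

Definition Op (f : R -> R -> R) : R -> R -> R := fun s t => RInt (fun r => p r * Pol f k s t r) 0 1.

Let cont f s t : C0 f -> forall r, continuous (fun r => p r * Pol f k s t r) r.
Proof. intros; apply continuous_mulR; auto. apply Pol_cont; auto. Qed.

Lemma Op_minus f g s t : C0 f -> C0 g -> Op (fun x y => f x y - g x y) s t = Op f s t - Op g s t.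
Proof.
  intros Hf Hg. unfold Op. rewrite <- RInt_minusR by auto. apply RInt_ext. intros r _. unfold Pol.
  rewrite (RInt_ext _ (fun q => f (px s r q) (py t r q) * k q - g (px s r q) (py t r q) * k q))
    by (intros; eqR; ring).
  rewrite (RInt_minusR (fun q => f (px s r q) (py t r q) * k q) (fun q => g (px s r q) (py t r q) * k q)).
  - eqR; ring.
  - intros q. apply (C0_contS (fun q r => f (px s r q) (py t r q) * k q) q r), C0_polar; auto.
  - intros q. apply (C0_contS (fun q r => g (px s r q) (py t r q) * k q) q r), C0_polar; auto.
Qed.
Lemma Op_scal c f s t : C0 f -> Op (fun x y => c * f x y) s t = c * Op f s t.
Proof.
  intros Hf. unfold Op. rewrite <- RInt_scalR by auto. apply RInt_ext. intros r _. unfold Pol.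
  rewrite (RInt_ext _ (fun q => c * (f (px s r q) (py t r q) * k q))) by (intros; eqR; ring).
  rewrite (RInt_scalR (fun q => f (px s r q) (py t r q) * k q)).
  - eqR; ring.
  - intros q. apply (C0_contS (fun q r => f (px s r q) (py t r q) * k q) q r), C0_polar; auto.
Qed.
Lemma Op_tr c d f s t : Op (tr c d f) s t = Op f (s + c) (t + d).
Proof.
  unfold Op, Pol, tr. apply RInt_ext. intros r _. f_equal. apply RInt_ext. intros q _.
  unfold px, py. f_equal. f_equal; ring.
Qed.
(** [32 = 4 * 8], where 4 bounds the radial weight and [2 * PI <= 8]. The horizontal semi-axis
    [sqrt 2 * r] and the vertical one [r] stay below 3 for [r <= 1]. *)
Lemma Op_bound f s t M : C0 f -> (forall x y, Rabs (x - s) <= 3 -> Rabs (y - t) <= 3 -> Rabs (f x y) <= M) ->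
  Rabs (Op f s t) <= 32 * M.
Proof.
  intros Hf HM.
  assert (HM0 : 0 <= M).
  { eapply Rle_trans; [apply Rabs_pos|]. apply (HM s t); rewrite Rminus_diag, Rabs_R0; lra. }
  assert (HPI := PI_4). assert (HPI0 := PI_RGT_0).
  replace (32 * M) with ((1 - 0) * (32 * M)) by ring.
  apply RInt_abs_const; [lra|auto|]. intros r Hr. rewrite Rabs_mult.
  replace (32 * M) with (4 * (8 * M)) by ring.
  apply Rmult_le_compat; auto using Rabs_pos.
  apply Rle_trans with ((2 * PI - 0) * M); [|nra].
  apply RInt_abs_const; [lra| |].
  - intros q. apply (C0_contS (fun q r => f (px s r q) (py t r q) * k q) q r), C0_polar; auto.
  - intros q Hq. rewrite Rabs_mult. rewrite <- (Rmult_1_r M).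
    apply Rmult_le_compat; auto using Rabs_pos.
    assert (H2 := rt2_bd). assert (Hc := COS_bound q). assert (Hs := SIN_bound q).
    apply HM; unfold px, py; apply Rabs_le.
    + replace (s + rt2 * r * cos q - s) with ((rt2 * r) * cos q) by ring.
      assert (0 <= rt2 * r <= 2) by nra. nra.
    + replace (t + r * sin q - t) with (r * sin q) by ring. nra.
Qed.

(** [Op] commutes with translations, so its continuity reduces to [Op_bound] for [f] minus a
    translate, which is uniformly small near the ellipse. The derivatives below follow in the same
    way from difference quotients. *)
Lemma C0_Op f : C0 f -> C0 (Op f).
Proof.
  intros Hf s t eps.
  assert (He : 0 < eps / 64) by (assert (0 < eps) by apply cond_pos; lra).
  destruct (uniform_continuity_2d f (s - 4) (s + 4) (t - 4) (t + 4) (fun x y _ _ => Hf x y) (mkposreal _ He)) as [d Hd].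
  simpl in Hd.
  assert (Hm : 0 < Rmin d 1) by (apply Rmin_pos; [apply cond_pos | lra]).
  exists (mkposreal _ Hm); simpl; intros u v Hu Hv.
  assert (Hu1 := Rlt_le_trans _ _ _ Hu (Rmin_l _ _)). assert (Hu2 := Rlt_le_trans _ _ _ Hu (Rmin_r _ _)).
  assert (Hv1 := Rlt_le_trans _ _ _ Hv (Rmin_l _ _)). assert (Hv2 := Rlt_le_trans _ _ _ Hv (Rmin_r _ _)).
  replace (Op f u v) with (Op (tr (u - s) (v - t) f) s t).
  2:{ rewrite Op_tr. f_equal; ring. }
  rewrite <- Op_minus by auto with c0.
  apply Rle_lt_trans with (32 * (eps / 64)); [|lra].
  apply Op_bound; auto with c0. intros x y Hx Hy. unfold tr. apply Rlt_le.
  apply Rabs_le_between in Hx. apply Rabs_le_between in Hy. apply Rabs_def2 in Hu2. apply Rabs_def2 in Hv2.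
  apply Hd; try lra.
  - replace (x + (u - s) - x) with (u - s) by ring; auto.
  - replace (y + (v - t) - y) with (v - t) by ring; auto.
Qed.

Lemma Op_dS f s t : C0 f -> diffS f -> C0 (dS f) -> is_derive (fun z => Op f z t) s (Op (dS f) s t).
Proof.
  intros Hf Hd Hc. apply is_derive_Reals. intros eps Heps.
  assert (He : 0 < eps / 64) by lra.
  destruct (uniform_continuity_2d (dS f) (s - 4) (s + 4) (t - 4) (t + 4) (fun x y _ _ => Hc x y) (mkposreal _ He)) as [d D].
  simpl in D.
  assert (Hm : 0 < Rmin d 1) by (apply Rmin_pos; [apply cond_pos | lra]).
  exists (mkposreal _ Hm); simpl; intros h Hh0 Hh.
  assert (Hh1 := Rlt_le_trans _ _ _ Hh (Rmin_l _ _)). assert (Hh2 := Rlt_le_trans _ _ _ Hh (Rmin_r _ _)).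
  replace (Op f (s + h) t) with (Op (tr h 0 f) s t) by (rewrite Op_tr, Rplus_0_r; auto).
  replace ((Op (tr h 0 f) s t - Op f s t) / h) with (/ h * (Op (tr h 0 f) s t - Op f s t)) by (field; auto).
  rewrite <- Op_minus, <- Op_scal, <- Op_minus by auto 10 with c0.
  apply Rle_lt_trans with (32 * (eps / 64)); [|lra].
  apply Op_bound; auto 10 with c0. intros x y Hx Hy. unfold tr. rewrite Rplus_0_r.
  destruct (MVT_gen_R (fun z => f z y) (fun z => dS f z y) x (x + h)) as [c [C1 C2]].
  { intros; apply is_derive_dS; auto. }
  cbv beta in C2. rewrite C2. replace (/ h * (dS f c y * (x + h - x)) - dS f x y) with (dS f c y - dS f x y) by (field; auto).
  apply Rlt_le. apply Rabs_le_between in Hx. apply Rabs_le_between in Hy.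
  assert (Hcx := Rminmax_near x (x + h) c d C1 ltac:(replace (x + h - x) with h by ring; auto)).
  assert (Hcx1 := Rminmax_near x (x + h) c 1 C1 ltac:(replace (x + h - x) with h by ring; auto)).
  apply Rabs_def2 in Hcx1.
  apply D; auto; try lra. rewrite Rminus_diag, Rabs_R0; apply cond_pos.
Qed.
Lemma Op_dT f s t : C0 f -> diffT f -> C0 (dT f) -> is_derive (fun z => Op f s z) t (Op (dT f) s t).
Proof.
  intros Hf Hd Hc. apply is_derive_Reals. intros eps Heps.
  assert (He : 0 < eps / 64) by lra.
  destruct (uniform_continuity_2d (dT f) (s - 4) (s + 4) (t - 4) (t + 4) (fun x y _ _ => Hc x y) (mkposreal _ He)) as [d D].
  simpl in D.
  assert (Hm : 0 < Rmin d 1) by (apply Rmin_pos; [apply cond_pos | lra]).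
  exists (mkposreal _ Hm); simpl; intros h Hh0 Hh.
  assert (Hh1 := Rlt_le_trans _ _ _ Hh (Rmin_l _ _)). assert (Hh2 := Rlt_le_trans _ _ _ Hh (Rmin_r _ _)).
  replace (Op f s (t + h)) with (Op (tr 0 h f) s t) by (rewrite Op_tr, Rplus_0_r; auto).
  replace ((Op (tr 0 h f) s t - Op f s t) / h) with (/ h * (Op (tr 0 h f) s t - Op f s t)) by (field; auto).
  rewrite <- Op_minus, <- Op_scal, <- Op_minus by auto 10 with c0.
  apply Rle_lt_trans with (32 * (eps / 64)); [|lra].
  apply Op_bound; auto 10 with c0. intros x y Hx Hy. unfold tr. rewrite Rplus_0_r.
  destruct (MVT_gen_R (fun z => f x z) (fun z => dT f x z) y (y + h)) as [c [C1 C2]].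
  { intros; apply is_derive_dT; auto. }
  cbv beta in C2. rewrite C2. replace (/ h * (dT f x c * (y + h - y)) - dT f x y) with (dT f x c - dT f x y) by (field; auto).
  apply Rlt_le. apply Rabs_le_between in Hx. apply Rabs_le_between in Hy.
  assert (Hcx := Rminmax_near y (y + h) c d C1 ltac:(replace (y + h - y) with h by ring; auto)).
  assert (Hcx1 := Rminmax_near y (y + h) c 1 C1 ltac:(replace (y + h - y) with h by ring; auto)).
  apply Rabs_def2 in Hcx1.
  apply D; auto; try lra. rewrite Rminus_diag, Rabs_R0; apply cond_pos.
Qed.

Lemma Ck_Op n f : Ck n f -> Ck n (Op f).
Proof.
  revert f; induction n; intros f Hf.
  - split; [apply C0_Op, Hf | exact I].
  - destruct Hf as (f0 & f1 & f2 & f3 & f4).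
    assert (c3 := Ck_C0 _ _ f3). assert (c4 := Ck_C0 _ _ f4).
    split; [apply C0_Op; auto|]. repeat split.
    + eapply diffS_intro; intros; apply Op_dS; auto.
    + eapply diffT_intro; intros; apply Op_dT; auto.
    + erewrite dS_unique by (intros; apply Op_dS; auto). auto.
    + erewrite dT_unique by (intros; apply Op_dT; auto). auto.
Qed.
End Polar.

Definition LL (w : R -> R -> R) : R -> R -> R := fun s t => 2 * dS (dS w) s t + dT (dT w) s t.

Definition kS : R -> R := fun r => 4 * r ^ 2.
Definition kF : R -> R := fun r => / 2 * (1 - r ^ 2) ^ 2.
Lemma kS_cont x : continuous kS x.
Proof. unfold kS; auto with c0. Qed.
Lemma kF_cont x : continuous kF x.
Proof.
  unfold kF. apply continuous_scalR, continuous_powR, continuous_minusR; auto with c0. apply continuous_const.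
Qed.
Lemma kS_bd x : 0 <= x <= 1 -> Rabs (kS x) <= 4.
Proof. intros; unfold kS. rewrite Rabs_pos_eq; nra. Qed.
Lemma kF_bd x : 0 <= x <= 1 -> Rabs (kF x) <= 4.
Proof.
  intros; unfold kF. assert (0 <= 1 - x ^ 2 <= 1) by nra.
  rewrite Rabs_pos_eq; [|assert (0 <= (1 - x ^ 2) ^ 2) by apply pow2_ge_0; lra].
  simpl in *. nra.
Qed.
Lemma cos_bd x : Rabs (cos x) <= 1.
Proof. apply Rabs_le, COS_bound. Qed.
Lemma sin_bd x : Rabs (sin x) <= 1.
Proof. apply Rabs_le, SIN_bound. Qed.

Lemma trig_int1 : RInt (fun q => cos q * cos q) 0 (2 * PI) = PI.
Proof.
  rewrite (RInt_D (fun q => / 2 * (q + sin q * cos q))).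
  - rewrite sin_2PI, sin_0. eqR; field.
  - intros x. auto_derive; auto. assert (H := sin2_cos2 x). unfold Rsqr in H.
    replace 1 with (sin x * sin x + cos x * cos x) at 1 by auto. eqR; field.
  - auto with c0.
Qed.
Lemma trig_int2 : RInt (fun q => sin q * sin q) 0 (2 * PI) = PI.
Proof.
  rewrite (RInt_D (fun q => / 2 * (q - sin q * cos q))).
  - rewrite sin_2PI, sin_0. eqR; field.
  - intros x. auto_derive; auto. assert (H := sin2_cos2 x). unfold Rsqr in H.
    replace 1 with (sin x * sin x + cos x * cos x) at 1 by auto. eqR; field.
  - auto with c0.
Qed.
Lemma trig_int3 : RInt (fun q => sin q * cos q) 0 (2 * PI) = 0.
Proof.
  rewrite (RInt_D (fun q => / 2 * (sin q * sin q))).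
  - rewrite sin_2PI, sin_0. eqR; ring.
  - intros x. auto_derive; auto. eqR; field.
  - auto with c0.
Qed.

Lemma Pol_at0 f (k l : R -> R) (c s t : R) : (forall q, k q = c * l q) -> (forall q, continuous l q) ->
  Pol f k s t 0 = f s t * c * RInt l 0 (2 * PI).
Proof.
  intros H Hl. unfold Pol. rewrite <- RInt_scalR by auto. apply RInt_ext. intros q _.
  unfold px, py. rewrite Rmult_0_r, !Rmult_0_l, !Rplus_0_r, H. eqR. ring.
Qed.

(** At [r = 0] the orthogonality of [sin] and [cos] isolates one partial derivative; [rt2] is the
    ratio of the semi-axes and [PI] the integral of the squared mode. *)
Lemma dS_repr w s t : Ck 2 w -> rt2 * PI * dS w s t = Op cos kS w s t - Op cos kF (LL w) s t.
Proof.
  intros Hw.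
  assert (CL : C0 (LL w)).
  { destruct Hw as (H0 & H1 & H2 & H3 & H4). unfold LL.
    assert (C0 (dS (dS w))) by apply H3. assert (C0 (dT (dT w))) by apply H4. auto with c0. }
  assert (Cw : C0 w) by apply Hw.
  assert (RF := repr_formula w Hw cos (fun q => - sin q)).
  unfold Op. rewrite <- RInt_minusR.
  - transitivity (RInt (fun r => 4 * r ^ 2 * Pol w cos s t r - / 2 * (1 - r ^ 2) ^ 2 * Pol (LL w) cos s t r) 0 1).
    2:{ apply RInt_ext; intros; unfold kS, kF. reflexivity. }
    unfold LL. rewrite <- RF.
    + rewrite (Pol_at0 _ _ (fun q : R => cos q * cos q) rt2), (Pol_at0 _ _ (fun q : R => sin q * cos q) 1); auto with c0; try (intros; ring).
      rewrite trig_int1, trig_int3. ring.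
    + intros; auto_derive; auto; ring.
    + intros; auto_derive; auto; ring.
    + rewrite cos_2PI, cos_0; auto.
    + rewrite sin_2PI, sin_0; auto.
  - intros; apply continuous_mulR; [apply kS_cont | apply Pol_cont; auto with c0].
  - intros; apply continuous_mulR; [apply kF_cont | apply Pol_cont; auto with c0].
Qed.
Lemma dT_repr w s t : Ck 2 w -> PI * dT w s t = Op sin kS w s t - Op sin kF (LL w) s t.
Proof.
  intros Hw.
  assert (CL : C0 (LL w)).
  { destruct Hw as (H0 & H1 & H2 & H3 & H4). unfold LL.
    assert (C0 (dS (dS w))) by apply H3. assert (C0 (dT (dT w))) by apply H4. auto with c0. }
  assert (Cw : C0 w) by apply Hw.
  assert (RF := repr_formula w Hw sin cos).
  unfold Op. rewrite <- RInt_minusR.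
  - transitivity (RInt (fun r => 4 * r ^ 2 * Pol w sin s t r - / 2 * (1 - r ^ 2) ^ 2 * Pol (LL w) sin s t r) 0 1).
    2:{ apply RInt_ext; intros; unfold kS, kF. reflexivity. }
    unfold LL. rewrite <- RF.
    + rewrite (Pol_at0 _ _ (fun q : R => sin q * cos q) rt2), (Pol_at0 _ _ (fun q : R => sin q * sin q) 1); auto with c0; try (intros; ring).
      rewrite trig_int2, trig_int3. ring.
    + intros; auto_derive; auto; ring.
    + intros; auto_derive; auto; ring.
    + rewrite sin_2PI, sin_0; auto.
    + rewrite cos_2PI, cos_0; auto.
  - intros; apply continuous_mulR; [apply kS_cont | apply Pol_cont; auto with c0].
  - intros; apply continuous_mulR; [apply kF_cont | apply Pol_cont; auto with c0].
Qed.

Lemma Ck_scal n c f : Ck n f -> Ck n (fun s t => c * f s t).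
Proof. intros; apply (Ck_mult n (fun _ _ => c)); auto. apply Ck_const. Qed.
Lemma Ck_minus n f g : Ck n f -> Ck n g -> Ck n (fun s t => f s t - g s t).
Proof.
  intros. apply (Ck_plus n f (fun s t => - g s t)); auto.
  replace (fun s t => - g s t) with (fun s t => (-1) * g s t) by (apply fun2_ext; intros; ring).
  apply Ck_scal; auto.
Qed.

(* Interior regularity gains one derivative: [dS w], [dT w] are averages of [w] and [LL w]. *)
Lemma regularity_step n w : Ck 2 w -> Ck n w -> Ck n (LL w) -> Ck (S n) w.
Proof.
  intros H2 Hn HL. assert (HP := PI_RGT_0). assert (H3 := rt2_bd).
  split; [apply H2|]. split; [apply H2|]. split; [apply H2|]. split.
  - replace (dS w) with (fun s t => / (rt2 * PI) * (Op cos kS w s t - Op cos kF (LL w) s t)).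
    + apply Ck_scal, Ck_minus; apply Ck_Op; auto using kS_bd, kF_bd, kS_cont, kF_cont, cos_bd with c0.
    + apply fun2_ext; intros. rewrite <- dS_repr by auto. field. split; lra.
  - replace (dT w) with (fun s t => / PI * (Op sin kS w s t - Op sin kF (LL w) s t)).
    + apply Ck_scal, Ck_minus; apply Ck_Op; auto using kS_bd, kF_bd, kS_cont, kF_cont, sin_bd with c0.
    + apply fun2_ext; intros. rewrite <- dT_repr by auto. field. lra.
Qed.

Lemma grad_bound w s t M N : Ck 2 w ->
  (forall x y, Rabs (x - s) <= 3 -> Rabs (y - t) <= 3 -> Rabs (w x y) <= M) ->
  (forall x y, Rabs (x - s) <= 3 -> Rabs (y - t) <= 3 -> Rabs (LL w x y) <= N) ->
  Rabs (dS w s t) <= 32 * M + 32 * N /\ Rabs (dT w s t) <= 32 * M + 32 * N.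
Proof.
  intros H2 HM HN.
  assert (CL : C0 (LL w)).
  { destruct H2 as (H0 & H1 & H2 & H3 & H4). unfold LL.
    assert (C0 (dS (dS w))) by apply H3. assert (C0 (dT (dT w))) by apply H4. auto with c0. }
  assert (Cw : C0 w) by apply H2.
  assert (HP : 1 <= PI) by (assert (H := PI2_1); lra). assert (H3 := rt2_sq). assert (H4 := rt2_bd).
  assert (H5 : 1 <= rt2) by nra.
  assert (ES := dS_repr w s t H2). assert (ET := dT_repr w s t H2).
  assert (B1 := Op_bound cos kS ltac:(auto with c0) kS_cont cos_bd kS_bd w s t M Cw HM).
  assert (B2 := Op_bound cos kF ltac:(auto with c0) kF_cont cos_bd kF_bd (LL w) s t N CL HN).
  assert (B3 := Op_bound sin kS ltac:(auto with c0) kS_cont sin_bd kS_bd w s t M Cw HM).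
  assert (B4 := Op_bound sin kF ltac:(auto with c0) kF_cont sin_bd kF_bd (LL w) s t N CL HN).
  split.
  - apply Rle_trans with (Rabs (rt2 * PI * dS w s t)).
    + rewrite Rabs_mult, (Rabs_pos_eq (rt2 * PI)) by nra. assert (H := Rabs_pos (dS w s t)).
      assert (1 <= rt2 * PI) by nra. nra.
    + rewrite ES. eapply Rle_trans; [apply Rabs_triang|]. rewrite Rabs_Ropp. lra.
  - apply Rle_trans with (Rabs (PI * dT w s t)).
    + rewrite Rabs_mult, (Rabs_pos_eq PI) by lra. assert (H := Rabs_pos (dT w s t)). nra.
    + rewrite ET. eapply Rle_trans; [apply Rabs_triang|]. rewrite Rabs_Ropp. lra.
Qed.

(** * Caccioppoli's inequality *)

(** Its square is continuously differentiable, so a truncated parabola can serve as a cutoff as long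
    as only its square is differentiated. *)
Definition ppart (x : R) : R := Rmax 0 x.
Lemma ppart_ge0 x : 0 <= ppart x.
Proof. apply Rmax_l. Qed.
Lemma ppart_neg x : x <= 0 -> ppart x = 0.
Proof. intros; apply Rmax_left; auto. Qed.
Lemma ppart_lip x y : Rabs (ppart x - ppart y) <= Rabs (x - y).
Proof.
  unfold ppart, Rmax. destruct (Rle_dec 0 x), (Rle_dec 0 y); unfold Rabs;
  repeat destruct Rcase_abs; lra.
Qed.
Lemma is_derive_ppart_sq x : is_derive (fun x => ppart x ^ 2) x (2 * ppart x).
Proof.
  apply is_derive_Reals. intros eps He. exists (mkposreal _ He). simpl. intros h Hh0 Hh.
  assert (E : Rabs (ppart (x + h) ^ 2 - ppart x ^ 2 - 2 * ppart x * h) <= h ^ 2).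
  { unfold ppart, Rmax. destruct (Rle_dec 0 (x + h)), (Rle_dec 0 x); apply Rabs_le; simpl; split; nra. }
  replace ((ppart (x + h) * (ppart (x + h) * 1) - ppart x * (ppart x * 1)) / h - 2 * ppart x) with
    ((ppart (x + h) ^ 2 - ppart x ^ 2 - 2 * ppart x * h) / h) by (simpl; field; auto).
  unfold Rdiv. rewrite Rabs_mult, Rabs_inv.
  apply Rle_lt_trans with (h ^ 2 * / Rabs h).
  - apply Rmult_le_compat_r; auto. apply Rlt_le, Rinv_0_lt_compat, Rabs_pos_lt; auto.
  - rewrite <- (pow2_abs h). replace (Rabs h ^ 2 * / Rabs h) with (Rabs h); auto.
    field. apply Rabs_no_R0; auto.
Qed.

Section Cutoff.
Variables x0 r : R.
Hypothesis Hr : 1 <= r.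
Definition cut (x : R) : R := ppart (1 - ((x - x0) / r) ^ 2).
(** The derivative of [cut ^ 2], not of [cut]. The remaining factor [cut] is the square root of the
    weight and is what Young's inequality needs. *)
Definition cut' (x : R) : R := - 4 * ((x - x0) / r) * / r * cut x.
Lemma cut_der x : is_derive (fun x => cut x ^ 2) x (cut' x).
Proof.
  unfold cut', cut. evar_last.
  - apply (is_derive_comp (fun y => ppart y ^ 2) (fun x => 1 - ((x - x0) / r) ^ 2)).
    + apply is_derive_ppart_sq.
    + instantiate (1 := - 2 * ((x - x0) / r) * / r). auto_derive; auto. simpl; field; lra.
  - unfold scal; simpl; unfold mult; simpl. ring.
Qed.
Lemma cut_cont x : continuous cut x.
Proof.
  unfold cut. apply (continuous_comp (fun x => 1 - ((x - x0) / r) ^ 2) ppart).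
  - apply (ex_derive_continuous (K := R_AbsRing) (V := R_NormedModule)). auto_derive; auto.
  - apply continuous_intro. intros eps. exists eps. intros y Hy. eapply Rle_lt_trans; [apply ppart_lip | auto].
Qed.
Lemma cut'_cont x : continuous cut' x.
Proof.
  unfold cut'. apply continuous_mulR; [|apply cut_cont].
  apply (ex_derive_continuous (K := R_AbsRing) (V := R_NormedModule)). auto_derive; auto.
Qed.
Lemma cut_ge0 x : 0 <= cut x.
Proof. apply ppart_ge0. Qed.
Lemma cut_le1 x : cut x <= 1.
Proof. unfold cut, ppart. apply Rmax_lub; [lra|]. assert (0 <= ((x - x0) / r) ^ 2) by apply pow2_ge_0. lra. Qed.
Lemma cut_out x : r <= Rabs (x - x0) -> cut x = 0.
Proof.
  intros H. apply ppart_neg. rewrite <- pow2_abs. unfold Rdiv. rewrite Rabs_mult, Rabs_inv, (Rabs_pos_eq r) by lra.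
  assert (1 <= Rabs (x - x0) * / r).
  { apply Rmult_le_reg_r with r; [lra|]. rewrite Rmult_assoc, Rinv_l; lra. }
  simpl. nra.
Qed.
Lemma cut_in lam x : 0 <= lam <= 1 -> Rabs (x - x0) <= lam * r -> 1 - lam ^ 2 <= cut x.
Proof.
  intros Hl H. apply Rle_trans with (1 - ((x - x0) / r) ^ 2); [|apply Rmax_r].
  rewrite <- (pow2_abs ((x - x0) / r)). unfold Rdiv. rewrite Rabs_mult, Rabs_inv, (Rabs_pos_eq r) by lra.
  assert (0 <= Rabs (x - x0) * / r <= lam).
  { split; [apply Rmult_le_pos; [apply Rabs_pos | apply Rlt_le, Rinv_0_lt_compat; lra]|].
    apply Rmult_le_reg_r with r; [lra|]. rewrite Rmult_assoc, Rinv_l; lra. }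
  simpl. nra.
Qed.
(** If both points lie outside the support there is nothing to do. Otherwise the difference of
    squares is expanded around the point inside, which gives [(1 + 2 r) / r^2], below [4 / r] since
    [1 <= r]. *)
Lemma cut_lip x y : Rabs (x - y) <= 1 -> Rabs (cut x - cut y) <= 4 / r.
Proof.
  intros H.
  assert (H4 : 0 <= 4 / r) by (apply Rlt_le, Rdiv_lt_0_compat; lra).
  destruct (Rle_lt_dec r (Rabs (x - x0))) as [Hx|Hx]; destruct (Rle_lt_dec r (Rabs (y - x0))) as [Hy|Hy].
  - rewrite !cut_out by auto. rewrite Rminus_diag, Rabs_R0; auto.
  - clear Hx. eapply Rle_trans; [apply ppart_lip|].
    replace (1 - ((x - x0) / r) ^ 2 - (1 - ((y - x0) / r) ^ 2)) with ((y - x) * ((x - y) + 2 * (y - x0)) * / (r * r)) by (field; lra).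
    rewrite !Rabs_mult. rewrite (Rabs_pos_eq (/ (r * r))) by (apply Rlt_le, Rinv_0_lt_compat; nra).
    apply Rmult_le_reg_r with (r * r); [nra|]. rewrite Rmult_assoc, Rinv_l, Rmult_1_r by nra.
    replace (4 / r * (r * r)) with (4 * r) by (field; lra).
    assert (Rabs (x - y + 2 * (y - x0)) <= 1 + 2 * r).
    { eapply Rle_trans; [apply Rabs_triang|]. rewrite Rabs_mult, (Rabs_pos_eq 2) by lra. lra. }
    rewrite Rabs_minus_sym. assert (P1 := Rabs_pos (x - y)). assert (P2 := Rabs_pos (x - y + 2 * (y - x0))). nra.
  - eapply Rle_trans; [apply ppart_lip|].
    replace (1 - ((x - x0) / r) ^ 2 - (1 - ((y - x0) / r) ^ 2)) with ((y - x) * ((y - x) + 2 * (x - x0)) * / (r * r)) by (field; lra).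
    rewrite !Rabs_mult. rewrite (Rabs_pos_eq (/ (r * r))) by (apply Rlt_le, Rinv_0_lt_compat; nra).
    apply Rmult_le_reg_r with (r * r); [nra|]. rewrite Rmult_assoc, Rinv_l, Rmult_1_r by nra.
    replace (4 / r * (r * r)) with (4 * r) by (field; lra).
    assert (Rabs (y - x + 2 * (x - x0)) <= 1 + 2 * r).
    { eapply Rle_trans; [apply Rabs_triang|]. rewrite Rabs_mult, (Rabs_pos_eq 2) by lra. rewrite (Rabs_minus_sym y x). lra. }
    rewrite Rabs_minus_sym. assert (P1 := Rabs_pos (x - y)). assert (P2 := Rabs_pos (y - x + 2 * (x - x0))). nra.
  - eapply Rle_trans; [apply ppart_lip|].
    replace (1 - ((x - x0) / r) ^ 2 - (1 - ((y - x0) / r) ^ 2)) with ((y - x) * ((y - x) + 2 * (x - x0)) * / (r * r)) by (field; lra).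
    rewrite !Rabs_mult. rewrite (Rabs_pos_eq (/ (r * r))) by (apply Rlt_le, Rinv_0_lt_compat; nra).
    apply Rmult_le_reg_r with (r * r); [nra|]. rewrite Rmult_assoc, Rinv_l, Rmult_1_r by nra.
    replace (4 / r * (r * r)) with (4 * r) by (field; lra).
    assert (Rabs (y - x + 2 * (x - x0)) <= 1 + 2 * r).
    { eapply Rle_trans; [apply Rabs_triang|]. rewrite Rabs_mult, (Rabs_pos_eq 2) by lra. rewrite (Rabs_minus_sym y x). lra. }
    rewrite Rabs_minus_sym. assert (P1 := Rabs_pos (x - y)). assert (P2 := Rabs_pos (y - x + 2 * (x - x0))). nra.
Qed.
Lemma cut'_bd x : Rabs (cut' x) <= 4 / r * cut x.
Proof.
  destruct (Rle_lt_dec r (Rabs (x - x0))) as [Hx|Hx].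
  - unfold cut'. rewrite (cut_out x Hx), !Rmult_0_r, Rabs_R0; lra.
  - unfold cut'. rewrite Rabs_mult, (Rabs_pos_eq (cut x)) by apply cut_ge0.
    apply Rmult_le_compat_r; [apply cut_ge0|].
    replace (-4 * ((x - x0) / r) * / r) with (-4 * (x - x0) * / (r * r)) by (field; lra).
    rewrite !Rabs_mult. rewrite (Rabs_pos_eq (/ (r * r))) by (apply Rlt_le, Rinv_0_lt_compat; nra).
    apply Rmult_le_reg_r with (r * r); [nra|]. rewrite Rmult_assoc, Rinv_l, Rmult_1_r by nra.
    replace (4 / r * (r * r)) with (4 * r) by (field; lra).
    replace (Rabs (-4)) with 4 by (rewrite Rabs_left; lra). lra.
Qed.
End Cutoff.

Definition Box (f : R -> R -> R) (s0 t0 rho : R) : R := I2 f (s0 - rho) (s0 + rho) (t0 - rho) (t0 + rho).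

Section Cacc.
Variables w p : R -> R -> R.
Hypothesis Sw : smooth w.
Hypothesis Sp : smooth p.
(** The nonlocal flux of the equation: the potential 1 produces the difference of [w], and [p] will
    hold the contribution of [V1]. *)
Let P := fun s t => (sh 1 w s t - w s t) + p s t.
Hypothesis Ew : forall s t, LL w s t = P s t - sh (-1) P s t.
Variables s0 t0 r : R.
Hypothesis Hr : 1 <= r.

Let v := fun s t => cut s0 r s * cut t0 r t.
Let th := fun s t => cut s0 r s ^ 2 * cut t0 r t ^ 2.
Let ths := fun s t => cut' s0 r s * cut t0 r t ^ 2.
Let tht := fun s t => cut s0 r s ^ 2 * cut' t0 r t.
Let W := dS w.
Let Z := dT w.
(** A margin of at least one unit beyond the support of the cutoff, so that the shift by one and all
    integrations by parts are exact. *)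
Let M := r + 2.

Let SP : smooth P.
Proof. unfold P; auto with sm. Qed.
Let Cv : C0 v.
Proof. unfold v. apply C0_mult; [apply C0_2 | apply C0_1]; intros; apply cut_cont; auto. Qed.
Let Cc1 : C0 (fun s _ : R => cut s0 r s).
Proof. apply C0_2; intros; apply cut_cont; auto. Qed.
Let Cc2 : C0 (fun _ t : R => cut t0 r t).
Proof. apply C0_1; intros; apply cut_cont; auto. Qed.
Let Cc3 : C0 (fun s _ : R => cut' s0 r s).
Proof. apply C0_2; intros; apply cut'_cont; auto. Qed.
Let Cc4 : C0 (fun _ t : R => cut' t0 r t).
Proof. apply C0_1; intros; apply cut'_cont; auto. Qed.
Let Cth : C0 th.
Proof. unfold th. apply (C0_mult (fun s _ => cut s0 r s ^ 2) (fun _ t => cut t0 r t ^ 2)); auto with c0. Qed.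
Let Cths : C0 ths.
Proof. unfold ths. apply (C0_mult (fun s _ => cut' s0 r s) (fun _ t => cut t0 r t ^ 2)); auto with c0. Qed.
Let Ctht : C0 tht.
Proof. unfold tht. apply (C0_mult (fun s _ => cut s0 r s ^ 2) (fun _ t => cut' t0 r t)); auto with c0. Qed.
Let Cw : C0 w. Proof. auto with sm. Qed.
Let CW : C0 W. Proof. unfold W; auto with sm. Qed.
Let CZ : C0 Z. Proof. unfold Z; auto with sm. Qed.
Let CP : C0 P. Proof. auto with sm. Qed.
Let Cp : C0 p. Proof. auto with sm. Qed.
Let CWS : C0 (dS W). Proof. unfold W; auto with sm. Qed.
Let CZT : C0 (dT Z). Proof. unfold Z; auto with sm. Qed.

Let byparts_S : Box (fun s t => (ths s t * w s t + th s t * W s t) * W s t + th s t * w s t * dS W s t) s0 t0 M = 0.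
Proof.
  set (G := fun s t : R => (ths s t * w s t + th s t * W s t) * W s t + th s t * w s t * dS W s t).
  set (F := fun s t : R => th s t * w s t * W s t).
  assert (D : forall s t, is_derive (fun s => F s t) s (G s t)).
  { intros s t. unfold F, G. apply (is_derive_mult (fun s => th s t * w s t) (fun s => W s t)).
    - apply (is_derive_mult (fun s => th s t) (fun s => w s t)).
      + unfold th, ths. evar_last.
        * apply (is_derive_mult (fun s => cut s0 r s ^ 2) (fun _ => cut t0 r t ^ 2)); [apply cut_der; auto | apply (is_derive_const (cut t0 r t ^ 2)) | intros; apply Rmult_comm].
        * unfold plus, mult, zero; simpl. ring.
      + apply is_derive_dS; auto with sm.
      + intros; apply Rmult_comm.
    - apply is_derive_dS; unfold W; auto with sm.
    - intros; apply Rmult_comm. }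
  unfold Box. rewrite <- (dS_unique F G D). rewrite I2_dS.
  - rewrite (RInt_ext _ (fun _ => 0)).
    + rewrite RInt_constR; eqR; ring.
    + intros t _. unfold F, th, M. rewrite !(cut_out s0 r Hr).
      * eqR; simpl; ring.
      * rewrite Rabs_left; lra.
      * rewrite Rabs_right; lra.
  - intros s t; eexists; apply D.
  - rewrite (dS_unique F G D). unfold G. auto 12 with c0.
Qed.
Let byparts_T : Box (fun s t => (tht s t * w s t + th s t * Z s t) * Z s t + th s t * w s t * dT Z s t) s0 t0 M = 0.
Proof.
  set (G := fun s t : R => (tht s t * w s t + th s t * Z s t) * Z s t + th s t * w s t * dT Z s t).
  set (F := fun s t : R => th s t * w s t * Z s t).
  assert (D : forall s t, is_derive (fun t => F s t) t (G s t)).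
  { intros s t. unfold F, G. apply (is_derive_mult (fun t => th s t * w s t) (fun t => Z s t)).
    - apply (is_derive_mult (fun t => th s t) (fun t => w s t)).
      + unfold th, tht. evar_last.
        * apply (is_derive_mult (fun _ => cut s0 r s ^ 2) (fun t => cut t0 r t ^ 2)); [apply (is_derive_const (cut s0 r s ^ 2)) | apply cut_der; auto | intros; apply Rmult_comm].
        * unfold plus, mult, zero; simpl. ring.
      + apply is_derive_dT; auto with sm.
      + intros; apply Rmult_comm.
    - apply is_derive_dT; unfold Z; auto with sm.
    - intros; apply Rmult_comm. }
  unfold Box. rewrite <- (dT_unique F G D). rewrite I2_dT.
  - assert (K : forall y, r <= Rabs (y - t0) -> forall a b, RInt (fun s => F s y) a b = 0).
    { intros y Hy a b. rewrite (RInt_ext _ (fun _ => 0)).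
      - rewrite RInt_constR; eqR; ring.
      - intros s _. unfold F, th. rewrite (cut_out t0 r Hr y Hy). eqR; simpl; ring. }
    rewrite !K; [ring| |]; unfold M; [rewrite Rabs_left; lra | rewrite Rabs_right; lra].
  - unfold F; auto with c0.
  - intros s t; eexists; apply D.
  - rewrite (dT_unique F G D). unfold G. auto 12 with c0.
Qed.
Let shift_id : Box (fun s t => sh 1 (fun s t => th s t * w s t) s t * P s t) s0 t0 M
    = Box (fun s t => th s t * w s t * sh (-1) P s t) s0 t0 M.
Proof.
  set (X := fun s t => th s t * w s t * sh (-1) P s t).
  assert (CX : C0 X) by (unfold X; auto 10 with c0).
  unfold Box. rewrite (I2_ext _ (sh 1 X)).
  2:{ intros; unfold X, sh. replace (s + 1 + -1) with s by ring. ring. }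
  rewrite I2_sh by auto. unfold I2. apply RInt_ext. intros t _.
  assert (CXt : forall x, continuous (fun s => X s t) x) by (intros; apply C0_contS; auto).
  assert (E1 := RInt_split (fun s => X s t) (s0 - M) (s0 - M + 1) (s0 + M + 1) CXt).
  assert (E2 := RInt_split (fun s => X s t) (s0 - M) (s0 + M) (s0 + M + 1) CXt).
  assert (K : forall a, (forall x, a <= x <= a + 1 -> r <= Rabs (x - s0)) -> RInt (fun s => X s t) a (a + 1) = 0).
  { intros a Ha. rewrite (RInt_ext _ (fun _ => 0)).
    - rewrite RInt_constR; eqR; ring.
    - intros x Hx. rewrite Rmin_left, Rmax_right in Hx by lra. unfold X, th.
      rewrite (cut_out s0 r Hr x); [eqR; simpl; ring|]. apply Ha; lra. }
  rewrite (K (s0 - M)) in E1. rewrite (K (s0 + M)) in E2.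
  - eqR. lra.
  - intros x Hx. unfold M in Hx. rewrite Rabs_right; lra.
  - intros x Hx. unfold M in Hx. rewrite Rabs_left; lra.
Qed.

(** The equation tested with [th w]: the local part is integrated by parts, the nonlocal part is
    summed by parts with [shift_id]. *)
Let identity : Box (fun s t => th s t * (2 * W s t ^ 2 + Z s t ^ 2)) s0 t0 M =
  Box (fun s t => (sh 1 th s t * sh 1 w s t - th s t * w s t) * P s t
      - w s t * (2 * ths s t * W s t + tht s t * Z s t)) s0 t0 M.
Proof.
  unfold Box in *.
  rewrite (I2_ext (fun s t => th s t * (2 * W s t ^ 2 + Z s t ^ 2))
    (fun s t => (2 * ((ths s t * w s t + th s t * W s t) * W s t + th s t * w s t * dS W s t)
      + ((tht s t * w s t + th s t * Z s t) * Z s t + th s t * w s t * dT Z s t))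
      - (th s t * w s t * P s t - th s t * w s t * sh (-1) P s t)
      - w s t * (2 * ths s t * W s t + tht s t * Z s t))).
  2:{ intros s t. assert (E := Ew s t). unfold LL in E. fold W Z in E.
      replace (th s t * w s t * P s t - th s t * w s t * sh (-1) P s t) with (th s t * w s t * (2 * dS W s t + dT Z s t)) by (rewrite E; ring).
      ring. }
  rewrite (I2_ext (fun s t => (sh 1 th s t * sh 1 w s t - th s t * w s t) * P s t
      - w s t * (2 * ths s t * W s t + tht s t * Z s t)) (fun s t => sh 1 (fun s t => th s t * w s t) s t * P s t - th s t * w s t * P s t
      - w s t * (2 * ths s t * W s t + tht s t * Z s t))) by (intros; unfold sh; ring).
  rewrite !(I2_minus _ (fun s t => w s t * (2 * ths s t * W s t + tht s t * Z s t))) by auto 16 with c0.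
  f_equal.
  rewrite (I2_minus _ (fun s t => th s t * w s t * P s t - th s t * w s t * sh (-1) P s t)) by auto 16 with c0.
  rewrite I2_plus by auto 16 with c0. rewrite I2_scal by auto 16 with c0.
  rewrite byparts_S, byparts_T.
  rewrite !I2_minus by auto 16 with c0. rewrite shift_id. ring.
Qed.

Let v_ge0 s t : 0 <= v s t.
Proof. unfold v. apply Rmult_le_pos; apply cut_ge0. Qed.
Let v_le1 s t : v s t <= 1.
Proof.
  unfold v. assert (H1 := cut_ge0 s0 r s). assert (H2 := cut_ge0 t0 r t).
  assert (H3 := cut_le1 s0 r s). assert (H4 := cut_le1 t0 r t). nra.
Qed.
Let th_v s t : th s t = v s t ^ 2.
Proof. unfold th, v. ring. Qed.
Let v_lip s s' t : Rabs (s - s') <= 1 -> Rabs (v s t - v s' t) <= 4 / r.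
Proof.
  intros H. unfold v. replace (cut s0 r s * cut t0 r t - cut s0 r s' * cut t0 r t) with ((cut s0 r s - cut s0 r s') * cut t0 r t) by ring.
  rewrite Rabs_mult, (Rabs_pos_eq (cut t0 r t)) by apply cut_ge0.
  assert (H1 := cut_lip s0 r Hr s s' H). assert (H2 := cut_ge0 t0 r t). assert (H4 := cut_le1 t0 r t).
  assert (H5 := Rabs_pos (cut s0 r s - cut s0 r s')). nra.
Qed.
Let ths_bd s t : Rabs (ths s t) <= 4 / r * v s t.
Proof.
  unfold ths, v. rewrite Rabs_mult, (Rabs_pos_eq (cut t0 r t ^ 2)) by apply pow2_ge_0.
  assert (H1 := cut'_bd s0 r Hr s). assert (H2 := cut_ge0 t0 r t). assert (H4 := cut_le1 t0 r t).
  assert (H5 := cut_ge0 s0 r s). assert (0 < 4 / r) by (apply Rdiv_lt_0_compat; lra).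
  assert (H6 := Rabs_pos (cut' s0 r s)).
  apply Rle_trans with (4 / r * cut s0 r s * cut t0 r t ^ 2).
  - apply Rmult_le_compat_r; auto. apply pow2_ge_0.
  - rewrite Rmult_assoc. apply Rmult_le_compat_l; [lra|]. simpl. apply Rmult_le_compat_l; nra.
Qed.
Let tht_bd s t : Rabs (tht s t) <= 4 / r * v s t.
Proof.
  unfold tht, v. rewrite Rabs_mult, (Rabs_pos_eq (cut s0 r s ^ 2)) by apply pow2_ge_0.
  assert (H1 := cut'_bd t0 r Hr t). assert (H2 := cut_ge0 s0 r s). assert (H4 := cut_le1 s0 r s).
  assert (H5 := cut_ge0 t0 r t). assert (0 < 4 / r) by (apply Rdiv_lt_0_compat; lra).
  assert (H6 := Rabs_pos (cut' t0 r t)).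
  apply Rle_trans with (cut s0 r s ^ 2 * (4 / r * cut t0 r t)).
  - apply Rmult_le_compat_l; auto. apply pow2_ge_0.
  - replace (cut s0 r s ^ 2 * (4 / r * cut t0 r t)) with (4 / r * (cut s0 r s ^ 2 * cut t0 r t)) by ring.
    apply Rmult_le_compat_l; [lra|]. simpl. apply Rmult_le_compat_r; nra.
Qed.

Let D := fun s t => sh 1 w s t - w s t.
Let CD : C0 D. Proof. unfold D; auto with c0. Qed.

Let absorb a b d : 0 < d -> Rabs (a * b) <= d * a ^ 2 + / (4 * d) * b ^ 2.
Proof.
  intros Hd. assert (E : d * a ^ 2 + / (4 * d) * b ^ 2 = Rabs (a * b) + / (4 * d) * (2 * d * Rabs a - Rabs b) ^ 2).
  { rewrite Rabs_mult, <- (pow2_abs a), <- (pow2_abs b). field; lra. }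
  rewrite E. assert (0 <= / (4 * d) * (2 * d * Rabs a - Rabs b) ^ 2).
  { apply Rmult_le_pos; [apply Rlt_le, Rinv_0_lt_compat; lra | apply pow2_ge_0]. } lra.
Qed.

(** Young's inequality with small parameters. The coefficient 5/4 of [th D^2] must remain well below
    the 2 of the local term [2 W^2], because [th D^2] will be estimated by [th W^2] up to an error
    of order 1/r. *)
Let pointwise s t : (sh 1 th s t * sh 1 w s t - th s t * w s t) * P s t
      - w s t * (2 * ths s t * W s t + tht s t * Z s t) <=
   5/4 * (th s t * D s t ^ 2) + 1/8 * (th s t * (W s t ^ 2 + Z s t ^ 2))
   + 200 / r ^ 2 * (sh 1 w s t ^ 2 + w s t ^ 2) + 3 * p s t ^ 2.
Proof.
  set (L := 4 / r).
  assert (HL : 0 < L) by (unfold L; apply Rdiv_lt_0_compat; lra).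
  replace (200 / r ^ 2) with (25 / 2 * L ^ 2) by (unfold L; field; lra).
  set (V := v s t). set (T := sh 1 w s t). set (x := w s t). set (y := W s t). set (z := Z s t).
  assert (ED : D s t = T - x) by reflexivity. set (d := D s t) in *.
  assert (EP : P s t = d + p s t) by reflexivity. set (q := p s t) in *.
  set (e := sh 1 v s t - v s t).
  assert (He : Rabs e <= L) by (unfold e, sh; apply v_lip; replace (s + 1 - s) with 1 by ring; rewrite Rabs_R1; lra).
  assert (HV0 : 0 <= V) by apply v_ge0. assert (HV1 : V <= 1) by apply v_le1.
  assert (HVe : V + e <= 1) by (unfold V, e; assert (H := v_le1 (s + 1) t); unfold sh; lra).
  assert (HVe0 : 0 <= V + e) by (unfold V, e; assert (H := v_ge0 (s + 1) t); unfold sh; lra).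
  assert (Eth : sh 1 th s t = (V + e) ^ 2).
  { unfold sh. rewrite th_v. unfold V, e, sh. f_equal. ring. }
  rewrite Eth, th_v, EP. fold V.
  assert (B1 := ths_bd s t). assert (B2 := tht_bd s t). fold L in B1, B2. fold V in B1, B2.
  set (a1 := ths s t) in *. set (a2 := tht s t) in *.
  assert (K1 : - (x * (2 * a1 * y)) <= 1/8 * (V ^ 2 * y ^ 2) + 8 * L ^ 2 * x ^ 2).
  { apply Rle_trans with (Rabs ((V * y) * (2 * L * x))).
    - replace (- (x * (2 * a1 * y))) with ((- a1) * (2 * (x * y))) by ring.
      eapply Rle_trans; [apply Rle_abs|]. rewrite !Rabs_mult, Rabs_Ropp, (Rabs_pos_eq V), (Rabs_pos_eq L) by lra.
      replace (V * Rabs y * (Rabs 2 * L * Rabs x)) with ((L * V) * (Rabs 2 * (Rabs x * Rabs y))) by ring.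
      apply Rmult_le_compat_r; auto. apply Rmult_le_pos; [apply Rabs_pos|]. apply Rmult_le_pos; apply Rabs_pos.
    - eapply Rle_trans; [apply (absorb _ _ (1/8)); lra|]. right; field. }
  assert (K2 : - (x * (a2 * z)) <= 1/8 * (V ^ 2 * z ^ 2) + 2 * L ^ 2 * x ^ 2).
  { apply Rle_trans with (Rabs ((V * z) * (L * x))).
    - replace (- (x * (a2 * z))) with ((- a2) * (x * z)) by ring.
      eapply Rle_trans; [apply Rle_abs|]. rewrite !Rabs_mult, Rabs_Ropp, (Rabs_pos_eq V), (Rabs_pos_eq L) by lra.
      replace (V * Rabs z * (L * Rabs x)) with ((L * V) * (Rabs x * Rabs z)) by ring.
      apply Rmult_le_compat_r; auto. apply Rmult_le_pos; apply Rabs_pos.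
    - eapply Rle_trans; [apply (absorb _ _ (1/8)); lra|]. right; field. }
  assert (He2 : e ^ 2 <= L ^ 2) by (rewrite <- (pow2_abs e); apply pow_incr; split; auto; apply Rabs_pos).
  assert (K3 : (V * d) * (V * q) <= 1/8 * (V ^ 2 * d ^ 2) + 2 * q ^ 2).
  { eapply Rle_trans; [apply Rle_abs|]. eapply Rle_trans; [apply (absorb _ _ (1/8)); lra|].
    assert (V ^ 2 <= 1) by (simpl; nra). assert (0 <= q ^ 2) by apply pow2_ge_0.
    replace ((V * q) ^ 2) with (V ^ 2 * q ^ 2) by ring. replace ((V * d) ^ 2) with (V ^ 2 * d ^ 2) by ring. nra. }
  assert (HT2 : 0 <= T ^ 2) by apply pow2_ge_0. assert (Hx2 : 0 <= x ^ 2) by apply pow2_ge_0.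
  assert (HeT : e ^ 2 * T ^ 2 <= L ^ 2 * T ^ 2) by (apply Rmult_le_compat_r; auto).
  assert (K4 : (V * d) * (2 * e * T) <= 1/8 * (V ^ 2 * d ^ 2) + 8 * L ^ 2 * T ^ 2).
  { eapply Rle_trans; [apply Rle_abs|]. eapply Rle_trans; [apply (absorb _ _ (1/8)); lra|].
    replace ((V * d) ^ 2) with (V ^ 2 * d ^ 2) by ring. replace ((2 * e * T) ^ 2) with (4 * (e ^ 2 * T ^ 2)) by ring. lra. }
  assert (K5 : e ^ 2 * (T * d) <= L ^ 2 * (3/2 * T ^ 2 + 1/2 * x ^ 2)).
  { rewrite ED. apply Rle_trans with (e ^ 2 * (3/2 * T ^ 2 + 1/2 * x ^ 2)).
    - apply Rmult_le_compat_l; [apply pow2_ge_0|]. assert (0 <= (T + x) ^ 2) by apply pow2_ge_0. nra.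
    - apply Rmult_le_compat_r; nra. }
  assert (K6 : ((V + e + V) * (e * T)) * q <= L ^ 2 * T ^ 2 + q ^ 2).
  { eapply Rle_trans; [apply Rle_abs|]. rewrite Rmult_comm. eapply Rle_trans; [apply (absorb _ _ 1); lra|].
    replace (((V + e + V) * (e * T)) ^ 2) with ((V + e + V) ^ 2 * (e ^ 2 * T ^ 2)) by ring.
    assert ((V + e + V) ^ 2 <= 4) by (simpl; nra).
    assert (0 <= e ^ 2 * T ^ 2) by (apply Rmult_le_pos; auto; apply pow2_ge_0). nra. }
  replace (((V + e) ^ 2 * T - V ^ 2 * x) * (d + q) - x * (2 * a1 * y + a2 * z)) with
    (V ^ 2 * d ^ 2 + (V * d) * (V * q) + (V * d) * (2 * e * T) + e ^ 2 * (T * d) + ((V + e + V) * (e * T)) * q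
     - x * (2 * a1 * y) - x * (a2 * z)) by (rewrite ED; ring).
  assert (HLx : 0 <= L ^ 2 * x ^ 2) by (apply Rmult_le_pos; auto; apply pow2_ge_0).
  assert (HLT : 0 <= L ^ 2 * T ^ 2) by (apply Rmult_le_pos; auto; apply pow2_ge_0).
  lra.
Qed.

(** The term with [16 / r] is the trace of nonlocality: the weight at [s] is compared with the
    weight at points up to one unit away, and the cutoff varies by O(1/r) over that distance. *)
Lemma caccioppoli lam : 0 <= lam < 1 ->
  (1 - lam ^ 2) ^ 4 * Box (fun s t => dS w s t ^ 2 + dT w s t ^ 2) s0 t0 (lam * r) <=
  16 / r * Box (fun s t => dS w s t ^ 2) s0 t0 (r + 3)
  + 640 / r ^ 2 * Box (fun s t => w s t ^ 2) s0 t0 (r + 3) + 5 * Box (fun s t => p s t ^ 2) s0 t0 (r + 3).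
Proof.
  intros Hl. fold W Z.
  assert (HM : M <= r + 3) by (unfold M; lra). assert (HM0 : 0 <= M) by (unfold M; lra).
  assert (Hlr : 0 <= lam * r <= M) by (unfold M; nra).
  assert (CW2 : C0 (fun s t => W s t ^ 2)) by auto with c0.
  assert (Cw2 : C0 (fun s t => w s t ^ 2)) by auto with c0.
  assert (Cp2 : C0 (fun s t => p s t ^ 2)) by auto with c0.
  assert (CTw : C0 (sh 1 w)) by auto with c0.
  assert (I1 : Box (fun s t => th s t * (2 * W s t ^ 2 + Z s t ^ 2)) s0 t0 M <=
     5/4 * Box (fun s t => th s t * D s t ^ 2) s0 t0 M + 1/8 * Box (fun s t => th s t * (W s t ^ 2 + Z s t ^ 2)) s0 t0 M
     + 200 / r ^ 2 * (Box (fun s t => sh 1 w s t ^ 2) s0 t0 M + Box (fun s t => w s t ^ 2) s0 t0 M) + 3 * Box (fun s t => p s t ^ 2) s0 t0 M).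
  { rewrite identity. unfold Box.
    rewrite <- I2_plus, <- !I2_scal, <- !I2_plus by auto 12 with c0.
    apply I2_le; try lra; auto 16 with c0. }
  assert (I2' : Box (fun s t => th s t * D s t ^ 2) s0 t0 M <= Box (fun s t => th s t * W s t ^ 2) s0 t0 (r + 3) + 8 / r * Box (fun s t => W s t ^ 2) s0 t0 (r + 3)).
  { unfold Box. rewrite <- I2_scal, <- I2_plus by auto 12 with c0.
    apply Rle_trans with (I2 (fun s t => th s t * W s t ^ 2 + 8 / r * W s t ^ 2) (s0 - M) (s0 + M + 1) (t0 - M) (t0 + M)).
    - unfold I2. apply RInt_le; [lra| | |].
      + apply ex_RInt_param; auto 12 with c0.
      + apply ex_RInt_param; auto 12 with c0.
      + intros t _.
        assert (K := RInt_avg_diff (fun s => w s t) (fun s => W s t) (fun s => th s t) (fun s => th s t + 8 / r) (s0 - M) (s0 + M)).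
        eapply Rle_trans; [apply K|].
        * lra.
        * intros; apply is_derive_dS; auto with sm.
        * intros; apply (C0_contS W); auto.
        * intros; apply (C0_contS th); auto.
        * intros. apply continuous_plusR; [apply (C0_contS th); auto | apply continuous_const].
        * intros x. rewrite th_v. assert (0 <= v x t ^ 2) by apply pow2_ge_0.
          assert (0 < 8 / r) by (apply Rdiv_lt_0_compat; lra). lra.
        * intros s x Hx. rewrite !th_v.
          assert (H := v_lip s x t ltac:(apply Rabs_le; lra)). apply Rabs_le_between in H.
          assert (H1 := v_ge0 s t). assert (H2 := v_ge0 x t). assert (H3 := v_le1 s t). assert (H4 := v_le1 x t).
          replace (8 / r) with (2 * (4 / r)) by (field; lra). set (L := 4 / r) in *.
          replace (v s t ^ 2) with (v x t ^ 2 + (v s t - v x t) * (v s t + v x t)) by ring. nra.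
        * right. apply RInt_ext. intros x _. eqR. ring.
    - apply I2_mono_dom; try (unfold M; lra); auto 12 with c0.
      intros s t _ _. rewrite th_v. assert (0 <= v s t ^ 2) by apply pow2_ge_0. assert (0 <= W s t ^ 2) by apply pow2_ge_0.
      assert (0 < 8 / r) by (apply Rdiv_lt_0_compat; lra). apply Rplus_le_le_0_compat; apply Rmult_le_pos; lra. }
  assert (I3 : Box (fun s t => sh 1 w s t ^ 2) s0 t0 M <= Box (fun s t => w s t ^ 2) s0 t0 (r + 3)).
  { unfold Box. replace (I2 (fun s t => sh 1 w s t ^ 2)) with (I2 (sh 1 (fun s t => w s t ^ 2))) by reflexivity.
    rewrite I2_sh by auto. apply I2_mono_dom; try (unfold M; lra); auto. intros; apply pow2_ge_0. }
  assert (mono : forall f, C0 f -> (forall s t, 0 <= f s t) -> Box f s0 t0 M <= Box f s0 t0 (r + 3)).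
  { intros f Cf Hf. unfold Box. apply I2_mono_dom; try (unfold M; lra); auto. }
  assert (I4 := mono _ Cw2 (fun s t => pow2_ge_0 (w s t))). assert (I5 := mono _ Cp2 (fun s t => pow2_ge_0 (p s t))).
  assert (I6 : Box (fun s t => th s t * W s t ^ 2) s0 t0 (r + 3) = Box (fun s t => th s t * W s t ^ 2) s0 t0 M).
  { apply Rle_antisym; [|apply mono; auto with c0; intros s t; rewrite th_v; apply Rmult_le_pos; apply pow2_ge_0].
    assert (CX : C0 (fun s t => th s t * W s t ^ 2)) by auto with c0.
    unfold Box, I2.
    assert (Cc : forall t x, continuous (fun s => th s t * W s t ^ 2) x) by (intros; apply (C0_contS (fun s t => th s t * W s t ^ 2)); auto).
    set (F := fun t => RInt (fun s => th s t * W s t ^ 2) (s0 - (r + 3)) (s0 + (r + 3))).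
    set (G := fun t => RInt (fun s => th s t * W s t ^ 2) (s0 - M) (s0 + M)).
    assert (Z0 : forall (f : R -> R) a b, a <= b -> (forall x, a < x < b -> f x = 0) -> RInt f a b = 0).
    { intros f a b Hab Hf. rewrite (RInt_ext _ (fun _ => 0)); [rewrite RInt_constR; eqR; ring|].
      intros x Hx. rewrite Rmin_left, Rmax_right in Hx by lra. apply Hf; auto. }
    assert (FG : forall t, F t = G t).
    { intros t. unfold F, G.
      rewrite <- (RInt_split (fun s : R => th s t * W s t ^ 2) (s0 - (r + 3)) (s0 - M) (s0 + (r + 3)) (Cc t)), <- (RInt_split (fun s : R => th s t * W s t ^ 2) (s0 - M) (s0 + M) (s0 + (r + 3)) (Cc t)).
      rewrite (Z0 _ (s0 - (r + 3)) (s0 - M)), (Z0 _ (s0 + M) (s0 + (r + 3))); try (unfold M; lra).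
      - intros x Hx. unfold th. rewrite (cut_out s0 r Hr x); [simpl; ring|]. unfold M in Hx. rewrite Rabs_right; lra.
      - intros x Hx. unfold th. rewrite (cut_out s0 r Hr x); [simpl; ring|]. unfold M in Hx. rewrite Rabs_left; lra. }
    assert (CF : forall x, continuous F x) by (intros; apply (RInt_param_cont (fun s t => th s t * W s t ^ 2)); auto).
    rewrite <- (RInt_split F (t0 - (r + 3)) (t0 - M) (t0 + (r + 3)) CF), <- (RInt_split F (t0 - M) (t0 + M) (t0 + (r + 3)) CF).
    assert (F0 : forall t, r <= Rabs (t - t0) -> F t = 0).
    { intros t Ht. apply Z0; [lra|]. intros x _. unfold th. rewrite (cut_out t0 r Hr t Ht). simpl; ring. }
    rewrite (Z0 F (t0 - (r + 3)) (t0 - M)), (Z0 F (t0 + M) (t0 + (r + 3))); try (unfold M; lra).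
    - right. rewrite Rplus_0_l, Rplus_0_r. apply RInt_ext. intros; apply FG.
    - intros x Hx. apply F0. unfold M in Hx. rewrite Rabs_right; lra.
    - intros x Hx. apply F0. unfold M in Hx. rewrite Rabs_left; lra. }
  assert (I7 : (1 - lam ^ 2) ^ 4 * Box (fun s t => W s t ^ 2 + Z s t ^ 2) s0 t0 (lam * r) <=
     Box (fun s t => th s t * (W s t ^ 2 + Z s t ^ 2)) s0 t0 M).
  { apply Rle_trans with (Box (fun s t => th s t * (W s t ^ 2 + Z s t ^ 2)) s0 t0 (lam * r)).
    - unfold Box. rewrite <- I2_scal by auto with c0. apply I2_le; try lra; auto with c0.
      intros s t Hs Ht. apply Rmult_le_compat_r; [assert (A := pow2_ge_0 (W s t)); assert (B := pow2_ge_0 (Z s t)); lra|].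
      rewrite th_v. replace ((1 - lam ^ 2) ^ 4) with (((1 - lam ^ 2) * (1 - lam ^ 2)) ^ 2) by ring.
      assert (0 <= 1 - lam ^ 2) by (simpl; nra).
      apply pow_incr. split; [apply Rmult_le_pos; auto|]. unfold v.
      apply Rmult_le_compat; auto; apply cut_in; try lra; apply Rabs_le; lra.
    - unfold Box. apply I2_mono_dom; try (unfold M; lra); auto with c0; try lra.
      intros s t _ _. rewrite th_v. apply Rmult_le_pos; [apply pow2_ge_0|]. assert (A := pow2_ge_0 (W s t)); assert (B := pow2_ge_0 (Z s t)); lra. }
  assert (E1 : Box (fun s t => th s t * (2 * W s t ^ 2 + Z s t ^ 2)) s0 t0 M =
     Box (fun s t => th s t * W s t ^ 2) s0 t0 M + Box (fun s t => th s t * (W s t ^ 2 + Z s t ^ 2)) s0 t0 M).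
  { unfold Box. rewrite <- I2_plus by auto with c0. apply I2_ext; intros; ring. }
  assert (I8 : Box (fun s t => th s t * W s t ^ 2) s0 t0 M <= Box (fun s t => th s t * (W s t ^ 2 + Z s t ^ 2)) s0 t0 M).
  { unfold Box. apply I2_le; try lra; auto with c0. intros s t _ _. rewrite th_v.
    apply Rmult_le_compat_l; [apply pow2_ge_0|]. assert (B := pow2_ge_0 (Z s t)); lra. }
  (* Write [S] for the weighted integral of [W^2 + Z^2] and [X <= S] for that of [W^2]. Absorbing
     [5/4 X + 1/8 S] into [X + S] leaves at least [5/8 S], which turns 10, 400 and 3 into 16, 640
     and 24/5. *)
  assert (H8 : 8 / r = / 2 * (16 / r)) by (field; lra).
  assert (H200 : 200 / r ^ 2 = 5 / 16 * (640 / r ^ 2)) by (field; lra).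
  rewrite H8 in I2'. rewrite H200 in I1.
  assert (H640 : 0 <= 640 / r ^ 2) by (apply Rlt_le, Rdiv_lt_0_compat; [lra|]; apply pow_lt; lra).
  set (A := 640 / r ^ 2) in *. set (B := 16 / r) in *.
  assert (J1 : A * (Box (fun s t => sh 1 w s t ^ 2) s0 t0 M + Box (fun s t => w s t ^ 2) s0 t0 M) <= A * (2 * Box (fun s t => w s t ^ 2) s0 t0 (r + 3))).
  { apply Rmult_le_compat_l; auto; lra. }
  assert (J2 : 0 <= Box (fun s t => p s t ^ 2) s0 t0 (r + 3)).
  { unfold Box; apply I2_nonneg; try lra; auto. intros; apply pow2_ge_0. }
  lra.
Qed.
End Cacc.

(** * Liouville's theorem *)

(** Every point of the box is reached from the origin in [S n] equal steps, each short enough that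
    [f] changes by less than 1. *)
Lemma C0_bounded_box f K : C0 f -> exists M, forall s t, Rabs s <= K -> Rabs t <= K -> Rabs (f s t) <= M.
Proof.
  intros Hf.
  destruct (uniform_continuity_2d f (- K) K (- K) K (fun x y _ _ => Hf x y) (mkposreal 1 Rlt_0_1)) as [d Hd].
  simpl in Hd.
  destruct (Rle_lt_dec 0 K) as [HK|HK].
  2:{ exists 0; intros s t Hs. assert (H := Rabs_pos s); lra. }
  assert (Hdp := cond_pos d).
  destruct (nfloor_ex (K / d)) as [n [_ Hn]].
  { apply Rmult_le_pos; auto. apply Rlt_le, Rinv_0_lt_compat; auto. }
  set (N := INR n + 1) in *. assert (HN : 0 < N) by (unfold N; assert (H := pos_INR n); lra).
  assert (Hs : K / N < d).
  { apply Rmult_lt_reg_r with N; auto. unfold Rdiv. rewrite Rmult_assoc, Rinv_l, Rmult_1_r by lra.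
    apply Rmult_lt_reg_r with (/ d); [apply Rinv_0_lt_compat; auto|].
    rewrite (Rmult_comm d), Rmult_assoc, Rinv_r, Rmult_1_r by lra. auto. }
  exists (Rabs (f 0 0) + N). intros s t Hs1 Ht1.
  assert (Q : forall j, (j <= S n)%nat -> Rabs (f (INR j * (s / N)) (INR j * (t / N))) <= Rabs (f 0 0) + INR j).
  { assert (Hb : forall x, Rabs x <= K -> Rabs (x / N) < d).
    { intros x Hx. unfold Rdiv. rewrite Rabs_mult, Rabs_inv, (Rabs_pos_eq N) by lra.
      eapply Rle_lt_trans; [|apply Hs]. apply Rmult_le_compat_r; auto. apply Rlt_le, Rinv_0_lt_compat; auto. }
    assert (Hin : forall j x, (j <= S n)%nat -> Rabs x <= K -> - K <= INR j * (x / N) <= K).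
    { intros j x Hj Hx. apply Rabs_le_between. rewrite Rabs_mult. unfold Rdiv. rewrite Rabs_mult, Rabs_inv, (Rabs_pos_eq N) by lra.
      rewrite (Rabs_pos_eq (INR j)) by apply pos_INR.
      apply le_INR in Hj. rewrite S_INR in Hj. fold N in Hj.
      apply Rmult_le_reg_r with N; auto.
      replace (INR j * (Rabs x * / N) * N) with (INR j * Rabs x) by (field; lra).
      rewrite Rmult_comm. apply Rmult_le_compat; auto using Rabs_pos, pos_INR. }
    induction j; intros Hj.
    - simpl. rewrite !Rmult_0_l. lra.
    - assert (IH := IHj ltac:(lia)).
      assert (A := Hd (INR j * (s / N)) (INR j * (t / N)) (INR (S j) * (s / N)) (INR (S j) * (t / N))
        (Hin j s ltac:(lia) Hs1) (Hin j t ltac:(lia) Ht1) (Hin (S j) s Hj Hs1) (Hin (S j) t Hj Ht1)).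
      assert (E1 : forall x, INR (S j) * x - INR j * x = x) by (intros; rewrite S_INR; ring).
      rewrite !E1 in A.
      specialize (A (Hb s Hs1) (Hb t Ht1)).
      replace (f (INR (S j) * (s / N)) (INR (S j) * (t / N))) with
        (f (INR j * (s / N)) (INR j * (t / N)) + (f (INR (S j) * (s / N)) (INR (S j) * (t / N)) - f (INR j * (s / N)) (INR j * (t / N)))) by ring.
      eapply Rle_trans; [apply Rabs_triang|]. rewrite (S_INR j) at 3. lra. }
  specialize (Q (S n) (le_n _)). rewrite S_INR in Q. fold N in Q.
  replace (N * (s / N)) with s in Q by (field; lra). replace (N * (t / N)) with t in Q by (field; lra). auto.
Qed.

Lemma Box_mono f s t a b : 0 <= a -> a <= b -> C0 f -> (forall x y, 0 <= f x y) -> Box f s t a <= Box f s t b.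
Proof. intros Ha Hb Hf Hp. unfold Box. apply I2_mono_dom; [lra | lra | lra | lra | lra | lra | assumption | auto]. Qed.
Lemma Box_le f g s t a : 0 <= a -> C0 f -> C0 g ->
  (forall x y, Rabs (x - s) <= a -> Rabs (y - t) <= a -> f x y <= g x y) -> Box f s t a <= Box g s t a.
Proof. intros Ha Hf Hg H. unfold Box. apply I2_le; [lra | lra | assumption | assumption |]. intros; apply H; apply Rabs_le; lra. Qed.
Lemma Box_le_const f s t a k : 0 <= a -> C0 f ->
  (forall x y, Rabs (x - s) <= a -> Rabs (y - t) <= a -> f x y <= k) -> Box f s t a <= 4 * a ^ 2 * k.
Proof.
  intros Ha Hf H. apply Rle_trans with (k * (s + a - (s - a)) * (t + a - (t - a))); [|right; ring].
  unfold Box. apply I2_le_const; [lra | lra | assumption |]. intros; apply H; apply Rabs_le; lra.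
Qed.
Lemma Box_nonneg f s t a : 0 <= a -> C0 f -> (forall x y, 0 <= f x y) -> 0 <= Box f s t a.
Proof. intros Ha Hf H. unfold Box. apply I2_nonneg; [lra | lra | assumption | auto]. Qed.

Lemma nb0 s t : nb 0 (Rmax (Rabs s) (Rabs t)) s t.
Proof. unfold nb; lra. Qed.

Lemma BO0_bounded f : C0 f -> BO 0 (fun _ => f) -> exists M, 0 < M /\ forall s t, Rabs (f s t) <= M.
Proof.
  intros Hf H. destruct (H 0) as (C & r0 & HC & Hr0 & HB).
  destruct (C0_bounded_box f r0 Hf) as [M HM].
  exists (Rmax C M). split; [apply Rlt_le_trans with C; auto; apply Rmax_l|].
  intros s t. destruct (Rle_lt_dec r0 (Rmax (Rabs s) (Rabs t))) as [H1|H1].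
  - eapply Rle_trans; [apply (HB _ s t H1 (nb0 s t))|]. simpl. rewrite Rmult_1_r. apply Rmax_l.
  - eapply Rle_trans; [apply HM|apply Rmax_r].
    + apply Rle_trans with (Rmax (Rabs s) (Rabs t)); [apply Rmax_l | lra].
    + apply Rle_trans with (Rmax (Rabs s) (Rabs t)); [apply Rmax_r | lra].
Qed.

Lemma I2_small_zero f s t : C0 f -> (forall s t, 0 <= f s t) ->
  (forall e, 0 < e -> exists r0, forall r, r0 <= r -> I2 f (- r) r (- r) r <= e) -> f s t = 0.
Proof.
  intros Hf Hp H. destruct (Rle_lt_dec (f s t) 0) as [H0|H0]; [apply Rle_antisym; auto|]. exfalso.
  assert (Hh : 0 < f s t / 2) by lra.
  destruct (Hf s t (mkposreal _ Hh)) as [d Hd]. simpl in Hd. assert (Hdp := cond_pos d).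
  set (q := d / 2). assert (Hq : 0 < q < d) by (unfold q; lra).
  destruct (H (f s t / 4 * (2 * q) * (2 * q))) as [r0 Hr0].
  { apply Rmult_lt_0_compat; [apply Rmult_lt_0_compat|]; lra. }
  set (r := Rmax r0 (Rabs s + Rabs t + q)).
  assert (H1 : r0 <= r) by apply Rmax_l. assert (H2 : Rabs s + Rabs t + q <= r) by apply Rmax_r.
  specialize (Hr0 r H1).
  assert (A := Rle_abs s). assert (B := Rle_abs t). assert (A' := Rle_abs (- s)). assert (B' := Rle_abs (- t)).
  rewrite Rabs_Ropp in A', B'. assert (PA := Rabs_pos s). assert (PB := Rabs_pos t).
  assert (K : I2 (fun _ _ => f s t / 2) (s - q) (s + q) (t - q) (t + q) <= I2 f (- r) r (- r) r).
  { apply Rle_trans with (I2 f (s - q) (s + q) (t - q) (t + q)).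
    - apply I2_le; [lra | lra | apply C0_const | assumption |]. intros x y Hx Hy.
      assert (D := Hd x y ltac:(apply Rabs_def1; lra) ltac:(apply Rabs_def1; lra)). apply Rabs_def2 in D. lra.
    - apply I2_mono_dom; [lra | lra | lra | lra | lra | lra | assumption | auto]. }
  rewrite I2_const in K.
  replace (s + q - (s - q)) with (2 * q) in K by ring. replace (t + q - (t - q)) with (2 * q) in K by ring.
  assert (0 < f s t * ((2 * q) * (2 * q))) by (apply Rmult_lt_0_compat; [|apply Rmult_lt_0_compat]; lra). nra.
Qed.

Lemma del2 f s t : del (del f) s t = sh 1 f s t - 2 * f s t + sh (-1) f s t.
Proof.
  unfold del, sh. replace (s + / 2 + / 2) with (s + 1) by lra.
  replace (s + / 2 + - / 2) with s by lra. replace (s + - / 2 + / 2) with s by lra.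
  replace (s + - / 2 + - / 2) with (s + -1) by lra. ring.
Qed.

(** Each use of Caccioppoli's inequality lowers the growth of the Dirichlet integral by one power of
    [r]: from r^2, given by the gradient bound, to r, to O(1), and finally to o(1) by means of the
    decay of [w]. So [w] is constant. Decay is asked for only as [Rabs t] grows, since the theorem
    must also apply to functions that are periodic in [s]. *)
Theorem liouville w M : smooth w -> (forall s t, L0 w s t = 0) -> 0 < M -> (forall s t, Rabs (w s t) <= M) ->
  (forall e, 0 < e -> exists r0, 0 <= r0 /\ forall s t, r0 <= Rabs t -> Rabs (w s t) <= e) -> forall s t, w s t = 0.
Proof.
  intros Sw Hw HM0 HM HL.
  assert (ELL : forall s t, LL w s t = sh 1 w s t - 2 * w s t + sh (-1) w s t).
  { intros s t. assert (E := Hw s t). unfold L0 in E. rewrite del2 in E. unfold LL. lra. }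
  assert (HLM : forall s t, Rabs (LL w s t) <= 4 * M).
  { intros s t. rewrite ELL. assert (A1 := HM s t). assert (A2 := HM (s + 1) t). assert (A3 := HM (s + -1) t).
    unfold sh. apply Rabs_le_between in A1. apply Rabs_le_between in A2. apply Rabs_le_between in A3.
    apply Rabs_le. lra. }
  set (N := 32 * M + 32 * (4 * M)).
  assert (HG : forall s t, Rabs (dS w s t) <= N /\ Rabs (dT w s t) <= N).
  { intros s t. apply grad_bound; auto. }
  set (A := fun rho => Box (fun s t => dS w s t ^ 2 + dT w s t ^ 2) 0 0 rho).
  assert (CG : C0 (fun s t => dS w s t ^ 2 + dT w s t ^ 2)) by auto 10 with c0.
  assert (CW : C0 (fun s t => dS w s t ^ 2)) by auto 10 with c0.
  assert (Cw : C0 (fun s t => w s t ^ 2)) by auto 10 with c0.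
  assert (C0z : Box (fun _ _ => 0 ^ 2) 0 0 = fun _ => 0).
  { apply functional_extensionality; intro x. unfold Box. replace (0 ^ 2) with 0 by ring. rewrite I2_const. ring. }
  assert (step : forall r, 3 <= r -> A (/ 2 * r) <= 64 / r * A (2 * r) + 2560 / r ^ 2 * Box (fun s t => w s t ^ 2) 0 0 (2 * r)).
  { intros r Hr.
    assert (K := caccioppoli w (fun _ _ => 0) Sw (smooth_const 0)
      ltac:(intros x y; rewrite ELL; unfold sh; replace (x + -1 + 1) with x by ring; ring) 0 0 r ltac:(lra) (/ 2) ltac:(lra)).
    cbv beta in K. rewrite C0z in K.
    assert (m1 : Box (fun s t => dS w s t ^ 2) 0 0 (r + 3) <= A (2 * r)).
    { apply Rle_trans with (Box (fun s t => dS w s t ^ 2) 0 0 (2 * r)).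
      - apply Box_mono; [lra | lra | exact CW | intros; apply pow2_ge_0].
      - apply Box_le; [lra | exact CW | exact CG |]. intros s t _ _. assert (B := pow2_ge_0 (dT w s t)). lra. }
    assert (m2 : Box (fun s t => w s t ^ 2) 0 0 (r + 3) <= Box (fun s t => w s t ^ 2) 0 0 (2 * r)).
    { apply Box_mono; [lra | lra | exact Cw | intros; apply pow2_ge_0]. }
    fold (A (/ 2 * r)) in K.
    assert (H1 : 0 < 16 / r) by (apply Rdiv_lt_0_compat; lra).
    assert (H2 : 0 < 640 / r ^ 2) by (apply Rdiv_lt_0_compat; [lra | apply pow_lt; lra]).
    replace (64 / r) with (4 * (16 / r)) by (field; lra). replace (2560 / r ^ 2) with (4 * (640 / r ^ 2)) by (field; lra).
    set (c1 := 16 / r) in *. set (c2 := 640 / r ^ 2) in *.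
    (* This exceeds 1/4, whence the factor 4 that turns 16 and 640 into 64 and 2560. *)
    assert (E : (1 - (/ 2) ^ 2) ^ 4 = 81 / 256) by field. rewrite E in K.
    assert (0 <= A (/ 2 * r)). { apply Box_nonneg; [lra | exact CG |].
      intros s t. assert (B := pow2_ge_0 (dT w s t)). assert (B' := pow2_ge_0 (dS w s t)). lra. }
    nra. }
  assert (bw : forall r, 0 < r -> Box (fun s t => w s t ^ 2) 0 0 (2 * r) <= 16 * r ^ 2 * M ^ 2).
  { intros r Hr. eapply Rle_trans; [apply (Box_le_const _ 0 0 (2 * r) (M ^ 2)); [lra | exact Cw |]|].
    - intros s t _ _. rewrite <- pow2_abs. apply pow_incr. split; auto. apply Rabs_pos.
    - right; ring. }
  assert (A1 : forall r, 0 < r -> A r <= 8 * r ^ 2 * N ^ 2).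
  { intros r Hr. unfold A. eapply Rle_trans; [apply (Box_le_const _ 0 0 r (2 * N ^ 2)); [lra | exact CG |]|].
    - intros s t _ _. destruct (HG s t) as [G1 G2]. rewrite <- (pow2_abs (dS w s t)), <- (pow2_abs (dT w s t)).
      assert (Rabs (dS w s t) ^ 2 <= N ^ 2) by (apply pow_incr; split; auto; apply Rabs_pos).
      assert (Rabs (dT w s t) ^ 2 <= N ^ 2) by (apply pow_incr; split; auto; apply Rabs_pos). lra.
    - right; ring. }
  assert (A2 : exists C, 0 <= C /\ forall r, 3 <= r -> A (/ 2 * r) <= C * r).
  { exists (2048 * N ^ 2 + 40960 * M ^ 2). split; [assert (B := pow2_ge_0 N); assert (B' := pow2_ge_0 M); lra|].
    intros r Hr. eapply Rle_trans; [apply step; auto|].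
    assert (B1 := A1 (2 * r) ltac:(lra)). assert (B2 := bw r ltac:(lra)).
    assert (64 / r * A (2 * r) <= 64 / r * (8 * (2 * r) ^ 2 * N ^ 2)).
    { apply Rmult_le_compat_l; auto. apply Rlt_le, Rdiv_lt_0_compat; lra. }
    assert (2560 / r ^ 2 * Box (fun s t => w s t ^ 2) 0 0 (2 * r) <= 2560 / r ^ 2 * (16 * r ^ 2 * M ^ 2)).
    { apply Rmult_le_compat_l; auto. apply Rlt_le, Rdiv_lt_0_compat; [lra | apply pow_lt; lra]. }
    replace (64 / r * (8 * (2 * r) ^ 2 * N ^ 2)) with (2048 * N ^ 2 * r) in H by (field; lra).
    replace (2560 / r ^ 2 * (16 * r ^ 2 * M ^ 2)) with (40960 * M ^ 2) in H0 by (field; lra).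
    assert (0 <= M ^ 2) by apply pow2_ge_0. nra. }
  destruct A2 as (C & HC0 & HC).
  assert (A3 : exists C', 0 <= C' /\ forall r, 3 <= r -> A (/ 2 * r) <= C').
  { exists (256 * C + 40960 * M ^ 2). split; [assert (B' := pow2_ge_0 M); lra|].
    intros r Hr. eapply Rle_trans; [apply step; auto|].
    assert (B1 := HC (4 * r) ltac:(lra)). replace (/ 2 * (4 * r)) with (2 * r) in B1 by field.
    assert (B2 := bw r ltac:(lra)).
    assert (64 / r * A (2 * r) <= 64 / r * (C * (4 * r))).
    { apply Rmult_le_compat_l; auto. apply Rlt_le, Rdiv_lt_0_compat; lra. }
    assert (2560 / r ^ 2 * Box (fun s t => w s t ^ 2) 0 0 (2 * r) <= 2560 / r ^ 2 * (16 * r ^ 2 * M ^ 2)).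
    { apply Rmult_le_compat_l; auto. apply Rlt_le, Rdiv_lt_0_compat; [lra | apply pow_lt; lra]. }
    replace (64 / r * (C * (4 * r))) with (256 * C) in H by (field; lra).
    replace (2560 / r ^ 2 * (16 * r ^ 2 * M ^ 2)) with (40960 * M ^ 2) in H0 by (field; lra). lra. }
  destruct A3 as (C' & HC0' & HC').
  assert (small_w : forall e, 0 < e -> exists r1, 1 <= r1 /\ forall r, r1 <= r -> Box (fun s t => w s t ^ 2) 0 0 (2 * r) <= e * r ^ 2).
  { intros e He. assert (Hse : 0 < sqrt (e / 32)) by (apply sqrt_lt_R0; lra).
    destruct (HL (sqrt (e / 32)) Hse) as (r0 & Hr0 & HB).
    (* In the strip where [Rabs t < r0] there is no decay, only the bound [M]. The continuous
       majorant [K / (1 + t^2)] covers the strip, and its integral over the box is O(r) because that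
       of [1 / (1 + t^2)] over the line is finite. *)
    set (K := M ^ 2 * (1 + r0 ^ 2)). assert (HK : 0 < K) by (unfold K; assert (0 < M ^ 2) by (apply pow_lt; auto); assert (0 <= r0 ^ 2) by apply pow2_ge_0; nra).
    assert (Cin : forall x, continuous (fun t => K * / (1 + t ^ 2)) x).
    { intros x. apply (ex_derive_continuous (K := R_AbsRing) (V := R_NormedModule)). auto_derive.
      assert (0 <= x ^ 2) by apply pow2_ge_0. simpl in *; lra. }
    assert (Cmaj : C0 (fun _ t => K * / (1 + t ^ 2))) by (apply C0_1; auto).
    exists (Rmax 1 (32 * K / e)). split; [apply Rmax_l|]. intros r Hr.
    assert (Hr1 : 1 <= r) by (eapply Rle_trans; [apply Rmax_l | eauto]).
    assert (Hr2 : 32 * K / e <= r) by (eapply Rle_trans; [apply Rmax_r | eauto]).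
    apply Rle_trans with (Box (fun s t => e / 32 + K * / (1 + t ^ 2)) 0 0 (2 * r)).
    - apply Box_le; [lra | exact Cw | apply C0_plus; [apply C0_const | exact Cmaj] |]. intros s t _ _.
      assert (P1 : 0 < 1 + t ^ 2) by (assert (0 <= t ^ 2) by apply pow2_ge_0; lra).
      destruct (Rle_lt_dec r0 (Rabs t)) as [Hs|Hs].
      + assert (B := HB s t Hs).
        assert (w s t ^ 2 <= e / 32).
        { rewrite <- pow2_abs. rewrite <- (pow2_sqrt (e / 32)) by lra. apply pow_incr; split; auto. apply Rabs_pos. }
        assert (0 < K * / (1 + t ^ 2)) by (apply Rmult_lt_0_compat; auto; apply Rinv_0_lt_compat; auto). lra.
      + assert (w s t ^ 2 <= M ^ 2) by (rewrite <- pow2_abs; apply pow_incr; split; auto; apply Rabs_pos).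
        assert (M ^ 2 <= K * / (1 + t ^ 2)).
        { apply Rmult_le_reg_r with (1 + t ^ 2); auto. rewrite Rmult_assoc, Rinv_l, Rmult_1_r by lra.
          unfold K. apply Rmult_le_compat_l; [apply pow2_ge_0|].
          rewrite <- (pow2_abs t). assert (Rabs t ^ 2 <= r0 ^ 2) by (apply pow_incr; split; [apply Rabs_pos | lra]). lra. }
        lra.
    - unfold Box. rewrite I2_plus, I2_const by auto with c0.
      assert (I2 (fun _ t => K * / (1 + t ^ 2)) (0 - 2 * r) (0 + 2 * r) (0 - 2 * r) (0 + 2 * r) <= 16 * K * r).
      { unfold I2.
        assert (E : RInt (fun t => RInt (fun _ => K * / (1 + t ^ 2)) (0 - 2 * r) (0 + 2 * r)) (0 - 2 * r) (0 + 2 * r)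
          = 4 * r * (K * (atan (0 + 2 * r) - atan (0 - 2 * r)))).
        { rewrite (RInt_ext _ (fun t => 4 * r * (K * / (1 + t ^ 2)))).
          2:{ intros x _. rewrite RInt_constR. eqR. ring. }
          rewrite RInt_scalR by auto. f_equal.
          rewrite (RInt_D (fun s => K * atan s)); auto; [eqR; ring|].
          intros x. auto_derive; auto. eqR. assert (0 <= x ^ 2) by apply pow2_ge_0. field. simpl in *; lra. }
        rewrite E.
        assert (B1 := atan_bound (0 + 2 * r)). assert (B2 := atan_bound (0 - 2 * r)). assert (PB := PI_4).
        apply Rle_trans with (4 * r * (K * 4)); [|lra].
        apply Rmult_le_compat_l; [lra|]. apply Rmult_le_compat_l; lra. }
      assert (16 * K * r <= e / 2 * r ^ 2).
      { apply Rmult_le_compat_r with (r := e) in Hr2; [|lra].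
        replace (32 * K / e * e) with (32 * K) in Hr2 by (field; lra). simpl. nra. }
      replace (e / 32 * (0 + 2 * r - (0 - 2 * r)) * (0 + 2 * r - (0 - 2 * r))) with (e / 2 * r ^ 2) by field.
      lra. }
  assert (Gz : forall s t, dS w s t ^ 2 + dT w s t ^ 2 = 0).
  { intros s t. apply (I2_small_zero (fun s t => dS w s t ^ 2 + dT w s t ^ 2)); auto.
    - intros x y. assert (B := pow2_ge_0 (dT w x y)). assert (B' := pow2_ge_0 (dS w x y)). lra.
    - intros e He. destruct (small_w (e / 5120)) as (r1 & Hr1 & HS); [lra|].
      exists (Rmax (Rmax 3 r1) (128 * C' / e)). intros rr Hrr.
      set (r := 2 * rr).
      assert (Q1 : Rmax 3 r1 <= rr) by (eapply Rle_trans; [apply Rmax_l | eauto]).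
      assert (Q2 : 3 <= rr) by (eapply Rle_trans; [apply Rmax_l | eauto]).
      assert (Q3 : r1 <= rr) by (eapply Rle_trans; [apply Rmax_r | eauto]).
      assert (Q4 : 128 * C' / e <= rr) by (eapply Rle_trans; [apply Rmax_r | eauto]).
      assert (K := step r ltac:(unfold r; lra)).
      assert (K2 := HC' (4 * r) ltac:(unfold r; lra)). replace (/ 2 * (4 * r)) with (2 * r) in K2 by field.
      assert (K3 := HS r ltac:(unfold r; lra)).
      assert (Hrp : 0 < r) by (unfold r; lra).
      assert (64 / r * A (2 * r) <= e / 4).
      { apply Rle_trans with (64 / r * C').
        - apply Rmult_le_compat_l; auto. apply Rlt_le, Rdiv_lt_0_compat; lra.
        - apply Rmult_le_reg_r with r; auto. replace (64 / r * C' * r) with (64 * C') by (field; lra).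
          apply Rmult_le_compat_r with (r := e) in Q4; [|lra].
          replace (128 * C' / e * e) with (128 * C') in Q4 by (field; lra). unfold r. nra. }
      assert (2560 / r ^ 2 * Box (fun s t => w s t ^ 2) 0 0 (2 * r) <= e / 2).
      { apply Rle_trans with (2560 / r ^ 2 * (e / 5120 * r ^ 2)).
        - apply Rmult_le_compat_l; auto. apply Rlt_le, Rdiv_lt_0_compat; [lra | apply pow_lt; lra].
        - right; field; lra. }
      replace (/ 2 * r) with rr in K by (unfold r; field).
      assert (EA : I2 (fun s t => dS w s t ^ 2 + dT w s t ^ 2) (- rr) rr (- rr) rr = A rr).
      { unfold A, Box. rewrite Rminus_0_l, Rplus_0_l. reflexivity. }
      rewrite EA. lra. }
  assert (GT : forall s t, dT w s t = 0).
  { intros s t. assert (E := Gz s t). assert (B := pow2_ge_0 (dT w s t)). assert (B' := pow2_ge_0 (dS w s t)).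
    apply Rsqr_0_uniq. unfold Rsqr. nra. }
  intros s t. destruct (Req_dec (w s t) 0) as [|Hne]; auto. exfalso.
  assert (H := Rabs_pos_lt _ Hne).
  destruct (HL (Rabs (w s t) / 2)) as (r0 & Hr0 & HB); [lra|].
  assert (E : w s r0 = w s t).
  { destruct (MVT_gen_R (fun z => w s z) (fun z => dT w s z) t r0) as [c [_ Hc]].
    - intros; apply is_derive_dT; auto with sm.
    - rewrite GT in Hc. lra. }
  assert (B := HB s r0 ltac:(rewrite Rabs_pos_eq; lra)). rewrite E in B. lra.
Qed.

Corollary liouville_LO w : smooth w -> (forall s t, L0 w s t = 0) -> LO 0 (fun _ => w) -> forall s t, w s t = 0.
Proof.
  intros Sw Hw HL. destruct (BO0_bounded w (smooth_C0 _ Sw) (LO_BO _ _ HL)) as (M & HM0 & HM).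
  apply (liouville w M); auto. intros e He. destruct (HL 0 e He) as (r0 & Hr0 & HB). exists r0. split; [lra|].
  intros s t Ht. assert (B := HB (Rmax (Rabs s) (Rabs t)) s t ltac:(eapply Rle_trans; [eauto | apply Rmax_r]) (nb0 s t)).
  simpl in B. lra.
Qed.

(** * Decay of derivatives *)

Definition Nm (s t : R) : R := Rmax (Rabs s) (Rabs t).

Lemma powerRZ_opp_nat x n : powerRZ x (- Z.of_nat n) = / x ^ n.
Proof.
  destruct n; simpl; [field|]. rewrite SuccNat2Pos.id_succ. auto.
Qed.
Lemma powerRZ_comparable m : exists K, 0 < K /\
  forall r x, 1 <= r -> r / 2 <= x <= 2 * r -> powerRZ x m <= K * powerRZ r m.
Proof.
  destruct (Z_le_gt_dec 0 m) as [H|H].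
  - exists (2 ^ Z.to_nat m). split; [apply pow_lt; lra|]. intros r x Hr Hx.
    replace m with (Z.of_nat (Z.to_nat m)) at 1 3 by lia. rewrite <- !pow_powerRZ, <- Rpow_mult_distr.
    apply pow_incr. lra.
  - exists (2 ^ Z.to_nat (- m)). split; [apply pow_lt; lra|]. intros r x Hr Hx.
    replace m with (- Z.of_nat (Z.to_nat (- m)))%Z at 1 3 by lia. rewrite !powerRZ_opp_nat.
    set (n := Z.to_nat (- m)).
    apply Rle_trans with (/ (r / 2) ^ n).
    + apply Rinv_le_contravar; [apply pow_lt; lra | apply pow_incr; lra].
    + unfold Rdiv. rewrite Rpow_mult_distr, pow_inv, Rinv_mult, Rinv_inv. lra.
Qed.

Lemma Nm_nb k s t : 0 <= k -> nb k (Nm s t) s t.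
Proof. unfold nb, Nm; lra. Qed.
Lemma nb_half k r s t : nb k r s t -> 2 * k <= r -> r / 2 <= Nm s t <= 2 * r.
Proof. unfold nb, Nm. intros; lra. Qed.

(** For a single function the scale of a point may be taken to be its own norm: on a ring of fixed
    width the two are comparable, and so are their powers. *)
Lemma LO_c m f : LO m (fun _ => f) <-> forall e, 0 < e -> exists r0, 1 <= r0 /\
  forall s t, r0 <= Nm s t -> Rabs (f s t) <= e * powerRZ (Nm s t) m.
Proof.
  split; intros H.
  - intros e He. destruct (H 0 e He) as (r0 & A & B). exists r0; split; auto.
    intros s t Hs. apply B; auto. apply Nm_nb; lra.
  - intros k e He. destruct (powerRZ_comparable m) as (K & HK & HC).
    destruct (H (e / K)) as (r0 & A & B); [apply Rdiv_lt_0_compat; auto|].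
    exists (Rmax (2 * r0) (2 * k)). split; [apply Rle_trans with (2 * r0); [lra | apply Rmax_l]|].
    intros r s t Hr Hn. assert (2 * r0 <= r) by (eapply Rle_trans; [apply Rmax_l | eauto]).
    assert (2 * k <= r) by (eapply Rle_trans; [apply Rmax_r | eauto]).
    assert (C := nb_half k r s t Hn H1).
    eapply Rle_trans; [apply B; lra|]. replace (e * powerRZ r m) with (e / K * (K * powerRZ r m)) by (field; lra).
    apply Rmult_le_compat_l; [apply Rlt_le, Rdiv_lt_0_compat; auto|]. apply HC; lra.
Qed.
Lemma BO_c m f : BO m (fun _ => f) <-> exists C r0, 0 < C /\ 1 <= r0 /\
  forall s t, r0 <= Nm s t -> Rabs (f s t) <= C * powerRZ (Nm s t) m.
Proof.
  split; intros H.
  - destruct (H 0) as (C & r0 & HC & A & B). exists C, r0; repeat split; auto.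
    intros s t Hs. apply B; auto. apply Nm_nb; lra.
  - intros k. destruct (powerRZ_comparable m) as (K & HK & HC).
    destruct H as (C & r0 & HC0 & A & B).
    exists (C * K), (Rmax (2 * r0) (2 * k)). split; [apply Rmult_lt_0_compat; auto|].
    split; [apply Rle_trans with (2 * r0); [lra | apply Rmax_l]|].
    intros r s t Hr Hn. assert (2 * r0 <= r) by (eapply Rle_trans; [apply Rmax_l | eauto]).
    assert (2 * k <= r) by (eapply Rle_trans; [apply Rmax_r | eauto]).
    assert (C' := nb_half k r s t Hn H0).
    eapply Rle_trans; [apply B; lra|]. rewrite Rmult_assoc.
    apply Rmult_le_compat_l; [lra|]. apply HC; lra.
Qed.

Lemma tau_pos s t : 0 < tau s t.
Proof. unfold tau. assert (H := pow2_ge_0 s). assert (H0 := pow2_ge_0 t). lra. Qed.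
Lemma tau_ne s t : tau s t <> 0.
Proof. assert (H := tau_pos s t). lra. Qed.
Definition itau : R -> R -> R := fun s t => / tau s t.
Lemma smooth_itau : smooth itau.
Proof. apply smooth_inv; [apply smooth_tau | apply tau_ne]. Qed.
#[global] Hint Resolve smooth_itau : sm.
Lemma dS_tau : dS tau = fun s _ => 2 * s.
Proof. apply dS_unique; intros; unfold tau. auto_derive; auto. ring. Qed.
Lemma dT_tau : dT tau = fun _ t => 2 * t.
Proof. apply dT_unique; intros; unfold tau. auto_derive; auto. ring. Qed.
Lemma dS_itau : dS itau = fun s t => (-2 * s) * (itau s t * itau s t).
Proof.
  apply dS_unique; intros. evar_last; [apply (isS_inv tau); [auto with sm | apply tau_ne]|].
  rewrite dS_tau. unfold itau. ring.
Qed.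
Lemma dT_itau : dT itau = fun s t => (-2 * t) * (itau s t * itau s t).
Proof.
  apply dT_unique; intros. evar_last; [apply (isT_inv tau); [auto with sm | apply tau_ne]|].
  rewrite dT_tau. unfold itau. ring.
Qed.
Lemma tau_Nm s t : Nm s t ^ 2 <= tau s t.
Proof.
  unfold tau, Nm. assert (H := pow2_ge_0 s). assert (H0 := pow2_ge_0 t).
  unfold Rmax; destruct (Rle_dec (Rabs s) (Rabs t)); rewrite pow2_abs; lra.
Qed.
(** The derivatives of [1 / tau] are [- 2 s / tau^2] and [- 2 t / tau^2], so the bounds propagate by
    induction on the order, with Leibniz' rule for the square of [itau]. *)
Lemma SB_itau : SB (-2) (fun _ => itau).
Proof.
  split; [auto with sm|]. intros i j. remember (i + j)%nat as N eqn:EN. revert i j EN.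
  induction N as [N IH] using lt_wf_ind. intros i j EN.
  assert (Hq : forall i j, (i + j < N)%nat -> BO (-4 - Z.of_nat i - Z.of_nat j) (fun _ => pd i j (fun s t => itau s t * itau s t))).
  { intros i' j' Hij. replace (-4)%Z with (-2 + -2)%Z by lia.
    apply (pd_mult_class BO BO BO_plus BO_mult (-2) (-2) (fun _ => itau) (fun _ => itau)); auto with sm;
    intros; apply (IH (i'0 + j'0)%nat); auto; lia. }
  destruct i as [|i]; [destruct j as [|j]|].
  - apply BO_c. exists 1, 1. split; [lra|split; [lra|]]. intros s t H.
    replace (-2 - Z.of_nat 0 - Z.of_nat 0)%Z with (- Z.of_nat 2)%Z by lia. rewrite powerRZ_opp_nat, Rmult_1_l.
    change (pd 0 0 itau s t) with (/ tau s t). assert (P := tau_pos s t). rewrite Rabs_pos_eq.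
    + apply Rinv_le_contravar; [apply pow_lt; lra | apply tau_Nm].
    + apply Rlt_le, Rinv_0_lt_compat; auto.
  - rewrite pd_T, dT_itau.
    replace (-2 - Z.of_nat 0 - Z.of_nat (S j))%Z with (1 + -4 - Z.of_nat 0 - Z.of_nat j)%Z by lia.
    apply (pd_mult_class BO BO BO_plus BO_mult 1 (-4) (fun _ _ t => -2 * t) (fun _ s t => itau s t * itau s t)); auto with sm.
    + intros. apply (SB_scal 1 (-2) (fun _ _ t => t) SB_t).
    + intros; apply Hq. lia.
  - rewrite pd_S, dS_itau by auto with sm.
    replace (-2 - Z.of_nat (S i) - Z.of_nat j)%Z with (1 + -4 - Z.of_nat i - Z.of_nat j)%Z by lia.
    apply (pd_mult_class BO BO BO_plus BO_mult 1 (-4) (fun _ s _ => -2 * s) (fun _ s t => itau s t * itau s t)); auto with sm.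
    + intros. apply (SB_scal 1 (-2) (fun _ s _ => s) SB_s).
    + intros; apply Hq. lia.
Qed.

(* [V1] is [V - 1], where [V = tau (s + 1) tau (s - 1) / tau ^ 2]. *)
Definition V1 : R -> R -> R := fun s t => (2 * (t * t) - 2 * (s * s) + 3 / 2) * (itau s t * itau s t).
Definition VV : R -> R -> R := fun s t => 1 + V1 s t.
Lemma smooth_V1 : smooth V1.
Proof. unfold V1; auto 12 with sm. Qed.
Lemma smooth_VV : smooth VV.
Proof. unfold VV; auto using smooth_V1 with sm. Qed.
#[global] Hint Resolve smooth_V1 smooth_VV : sm.
Lemma VV_tau s t : VV s t = tau (s + 1) t * tau (s + -1) t / tau s t ^ 2.
Proof.
  unfold VV, V1, itau. assert (H := tau_ne s t).
  replace (tau (s + 1) t) with (tau s t + 1 + 2 * s) by (unfold tau; ring).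
  replace (tau (s + -1) t) with (tau s t + 1 - 2 * s) by (unfold tau; ring).
  replace (t * t) with (tau s t - / 4 - s * s) by (unfold tau; ring).
  field. auto.
Qed.
Lemma SB_tt : SB 2 (fun _ _ t => t * t).
Proof. apply (SB_mult 1 1 (fun _ _ t => t) (fun _ _ t => t)); apply SB_t. Qed.
Lemma SB_ss : SB 2 (fun _ s _ => s * s).
Proof. apply (SB_mult 1 1 (fun _ s _ => s) (fun _ s _ => s)); apply SB_s. Qed.
(** The potential differs from 1 by a symbol two orders lower; this is why it can be treated as a
    perturbation of the constant-coefficient equation. *)
Lemma SB_V1 : SB (-2) (fun _ => V1).
Proof.
  apply (SB_mult 2 (-4) (fun _ s t => 2 * (t * t) - 2 * (s * s) + 3 / 2) (fun _ s t => itau s t * itau s t)).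
  - apply (SB_plus 2 (fun _ s t => 2 * (t * t) - 2 * (s * s)) (fun _ _ _ => 3 / 2)).
    + apply (SB_minus 2 (fun _ s t => 2 * (t * t)) (fun _ s t => 2 * (s * s))); apply (SB_scal 2); [apply SB_tt | apply SB_ss].
    + apply (SB_le 0); [lia | apply SB_const].
  - apply (SB_mult (-2) (-2) (fun _ => itau) (fun _ => itau)); apply SB_itau.
Qed.
Lemma SB_VV : SB 0 (fun _ => VV).
Proof.
  apply (SB_plus 0 (fun _ _ _ => 1) (fun _ => V1)); [apply SB_const|].
  apply (SB_le (-2)); [lia | apply SB_V1].
Qed.

(** [g a ^ 2] exceeds no [g y ^ 2] by more than the variation of [g ^ 2], which is at most the
    integral of [g^2 / rho + rho g'^2]; averaging over [y] gives the claim. *)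
Lemma sobolev_line (g g' : R -> R) a rho : 0 < rho -> (forall x, is_derive g x (g' x)) -> (forall x, continuous g' x) ->
  g a ^ 2 <= 2 / rho * RInt (fun x => g x ^ 2) (a - rho) (a + rho) + rho * RInt (fun x => g' x ^ 2) (a - rho) (a + rho).
Proof.
  intros Hr Hd Hc.
  assert (Cg : forall x, continuous g x).
  { intros x. apply (ex_derive_continuous (K := R_AbsRing) (V := R_NormedModule)). eexists; apply Hd. }
  assert (Cg2 : forall x, continuous (fun x => g x ^ 2) x) by auto with c0.
  assert (Cg'2 : forall x, continuous (fun x => g' x ^ 2) x) by auto with c0.
  set (h := fun x => / rho * g x ^ 2 + rho * g' x ^ 2).
  assert (Ch : forall x, continuous h x) by (unfold h; auto with c0).
  set (q := fun x => 2 * (g x * g' x)).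
  assert (Cq : forall x, continuous q x) by (unfold q; auto with c0).
  assert (Dq : forall x, is_derive (fun x => g x ^ 2) x (q x)).
  { intros x. evar_last; [apply (is_derive_pow g 2), Hd|]. unfold q; simpl. ring. }
  assert (Hq : forall x, Rabs (q x) <= h x).
  { intros x. unfold q, h. assert (E : rho * (/ rho) = 1) by (field; lra).
    assert (Hi : 0 < / rho) by (apply Rinv_0_lt_compat; auto).
    assert (A := Rmult_le_pos _ _ (Rlt_le _ _ Hi) (pow2_ge_0 (g x - rho * g' x))).
    assert (B := Rmult_le_pos _ _ (Rlt_le _ _ Hi) (pow2_ge_0 (g x + rho * g' x))).
    replace (/ rho * (g x - rho * g' x) ^ 2) with (/ rho * g x ^ 2 + rho * g' x ^ 2 - 2 * (g x * g' x)) in A by (field; lra).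
    replace (/ rho * (g x + rho * g' x) ^ 2) with (/ rho * g x ^ 2 + rho * g' x ^ 2 + 2 * (g x * g' x)) in B by (field; lra).
    apply Rabs_le; lra. }
  assert (Hh : forall x, 0 <= h x) by (intros x; eapply Rle_trans; [apply Rabs_pos | apply Hq]).
  set (K := RInt h (a - rho) (a + rho)).
  assert (HK : forall y, a - rho <= y <= a + rho -> g a ^ 2 - K <= g y ^ 2).
  { intros y Hy. destruct (Rle_lt_dec y a) as [H|H].
    - assert (E := RInt_D (fun x => g x ^ 2) q y a Dq Cq). cbv beta in E.
      assert (RInt q y a <= RInt h y a).
      { apply RInt_le; auto; try (apply ex_RInt_C; auto). intros x _. assert (P := Hq x). apply Rabs_le_between in P; lra. }
      assert (RInt h y a <= K) by (apply RInt_mono_dom; auto; lra). lra.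
    - assert (E := RInt_D (fun x => g x ^ 2) q a y Dq Cq). cbv beta in E.
      assert (RInt (fun x => - q x) a y <= RInt h a y).
      { apply RInt_le; try lra; try (apply ex_RInt_C; auto).
        - intros x. apply (continuous_opp (V := R_NormedModule)); auto.
        - intros x _. assert (P := Hq x). apply Rabs_le_between in P; lra. }
      rewrite RInt_oppR in H0 by auto.
      assert (RInt h a y <= K) by (apply RInt_mono_dom; auto; lra). lra. }
  assert (HI : RInt (fun _ => g a ^ 2 - K) (a - rho) (a + rho) <= RInt (fun x => g x ^ 2) (a - rho) (a + rho)).
  { apply RInt_le; try lra; try (apply ex_RInt_C; auto).
    - intros; apply continuous_const.
    - intros; apply HK; lra. }
  rewrite RInt_constR in HI.
  assert (EK : K = / rho * RInt (fun x => g x ^ 2) (a - rho) (a + rho) + rho * RInt (fun x => g' x ^ 2) (a - rho) (a + rho)).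
  { unfold K, h. rewrite RInt_plusR by auto with c0. rewrite !RInt_scalR by auto with c0. eqR; ring. }
  assert (P : 0 <= RInt (fun x => g x ^ 2) (a - rho) (a + rho)).
  { apply RInt_nonneg; auto; try lra. intros; apply pow2_ge_0. }
  set (X := RInt (fun x => g x ^ 2) (a - rho) (a + rho)) in *.
  set (Y := RInt (fun x => g' x ^ 2) (a - rho) (a + rho)) in *.
  apply Rmult_le_reg_l with (2 * rho); [lra|].
  replace (2 * rho * (2 / rho * X + rho * Y)) with (4 * X + 2 * rho * (rho * Y)) by (field; lra).
  replace ((a + rho - (a - rho)) * (g a ^ 2 - K)) with (2 * rho * g a ^ 2 - 2 * (rho * K)) in HI by ring.
  replace (rho * K) with (X + rho * (rho * Y)) in HI by (rewrite EK; field; lra).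
  lra.
Qed.

(** The one-dimensional inequality is applied in [t] and then in [s]; the second derivative that
    results is the mixed one. *)
Lemma sobolev_box f s t rho : 0 < rho -> smooth f ->
  f s t ^ 2 <= 4 / rho ^ 2 * Box (fun x y => f x y ^ 2) s t rho + 2 * Box (fun x y => dS f x y ^ 2) s t rho
    + 2 * Box (fun x y => dT f x y ^ 2) s t rho + rho ^ 2 * Box (fun x y => dS (dT f) x y ^ 2) s t rho.
Proof.
  intros Hr Sf.
  assert (Q : forall g, smooth g -> RInt (fun y => g s y ^ 2) (t - rho) (t + rho) <=
    2 / rho * Box (fun x y => g x y ^ 2) s t rho + rho * Box (fun x y => dS g x y ^ 2) s t rho).
  { intros g Sg. assert (Cg : C0 (fun x y => g x y ^ 2)) by auto with c0.
    assert (Cg' : C0 (fun x y => dS g x y ^ 2)) by auto with c0.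
    assert (P1 := RInt_param_cont _ (s - rho) (s + rho) Cg). assert (P2 := RInt_param_cont _ (s - rho) (s + rho) Cg').
    assert (Ci : forall x, continuous (fun y => g s y ^ 2) x) by (intros; apply (C0_contT (fun x y => g x y ^ 2)); auto).
    unfold Box, I2. rewrite <- !RInt_scalR by auto. rewrite <- RInt_plusR by auto with c0.
    apply RInt_le; [lra | apply ex_RInt_C; auto | apply ex_RInt_C; auto with c0 |].
    intros y _. apply (sobolev_line (fun x => g x y) (fun x => dS g x y)); auto.
    - intros; apply is_derive_dS; auto with sm.
    - intros; apply C0_contS; auto with c0. }
  assert (L := sobolev_line (fun y => f s y) (fun y => dT f s y) t rho Hr
    (fun y => is_derive_dT f s y (smooth_diffT _ Sf)) (fun y => C0_contT _ s y (smooth_C0 _ (smooth_dT _ Sf)))).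
  cbv beta in L. assert (A := Q f Sf). assert (B := Q (dT f) (smooth_dT _ Sf)).
  assert (Hi : 0 < 2 / rho) by (apply Rdiv_lt_0_compat; lra).
  apply Rmult_le_compat_l with (r := 2 / rho) in A; [|lra].
  apply Rmult_le_compat_l with (r := rho) in B; [|lra].
  replace (4 / rho ^ 2 * Box (fun x y => f x y ^ 2) s t rho) with (2 / rho * (2 / rho * Box (fun x y => f x y ^ 2) s t rho)) by (field; lra).
  replace (2 * Box (fun x y => dS f x y ^ 2) s t rho) with (2 / rho * (rho * Box (fun x y => dS f x y ^ 2) s t rho)) by (field; lra).
  replace (2 * Box (fun x y => dT f x y ^ 2) s t rho) with (rho * (2 / rho * Box (fun x y => dT f x y ^ 2) s t rho)) by (field; lra).
  lra.
Qed.

(* [Ac] and [Bc] are the two classes to which Leibniz' rule [pd_mult_class] is applied: pointwise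
   bounded coefficients, and factors controlled only in mean square. *)
Definition Lq (n : Z) (F : R -> R -> R -> R) : Prop :=
  forall m, 0 < m < / 2 -> exists C r0, 0 < C /\ 1 <= r0 /\
    forall r s t, r0 <= r -> Nm s t = r -> Box (fun x y => F r x y ^ 2) s t (m * r) <= C * powerRZ r n.
Definition Ac (m : Z) (F : R -> R -> R -> R) : Prop := (exists f, C0 f /\ F = fun _ => f) /\ BO m F.
Definition Bc (m : Z) (F : R -> R -> R -> R) : Prop := (forall r, C0 (F r)) /\ Lq (2 * m + 2) F.

Lemma Lq_le n n' F : (n <= n')%Z -> Lq n F -> Lq n' F.
Proof.
  intros Hn H m Hm. destruct (H m Hm) as (C & r0 & HC & Hr0 & HB). exists C, r0; repeat split; auto.
  intros r s t Hr Hs. eapply Rle_trans; [apply HB; auto|]. apply Rmult_le_compat_l; [lra|].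
  replace n' with (n + (n' - n))%Z by lia. rewrite powerRZ_plus by lra.
  rewrite <- (Rmult_1_r (powerRZ r n)) at 1. apply Rmult_le_compat_l; [apply Rlt_le, powerRZ_pos; lra|].
  replace (n' - n)%Z with (Z.of_nat (Z.to_nat (n' - n))) by lia. rewrite <- pow_powerRZ. apply pow_R1_Rle; lra.
Qed.

(** The restriction [m < 1/2] in [Lq] serves this purpose: the box stays at a distance comparable to
    [r] from the origin, where powers of the norm are interchangeable. *)
Lemma Box_near s t m r x y : 0 < m < / 2 -> Nm s t = r -> Rabs (x - s) <= m * r -> Rabs (y - t) <= m * r ->
  r / 2 <= Nm x y <= 2 * r.
Proof.
  unfold Nm. intros Hm Hr Hx Hy.
  assert (A1 := Rabs_triang (x - s) s). assert (A2 := Rabs_triang (y - t) t).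
  assert (A3 := Rabs_triang (s - x) x). assert (A4 := Rabs_triang (t - y) y).
  replace (x - s + s) with x in A1 by ring. replace (y - t + t) with y in A2 by ring.
  replace (s - x + x) with s in A3 by ring. replace (t - y + y) with t in A4 by ring.
  rewrite (Rabs_minus_sym s) in A3. rewrite (Rabs_minus_sym t) in A4.
  assert (0 <= r). { rewrite <- Hr. eapply Rle_trans; [apply (Rabs_pos s) | apply Rmax_l]. }
  assert (m * r <= r / 2) by nra.
  unfold Rmax in *. destruct (Rle_dec (Rabs s) (Rabs t)), (Rle_dec (Rabs x) (Rabs y)); lra.
Qed.

Lemma Bc_plus m F G : Bc m F -> Bc m G -> Bc m (fun r s t => F r s t + G r s t).
Proof.
  intros [CF HF] [CG HG]. split; [auto with c0|]. intros q Hq.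
  destruct (HF q Hq) as (c1 & r1 & P1 & A1 & B1). destruct (HG q Hq) as (c2 & r2 & P2 & A2 & B2).
  exists (2 * c1 + 2 * c2), (Rmax r1 r2); split; [lra|split; [apply Rle_trans with r1; auto; apply Rmax_l|]].
  intros r s t Hr Hn.
  assert (H1 : r1 <= r) by (eapply Rle_trans; [apply Rmax_l | eauto]).
  assert (H2 : r2 <= r) by (eapply Rle_trans; [apply Rmax_r | eauto]).
  specialize (B1 r s t H1 Hn). specialize (B2 r s t H2 Hn).
  apply Rle_trans with (Box (fun x y => 2 * F r x y ^ 2 + 2 * G r x y ^ 2) s t (q * r)).
  - apply Box_le; [nra | auto with c0 | auto with c0 |]. intros x y _ _.
    assert (H := pow2_ge_0 (F r x y - G r x y)). nra.
  - unfold Box in *. rewrite I2_plus, !I2_scal by auto with c0. lra.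
Qed.

Lemma Bc_mult m n F G : Ac m F -> Bc n G -> Bc (m + n) (fun r s t => F r s t * G r s t).
Proof.
  intros [(f & Cf & ->) HF] [CG HG]. split; [auto with c0|]. intros q Hq.
  apply BO_c in HF. destruct HF as (c1 & r1 & P1 & A1 & B1). destruct (HG q Hq) as (c2 & r2 & P2 & A2 & B2).
  destruct (powerRZ_comparable m) as (K & HK & HKc).
  exists ((c1 * K) ^ 2 * c2), (Rmax (2 * r1) r2).
  assert (Hp : 0 < (c1 * K) ^ 2) by (apply pow_lt, Rmult_lt_0_compat; auto).
  split; [apply Rmult_lt_0_compat; auto|split; [apply Rle_trans with r2; auto; apply Rmax_r|]].
  intros r s t Hr Hn.
  assert (H1 : 2 * r1 <= r) by (eapply Rle_trans; [apply Rmax_l | eauto]).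
  assert (H2 : r2 <= r) by (eapply Rle_trans; [apply Rmax_r | eauto]).
  specialize (B2 r s t H2 Hn).
  apply Rle_trans with (Box (fun x y => (c1 * (K * powerRZ r m)) ^ 2 * G r x y ^ 2) s t (q * r)).
  - apply Box_le; [nra | auto with c0 | auto with c0 |]. intros x y Hx Hy.
    rewrite Rpow_mult_distr. apply Rmult_le_compat_r; [apply pow2_ge_0|].
    assert (N := Box_near s t q r x y Hq Hn Hx Hy).
    rewrite <- pow2_abs. apply pow_incr. split; [apply Rabs_pos|].
    eapply Rle_trans; [apply B1; lra|]. apply Rmult_le_compat_l; [lra|]. apply HKc; lra.
  - unfold Box in *. rewrite I2_scal by auto with c0.
    replace (2 * (m + n) + 2)%Z with (m + m + (2 * n + 2))%Z by lia. rewrite (powerRZ_plus r (m + m)), (powerRZ_plus r m m) by lra.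
    replace ((c1 * K) ^ 2 * c2 * (powerRZ r m * powerRZ r m * powerRZ r (2 * n + 2))) with
      ((c1 * (K * powerRZ r m)) ^ 2 * (c2 * powerRZ r (2 * n + 2))) by ring.
    apply Rmult_le_compat_l; [apply pow2_ge_0 | auto].
Qed.

(** The range of [m] is open, so for large [r] the shifted box fits into one with a slightly larger
    ratio. *)
Lemma Lq_sh n f c : C0 f -> Lq n (fun _ => f) -> Lq n (fun _ => sh c f).
Proof.
  intros Cf H m Hm. set (m' := (m + / 2) / 2). assert (Hm' : m < m' < / 2) by (unfold m'; lra).
  destruct (H m' ltac:(lra)) as (C & r0 & HC & Hr0 & HB).
  exists C, (Rmax r0 (Rabs c / (m' - m))). split; auto. split; [apply Rle_trans with r0; auto; apply Rmax_l|].
  intros r s t Hr Hn. assert (H1 : r0 <= r) by (eapply Rle_trans; [apply Rmax_l | eauto]).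
  assert (H2 : Rabs c / (m' - m) <= r) by (eapply Rle_trans; [apply Rmax_r | eauto]).
  assert (Hc : Rabs c <= m' * r - m * r).
  { apply Rmult_le_compat_r with (r := m' - m) in H2; [|lra].
    replace (Rabs c / (m' - m) * (m' - m)) with (Rabs c) in H2 by (field; lra). lra. }
  apply Rabs_le_between in Hc.
  eapply Rle_trans; [|apply (HB r s t H1 Hn)]. unfold Box.
  replace (I2 (fun x y => sh c f x y ^ 2) (s - m * r) (s + m * r) (t - m * r) (t + m * r)) with
    (I2 (sh c (fun x y => f x y ^ 2)) (s - m * r) (s + m * r) (t - m * r) (t + m * r)) by reflexivity.
  rewrite I2_sh by auto with c0.
  apply I2_mono_dom; [nra | nra | nra | nra | nra | nra | auto with c0 | intros; apply pow2_ge_0].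
Qed.

(** The unit-scale gradient bound yields boundedness without any gain in decay: the starting point
    for the iteration of Caccioppoli's inequality. *)
Lemma BO_grad w : smooth w -> BO 0 (fun _ => w) -> BO 0 (fun _ => LL w) ->
  BO 0 (fun _ => dS w) /\ BO 0 (fun _ => dT w).
Proof.
  intros Sw H1 H2.
  assert (Q : forall k, exists C r0, 0 < C /\ 1 <= r0 /\ forall r s t, r0 <= r -> nb k r s t ->
    Rabs (dS w s t) <= C * powerRZ r 0 /\ Rabs (dT w s t) <= C * powerRZ r 0).
  { intros k. destruct (H1 (k + 3)) as (c1 & r1 & P1 & A1 & B1). destruct (H2 (k + 3)) as (c2 & r2 & P2 & A2 & B2).
    exists (32 * c1 + 32 * c2), (Rmax r1 r2). split; [lra|split; [apply Rle_trans with r1; auto; apply Rmax_l|]].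
    intros r s t Hr Hn.
    assert (L1 : r1 <= r) by (eapply Rle_trans; [apply Rmax_l | eauto]).
    assert (L2 : r2 <= r) by (eapply Rle_trans; [apply Rmax_r | eauto]).
    assert (Hnb : forall x y, Rabs (x - s) <= 3 -> Rabs (y - t) <= 3 -> nb (k + 3) r x y).
    { intros x y Hx Hy. unfold nb in *.
      assert (E1 := Rabs_triang (x - s) s). assert (E2 := Rabs_triang (y - t) t).
      assert (E3 := Rabs_triang (s - x) x). assert (E4 := Rabs_triang (t - y) y).
      replace (x - s + s) with x in E1 by ring. replace (y - t + t) with y in E2 by ring.
      replace (s - x + x) with s in E3 by ring. replace (t - y + y) with t in E4 by ring.
      rewrite (Rabs_minus_sym s) in E3. rewrite (Rabs_minus_sym t) in E4.
      unfold Rmax in *. destruct (Rle_dec (Rabs s) (Rabs t)), (Rle_dec (Rabs x) (Rabs y)); lra. }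
    simpl. rewrite Rmult_1_r. apply grad_bound; auto.
    - intros x y Hx Hy. assert (E := B1 r x y L1 (Hnb x y Hx Hy)). simpl in E; lra.
    - intros x y Hx Hy. assert (E := B2 r x y L2 (Hnb x y Hx Hy)). simpl in E; lra. }
  split; intros k; destruct (Q k) as (C & r0 & A & B & D); exists C, r0; repeat split; auto;
    intros r s t Hr Hn; apply (D r s t Hr Hn).
Qed.

Lemma Lq_one : Lq 2 (fun _ _ _ => 1).
Proof.
  intros m Hm. exists 1, 1. split; [lra|split; [lra|]]. intros r s t Hr Hn.
  eapply Rle_trans; [apply (Box_le_const _ s t (m * r) 1); [nra | auto with c0 |]|].
  - intros; lra.
  - simpl. assert (H : m * r <= r / 2) by nra. assert (H0 : 0 <= m * r) by nra. nra.
Qed.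
(** The square of a function of order [m] has order [2 m], and the area of the box accounts for the
    remaining 2 in the exponent of [Bc]. *)
Lemma BO_Bc m f : C0 f -> BO m (fun _ => f) -> Bc m (fun _ => f).
Proof.
  intros Cf H.
  assert (B : Bc (m + 0) (fun _ s t => f s t * 1)).
  { apply (Bc_mult m 0 (fun _ => f) (fun _ _ _ => 1)).
    - split; auto. exists f; auto.
    - split; [auto with c0 | apply Lq_one]. }
  replace (m + 0)%Z with m in B by lia.
  replace (fun _ => f) with (fun _ : R => fun s t : R => f s t * 1); auto.
  apply functional_extensionality; intro; apply fun2_ext; intros; ring.
Qed.

(* Each application gains the factor [1/r] of Caccioppoli's inequality on slightly larger boxes. *)
Lemma Lq_caccioppoli n w p : smooth w -> smooth p ->
  (forall s t, LL w s t = (sh 1 w s t - w s t + p s t) - sh (-1) (fun s t => sh 1 w s t - w s t + p s t) s t) ->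
  Lq n (fun _ => dS w) -> Lq (n + 1) (fun _ => w) -> Lq (n - 1) (fun _ => p) ->
  Lq (n - 1) (fun _ => dS w) /\ Lq (n - 1) (fun _ => dT w).
Proof.
  intros Sw Sp Ew H1 H2 H3.
  assert (CW : C0 (fun x y => dS w x y ^ 2)) by auto with c0.
  assert (CT : C0 (fun x y => dT w x y ^ 2)) by auto with c0.
  assert (CG : C0 (fun x y => dS w x y ^ 2 + dT w x y ^ 2)) by (apply C0_plus; auto).
  assert (Q : forall m, 0 < m < / 2 -> exists C r0, 0 < C /\ 1 <= r0 /\
    forall r s t, r0 <= r -> Nm s t = r -> Box (fun x y => dS w x y ^ 2 + dT w x y ^ 2) s t (m * r) <= C * powerRZ r (n - 1)).
  (* Three nested boxes: the cutoff lives on the one of ratio [m1], the estimate holds on the one of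
     ratio [m], and the widening by 3 in [caccioppoli] is absorbed into the one of ratio [m2] for
     large [r]. *)
  { intros m Hm. set (m2 := (m + / 2) / 2). set (m1 := (m + m2) / 2).
    assert (Hm1 : m < m1 < m2) by (unfold m1, m2; lra). assert (Hm2 : m2 < / 2) by (unfold m2; lra).
    destruct (H1 m2 ltac:(lra)) as (c1 & r1 & P1 & A1 & B1).
    destruct (H2 m2 ltac:(lra)) as (c2 & r2 & P2 & A2 & B2).
    destruct (H3 m2 ltac:(lra)) as (c3 & r3 & P3 & A3 & B3).
    set (lam := m / m1).
    assert (Hl : 0 < lam < 1).
    { unfold lam; split; [apply Rdiv_lt_0_compat; lra|]. apply Rmult_lt_reg_r with m1; [lra|].
      unfold Rdiv. rewrite Rmult_assoc, Rinv_l; lra. }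
    assert (Hg : 0 < (1 - lam ^ 2) ^ 4) by (apply pow_lt; nra).
    set (g := (1 - lam ^ 2) ^ 4) in *.
    exists ((16 / m1 * c1 + 640 / m1 ^ 2 * c2 + 5 * c3) / g),
      (Rmax (Rmax r1 (Rmax r2 r3)) (3 / (m2 - m1) + 1 / m1)).
    assert (Pm : 0 < 16 / m1) by (apply Rdiv_lt_0_compat; lra).
    assert (Pm' : 0 < 640 / m1 ^ 2) by (apply Rdiv_lt_0_compat; [lra | apply pow_lt; lra]).
    split; [apply Rdiv_lt_0_compat; auto; nra|].
    split; [apply Rle_trans with r1; auto; eapply Rle_trans; [apply Rmax_l | apply Rmax_l]|].
    intros r s t Hr Hn.
    assert (L0 : Rmax r1 (Rmax r2 r3) <= r) by (eapply Rle_trans; [apply Rmax_l | eauto]).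
    assert (L1 : r1 <= r) by (eapply Rle_trans; [apply Rmax_l | eauto]).
    assert (L23 : Rmax r2 r3 <= r) by (eapply Rle_trans; [apply Rmax_r | eauto]).
    assert (L2 : r2 <= r) by (eapply Rle_trans; [apply Rmax_l | eauto]).
    assert (L3 : r3 <= r) by (eapply Rle_trans; [apply Rmax_r | eauto]).
    assert (L4 : 3 / (m2 - m1) + 1 / m1 <= r) by (eapply Rle_trans; [apply Rmax_r | eauto]).
    assert (Q1 : 0 < 3 / (m2 - m1)) by (apply Rdiv_lt_0_compat; lra).
    assert (Q2 : 0 < 1 / m1) by (apply Rdiv_lt_0_compat; lra).
    assert (L5 : 1 <= m1 * r).
    { replace 1 with (m1 * (1 / m1)) by (field; lra). apply Rmult_le_compat_l; lra. }
    assert (L6 : m1 * r + 3 <= m2 * r).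
    { assert (3 <= (m2 - m1) * r); [|lra]. replace 3 with ((m2 - m1) * (3 / (m2 - m1))) by (field; lra).
      apply Rmult_le_compat_l; lra. }
    assert (K := caccioppoli w p Sw Sp Ew s t (m1 * r) L5 lam ltac:(lra)).
    replace (lam * (m1 * r)) with (m * r) in K by (unfold lam; field; lra). fold g in K.
    assert (L7 : 0 <= m1 * r + 3) by lra.
    assert (M1 := Box_mono (fun x y => dS w x y ^ 2) s t _ _ L7 L6 CW (fun x y => pow2_ge_0 _)).
    assert (M2 := Box_mono (fun x y => w x y ^ 2) s t _ _ L7 L6 ltac:(auto with c0) (fun x y => pow2_ge_0 _)).
    assert (M3 := Box_mono (fun x y => p x y ^ 2) s t _ _ L7 L6 ltac:(auto with c0) (fun x y => pow2_ge_0 _)).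
    specialize (B1 r s t L1 Hn). specialize (B2 r s t L2 Hn). specialize (B3 r s t L3 Hn).
    assert (E1 : powerRZ r n = r * powerRZ r (n - 1)).
    { replace n with (1 + (n - 1))%Z at 1 by lia. rewrite powerRZ_plus by lra. simpl; ring. }
    assert (E2 : powerRZ r (n + 1) = r ^ 2 * powerRZ r (n - 1)).
    { replace (n + 1)%Z with (1 + (1 + (n - 1)))%Z at 1 by lia. rewrite !powerRZ_plus by lra. simpl; ring. }
    rewrite E1 in B1. rewrite E2 in B2. set (pw := powerRZ r (n - 1)) in *.
    assert (F1 : 16 / (m1 * r) * Box (fun x y => dS w x y ^ 2) s t (m1 * r + 3) <= 16 / m1 * c1 * pw).
    { replace (16 / m1 * c1 * pw) with (16 / (m1 * r) * (c1 * (r * pw))) by (field; lra).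
      apply Rmult_le_compat_l; [apply Rlt_le, Rdiv_lt_0_compat; lra | lra]. }
    assert (F2 : 640 / (m1 * r) ^ 2 * Box (fun x y => w x y ^ 2) s t (m1 * r + 3) <= 640 / m1 ^ 2 * c2 * pw).
    { replace (640 / m1 ^ 2 * c2 * pw) with (640 / (m1 * r) ^ 2 * (c2 * (r ^ 2 * pw))) by (field; lra).
      apply Rmult_le_compat_l; [apply Rlt_le, Rdiv_lt_0_compat; [lra | apply pow_lt; lra] | lra]. }
    apply Rmult_le_reg_l with g; auto.
    replace (g * ((16 / m1 * c1 + 640 / m1 ^ 2 * c2 + 5 * c3) / g * pw)) with
      (16 / m1 * c1 * pw + 640 / m1 ^ 2 * c2 * pw + 5 * (c3 * pw)) by (field; lra).
    lra. }
  split; intros m Hm; destruct (Q m Hm) as (C & r0 & A & B & D); exists C, r0; repeat split; auto;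
    intros r s t Hr Hn; (eapply Rle_trans; [|apply (D r s t Hr Hn)]); (apply Box_le; [nra | auto | auto |]);
    intros x y _ _; assert (P1 := pow2_ge_0 (dS w x y)); assert (P2 := pow2_ge_0 (dT w x y)); lra.
Qed.

Lemma Lq_sobolev k f : smooth f -> Lq (2 * k + 2) (fun _ => f) -> Lq (2 * k) (fun _ => dS f) ->
  Lq (2 * k) (fun _ => dT f) -> Lq (2 * k - 2) (fun _ => dS (dT f)) -> BO k (fun _ => f).
Proof.
  intros Sf H1 H2 H3 H4.
  destruct (H1 (/ 4) ltac:(lra)) as (c1 & r1 & P1 & A1 & B1). destruct (H2 (/ 4) ltac:(lra)) as (c2 & r2 & P2 & A2 & B2).
  destruct (H3 (/ 4) ltac:(lra)) as (c3 & r3 & P3 & A3 & B3). destruct (H4 (/ 4) ltac:(lra)) as (c4 & r4 & P4 & A4 & B4).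
  apply BO_c. exists (1 + (64 * c1 + 2 * c2 + 2 * c3 + c4)), (Rmax (Rmax r1 r2) (Rmax r3 r4)).
  split; [lra|]. split; [apply Rle_trans with r1; auto; eapply Rle_trans; [apply Rmax_l | apply Rmax_l]|].
  intros s t Hr. remember (Nm s t) as r eqn:Er.
  assert (L12 : Rmax r1 r2 <= r) by (eapply Rle_trans; [apply Rmax_l | eauto]).
  assert (L34 : Rmax r3 r4 <= r) by (eapply Rle_trans; [apply Rmax_r | eauto]).
  assert (L1 : r1 <= r) by (eapply Rle_trans; [apply Rmax_l | eauto]).
  assert (L2 : r2 <= r) by (eapply Rle_trans; [apply Rmax_r | eauto]).
  assert (L3 : r3 <= r) by (eapply Rle_trans; [apply Rmax_l | eauto]).
  assert (L4 : r4 <= r) by (eapply Rle_trans; [apply Rmax_r | eauto]).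
  specialize (B1 r s t L1 (eq_sym Er)). specialize (B2 r s t L2 (eq_sym Er)).
  specialize (B3 r s t L3 (eq_sym Er)). specialize (B4 r s t L4 (eq_sym Er)).
  assert (K := sobolev_box f s t (/ 4 * r) ltac:(lra) Sf).
  assert (E0 : powerRZ r (2 * k) = powerRZ r k ^ 2).
  { replace (2 * k)%Z with (k + k)%Z by lia. rewrite powerRZ_plus by lra. ring. }
  assert (E1 : powerRZ r (2 * k + 2) = r ^ 2 * powerRZ r k ^ 2).
  { rewrite powerRZ_plus, E0 by lra. simpl; ring. }
  assert (E4 : r ^ 2 * powerRZ r (2 * k - 2) = powerRZ r k ^ 2).
  { rewrite <- E0. replace (2 * k)%Z with (2 + (2 * k - 2))%Z at 2 by lia. rewrite (powerRZ_plus r 2) by lra. simpl; ring. }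
  rewrite E1 in B1. rewrite E0 in B2, B3.
  assert (Pk : 0 < powerRZ r k) by (apply powerRZ_pos; lra).
  set (q := powerRZ r k) in *.
  assert (F1 : 4 / (/ 4 * r) ^ 2 * Box (fun x y => f x y ^ 2) s t (/ 4 * r) <= 64 * c1 * q ^ 2).
  { replace (64 * c1 * q ^ 2) with (4 / (/ 4 * r) ^ 2 * (c1 * (r ^ 2 * q ^ 2))) by (field; lra).
    apply Rmult_le_compat_l; [apply Rlt_le, Rdiv_lt_0_compat; [lra | apply pow_lt; lra] | lra]. }
  assert (F4 : (/ 4 * r) ^ 2 * Box (fun x y => dS (dT f) x y ^ 2) s t (/ 4 * r) <= c4 * q ^ 2).
  { apply Rle_trans with ((/ 4 * r) ^ 2 * (c4 * powerRZ r (2 * k - 2))).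
    - apply Rmult_le_compat_l; [apply pow2_ge_0 | auto].
    - replace ((/ 4 * r) ^ 2 * (c4 * powerRZ r (2 * k - 2))) with (/ 16 * (c4 * (r ^ 2 * powerRZ r (2 * k - 2)))) by field.
      rewrite E4. assert (0 <= c4 * q ^ 2) by (apply Rmult_le_pos; [lra | apply pow2_ge_0]). lra. }
  assert (F : f s t ^ 2 <= (64 * c1 + 2 * c2 + 2 * c3 + c4) * q ^ 2) by lra.
  set (X := 64 * c1 + 2 * c2 + 2 * c3 + c4) in *. assert (HX : 0 < X) by (unfold X; lra).
  rewrite <- (Rabs_pos_eq ((1 + X) * q)) by nra.
  apply Rsqr_le_abs_0. unfold Rsqr.
  assert (0 < q * q) by nra. nra.
Qed.

Lemma smooth_LL f : smooth f -> smooth (LL f).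
Proof. intros; unfold LL; auto 10 with sm. Qed.
#[global] Hint Resolve smooth_LL : sm.
Lemma pd_LL i j f : smooth f -> pd i j (LL f) = LL (pd i j f).
Proof.
  intros Sf. unfold LL. rewrite (pd_plus i j (fun s t => 2 * dS (dS f) s t)), (pd_scal i j 2); auto with sm.
  apply fun2_ext; intros s t. f_equal.
  - rewrite <- (pd_S i j (dS f)), <- (pd_S (S i) j f) by auto with sm. reflexivity.
  - rewrite <- (pd_T i j (dT f)), <- (pd_T i (S j) f), !pd_Tl by auto. reflexivity.
Qed.
Lemma pd_pd i j k l f : smooth f -> pd i j (pd k l f) = pd (i + k) (j + l) f.
Proof.
  intros Sf. induction i.
  - induction j; [reflexivity|]. rewrite pd_Tl, IHj, <- pd_Tl by auto with sm. reflexivity.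
  - rewrite !pd_Sl, IHi. reflexivity.
Qed.

Lemma sh1_MVT f s t : diffS f -> exists x, s <= x <= s + 1 /\ sh 1 f s t - f s t = dS f x t.
Proof.
  intros H. destruct (MVT_R (fun z => f z t) (fun z => dS f z t) s (s + 1)) as [x [H1 H2]].
  - lra.
  - intros; apply is_derive_dS; auto.
  - exists x. split; auto. unfold sh. cbv beta in H2. lra.
Qed.
Lemma LO_sh1_diff m F : (forall r, diffS (F r)) -> LO m (fun r => dS (F r)) ->
  LO m (fun r s t => sh 1 (F r) s t - F r s t).
Proof.
  intros HF H k e He. destruct (H (k + 1) e He) as (r0 & A & B). exists r0; split; auto.
  intros r s t Hr Hn. destruct (sh1_MVT (F r) s t (HF r)) as [x [H1 H2]].
  rewrite H2. apply B; auto. apply nb_near with s; auto. lra.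
Qed.

(** * Landau's inequality, from O to o *)

Section Landau.
Variables (f : R -> R -> R) (m : Z).
Hypothesis Sf : smooth f.
Hypothesis Hm : (m <= 0)%Z.
Hypothesis Hf : LO m (fun _ => f).

(* Taylor's formula along a segment of length [d r] pointing away from the origin, where
   [powerRZ r m] can only decrease. *)
Lemma landau_aux (g g' : R -> R -> R) (move : R -> R -> R -> R * R) :
  (forall h s t, 0 <= h -> Nm s t <= Nm (fst (move h s t)) (snd (move h s t))) ->
  BO (m - 2) (fun _ => g') ->
  (forall h s t C, 0 < h -> (forall x, 0 <= x <= h -> Rabs (g' (fst (move x s t)) (snd (move x s t))) <= C) ->
     h * Rabs (g s t) <= Rabs (f (fst (move h s t)) (snd (move h s t))) + Rabs (f s t) + h ^ 2 * C) ->
  LO (m - 1) (fun _ => g).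
Proof.
  intros Hout Hg' HT. apply LO_c. intros e He.
  apply BO_c in Hg'. destruct Hg' as (C & r1 & HC & Hr1 & HB).
  (* The step [d r] balances the two errors after division by its length: the second derivative
     contributes [C d = e / 2], the two values of [f] contribute [e / 4] each. *)
  set (d := e / (2 * C)). assert (Hd : 0 < d) by (unfold d; apply Rdiv_lt_0_compat; lra).
  destruct (proj1 (LO_c m f) Hf (e * d / 4)) as (r0 & Hr0 & HL); [nra|].
  exists (Rmax r0 r1). split; [apply Rle_trans with r0; auto; apply Rmax_l|]. intros s t Hs.
  assert (L0 : r0 <= Nm s t) by (eapply Rle_trans; [apply Rmax_l | eauto]).
  assert (L1 : r1 <= Nm s t) by (eapply Rle_trans; [apply Rmax_r | eauto]).
  set (r := Nm s t) in *.
  assert (Hm2 : forall x y n, (n <= 0)%Z -> r <= Nm x y -> powerRZ (Nm x y) n <= powerRZ r n).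
  { intros x y n Hn Hxy. replace n with (- Z.of_nat (Z.to_nat (- n)))%Z by lia. rewrite !powerRZ_opp_nat.
    apply Rinv_le_contravar; [apply pow_lt; lra | apply pow_incr; lra]. }
  assert (K := HT (d * r) s t (C * powerRZ r (m - 2)) ltac:(nra)).
  assert (K1 : d * r * Rabs (g s t) <= Rabs (f (fst (move (d * r) s t)) (snd (move (d * r) s t))) + Rabs (f s t) + (d * r) ^ 2 * (C * powerRZ r (m - 2))).
  { apply K. intros x Hx. assert (O := Hout x s t ltac:(lra)). fold r in O.
    eapply Rle_trans; [apply HB; lra|]. apply Rmult_le_compat_l; [lra|]. apply Hm2; [lia | auto]. }
  assert (O := Hout (d * r) s t ltac:(nra)). fold r in O.
  assert (K2 : Rabs (f (fst (move (d * r) s t)) (snd (move (d * r) s t))) <= e * d / 4 * powerRZ r m).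
  { eapply Rle_trans; [apply HL; lra|]. apply Rmult_le_compat_l; [nra|]. apply Hm2; auto. }
  assert (K3 := HL s t L0). fold r in K3.
  assert (E1 : powerRZ r m = r * powerRZ r (m - 1)).
  { replace m with (1 + (m - 1))%Z at 1 by lia. rewrite powerRZ_plus by lra. simpl; ring. }
  assert (E2 : r ^ 2 * powerRZ r (m - 2) = r * powerRZ r (m - 1)).
  { replace (m - 1)%Z with (1 + (m - 2))%Z by lia. rewrite powerRZ_plus by lra. simpl; ring. }
  apply Rmult_le_reg_l with (d * r); [nra|].
  replace (d * r * (e * powerRZ r (m - 1))) with (e * d * powerRZ r m) by (rewrite E1; ring).
  replace ((d * r) ^ 2 * (C * powerRZ r (m - 2))) with (e * d / 2 * powerRZ r m) in K1.
  2:{ rewrite Rpow_mult_distr. replace (d ^ 2 * r ^ 2 * (C * powerRZ r (m - 2))) with (d ^ 2 * C * (r ^ 2 * powerRZ r (m - 2))) by ring.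
      rewrite E2, E1. unfold d. field. lra. }
  lra.
Qed.

Definition away (x h : R) : R := x + (if Rle_dec 0 x then h else - h).
Lemma away_abs x h : 0 <= h -> Rabs x <= Rabs (away x h).
Proof. intros Hh. unfold away. destruct (Rle_dec 0 x); [rewrite !Rabs_pos_eq | rewrite !Rabs_left]; lra. Qed.
Lemma taylor_away (q q' q'' : R -> R) x h C : 0 < h -> (forall y, is_derive q y (q' y)) -> (forall y, is_derive q' y (q'' y)) ->
  (forall y, 0 <= y <= h -> Rabs (q'' (away x y)) <= C) ->
  h * Rabs (q' x) <= Rabs (q (away x h)) + Rabs (q x) + h ^ 2 * C.
Proof.
  intros Hh D1 D2 HC.
  destruct (MVT_gen_R q q' x (away x h) D1) as [y [Hy E1]].
  destruct (MVT_gen_R q' q'' x y D2) as [z [Hz E2]].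
  assert (Hsg : (0 <= x /\ away x h = x + h) \/ (x < 0 /\ away x h = x - h)).
  { unfold away. destruct (Rle_dec 0 x); [left | right]; split; lra. }
  assert (Hzz : exists v, 0 <= v <= h /\ z = away x v).
  { exists (Rabs (z - x)). unfold Rmin, Rmax in *. unfold away in *.
    destruct (Rle_dec 0 x), (Rle_dec x (x + h)), (Rle_dec x (x + - h)), (Rle_dec x y); try lra;
    unfold Rabs; destruct (Rcase_abs (z - x)); lra. }
  destruct Hzz as (v & Hv & ->). specialize (HC v Hv).
  assert (Hyx : Rabs (y - x) <= h).
  { apply Rabs_le. unfold Rmin, Rmax in Hy. destruct Hsg as [[? E]|[? E]]; rewrite E in Hy;
    destruct (Rle_dec x _); lra. }
  assert (Ea : Rabs (away x h - x) = h).
  { destruct Hsg as [[? E]|[? E]]; rewrite E; [rewrite Rabs_pos_eq | rewrite Rabs_left]; lra. }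
  assert (F : h * Rabs (q' x) = Rabs (q (away x h) + (- q x) + - (q'' (away x v) * (y - x) * (away x h - x)))).
  { rewrite <- Ea at 1. rewrite <- Rabs_mult. f_equal. rewrite <- E2. lra. }
  rewrite F. eapply Rle_trans; [apply Rabs_triang|]. rewrite Rabs_Ropp, !Rabs_mult, Ea.
  assert (T := Rabs_triang (q (away x h)) (- q x)). rewrite Rabs_Ropp in T.
  assert (Rabs (q'' (away x v)) * Rabs (y - x) * h <= C * h * h).
  { apply Rmult_le_compat_r; [lra|]. apply Rmult_le_compat; auto using Rabs_pos. }
  lra.
Qed.

Lemma landau_S : BO (m - 2) (fun _ => dS (dS f)) -> LO (m - 1) (fun _ => dS f).
Proof.
  intros H. apply (landau_aux (dS f) (dS (dS f)) (fun h s t => (away s h, t))); auto; simpl.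
  - intros h s t Hh. unfold Nm. apply Rmax_lub; [|apply Rmax_r]. eapply Rle_trans; [apply away_abs, Hh | apply Rmax_l].
  - intros h s t C Hh HC. apply (taylor_away (fun z => f z t) (fun z => dS f z t) (fun z => dS (dS f) z t)); auto;
    intros; apply is_derive_dS; auto with sm.
Qed.
Lemma landau_T : BO (m - 2) (fun _ => dT (dT f)) -> LO (m - 1) (fun _ => dT f).
Proof.
  intros H. apply (landau_aux (dT f) (dT (dT f)) (fun h s t => (s, away t h))); auto; simpl.
  - intros h s t Hh. unfold Nm. apply Rmax_lub; [apply Rmax_l|]. eapply Rle_trans; [apply away_abs, Hh | apply Rmax_r].
  - intros h s t C Hh HC. apply (taylor_away (fun z => f s z) (fun z => dT f s z) (fun z => dT (dT f) s z)); auto;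
    intros; apply is_derive_dT; auto with sm.
Qed.
End Landau.

(** * Symbol estimates for solutions that tend to zero *)

Section Decay.
Variable u : R -> R -> R.
Hypothesis Su : smooth u.
Definition uD : R -> R -> R := fun s t => sh 1 u s t - u s t.
Definition zf : R -> R -> R := fun s t => VV s t * uD s t.
Hypothesis Eu : forall s t, LL u s t = zf s t - sh (-1) zf s t.
Hypothesis Hu : LO 0 (fun _ => u).

Lemma smooth_uD : smooth uD.
Proof. unfold uD; auto with sm. Qed.
Hint Resolve smooth_uD : sm.
Lemma smooth_zf : smooth zf.
Proof. unfold zf; auto with sm. Qed.
Hint Resolve smooth_zf : sm.

Lemma pd_uD i j : pd i j uD = fun s t => sh 1 (pd i j u) s t - pd i j u s t.
Proof. unfold uD. rewrite pd_minus, pd_sh by auto with sm. reflexivity. Qed.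
Lemma LL_pd i j s t : LL (pd i j u) s t = pd i j zf s t - sh (-1) (pd i j zf) s t.
Proof.
  rewrite <- pd_LL by auto.
  replace (LL u) with (fun s t => zf s t - sh (-1) zf s t) by (apply fun2_ext; intros; rewrite Eu; auto).
  rewrite pd_minus, pd_sh by auto with sm. reflexivity.
Qed.

Lemma BO_minus m F G : BO m F -> BO m G -> BO m (fun r s t => F r s t - G r s t).
Proof.
  intros HF HG. replace (fun r s t => F r s t - G r s t) with (fun r s t => F r s t + -1 * G r s t).
  - apply BO_plus; auto. apply (BO_mult 0 m (fun _ _ _ => -1)); auto. apply BO_const.
  - apply functional_extensionality; intro; apply fun2_ext; intros; ring.
Qed.

(* All derivatives of [V] have order at most [0], so boundedness propagates without tracking orders. *)
Lemma BO_zf k : (forall i, (i <= k)%nat -> BO 0 (fun _ => pd i 0 u)) -> BO 0 (fun _ => pd k 0 zf).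
Proof.
  intros H. replace 0%Z with (0 + Z.of_nat k - Z.of_nat k - Z.of_nat 0)%Z by lia.
  apply (pd_mult_class BO BO BO_plus BO_mult 0 (Z.of_nat k) (fun _ => VV) (fun _ => uD)); auto with sm.
  - intros i j _ _. apply SB_VV.
  - intros i j Hi Hj. replace j with 0%nat by lia. apply (BO_le 0); [lia|]. rewrite pd_uD.
    apply (BO_minus 0 (fun _ => sh 1 (pd i 0 u)) (fun _ => pd i 0 u)); [apply (BO_sh 0 1 (fun _ => pd i 0 u))|]; apply H; auto.
Qed.
(** The right-hand side of the equation contains shifts but no derivatives, so the gradient bound
    for [pd k 0 u] closes an induction on [k]. *)
Lemma BO_derivs k : BO 0 (fun _ => pd k 0 u) /\ BO 0 (fun _ => dT (pd k 0 u)).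
Proof.
  assert (Q : forall k, (forall i, (i <= k)%nat -> BO 0 (fun _ => pd i 0 u)) ->
    BO 0 (fun _ => pd (S k) 0 u) /\ BO 0 (fun _ => dT (pd k 0 u))).
  { clear k. intros k H. apply BO_grad; auto with sm.
    replace (LL (pd k 0 u)) with (fun s t => pd k 0 zf s t - sh (-1) (pd k 0 zf) s t)
      by (apply fun2_ext; intros; rewrite LL_pd; auto).
    assert (B := BO_zf k H). apply (BO_minus 0 (fun _ => pd k 0 zf) (fun _ => sh (-1) (pd k 0 zf))); auto.
    apply (BO_sh 0 (-1) (fun _ => pd k 0 zf)); auto. }
  assert (P : forall i, (i <= k)%nat -> BO 0 (fun _ => pd i 0 u)).
  { induction k as [|k IH].
    - intros i Hi. replace i with 0%nat by lia. apply LO_BO, Hu.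
    - intros i Hi. destruct (Nat.eq_dec i (S k)) as [->|]; [|apply IH; lia]. apply Q, IH. }
  split; [apply P; auto | apply Q, P].
Qed.

Definition pert (k : nat) : R -> R -> R := pd k 0 (fun s t => V1 s t * uD s t).
Lemma smooth_pert k : smooth (pert k).
Proof. unfold pert; auto with sm. Qed.
Hint Resolve smooth_pert : sm.
Lemma LL_pert k : forall s t, LL (pd k 0 u) s t =
  (sh 1 (pd k 0 u) s t - pd k 0 u s t + pert k s t) - sh (-1) (fun s t => sh 1 (pd k 0 u) s t - pd k 0 u s t + pert k s t) s t.
Proof.
  assert (E : pd k 0 zf = fun s t => sh 1 (pd k 0 u) s t - pd k 0 u s t + pert k s t).
  { unfold pert. replace zf with (fun s t => uD s t + V1 s t * uD s t)
      by (apply fun2_ext; intros; unfold zf, VV; ring).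
    rewrite (pd_plus k 0 uD (fun s t => V1 s t * uD s t)), pd_uD; auto with sm. }
  intros s t. rewrite LL_pd, E. reflexivity.
Qed.

Definition Lk (k : nat) : Prop := Bc (- Z.of_nat k) (fun _ => pd k 0 u).

(** The two orders gained from [V1] keep the perturbation ahead of every exponent that occurs in
    [Lk_step]. *)
Lemma Bc_pert k : (forall j, (j <= k)%nat -> Lk j) -> Bc (-2 - Z.of_nat k) (fun _ => pert k).
Proof.
  intros H. replace (-2 - Z.of_nat k)%Z with (-2 + 0 - Z.of_nat k - Z.of_nat 0)%Z by lia.
  apply (pd_mult_class Ac Bc Bc_plus Bc_mult (-2) 0 (fun _ => V1) (fun _ => uD)); auto with sm.
  - intros i j _ _. split; [eexists; split; [|reflexivity]; auto with c0 sm | apply SB_V1].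
  - intros i j Hi Hj. replace j with 0%nat by lia. rewrite pd_uD.
    destruct (H i Hi) as [C L]. replace (0 - Z.of_nat i - Z.of_nat 0)%Z with (- Z.of_nat i)%Z by lia.
    replace (fun _ : R => fun s t : R => sh 1 (pd i 0 u) s t - pd i 0 u s t) with
      (fun _ : R => fun s t : R => sh 1 (pd i 0 u) s t + -1 * pd i 0 u s t)
      by (apply functional_extensionality; intro; apply fun2_ext; intros; ring).
    apply (Bc_plus (- Z.of_nat i) (fun _ => sh 1 (pd i 0 u)) (fun _ s t => -1 * pd i 0 u s t)).
    + split; [auto with c0|]. apply Lq_sh; auto. apply (C 0).
    + apply (Bc_mult 0 (- Z.of_nat i) (fun _ _ _ => -1) (fun _ => pd i 0 u)); [|apply (H i Hi)].
      split; [eexists; split; [|reflexivity]; auto with c0 | apply BO_const].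
Qed.

(** The exponent of the mean square of [dS (pd k 0 u)] starts at 2, which is mere boundedness, and
    Caccioppoli's inequality is used [2 k + 2] times to bring it down to [-2 k]. There the iteration
    ends, because the term with [w] itself then limits it. *)
Lemma Lk_step k : (forall j, (j <= k)%nat -> Lk j) ->
  Lk (S k) /\ Lq (-2 * Z.of_nat k) (fun _ => dT (pd k 0 u)).
Proof.
  intros H. assert (Hp := proj2 (Bc_pert k H)). assert (Hk := proj2 (H k (le_n _))).
  assert (Q : forall q, (Z.of_nat q <= 2 * Z.of_nat k + 1)%Z ->
    Lq (2 - Z.of_nat q) (fun _ => dS (pd k 0 u)) ->
    Lq (2 - Z.of_nat q - 1) (fun _ => dS (pd k 0 u)) /\ Lq (2 - Z.of_nat q - 1) (fun _ => dT (pd k 0 u))).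
  { intros q Hq L. apply (Lq_caccioppoli _ (pd k 0 u) (pert k)); auto with sm.
    - apply LL_pert.
    - eapply Lq_le; [|apply Hk]. lia.
    - eapply Lq_le; [|apply Hp]. lia. }
  assert (P : forall q, (Z.of_nat q <= 2 * Z.of_nat k + 1)%Z -> Lq (2 - Z.of_nat q) (fun _ => dS (pd k 0 u))).
  { induction q as [|q IH]; intros Hq.
    - apply (BO_Bc 0); [auto with c0 | apply (BO_derivs (S k))].
    - replace (2 - Z.of_nat (S q))%Z with (2 - Z.of_nat q - 1)%Z by lia. apply Q; [lia | apply IH; lia]. }
  destruct (Q (2 * k + 1)%nat) as [Q1 Q2]; [lia | apply P; lia |].
  split.
  - split; [intros; auto with c0 sm|]. replace (2 * - Z.of_nat (S k) + 2)%Z with (2 - Z.of_nat (2 * k + 1) - 1)%Z by lia. apply Q1.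
  - replace (-2 * Z.of_nat k)%Z with (2 - Z.of_nat (2 * k + 1) - 1)%Z by lia. apply Q2.
Qed.
Lemma Lk_all k : Lk k.
Proof.
  assert (Q : forall j, (j <= k)%nat -> Lk j); [|auto].
  induction k as [|k IH]; intros j Hj.
  - replace j with 0%nat by lia. apply (BO_Bc 0); [auto with c0 | apply (BO_derivs 0)].
  - destruct (Nat.eq_dec j (S k)) as [->|]; [|apply IH; lia]. apply Lk_step, IH.
Qed.

Lemma BO_pdS k : BO (- Z.of_nat k) (fun _ => pd k 0 u).
Proof.
  apply Lq_sobolev; auto with sm.
  - apply Lk_all.
  - generalize (proj2 (Lk_all (S k))). replace (2 * - Z.of_nat (S k) + 2)%Z with (2 * - Z.of_nat k)%Z by lia. auto.
  - replace (2 * - Z.of_nat k)%Z with (-2 * Z.of_nat k)%Z by lia. apply Lk_step; intros; apply Lk_all.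
  - replace (2 * - Z.of_nat k - 2)%Z with (-2 * Z.of_nat (S k))%Z by lia.
    rewrite smooth_dS_dT, <- pd_Sl by auto with sm. apply Lk_step; intros; apply Lk_all.
Qed.
(** Caccioppoli and Sobolev yield O only; the o known for [u] is handed on from each derivative to
    the next by Landau's inequality. *)
Lemma LO_pdS k : LO (- Z.of_nat k) (fun _ => pd k 0 u).
Proof.
  induction k; [apply Hu|].
  replace (- Z.of_nat (S k))%Z with (- Z.of_nat k - 1)%Z by lia. rewrite pd_Sl.
  apply landau_S; auto with sm; [lia|].
  generalize (BO_pdS (S (S k))). rewrite !pd_Sl. replace (- Z.of_nat (S (S k)))%Z with (- Z.of_nat k - 2)%Z by lia. auto.
Qed.

Lemma LO_minus m F G : LO m F -> LO m G -> LO m (fun r s t => F r s t - G r s t).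
Proof.
  intros HF HG. apply LO_ext with (fun r s t => F r s t + -1 * G r s t); [intros; ring|].
  apply LO_plus; auto. apply (LO_mult 0 m (fun _ _ _ => -1)); auto. apply BO_const.
Qed.

Lemma pdT_eq i j s t : pd i (S (S j)) u s t = -2 * pd (S (S i)) j u s t + (pd i j zf s t - sh (-1) (pd i j zf) s t).
Proof.
  rewrite <- LL_pd. unfold LL. rewrite !pd_Sl, !pd_Tl by auto. ring.
Qed.
(** The equation exchanges two [t]-derivatives for two [s]-derivatives and a term containing two
    unit differences, one outside and one inside the product with [VV]; each difference gains one
    order. *)
Lemma LO_pdTT i j : (forall i' j', (j' <= j)%nat -> LO (- Z.of_nat i' - Z.of_nat j') (fun _ => pd i' j' u)) ->
  LO (- Z.of_nat i - Z.of_nat j - 2) (fun _ => pd i (S (S j)) u).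
Proof.
  intros H.
  apply LO_ext with (fun _ s t => -2 * pd (S (S i)) j u s t + (pd i j zf s t - sh (-1) (pd i j zf) s t)).
  { intros; symmetry; apply pdT_eq. }
  apply LO_plus.
  - replace (- Z.of_nat i - Z.of_nat j - 2)%Z with (0 + (- Z.of_nat (S (S i)) - Z.of_nat j))%Z by lia.
    apply (LO_mult 0 _ (fun _ _ _ => -2)); [apply BO_const | apply H; auto].
  - apply LO_ext with (fun _ => sh (-1) (fun s t => sh 1 (pd i j zf) s t - pd i j zf s t)).
    { intros _ s t. unfold sh. replace (s + -1 + 1) with s by ring. auto. }
    apply (LO_sh _ (-1) (fun _ s t => sh 1 (pd i j zf) s t - pd i j zf s t)).
    apply (LO_sh1_diff _ (fun _ => pd i j zf)); [intros; auto with sm|].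
    replace (- Z.of_nat i - Z.of_nat j - 2)%Z with (0 + -1 - Z.of_nat (S i) - Z.of_nat j)%Z by lia.
    change (LO (0 + -1 - Z.of_nat (S i) - Z.of_nat j) (fun _ => pd (S i) j zf)).
    apply (pd_mult_class BO LO LO_plus LO_mult 0 (-1) (fun _ => VV) (fun _ => uD)); auto with sm.
    + intros; apply SB_VV.
    + intros i' j' Hi Hj. rewrite pd_uD. apply (LO_sh1_diff _ (fun _ => pd i' j' u)); [intros; auto with sm|].
      generalize (H (S i') j' Hj). replace (- Z.of_nat (S i') - Z.of_nat j')%Z with (-1 - Z.of_nat i' - Z.of_nat j')%Z by lia. auto.
Qed.

(** [LO_pdTT] advances by two [t]-derivatives at once; Landau's inequality supplies the one in
    between. *)
Theorem SO_decay : SO 0 (fun _ => u).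
Proof.
  split; auto. intros i j. replace (0 - Z.of_nat i - Z.of_nat j)%Z with (- Z.of_nat i - Z.of_nat j)%Z by lia.
  revert i. assert (Q : forall j' i, (j' <= j)%nat -> LO (- Z.of_nat i - Z.of_nat j') (fun _ => pd i j' u)).
  { induction j as [|j IH]; intros j' i Hj.
    - replace j' with 0%nat by lia. replace (- Z.of_nat i - Z.of_nat 0)%Z with (- Z.of_nat i)%Z by lia. apply LO_pdS.
    - destruct (Nat.eq_dec j' (S j)) as [->|]; [|apply IH; lia].
      replace (- Z.of_nat i - Z.of_nat (S j))%Z with (- Z.of_nat i - Z.of_nat j - 1)%Z by lia.
      rewrite pd_Tl by auto. apply landau_T; auto with sm; [lia|].
      generalize (LO_BO _ _ (LO_pdTT i j (fun i' j' H => IH j' i' H))). rewrite !pd_Tl by auto. auto. }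
  intros i; apply Q; auto.
Qed.
End Decay.

(** * Summation over translates *)

(* A telescoping weight: [sum_k wt r k = 1 / r]. *)
Definition wt (r : R) (k : nat) : R := / ((r + INR k) * (r + INR k + 1)).
Lemma wt_pos r k : 0 < r -> 0 < wt r k.
Proof. intros. assert (H0 := pos_INR k). apply Rinv_0_lt_compat, Rmult_lt_0_compat; lra. Qed.
Lemma is_lim_inv_INR r : 0 < r -> is_lim_seq (fun n => / (r + INR n)) 0.
Proof.
  intros Hr. apply (is_lim_seq_inv (fun n => r + INR n) p_infty); [|discriminate].
  apply (is_lim_seq_plus (fun _ => r) INR r p_infty p_infty); [apply is_lim_seq_const | apply is_lim_seq_INR | reflexivity].
Qed.
Lemma wt_series r : 0 < r -> is_series (wt r) (/ r).
Proof.
  intros Hr.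
  assert (E : forall n, sum_n (wt r) n = / r - / (r + INR (S n))).
  { induction n.
    - rewrite sum_O. unfold wt. simpl. field; lra.
    - rewrite sum_Sn, IHn. unfold wt. rewrite !S_INR. assert (H := pos_INR n). unfold plus; simpl. field; lra. }
  change (is_lim_seq (sum_n (wt r)) (/ r)).
  apply (is_lim_seq_ext (fun n => / r - / (r + INR (S n)))); [intros; symmetry; apply E|].
  replace (Finite (/ r)) with (Finite (/ r - 0)) by (f_equal; ring).
  apply (is_lim_seq_minus' (fun _ => / r) (fun n => / (r + INR (S n)))); [apply is_lim_seq_const|].
  apply (is_lim_seq_incr_1 (fun n => / (r + INR n))), is_lim_inv_INR; auto.
Qed.
Lemma Series_bound (x : nat -> R) C r : 0 < r -> (forall k, Rabs (x k) <= C * wt r k) ->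
  ex_series x /\ Rabs (Series x) <= C * / r.
Proof.
  intros Hr H. assert (W := wt_series r Hr).
  assert (EW : ex_series (fun k => C * wt r k)) by (apply (ex_series_scal (V := R_NormedModule)); eexists; apply W).
  assert (EA : ex_series (fun k => Rabs (x k))).
  { apply (ex_series_le (V := R_CompleteNormedModule)) with (fun k => C * wt r k); auto.
    intros n. change (norm (Rabs (x n))) with (Rabs (Rabs (x n))). rewrite Rabs_Rabsolu. apply H. }
  split; [apply ex_series_Rabs; auto|].
  eapply Rle_trans; [apply Series_Rabs; auto|].
  eapply Rle_trans; [apply (Series_le _ (fun k => C * wt r k)); auto|].
  - intros n; split; [apply Rabs_pos | apply H].
  - rewrite Series_scal_l, (is_series_unique _ _ W). lra.
Qed.

Definition Ser (f : nat -> R -> R -> R) : R -> R -> R := fun s t => Series (fun k => f k s t).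
(** Domination of every derivative by the same summable weight, locally uniformly. The class is
    closed under differentiation, so termwise differentiation can be iterated. *)
Definition Dom (f : nat -> R -> R -> R) : Prop :=
  (forall k, smooth (f k)) /\
  forall i j K, exists C, forall k s t, Rabs s <= K -> Rabs t <= K -> Rabs (pd i j (f k) s t) <= C * wt 1 k.

Lemma Dom_dS f : Dom f -> Dom (fun k => dS (f k)).
Proof.
  intros [Sf H]; split; [auto with sm|]. intros i j K. destruct (H (S i) j K) as [C HC]. exists C.
  intros k s t Hs Ht. rewrite <- pd_S by auto. apply HC; auto.
Qed.
Lemma Dom_dT f : Dom f -> Dom (fun k => dT (f k)).
Proof.
  intros [Sf H]; split; [auto with sm|]. intros i j K. destruct (H i (S j) K) as [C HC]. exists C.
  intros k s t Hs Ht. rewrite <- pd_T by auto. apply HC; auto.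
Qed.
Lemma Dom_ex f s t : Dom f -> ex_series (fun k => f k s t).
Proof.
  intros [Sf H]. destruct (H 0%nat 0%nat (Rabs s + Rabs t)) as [C HC].
  assert (A := Rabs_pos s). assert (B := Rabs_pos t).
  apply (Series_bound _ C 1); [lra|]. intros k. apply HC; lra.
Qed.

Lemma taylor1_bound (q q' q'' : R -> R) x y C : (forall z, is_derive q z (q' z)) -> (forall z, is_derive q' z (q'' z)) ->
  (forall z, Rmin x y <= z <= Rmax x y -> Rabs (q'' z) <= C) -> Rabs (q y - q x - (y - x) * q' x) <= C * (y - x) ^ 2.
Proof.
  intros D1 D2 HC.
  destruct (MVT_gen_R q q' x y D1) as [c [Hc E1]]. destruct (MVT_gen_R q' q'' x c D2) as [d [Hd E2]].
  rewrite E1. replace (q' c * (y - x) - (y - x) * q' x) with ((q' c - q' x) * (y - x)) by ring. rewrite E2.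
  assert (Hcx : Rabs (c - x) <= Rabs (y - x)).
  { unfold Rmin, Rmax in Hc. destruct (Rle_dec x y).
    - rewrite !Rabs_pos_eq; lra.
    - rewrite !(Rabs_minus_sym _ x), !Rabs_pos_eq; lra. }
  assert (Hdx : Rmin x y <= d <= Rmax x y).
  { unfold Rmin, Rmax in *. destruct (Rle_dec x y), (Rle_dec x c); lra. }
  rewrite !Rabs_mult, <- (pow2_abs (y - x)). assert (A := Rabs_pos (y - x)). assert (B := Rabs_pos (c - x)).
  simpl. rewrite Rmult_1_r. rewrite <- Rmult_assoc.
  apply Rmult_le_compat_r; auto. apply Rmult_le_compat; auto. apply Rabs_pos.
Qed.
(** A quadratic Taylor remainder can be summed term by term, so a series is differentiated without
    any argument on uniform convergence of derivatives. *)
Lemma is_derive_quadratic (F : R -> R) x l C : (forall y, Rabs (y - x) <= 1 -> Rabs (F y - F x - (y - x) * l) <= C * (y - x) ^ 2) ->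
  is_derive F x l.
Proof.
  intros H. apply is_derive_Reals. intros e He.
  assert (HC : 0 < Rabs C + 1) by (assert (A := Rabs_pos C); lra).
  assert (Hd : 0 < Rmin 1 (e / (Rabs C + 1))) by (apply Rmin_pos; [lra | apply Rdiv_lt_0_compat; auto]).
  exists (mkposreal _ Hd). intros h Hh0 Hh. simpl in Hh.
  assert (H1 : Rabs h < 1) by (eapply Rlt_le_trans; [apply Hh | apply Rmin_l]).
  assert (H2 : Rabs h < e / (Rabs C + 1)) by (eapply Rlt_le_trans; [apply Hh | apply Rmin_r]).
  specialize (H (x + h)). replace (x + h - x) with h in H by ring. specialize (H ltac:(lra)).
  replace ((F (x + h) - F x) / h - l) with ((F (x + h) - F x - h * l) * / h) by (field; auto).
  rewrite Rabs_mult, Rabs_inv. assert (Ph := Rabs_pos_lt _ Hh0).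
  apply Rmult_lt_reg_r with (Rabs h); auto. rewrite Rmult_assoc, Rinv_l, Rmult_1_r by lra.
  eapply Rle_lt_trans; [apply H|]. rewrite <- pow2_abs.
  apply Rle_lt_trans with ((Rabs C + 1) * Rabs h * Rabs h).
  - assert (A := Rle_abs C). assert (B := pow2_ge_0 (Rabs h)). nra.
  - apply Rmult_lt_compat_r; auto. apply Rmult_lt_compat_r with (r := Rabs C + 1) in H2; auto.
    replace (e / (Rabs C + 1) * (Rabs C + 1)) with e in H2 by (field; lra). lra.
Qed.

Lemma Ser_derS f s t : Dom f -> is_derive (fun z => Ser f z t) s (Ser (fun k => dS (f k)) s t).
Proof.
  intros D. destruct D as [Sf H]. assert (D : Dom f) by (split; auto).
  assert (A := Rabs_pos s). assert (B := Rabs_pos t).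
  destruct (H 2%nat 0%nat (Rabs s + Rabs t + 1)) as [C HC].
  apply (is_derive_quadratic _ _ _ C). intros y Hy. unfold Ser.
  rewrite <- Series_minus, <- Series_scal_l, <- Series_minus.
  - destruct (Series_bound (fun k => f k y t - f k s t - (y - s) * dS (f k) s t) (C * (y - s) ^ 2) 1) as [_ E]; [lra| |].
    + intros k. replace (C * (y - s) ^ 2 * wt 1 k) with (C * wt 1 k * (y - s) ^ 2) by ring.
      apply (taylor1_bound (fun z => f k z t) (fun z => dS (f k) z t) (fun z => dS (dS (f k)) z t)).
      * intros; apply is_derive_dS; auto with sm.
      * intros; apply is_derive_dS; auto with sm.
      * intros z Hz. apply (HC k z t); [|lra].
        assert (Rabs (z - s) < Rabs (y - s) + / 2) by (apply (Rminmax_near s y); auto; lra).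
        unfold Rmin, Rmax in Hz. assert (T := Rabs_triang (z - s) s). replace (z - s + s) with z in T by ring.
        apply Rabs_le_between in Hy. apply Rle_trans with (Rabs (z - s) + Rabs s); auto.
        assert (Rabs (z - s) <= 1); [|lra]. apply Rabs_le. destruct (Rle_dec s y); lra.
    + rewrite Rinv_1, Rmult_1_r in E. apply E.
  - apply (ex_series_minus (V := R_NormedModule)); apply Dom_ex; auto.
  - apply (ex_series_scal (V := R_NormedModule)). apply (Dom_ex (fun k => dS (f k))), Dom_dS; auto.
  - apply Dom_ex; auto.
  - apply Dom_ex; auto.
Qed.
Lemma Ser_derT f s t : Dom f -> is_derive (fun z => Ser f s z) t (Ser (fun k => dT (f k)) s t).
Proof.
  intros D. destruct D as [Sf H]. assert (D : Dom f) by (split; auto).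
  assert (A := Rabs_pos s). assert (B := Rabs_pos t).
  destruct (H 0%nat 2%nat (Rabs s + Rabs t + 1)) as [C HC].
  apply (is_derive_quadratic _ _ _ C). intros y Hy. unfold Ser.
  rewrite <- Series_minus, <- Series_scal_l, <- Series_minus.
  - destruct (Series_bound (fun k => f k s y - f k s t - (y - t) * dT (f k) s t) (C * (y - t) ^ 2) 1) as [_ E]; [lra| |].
    + intros k. replace (C * (y - t) ^ 2 * wt 1 k) with (C * wt 1 k * (y - t) ^ 2) by ring.
      apply (taylor1_bound (fun z => f k s z) (fun z => dT (f k) s z) (fun z => dT (dT (f k)) s z)).
      * intros; apply is_derive_dT; auto with sm.
      * intros; apply is_derive_dT; auto with sm.
      * intros z Hz. apply (HC k s z); [lra|].
        unfold Rmin, Rmax in Hz. assert (T := Rabs_triang (z - t) t). replace (z - t + t) with z in T by ring.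
        apply Rabs_le_between in Hy. apply Rle_trans with (Rabs (z - t) + Rabs t); auto.
        assert (Rabs (z - t) <= 1); [|lra]. apply Rabs_le. destruct (Rle_dec t y); lra.
    + rewrite Rinv_1, Rmult_1_r in E. apply E.
  - apply (ex_series_minus (V := R_NormedModule)); apply Dom_ex; auto.
  - apply (ex_series_scal (V := R_NormedModule)). apply (Dom_ex (fun k => dT (f k))), Dom_dT; auto.
  - apply Dom_ex; auto.
  - apply Dom_ex; auto.
Qed.

Lemma C0_of_lip f : (forall K, exists C, forall s t s' t', Rabs s <= K -> Rabs t <= K -> Rabs s' <= K -> Rabs t' <= K ->
  Rabs (f s' t' - f s t) <= C * (Rabs (s' - s) + Rabs (t' - t))) -> C0 f.
Proof.
  intros H s t e. destruct (H (Rabs s + Rabs t + 1)) as [C HC].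
  assert (A := Rabs_pos s). assert (B := Rabs_pos t). assert (PC := Rabs_pos C). assert (He := cond_pos e).
  assert (Hd : 0 < Rmin 1 (e / (2 * (Rabs C + 1)))) by (apply Rmin_pos; [lra | apply Rdiv_lt_0_compat; lra]).
  exists (mkposreal _ Hd). simpl. intros x y Hx Hy.
  assert (X1 : Rabs (x - s) < 1) by (eapply Rlt_le_trans; [apply Hx | apply Rmin_l]).
  assert (Y1 : Rabs (y - t) < 1) by (eapply Rlt_le_trans; [apply Hy | apply Rmin_l]).
  assert (X2 : Rabs (x - s) < e / (2 * (Rabs C + 1))) by (eapply Rlt_le_trans; [apply Hx | apply Rmin_r]).
  assert (Y2 : Rabs (y - t) < e / (2 * (Rabs C + 1))) by (eapply Rlt_le_trans; [apply Hy | apply Rmin_r]).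
  assert (T1 := Rabs_triang (x - s) s). replace (x - s + s) with x in T1 by ring.
  assert (T2 := Rabs_triang (y - t) t). replace (y - t + t) with y in T2 by ring.
  eapply Rle_lt_trans; [apply HC; lra|].
  assert (Q1 := Rabs_pos (x - s)). assert (Q2 := Rabs_pos (y - t)). assert (Q3 := Rle_abs C).
  apply Rle_lt_trans with ((Rabs C + 1) * (Rabs (x - s) + Rabs (y - t))); [nra|].
  replace (pos e) with ((Rabs C + 1) * (e / (2 * (Rabs C + 1)) + e / (2 * (Rabs C + 1)))) by (field; lra).
  apply Rmult_lt_compat_l; lra.
Qed.
Lemma mvt_box g K A s t s' t' : smooth g -> (forall x y, Rabs x <= K -> Rabs y <= K -> Rabs (dS g x y) <= A /\ Rabs (dT g x y) <= A) ->
  Rabs s <= K -> Rabs t <= K -> Rabs s' <= K -> Rabs t' <= K ->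
  Rabs (g s' t' - g s t) <= A * (Rabs (s' - s) + Rabs (t' - t)).
Proof.
  intros Sg H Hs Ht Hs' Ht'.
  destruct (MVT_gen_R (fun z => g z t') (fun z => dS g z t') s s') as [x [Hx E1]].
  { intros; apply is_derive_dS; auto with sm. }
  destruct (MVT_gen_R (fun z => g s z) (fun z => dT g s z) t t') as [y [Hy E2]].
  { intros; apply is_derive_dT; auto with sm. }
  cbv beta in E1, E2. replace (g s' t' - g s t) with ((g s' t' - g s t') + (g s t' - g s t)) by ring. rewrite E1, E2.
  eapply Rle_trans; [apply Rabs_triang|]. rewrite !Rabs_mult, Rmult_plus_distr_l.
  apply Rabs_le_between in Hs. apply Rabs_le_between in Hs'. apply Rabs_le_between in Ht. apply Rabs_le_between in Ht'.
  apply Rplus_le_compat; (apply Rmult_le_compat_r; [apply Rabs_pos|]); apply H; apply Rabs_le; try lra.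
  - unfold Rmin, Rmax in Hx. destruct (Rle_dec s s'); lra.
  - unfold Rmin, Rmax in Hy. destruct (Rle_dec t t'); lra.
Qed.
Lemma C0_Ser f : Dom f -> C0 (Ser f).
Proof.
  intros D. destruct D as [Sf H]. assert (D : Dom f) by (split; auto).
  apply C0_of_lip. intros K. destruct (H 1%nat 0%nat K) as [C1 H1]. destruct (H 0%nat 1%nat K) as [C2 H2].
  exists (Rmax C1 C2). intros s t s' t' Hs Ht Hs' Ht'. unfold Ser. rewrite <- Series_minus by (apply Dom_ex; auto).
  destruct (Series_bound (fun k => f k s' t' - f k s t) (Rmax C1 C2 * (Rabs (s' - s) + Rabs (t' - t))) 1) as [_ E]; [lra| |].
  - intros k. assert (W := wt_pos 1 k Rlt_0_1).
    replace (Rmax C1 C2 * (Rabs (s' - s) + Rabs (t' - t)) * wt 1 k) with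
      (Rmax C1 C2 * wt 1 k * (Rabs (s' - s) + Rabs (t' - t))) by ring.
    apply (mvt_box (f k) K); auto. intros x y Hx Hy. split.
    + eapply Rle_trans; [apply (H1 k x y Hx Hy)|]. apply Rmult_le_compat_r; [lra | apply Rmax_l].
    + eapply Rle_trans; [apply (H2 k x y Hx Hy)|]. apply Rmult_le_compat_r; [lra | apply Rmax_r].
  - rewrite Rinv_1, Rmult_1_r in E. apply E.
Qed.
Lemma dS_Ser f : Dom f -> dS (Ser f) = Ser (fun k => dS (f k)).
Proof. intros D. apply dS_unique. intros; apply Ser_derS; auto. Qed.
Lemma dT_Ser f : Dom f -> dT (Ser f) = Ser (fun k => dT (f k)).
Proof. intros D. apply dT_unique. intros; apply Ser_derT; auto. Qed.
Lemma smooth_Ser f : Dom f -> smooth (Ser f).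
Proof.
  intros D n. revert f D. induction n; intros f D.
  - split; [apply C0_Ser; auto | exact I].
  - split; [apply C0_Ser; auto|]. repeat split.
    + eapply diffS_intro; intros; apply Ser_derS; auto.
    + eapply diffT_intro; intros; apply Ser_derT; auto.
    + rewrite dS_Ser by auto. apply (IHn (fun k => dS (f k))), Dom_dS; auto.
    + rewrite dT_Ser by auto. apply (IHn (fun k => dT (f k))), Dom_dT; auto.
Qed.
Lemma pd_Ser i j f : Dom f -> pd i j (Ser f) = Ser (fun k => pd i j (f k)).
Proof.
  revert f. induction i; intros f D.
  - revert f D. induction j; intros f D; [reflexivity|].
    rewrite pd_T, dT_Ser, (IHj (fun k => dT (f k))) by auto using Dom_dT.
    unfold Ser. apply fun2_ext; intros. apply Series_ext; intros k. rewrite <- (pd_T 0 j (f k)). reflexivity.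
  - rewrite pd_S by (apply smooth_Ser; auto). rewrite dS_Ser, (IHi (fun k => dS (f k))) by auto using Dom_dS.
    unfold Ser. apply fun2_ext; intros. apply Series_ext; intros k. rewrite <- (pd_S i j (f k)); [reflexivity | apply D].
Qed.

(** With value and gradient zero at the origin, the bounds of order less than two follow from the
    second derivatives by integration from the origin. *)
Lemma Dom_intro f : (forall k, smooth (f k)) -> (forall k, f k 0 0 = 0) -> (forall k, dS (f k) 0 0 = 0) -> (forall k, dT (f k) 0 0 = 0) ->
  (forall i j K, (2 <= i + j)%nat -> exists C, forall k s t, Rabs s <= K -> Rabs t <= K -> Rabs (pd i j (f k) s t) <= C * wt 1 k) ->
  Dom f.
Proof.
  intros Sf E0 ES ET H.
  assert (Q : forall g, (forall k : nat, smooth (g k)) -> (forall k, g k 0 0 = 0) ->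
    (forall K, exists C, forall k s t, Rabs s <= K -> Rabs t <= K -> Rabs (dS (g k) s t) <= C * wt 1 k) ->
    (forall K, exists C, forall k s t, Rabs s <= K -> Rabs t <= K -> Rabs (dT (g k) s t) <= C * wt 1 k) ->
    forall K, exists C, forall k s t, Rabs s <= K -> Rabs t <= K -> Rabs (g k s t) <= C * wt 1 k).
  { intros g Sg E H1 H2 K. destruct (H1 K) as [C1 B1]. destruct (H2 K) as [C2 B2].
    exists (Rmax C1 C2 * (K + K)). intros k s t Hs Ht. assert (W := wt_pos 1 k Rlt_0_1).
    assert (HK : 0 <= K) by (eapply Rle_trans; [apply Rabs_pos | eauto]).
    assert (P := mvt_box (g k) K (Rmax C1 C2 * wt 1 k) 0 0 s t (Sg k)). rewrite E, !Rminus_0_r, Rabs_R0 in P.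
    assert (A : 0 <= Rmax C1 C2 * wt 1 k).
    { eapply Rle_trans; [apply (Rabs_pos (dS (g k) s t))|]. eapply Rle_trans; [apply B1; auto|]. apply Rmult_le_compat_r; [lra | apply Rmax_l]. }
    eapply Rle_trans; [apply P; auto|].
    - intros x y Hx Hy. split.
      + eapply Rle_trans; [apply B1; auto|]. apply Rmult_le_compat_r; [lra | apply Rmax_l].
      + eapply Rle_trans; [apply B2; auto|]. apply Rmult_le_compat_r; [lra | apply Rmax_r].
    - replace (Rmax C1 C2 * (K + K) * wt 1 k) with (Rmax C1 C2 * wt 1 k * (K + K)) by ring.
      apply Rmult_le_compat_l; lra. }
  assert (HS : forall K, exists C, forall k s t, Rabs s <= K -> Rabs t <= K -> Rabs (dS (f k) s t) <= C * wt 1 k).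
  { apply Q; auto with sm; intros K.
    - apply (H 2 0)%nat; auto.
    - destruct (H 1 1 K)%nat as [C HC]; auto. exists C. intros k s t. rewrite <- smooth_dS_dT by auto. apply (HC k s t). }
  assert (HT : forall K, exists C, forall k s t, Rabs s <= K -> Rabs t <= K -> Rabs (dT (f k) s t) <= C * wt 1 k).
  { apply Q; auto with sm; intros K.
    - apply (H 1 1)%nat; auto.
    - apply (H 0 2)%nat; auto. }
  split; auto. intros [|[|i]] [|[|j]] K; try (apply H; lia).
  - apply Q; auto.
  - apply HT.
  - apply HS.
Qed.

Lemma Series_telescope (x : nat -> R) (l : R) : is_lim_seq x l -> is_series (fun k => x (S k) - x k) (l - x 0%nat).
Proof.
  intros H. change (is_lim_seq (sum_n (fun k => x (S k) - x k)) (l - x 0%nat)).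
  apply (is_lim_seq_ext (fun n => x (S n) - x 0%nat)).
  - induction n.
    + rewrite sum_O. auto.
    + rewrite sum_Sn, <- IHn. unfold plus; simpl. ring.
  - apply (is_lim_seq_minus' (fun n => x (S n)) (fun _ => x 0%nat)).
    + apply (is_lim_seq_incr_1 x), H.
    + apply is_lim_seq_const.
Qed.

Lemma Nm_ge_s s t : Rabs s <= Nm s t.
Proof. apply Rmax_l. Qed.
Lemma Nm_ge_t s t : Rabs t <= Nm s t.
Proof. apply Rmax_r. Qed.

Lemma lim_shift v c s t : LO 0 (fun _ => v) -> (forall k, INR k <= Rabs (c k)) -> is_lim_seq (fun k => v (s + c k) t) 0.
Proof.
  intros H Hc. apply is_lim_seq_spec. intros e. simpl.
  destruct (proj1 (LO_c 0 v) H (e / 2)) as (r0 & Hr0 & HB); [apply is_pos_div_2|].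
  destruct (nfloor_ex (r0 + Rabs s)) as [n [_ Hn]]; [assert (P := Rabs_pos s); lra|].
  exists (S n). intros k Hk. rewrite Rminus_0_r. apply le_INR in Hk. rewrite S_INR in Hk.
  assert (T := Rabs_triang (s + c k) (- s)). replace (s + c k + - s) with (c k) in T by ring. rewrite Rabs_Ropp in T.
  assert (B := HB (s + c k) t). assert (Q := Nm_ge_s (s + c k) t). specialize (Hc k).
  simpl in B. rewrite Rmult_1_r in B. assert (He := cond_pos e). specialize (B ltac:(lra)). lra.
Qed.

Lemma powerRZ_m2 x : powerRZ x (-2) = / x ^ 2.
Proof. apply (powerRZ_opp_nat x 2). Qed.
Lemma wt_ge K s x t k : 1 <= Nm (s + x) t -> Rabs s <= K -> INR k <= Rabs x ->
  powerRZ (Nm (s + x) t) (-2) <= (K + 3) ^ 2 * wt 1 k.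
Proof.
  intros HN Hs Hk. rewrite powerRZ_m2. set (N := Nm (s + x) t) in *.
  assert (T := Rabs_triang (s + x) (- s)). replace (s + x + - s) with x in T by ring. rewrite Rabs_Ropp in T.
  assert (Q := Nm_ge_s (s + x) t). fold N in Q. assert (Pk := pos_INR k). assert (Ps := Rabs_pos s).
  assert (Hk2 : INR k + 2 <= (K + 3) * N) by nra.
  assert (PN : 0 < N ^ 2) by (apply pow_lt; lra).
  unfold wt. apply Rmult_le_reg_r with (N ^ 2 * ((1 + INR k) * (1 + INR k + 1))).
  - apply Rmult_lt_0_compat; auto. apply Rmult_lt_0_compat; lra.
  - replace (/ N ^ 2 * (N ^ 2 * ((1 + INR k) * (1 + INR k + 1)))) with ((1 + INR k) * (1 + INR k + 1)) by (field; lra).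
    replace ((K + 3) ^ 2 * / ((1 + INR k) * (1 + INR k + 1)) * (N ^ 2 * ((1 + INR k) * (1 + INR k + 1)))) with (((K + 3) * N) ^ 2).
    2:{ field. split; lra. }
    apply Rle_trans with ((INR k + 2) ^ 2); [nra | apply pow_incr; lra].
Qed.
(** Far from the origin the order -2 matches the decay of the weight. The shifted point can be close
    to the origin only for boundedly many [k], and there boundedness of [v] suffices. *)
Lemma decay_wt v K : C0 v -> BO (-2) (fun _ => v) -> exists C, 0 <= C /\ forall s t x k, Rabs s <= K -> INR k <= Rabs x ->
  Rabs (v (s + x) t) <= C * wt 1 k.
Proof.
  intros Cv H. apply BO_c in H. destruct H as (C1 & r1 & HC1 & Hr1 & HB).
  destruct (C0_bounded_box v r1 Cv) as [M HM].
  assert (M0 : 0 <= M). { eapply Rle_trans; [apply (Rabs_pos (v 0 0))|]. apply HM; rewrite Rabs_R0; lra. }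
  exists (C1 * (K + 3) ^ 2 + M * (r1 + K + 2) ^ 2).
  assert (Q1 := pow2_ge_0 (K + 3)). assert (Q2 := pow2_ge_0 (r1 + K + 2)).
  assert (P1 : 0 <= C1 * (K + 3) ^ 2) by nra. assert (P2 : 0 <= M * (r1 + K + 2) ^ 2) by nra.
  split; [lra|]. intros s t x k Hs Hk. assert (W := wt_pos 1 k Rlt_0_1).
  destruct (Rle_lt_dec r1 (Nm (s + x) t)) as [L|L].
  - eapply Rle_trans; [apply HB; auto|].
    assert (A := wt_ge K s x t k ltac:(lra) Hs Hk).
    apply Rmult_le_compat_l with (r := C1) in A; [|lra]. nra.
  - assert (Qs := Nm_ge_s (s + x) t). assert (Qt := Nm_ge_t (s + x) t).
    assert (B := HM (s + x) t ltac:(lra) ltac:(lra)).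
    assert (T := Rabs_triang (s + x) (- s)). replace (s + x + - s) with x in T by ring. rewrite Rabs_Ropp in T.
    assert (Pk := pos_INR k).
    assert (1 <= (r1 + K + 2) ^ 2 * wt 1 k).
    { unfold wt. apply Rmult_le_reg_r with ((1 + INR k) * (1 + INR k + 1)); [apply Rmult_lt_0_compat; lra|].
      rewrite Rmult_assoc, Rinv_l, Rmult_1_r by (apply Rmult_integral_contrapositive; lra).
      apply Rle_trans with ((INR k + 2) ^ 2); [nra | apply pow_incr; lra]. }
    nra.
Qed.

Lemma dS_affine a b c : dS (fun s t : R => a + b * s + c * t) = fun _ _ => b.
Proof. apply dS_unique; intros. auto_derive; auto. ring. Qed.
Lemma dT_affine a b c : dT (fun s t : R => a + b * s + c * t) = fun _ _ => c.
Proof. apply dT_unique; intros. auto_derive; auto. ring. Qed.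
Lemma smooth_affine a b c : smooth (fun s t : R => a + b * s + c * t).
Proof. auto with sm. Qed.
#[global] Hint Resolve smooth_affine : sm.
Lemma pd_affine i j a b c : (2 <= i + j)%nat -> pd i j (fun s t : R => a + b * s + c * t) = fun _ _ => 0.
Proof.
  intros H. destruct i as [|[|i]].
  - destruct j as [|[|j]]; try lia. rewrite !pd_T, dT_affine, dT_const. apply pd_zero.
  - destruct j as [|j]; try lia. rewrite pd_T, dT_affine, pd_S, dS_const by auto with sm. apply pd_zero.
  - rewrite !pd_S, dS_affine, dS_const by auto with sm. apply pd_zero.
Qed.

Lemma LL_plus f g : smooth f -> smooth g -> LL (fun s t => f s t + g s t) = fun s t => LL f s t + LL g s t.
Proof.
  intros Sf Sg. unfold LL. rewrite !dS_plus, !dT_plus by auto 10 with sm.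
  apply fun2_ext; intros; ring.
Qed.
Lemma LL_sh c f : smooth f -> LL (sh c f) = sh c (LL f).
Proof. intros Sf. unfold LL. rewrite !dS_sh, !dT_sh by auto with sm. reflexivity. Qed.
Lemma LL_Ser f : Dom f -> LL (Ser f) = Ser (fun k => LL (f k)).
Proof.
  intros D. unfold LL. rewrite dS_Ser, dT_Ser by auto.
  rewrite (dS_Ser (fun k => dS (f k))), (dT_Ser (fun k => dT (f k))) by auto using Dom_dS, Dom_dT.
  apply fun2_ext; intros s t. unfold Ser.
  assert (E1 := Dom_ex _ s t (Dom_dS _ (Dom_dS _ D))). assert (E2 := Dom_ex _ s t (Dom_dT _ (Dom_dT _ D))). cbv beta in E1, E2.
  rewrite <- Series_scal_l, <- Series_plus; auto.
  apply (ex_series_scal (V := R_NormedModule)); auto.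
Qed.
Lemma Dom_pd i j f : Dom f -> Dom (fun k => pd i j (f k)).
Proof.
  intros [Sf H]; split; [auto with sm|]. intros i' j' K. destruct (H (i' + i)%nat (j' + j)%nat K) as [C HC]. exists C.
  intros k s t Hs Ht. rewrite pd_pd by auto. apply HC; auto.
Qed.

(** [cp] starts at 1 and [cm] at 0, so that the two together run through every integer exactly
    once. *)
Definition cp (k : nat) : R := INR k + 1.
Definition cm (k : nat) : R := - INR k.
Lemma cp_ge k : INR k <= Rabs (cp k).
Proof. unfold cp. assert (H := pos_INR k). rewrite Rabs_pos_eq; lra. Qed.
Lemma cm_ge k : INR k <= Rabs (cm k).
Proof. unfold cm. rewrite Rabs_Ropp. apply Rle_abs. Qed.

Section Build.
Variable u : R -> R -> R.
Hypothesis Su : smooth u.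
Hypothesis Eu : forall s t, LL u s t = zf u s t - sh (-1) (zf u) s t.
Hypothesis Du : SO 0 (fun _ => u).

Lemma u_LO i j : LO (- Z.of_nat i - Z.of_nat j) (fun _ => pd i j u).
Proof. generalize (proj2 Du i j). replace (0 - Z.of_nat i - Z.of_nat j)%Z with (- Z.of_nat i - Z.of_nat j)%Z by lia. auto. Qed.

(* [sum_k u(s + k, t)] diverges in general; subtracting first-order Taylor polynomials makes it
   converge without changing derivatives of order at least 2. *)
Definition Tay (c : nat -> R) (k : nat) : R -> R -> R :=
  fun s t => sh (c k) u s t - (u (c k) 0 + dS u (c k) 0 * s + dT u (c k) 0 * t).
Lemma smooth_Tay c k : smooth (Tay c k).
Proof. unfold Tay. apply smooth_minus; auto with sm. Qed.
Hint Resolve smooth_Tay : sm.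
Lemma pd_Tay c k i j : (2 <= i + j)%nat -> pd i j (Tay c k) = sh (c k) (pd i j u).
Proof.
  intros H. unfold Tay. rewrite (pd_minus i j (sh (c k) u)) by auto with sm.
  rewrite (pd_affine i j), pd_sh by auto. apply fun2_ext; intros; ring.
Qed.
Lemma Dom_Tay c : (forall k, INR k <= Rabs (c k)) -> Dom (Tay c).
Proof.
  intros Hc. apply Dom_intro; auto with sm.
  - intros k. unfold Tay, sh. rewrite Rplus_0_l. ring.
  - intros k. unfold Tay. rewrite (dS_minus (sh (c k) u)), dS_sh, dS_affine by auto with sm. unfold sh. rewrite Rplus_0_l. ring.
  - intros k. unfold Tay. rewrite (dT_minus (sh (c k) u)), dT_sh, dT_affine by auto with sm. unfold sh. rewrite Rplus_0_l. ring.
  - intros i j K H. destruct (decay_wt (pd i j u) K) as (C & HC & HB).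
    + auto with c0.
    + apply (BO_le (- Z.of_nat i - Z.of_nat j)); [lia | apply LO_BO, u_LO].
    + exists C. intros k s t Hs Ht. rewrite pd_Tay by auto. unfold sh. auto.
Qed.

Definition Sum (c : nat -> R) (v : R -> R -> R) : R -> R -> R := Ser (fun k => sh (c k) v).
Lemma Dom_sh c i j : (forall k, INR k <= Rabs (c k)) -> (2 <= i + j)%nat -> Dom (fun k => sh (c k) (pd i j u)).
Proof.
  intros Hc H. replace (fun k => sh (c k) (pd i j u)) with (fun k => pd i j (Tay c k)).
  - apply Dom_pd, Dom_Tay, Hc.
  - apply functional_extensionality; intros k. apply pd_Tay; auto.
Qed.

Definition b1 : R -> R -> R := Ser (Tay cp).
Lemma smooth_b1 : smooth b1.
Proof. apply smooth_Ser, Dom_Tay, cp_ge. Qed.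
Hint Resolve smooth_b1 : sm.
Lemma pd_b1 i j : (2 <= i + j)%nat -> pd i j b1 = Sum cp (pd i j u).
Proof.
  intros H. unfold b1. rewrite pd_Ser by apply Dom_Tay, cp_ge. unfold Sum. f_equal.
  apply functional_extensionality; intros k. apply pd_Tay; auto.
Qed.
(* The linear term [cb * s] corrects the constant lost by the subtracted polynomials. *)
Definition cb : R := sh (-1) b1 0 0 - b1 0 0 - u 0 0.
Definition b : R -> R -> R := fun s t => b1 s t + (0 + cb * s + 0 * t).
Lemma smooth_b : smooth b.
Proof. unfold b; auto with sm. Qed.
Hint Resolve smooth_b : sm.

(** The shifted copies of [u] telescope. The subtracted polynomials are affine, their unit
    differences are constants, and these cancel when the identity is compared with itself at the
    origin. *)
Lemma b1_diff s t : sh (-1) b1 s t - b1 s t = u s t + cb.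
Proof.
  assert (D := Dom_Tay cp cp_ge).
  assert (E : forall s t, ex_series (fun k => Tay cp k (s + -1) t - Tay cp k s t)).
  { intros. apply (ex_series_minus (V := R_NormedModule)); apply (Dom_ex (Tay cp)); auto. }
  assert (E2 : forall s t, sh (-1) b1 s t - b1 s t = Series (fun k => Tay cp k (s + -1) t - Tay cp k s t)).
  { intros. unfold b1, Ser, sh. rewrite Series_minus; auto; apply (Dom_ex (Tay cp)); auto. }
  assert (K : (sh (-1) b1 s t - b1 s t) - (sh (-1) b1 0 0 - b1 0 0) = u s t - u 0 0); [|unfold cb; lra].
  rewrite !E2, <- Series_minus by auto.
  set (y := fun k => u (s + INR k) t - u (0 + INR k) 0).
  assert (Ly : is_lim_seq y 0).
  { assert (Hc : forall k, INR k <= Rabs (INR k)) by (intros; apply Rle_abs).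
    assert (L0 : LO 0 (fun _ => u)) by apply (u_LO 0 0).
    replace (Finite 0) with (Finite (0 - 0)) by (f_equal; ring).
    apply (is_lim_seq_minus' (fun k => u (s + INR k) t) (fun k => u (0 + INR k) 0)); apply (lim_shift u INR); auto. }
  assert (T := is_series_unique _ _ (Series_telescope y 0 Ly)).
  rewrite (Series_ext _ (fun k => -1 * (y (S k) - y k))).
  - rewrite Series_scal_l, T. unfold y. simpl. rewrite !Rplus_0_r. ring.
  - intros k. unfold y, Tay, sh, cp. rewrite !S_INR.
    replace (s + -1 + (INR k + 1)) with (s + INR k) by ring. replace (0 + -1 + (INR k + 1)) with (0 + INR k) by ring.
    replace (0 + (INR k + 1)) with (0 + (INR k + 1)) by ring. ring.
Qed.
Lemma b_diff s t : sh (-1) b s t - b s t = u s t.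
Proof. assert (E := b1_diff s t). unfold b, sh in *. lra. Qed.

Lemma zf_pd_LO i j : LO (- Z.of_nat i - Z.of_nat j) (fun _ => pd i j (zf u)).
Proof.
  replace (- Z.of_nat i - Z.of_nat j)%Z with (0 + 0 - Z.of_nat i - Z.of_nat j)%Z by lia.
  apply (SO_mult 0 0 (fun _ => VV) (fun _ => uD u)); [apply SB_VV|].
  apply (SO_minus 0 (fun _ => sh 1 u) (fun _ => u)); auto. apply (SO_sh 0 1 (fun _ => u)); auto.
Qed.

Lemma Sum_LL c i j : (forall k, INR k <= Rabs (c k)) -> (2 <= i + j)%nat -> forall s t,
  LL (Sum c (pd i j u)) s t = Series (fun k => pd i j (zf u) (s + c k) t - pd i j (zf u) (s + c k + -1) t).
Proof.
  intros Hc H s t. unfold Sum. rewrite LL_Ser by (apply Dom_sh; auto). unfold Ser. apply Series_ext. intros k.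
  rewrite LL_sh by auto with sm. unfold sh at 1. rewrite (LL_pd u Su Eu). reflexivity.
Qed.
Lemma LO_weak m f : (m <= 0)%Z -> LO m (fun _ => f) -> LO 0 (fun _ => f).
Proof. intros; eapply LO_le; eauto. Qed.

(** [LL] annihilates the subtracted affine terms, and the series of [(1 - T^-1) zf] telescopes
    because [zf] tends to 0. *)
Lemma LL_b1 s t : LL b1 s t = - zf u s t.
Proof.
  unfold b1. rewrite LL_Ser by apply Dom_Tay, cp_ge. unfold Ser.
  set (y := fun k => zf u (s + INR k) t).
  assert (Ly : is_lim_seq y 0).
  { apply (lim_shift (zf u) INR); [apply (zf_pd_LO 0 0) | intros; apply Rle_abs]. }
  rewrite (Series_ext _ (fun k => y (S k) - y k)).
  - rewrite (is_series_unique _ _ (Series_telescope y 0 Ly)). unfold y; simpl. rewrite Rplus_0_r. ring.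
  - intros k. assert (E : LL (Tay cp k) s t = LL u (s + cp k) t).
    { assert (E2 := pd_Tay cp k 2 0 (le_n _)). assert (E3 := pd_Tay cp k 0 2 (le_n _)).
      unfold LL. change (dS (dS (Tay cp k))) with (pd 2 0 (Tay cp k)). change (dT (dT (Tay cp k))) with (pd 0 2 (Tay cp k)).
      rewrite E2, E3. reflexivity. }
    rewrite E, Eu. unfold y, sh, cp. rewrite S_INR. replace (s + (INR k + 1) + -1) with (s + INR k) by ring. reflexivity.
Qed.
(** Since [u = (T^-1 - 1) b], the difference [uD] is minus the second difference of [b]. *)
Lemma LL_b s t : LL b s t = VV s t * del (del b) s t.
Proof.
  assert (E : LL b s t = LL b1 s t).
  { unfold b. rewrite LL_plus by auto with sm. unfold LL at 2. rewrite !dS_affine, !dT_affine, dS_const, dT_const. ring. }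
  rewrite E, LL_b1, del2. unfold zf, uD. assert (E1 := b_diff (s + 1) t). assert (E0 := b_diff s t).
  unfold sh in *. replace (s + 1 + -1) with s in E1 by ring. rewrite <- E1, <- E0. ring.
Qed.
Lemma pd_b i j : (2 <= i + j)%nat -> pd i j b = Sum cp (pd i j u).
Proof.
  intros H. unfold b. rewrite (pd_plus i j b1) by auto with sm. rewrite pd_affine, pd_b1 by auto.
  apply fun2_ext; intros; ring.
Qed.
End Build.

#[local] Hint Resolve smooth_b : sm.

Lemma periodic_reduce (P : R -> R) : (forall s, P (s + 1) = P s) -> forall s, exists x, Rabs x <= 1 /\ P s = P x.
Proof.
  intros H s.
  assert (Q : forall n s, P (s + INR n) = P s).
  { induction n; intros x; [simpl; rewrite Rplus_0_r; auto|]. rewrite S_INR. replace (x + (INR n + 1)) with ((x + INR n) + 1) by ring.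
    rewrite H; auto. }
  destruct (Rle_lt_dec 0 s) as [Hs|Hs].
  - destruct (nfloor_ex s Hs) as [n Hn]. exists (s - INR n). split; [rewrite Rabs_pos_eq; lra|].
    rewrite <- (Q n (s - INR n)). f_equal; ring.
  - destruct (nfloor_ex (- s) ltac:(lra)) as [n Hn]. exists (s + INR n). split; [|rewrite Q; auto].
    apply Rabs_le; lra.
Qed.

Lemma powerRZ_antitone m r x : (m <= 0)%Z -> 1 <= r -> r <= x -> powerRZ x m <= powerRZ r m.
Proof.
  intros Hm Hr Hx. replace m with (- Z.of_nat (Z.to_nat (- m)))%Z by lia. rewrite !powerRZ_opp_nat.
  apply Rinv_le_contravar; [apply pow_lt; lra | apply pow_incr; lra].
Qed.

(** * Growth of the primitive [b] *)

Section Bounds.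
Variable u : R -> R -> R.
Hypothesis Su : smooth u.
Hypothesis Eu : forall s t, LL u s t = zf u s t - sh (-1) (zf u) s t.
Hypothesis Du : SO 0 (fun _ => u).

Section Order.
Variables i j : nat.
Hypothesis Hij : (2 <= i + j)%nat.
Let v := pd i j u.
Let Pi : R -> R -> R := fun s t => Sum cp v s t + Sum cm v s t.

Lemma Sum_smooth c : (forall k, INR k <= Rabs (c k)) -> smooth (Sum c v).
Proof. intros Hc. apply smooth_Ser, Dom_sh; auto. Qed.
Lemma Sum_diff c : (forall k, INR k <= Rabs (c k)) -> forall s t,
  Sum c v (s + 1) t - Sum c v s t = Series (fun k => v (s + 1 + c k) t - v (s + c k) t).
Proof.
  intros Hc s t. assert (D := Dom_sh u Su Du c i j Hc Hij). unfold Sum, Ser.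
  rewrite <- Series_minus; [reflexivity | apply (Dom_ex _ (s + 1) t D) | apply (Dom_ex _ s t D)].
Qed.
Lemma v_lim (c : nat -> R) s t : (forall k, INR k <= Rabs (c k)) -> is_lim_seq (fun k => v (s + c k) t) 0.
Proof. intros Hc. apply lim_shift; auto. apply (LO_weak (- Z.of_nat i - Z.of_nat j)); [lia | apply u_LO; auto]. Qed.
Lemma zv_lim (c : nat -> R) s t : (forall k, INR k <= Rabs (c k)) -> is_lim_seq (fun k => pd i j (zf u) (s + c k) t) 0.
Proof.
  intros Hc. apply (lim_shift (pd i j (zf u))); auto.
  apply (LO_weak (- Z.of_nat i - Z.of_nat j)); [lia | apply zf_pd_LO; auto].
Qed.
Lemma INR_ge k : INR k <= Rabs (INR k).
Proof. apply Rle_abs. Qed.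

(** A unit shift removes [v (s + 1) t] from the right-hand sum and adds it to the left-hand one. *)
Lemma Pi_periodic s t : Pi (s + 1) t = Pi s t.
Proof.
  unfold Pi. assert (E1 := Sum_diff cp cp_ge s t). assert (E2 := Sum_diff cm cm_ge s t).
  assert (T1 := is_series_unique _ _ (Series_telescope _ _ (v_lim INR (s + 1) t INR_ge))).
  assert (T2 := is_series_unique _ _ (Series_telescope _ _ (v_lim cm (s + 1) t cm_ge))).
  rewrite (Series_ext _ (fun k => v (s + 1 + INR (S k)) t - v (s + 1 + INR k) t)) in E1.
  2:{ intros k. unfold cp. rewrite S_INR. replace (s + (INR k + 1)) with (s + 1 + INR k) by ring. reflexivity. }
  rewrite (Series_ext _ (fun k => -1 * (v (s + 1 + cm (S k)) t - v (s + 1 + cm k) t))) in E2.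
  2:{ intros k. unfold cm. rewrite S_INR. replace (s + 1 + - (INR k + 1)) with (s + - INR k) by ring. ring. }
  rewrite Series_scal_l in E2. rewrite T1 in E1. rewrite T2 in E2.
  unfold cm in E2 at 3. simpl in E1, E2. rewrite Rplus_0_r in E1. rewrite Ropp_0, Rplus_0_r in E2. lra.
Qed.
(** Each one-sided series telescopes, and the two leave the same value of [pd i j (zf u)] with
    opposite signs. *)
Lemma Pi_LL s t : LL Pi s t = 0.
Proof.
  unfold Pi. rewrite LL_plus by (apply Sum_smooth; auto using cp_ge, cm_ge).
  unfold v. rewrite !(Sum_LL u Su Eu Du) by auto using cp_ge, cm_ge.
  assert (T1 := is_series_unique _ _ (Series_telescope _ _ (zv_lim INR s t INR_ge))).
  assert (T2 := is_series_unique _ _ (Series_telescope _ _ (zv_lim cm s t cm_ge))).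
  rewrite (Series_ext _ (fun k => pd i j (zf u) (s + INR (S k)) t - pd i j (zf u) (s + INR k) t)).
  2:{ intros k. unfold cp. rewrite S_INR. replace (s + (INR k + 1) + -1) with (s + INR k) by ring. reflexivity. }
  rewrite (Series_ext (fun k => pd i j (zf u) (s + cm k) t - pd i j (zf u) (s + cm k + -1) t)
    (fun k => -1 * (pd i j (zf u) (s + cm (S k)) t - pd i j (zf u) (s + cm k) t))).
  2:{ intros k. unfold cm. rewrite S_INR. replace (s + - (INR k + 1)) with (s + - INR k + -1) by ring. ring. }
  rewrite Series_scal_l, T1, T2. unfold cm. simpl. rewrite Ropp_0, !Rplus_0_r. ring.
Qed.
Lemma Sum_small c e t : (forall k, INR k <= Rabs (c k)) -> 0 <= e ->
  forall s, (forall k, Rabs (v (s + c k) t) <= e * wt 1 k) -> Rabs (Sum c v s t) <= e.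
Proof.
  intros Hc He s H. destruct (Series_bound (fun k => v (s + c k) t) e 1 Rlt_0_1 H) as [_ B].
  rewrite Rinv_1, Rmult_1_r in B. exact B.
Qed.
(* The two-sided sum is 1-periodic in [s], annihilated by [L0], and tends to 0 as [|t|] grows; hence
   left and right sums agree up to sign, and one of them avoids the origin. *)
Lemma Pi_zero s t : Pi s t = 0.
Proof.
  assert (SP : smooth Pi) by (apply smooth_plus; apply Sum_smooth; auto using cp_ge, cm_ge).
  assert (L2 : LO (-2) (fun _ => v)) by (apply (LO_le (- Z.of_nat i - Z.of_nat j)); [lia | apply u_LO; auto]).
  destruct (decay_wt v 1) as (C & HC & HB); [unfold v; auto with c0 | apply LO_BO, L2 |].
  apply (liouville Pi (2 * C + 1)); auto.
  - intros x y. unfold L0. rewrite del2. unfold sh. rewrite Pi_periodic.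
    assert (E := Pi_periodic (x + -1) y). replace (x + -1 + 1) with x in E by ring. rewrite <- E.
    assert (E2 := Pi_LL x y). unfold LL in E2. lra.
  - lra.
  - intros x y. destruct (periodic_reduce (fun s => Pi s y) (fun s => Pi_periodic s y) x) as (x' & Hx' & ->).
    unfold Pi. eapply Rle_trans; [apply Rabs_triang|].
    assert (B1 := Sum_small cp C y cp_ge HC x' (fun k => HB x' y (cp k) k Hx' (cp_ge k))).
    assert (B2 := Sum_small cm C y cm_ge HC x' (fun k => HB x' y (cm k) k Hx' (cm_ge k))). lra.
  - intros e He. destruct (proj1 (LO_c (-2) v) L2 (e / 32)) as (r0 & Hr0 & HL); [lra|].
    exists r0. split; [lra|]. intros x y Hy.
    destruct (periodic_reduce (fun s => Pi s y) (fun s => Pi_periodic s y) x) as (x' & Hx' & ->).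
    assert (Q : forall c k, INR k <= Rabs c -> Rabs (v (x' + c) y) <= e / 2 * wt 1 k).
    { intros c k Hk. assert (N := Nm_ge_t (x' + c) y).
      eapply Rle_trans; [apply HL; lra|].
      assert (A := wt_ge 1 x' c y k ltac:(lra) Hx' Hk). replace ((1 + 3) ^ 2) with 16 in A by ring. apply Rmult_le_compat_l with (r := e / 32) in A; lra. }
    unfold Pi. eapply Rle_trans; [apply Rabs_triang|].
    assert (B1 := Sum_small cp (e / 2) y cp_ge ltac:(lra) x' (fun k => Q (cp k) k (cp_ge k))).
    assert (B2 := Sum_small cm (e / 2) y cm_ge ltac:(lra) x' (fun k => Q (cm k) k (cm_ge k))). lra.
Qed.

Lemma powerRZ_wt m r N k : (m <= -2)%Z -> 1 <= r -> r <= N -> (r + INR k) / 2 <= N ->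
  powerRZ N m <= 8 * powerRZ r (m + 2) * wt r k.
Proof.
  intros Hm Hr HN Hk. assert (Pk := pos_INR k).
  replace m with ((m + 2) + -2)%Z at 1 by lia. rewrite powerRZ_plus, powerRZ_m2 by lra.
  assert (A := powerRZ_antitone (m + 2) r N ltac:(lia) Hr HN).
  assert (P1 : 0 < powerRZ N (m + 2)) by (apply powerRZ_pos; lra).
  assert (P2 : 0 < powerRZ r (m + 2)) by (apply powerRZ_pos; lra).
  assert (B : / N ^ 2 <= 8 * wt r k).
  { unfold wt. replace (8 * / ((r + INR k) * (r + INR k + 1))) with (/ ((r + INR k) * (r + INR k + 1) / 8)) by (field; lra).
    apply Rinv_le_contravar.
    - apply Rdiv_lt_0_compat; [apply Rmult_lt_0_compat|]; lra.
    - apply Rle_trans with (((r + INR k) / 2) ^ 2); [|apply pow_incr; lra]. nra. }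
  replace (8 * powerRZ r (m + 2) * wt r k) with (powerRZ r (m + 2) * (8 * wt r k)) by ring.
  apply Rmult_le_compat; auto; [lra|]. apply Rlt_le, Rinv_0_lt_compat, pow_lt; lra.
Qed.

(** Along the translates that lead away from the origin the norm is at least [r] and at least
    [(r + k) / 2], so summation costs exactly one power of [r]. *)
Lemma b_high_order : LO (1 - Z.of_nat i - Z.of_nat j) (fun _ => pd i j (b u)).
Proof.
  set (m := (- Z.of_nat i - Z.of_nat j)%Z).
  assert (Hv : LO m (fun _ => v)) by (apply u_LO; auto).
  replace (1 - Z.of_nat i - Z.of_nat j)%Z with (m + 1)%Z by lia.
  apply LO_c. intros e He. destruct (proj1 (LO_c m v) Hv (e / 8)) as (r0 & Hr0 & HL); [lra|].
  exists r0. split; auto. intros s t Hs. rewrite (pd_b u Su Du) by auto. fold v.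
  remember (Nm s t) as r eqn:Er. assert (Hr : 1 <= r) by lra.
  assert (Q : forall c, (forall k, r <= Nm (s + c k) t /\ (r + INR k) / 2 <= Nm (s + c k) t) -> Rabs (Sum c v s t) <= e * powerRZ r (m + 1)).
  { intros c Hc. destruct (Series_bound (fun k => v (s + c k) t) (e * powerRZ r (m + 2)) r) as [_ B]; [lra| |].
    - intros k. destruct (Hc k) as [H1 H2]. eapply Rle_trans; [apply HL; lra|].
      assert (A := powerRZ_wt m r _ k ltac:(lia) Hr H1 H2). apply Rmult_le_compat_l with (r := e / 8) in A; lra.
    - eapply Rle_trans; [apply B|]. replace (m + 2)%Z with (m + 1 + 1)%Z by lia. rewrite (powerRZ_plus r (m + 1)) by lra.
      right. simpl. field. lra. }
  assert (A1 := Nm_ge_s s t). assert (A2 := Nm_ge_t s t). rewrite <- Er in A1, A2.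
  assert (N1 : r <= Rabs s \/ r <= Rabs t).
  { rewrite Er. unfold Nm, Rmax. destruct (Rle_dec (Rabs s) (Rabs t)); lra. }
  destruct (Rle_lt_dec 0 s) as [Hs0|Hs0].
  - apply Q. intros k. assert (B1 := Nm_ge_s (s + cp k) t). assert (B2 := Nm_ge_t (s + cp k) t).
    unfold cp in *. assert (Pk := pos_INR k). rewrite Rabs_pos_eq in B1 by lra. rewrite (Rabs_pos_eq s) in N1 by lra. lra.
  - assert (Z := Pi_zero s t). unfold Pi in Z. replace (Sum cp v s t) with (- Sum cm v s t) by lra. rewrite Rabs_Ropp.
    apply Q. intros k. assert (B1 := Nm_ge_s (s + cm k) t). assert (B2 := Nm_ge_t (s + cm k) t).
    unfold cm in *. assert (Pk := pos_INR k). rewrite Rabs_left in B1 by lra. rewrite (Rabs_left s) in N1 by lra. lra.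
Qed.
End Order.

(** By the mean value theorem [u] is minus [dS b] at a nearby point, and moving to [s] costs a
    second derivative of order o(1/r). For [dT b] there is no such relation. *)
Lemma b_s_LO : LO 0 (fun _ => dS (b u)).
Proof.
  intros k e He. assert (H1 := proj2 Du 0%nat 0%nat). assert (H2 := b_high_order 2 0 ltac:(lia)).
  destruct (H1 k (e / 2)) as (r1 & A1 & B1); [lra|]. destruct (H2 (k + 1) (e / 2)) as (r2 & A2 & B2); [lra|].
  exists (Rmax r1 r2). split; [apply Rle_trans with r1; auto; apply Rmax_l|]. intros r s t Hr Hn.
  assert (L1 : r1 <= r) by (eapply Rle_trans; [apply Rmax_l | eauto]).
  assert (L2 : r2 <= r) by (eapply Rle_trans; [apply Rmax_r | eauto]).
  assert (Sb : smooth (b u)) by (apply smooth_b; auto).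
  destruct (MVT_R (fun z => b u z t) (fun z => dS (b u) z t) (s + -1) s) as [x [Hx E]].
  { lra. } { intros; apply is_derive_dS; auto with sm. }
  destruct (MVT_R (fun z => dS (b u) z t) (fun z => dS (dS (b u)) z t) x s) as [y [Hy E2]].
  { lra. } { intros; apply is_derive_dS; auto with sm. }
  assert (E3 := b_diff u Su Du s t). unfold sh in E3. cbv beta in E, E2.
  assert (E4 : dS (b u) s t = - u s t + dS (dS (b u)) y t * (s - x)).
  { replace (s - (s + -1)) with 1 in E by ring. lra. }
  rewrite E4. eapply Rle_trans; [apply Rabs_triang|]. rewrite Rabs_Ropp, Rabs_mult, (Rabs_pos_eq (s - x)) by lra.
  specialize (B1 r s t L1 Hn). specialize (B2 r y t L2 (nb_near k r s t y Hn ltac:(lra))).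
  simpl in B1, B2. change (pd 0 0 u s t) with (u s t) in B1. change (pd 2 0 (b u) y t) with (dS (dS (b u)) y t) in B2.
  replace (powerRZ r 0) with 1 in * by reflexivity.
  assert (B3 : Rabs (dS (dS (b u)) y t) <= e / 2).
  { eapply Rle_trans; [apply B2|]. rewrite Rmult_1_r. rewrite <- (Rmult_1_r (e / 2)) at 2.
    apply Rmult_le_compat_l; [lra|]. rewrite <- Rinv_1. apply Rinv_le_contravar; lra. }
  assert (P := Rabs_pos (dS (dS (b u)) y t)). nra.
Qed.
End Bounds.

Lemma path_S G s s' t D : diffS G -> (forall x, Rmin s s' <= x <= Rmax s s' -> Rabs (dS G x t) <= D) ->
  Rabs (G s' t) <= Rabs (G s t) + D * Rabs (s' - s).
Proof.
  intros HG H. destruct (MVT_gen_R (fun z => G z t) (fun z => dS G z t) s s') as [x [Hx E]].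
  { intros; apply is_derive_dS; auto. }
  cbv beta in E. replace (G s' t) with (G s t + (G s' t - G s t)) by ring. rewrite E.
  eapply Rle_trans; [apply Rabs_triang|]. rewrite Rabs_mult.
  apply Rplus_le_compat_l, Rmult_le_compat_r; [apply Rabs_pos | auto].
Qed.
Lemma path_T G s t t' D : diffT G -> (forall y, Rmin t t' <= y <= Rmax t t' -> Rabs (dT G s y) <= D) ->
  Rabs (G s t') <= Rabs (G s t) + D * Rabs (t' - t).
Proof.
  intros HG H. destruct (MVT_gen_R (fun z => G s z) (fun z => dT G s z) t t') as [x [Hx E]].
  { intros; apply is_derive_dT; auto. }
  cbv beta in E. replace (G s t') with (G s t + (G s t' - G s t)) by ring. rewrite E.
  eapply Rle_trans; [apply Rabs_triang|]. rewrite Rabs_mult.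
  apply Rplus_le_compat_l, Rmult_le_compat_r; [apply Rabs_pos | auto].
Qed.

Lemma Rabs_between x y z c : Rmin x y <= z <= Rmax x y -> Rabs x <= c -> Rabs y <= c -> Rabs z <= c.
Proof.
  intros H Hx Hy. apply Rabs_le_between in Hx. apply Rabs_le_between in Hy. apply Rabs_le.
  unfold Rmin, Rmax in H. destruct (Rle_dec x y); lra.
Qed.
Lemma nb_s k r x y : r - k <= Rabs x -> Rabs x <= r + k -> Rabs y <= r + k -> nb k r x y.
Proof. intros. unfold nb, Rmax. destruct (Rle_dec (Rabs x) (Rabs y)); lra. Qed.
Lemma nb_t k r x y : r - k <= Rabs y -> Rabs x <= r + k -> Rabs y <= r + k -> nb k r x y.
Proof. intros. unfold nb, Rmax. destruct (Rle_dec (Rabs x) (Rabs y)); lra. Qed.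

(* The ring [nb k r] is connected by axis-parallel paths of length O(r). *)
Lemma ring_bound G k r D : smooth G -> 0 <= k -> k <= r -> 1 <= r -> 0 <= D -> G r 0 = 0 ->
  (forall s t, nb k r s t -> Rabs (dS G s t) <= D /\ Rabs (dT G s t) <= D) ->
  forall s t, nb k r s t -> Rabs (G s t) <= 16 * r * D.
Proof.
  intros SG Hk Hkr Hr HD H0 H s t Hn.
  assert (Er : Rabs r = r) by (apply Rabs_pos_eq; lra). assert (Emr : Rabs (- r) = r) by (rewrite Rabs_Ropp; auto).
  assert (B := nb_bound _ _ _ _ Hn). destruct B as [Bs Bt].
  assert (HT : forall x y y', r - k <= Rabs x -> Rabs x <= r + k -> Rabs y <= r + k -> Rabs y' <= r + k ->
    Rabs (G x y') <= Rabs (G x y) + 4 * r * D).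
  { intros x y y' H1 H2 H3 H4. eapply Rle_trans; [apply (path_T G x y y' D); [auto with sm|]|].
    - intros z Hz. apply H. apply nb_s; auto. apply (Rabs_between y y'); auto.
    - assert (Rabs (y' - y) <= 4 * r).
      { apply Rabs_le_between in H3. apply Rabs_le_between in H4. apply Rabs_le. lra. }
      apply Rplus_le_compat_l. nra. }
  assert (HS : forall x x' y, r - k <= Rabs y -> Rabs y <= r + k -> Rabs x <= r + k -> Rabs x' <= r + k ->
    Rabs (G x' y) <= Rabs (G x y) + 4 * r * D).
  { intros x x' y H1 H2 H3 H4. eapply Rle_trans; [apply (path_S G x x' y D); [auto with sm|]|].
    - intros z Hz. apply H. apply nb_t; auto. apply (Rabs_between x x'); auto.
    - assert (Rabs (x' - x) <= 4 * r).
      { apply Rabs_le_between in H3. apply Rabs_le_between in H4. apply Rabs_le. lra. }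
      apply Rplus_le_compat_l. nra. }
  assert (A0 : Rabs (G r 0) = 0) by (rewrite H0; apply Rabs_R0).
  assert (Z0 : Rabs 0 = 0) by apply Rabs_R0.
  assert (P : 0 <= r * D) by nra.
  (* Two segments suffice on the horizontal sides and on the vertical side that contains [(r, 0)];
     the opposite side takes four. Each has length at most [4 r], whence the constant 16. *)
  destruct (Rle_lt_dec (r - k) (Rabs t)) as [Ht|Ht].
  { assert (A1 := HT r 0 t ltac:(lra) ltac:(lra) ltac:(lra) Bt).
    assert (A2 := HS r s t Ht Bt ltac:(lra) Bs). lra. }
  assert (Hs : r - k <= Rabs s).
  { destruct Hn as [Hn _]. unfold Rmax in Hn. destruct (Rle_dec (Rabs s) (Rabs t)); lra. }
  assert (HX : forall x x' y, (forall z, Rmin x x' <= z <= Rmax x x' -> r - k <= Rabs z <= r + k) -> Rabs y <= r + k ->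
    Rabs (x' - x) <= 4 * r -> Rabs (G x' y) <= Rabs (G x y) + 4 * r * D).
  { intros x x' y H1 H2 H3. eapply Rle_trans; [apply (path_S G x x' y D); [auto with sm|]|].
    - intros z Hz. apply H. destruct (H1 z Hz). apply nb_s; auto.
    - apply Rplus_le_compat_l. nra. }
  destruct (Rle_lt_dec 0 s) as [Hs0|Hs0].
  - rewrite (Rabs_pos_eq s) in * by lra.
    assert (A1 := HT r 0 t ltac:(lra) ltac:(lra) ltac:(lra) Bt).
    assert (A2 : Rabs (G s t) <= Rabs (G r t) + 4 * r * D).
    { apply HX; auto; [|apply Rabs_le; lra]. intros z Hz. unfold Rmin, Rmax in Hz.
      rewrite Rabs_pos_eq by (destruct (Rle_dec r s); lra). destruct (Rle_dec r s); lra. }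
    lra.
  - rewrite (Rabs_left s) in * by lra.
    assert (A1 := HT r 0 r ltac:(lra) ltac:(lra) ltac:(lra) ltac:(lra)).
    assert (A2 := HS r (- r) r ltac:(lra) ltac:(lra) ltac:(lra) ltac:(lra)).
    assert (A3 := HT (- r) r t ltac:(lra) ltac:(lra) ltac:(lra) Bt).
    assert (A4 : Rabs (G s t) <= Rabs (G (- r) t) + 4 * r * D).
    { apply HX; auto; [|apply Rabs_le; lra]. intros z Hz. unfold Rmin, Rmax in Hz.
      assert (z <= 0) by (destruct (Rle_dec (- r) s); lra).
      rewrite Rabs_left1 by auto. destruct (Rle_dec (- r) s); lra. }
    lra.
Qed.

(** Every point of the ring is joined to [(r, 0)], where [F r] vanishes, by a path of length O(r)
    inside the ring; this raises the order of the gradient by one. *)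
Lemma LO_ring m F : (forall r, smooth (F r)) -> (forall r, F r r 0 = 0) ->
  LO m (fun r => dS (F r)) -> LO m (fun r => dT (F r)) -> LO (m + 1) F.
Proof.
  intros SF F0 H1 H2 k e He.
  destruct (H1 (Rabs k) (e / 16)) as (r1 & A1 & B1); [lra|]. destruct (H2 (Rabs k) (e / 16)) as (r2 & A2 & B2); [lra|].
  exists (Rmax (Rmax r1 r2) (Rabs k)).
  split; [apply Rle_trans with r1; auto; eapply Rle_trans; [apply Rmax_l | apply Rmax_l]|]. intros r s t Hr Hn.
  assert (L0 : Rmax r1 r2 <= r) by (eapply Rle_trans; [apply Rmax_l | eauto]).
  assert (L1 : r1 <= r) by (eapply Rle_trans; [apply Rmax_l | eauto]).
  assert (L2 : r2 <= r) by (eapply Rle_trans; [apply Rmax_r | eauto]).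
  assert (L3 : Rabs k <= r) by (eapply Rle_trans; [apply Rmax_r | eauto]).
  assert (Hr1 : 1 <= r) by lra. assert (P := powerRZ_pos r m Hr1).
  assert (K := ring_bound (F r) (Rabs k) r (e / 16 * powerRZ r m) (SF r) (Rabs_pos k) L3 Hr1 ltac:(nra) (F0 r)).
  eapply Rle_trans; [apply K|].
  - intros x y Hxy. split; [apply B1 | apply B2]; auto.
  - unfold nb in *. assert (Q := Rle_abs k). lra.
  - rewrite powerRZ_plus by auto. right. simpl. field.
Qed.

Section Family.
Variable u : R -> R -> R.
Hypothesis Su : smooth u.
Hypothesis Eu : forall s t, LL u s t = zf u s t - sh (-1) (zf u) s t.
Hypothesis Du : SO 0 (fun _ => u).

(** The gradient of [dT b] is o(1/r), which does not exclude logarithmic growth of [dT b] along a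
    ray. Subtracting its value at [(r, 0)] restores o(1) on the ring of radius [r]. *)
Definition beta (r : R) : R := dT (b u) r 0.
Definition br (r : R) : R -> R -> R := fun s t => b u s t - (b u r 0 + 0 * s + beta r * t).

Lemma smooth_br r : smooth (br r).
Proof. unfold br. apply smooth_minus; auto with sm. Qed.
Hint Resolve smooth_br : sm.
Lemma dS_br r : dS (br r) = dS (b u).
Proof.
  unfold br. rewrite (dS_minus (b u)) by auto with sm. rewrite dS_affine. apply fun2_ext; intros; ring.
Qed.
Lemma dT_br r : dT (br r) = fun s t => dT (b u) s t - beta r.
Proof. unfold br. rewrite (dT_minus (b u)) by auto with sm. rewrite dT_affine. reflexivity. Qed.

(** Derivatives of order at least two do not see the normalization and come from [b_high_order];
    [dT] and the function itself are recovered from their gradients on the ring. *)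
Lemma SO_br : SO 1 br.
Proof.
  assert (Sb : smooth (b u)) by auto with sm.
  assert (HO : forall i j, (2 <= i + j)%nat -> LO (1 - Z.of_nat i - Z.of_nat j) (fun _ => pd i j (b u))).
  { intros; apply b_high_order; auto. }
  assert (HS : LO 0 (fun _ => dS (b u))) by (apply b_s_LO; auto).
  assert (HT : LO 0 (fun r => dT (br r))).
  { apply (LO_ring (-1) (fun r => dT (br r))); auto with sm.
    - intros r. rewrite dT_br. unfold beta. ring.
    - apply LO_ext with (fun _ => pd 1 1 (b u)); [|apply (HO 1 1)%nat; auto].
      intros r s t. rewrite (smooth_dS_dT (br r)), dS_br by auto with sm. simpl. rewrite <- (smooth_dS_dT (b u)); auto.
    - apply LO_ext with (fun _ => pd 0 2 (b u)); [|apply (HO 0 2)%nat; auto].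
      intros r s t. rewrite dT_br. rewrite (dT_minus (dT (b u)) (fun _ _ => beta r)), dT_const by auto with sm. simpl. unfold pd; simpl. ring. }
  assert (H0 : LO 1 br).
  { apply (LO_ring 0 br); auto with sm.
    - intros r. unfold br. ring.
    - apply LO_ext with (fun _ => dS (b u)); auto. intros; rewrite dS_br; auto. }
  split; [auto with sm|]. intros i j.
  assert (HH : (2 <= i + j)%nat -> LO (1 - Z.of_nat i - Z.of_nat j) (fun r => pd i j (br r))).
  { intros H. apply LO_ext with (fun _ => pd i j (b u)); auto. intros r s t. unfold br.
    rewrite (pd_minus i j (b u)), (pd_affine i j) by auto with sm. ring. }
  destruct i as [|[|i]]; [destruct j as [|[|j]] | destruct j as [|j] |]; try (apply HH; lia).
  - exact H0.
  - exact HT.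
  - apply LO_ext with (fun _ => dS (b u)); auto. intros r s t. change (pd 1 0 (br r)) with (dS (br r)). rewrite dS_br; auto.
Qed.
End Family.

(** * The equation for tau b *)

Definition D1 (f : R -> R -> R) : R -> R -> R := fun s t => sh 1 f s t - sh (-1) f s t.
Definition D2 (f : R -> R -> R) : R -> R -> R := fun s t => sh 1 f s t - 2 * f s t + sh (-1) f s t.
(** The commutator of [L0] with multiplication by [s]; the one with [t] is [2 dT]. *)
Definition cS (f : R -> R -> R) : R -> R -> R := fun s t => 4 * dS f s t - D1 f s t.
Lemma smooth_D1 f : smooth f -> smooth (D1 f).
Proof. intros; unfold D1; auto with sm. Qed.
Lemma smooth_D2 f : smooth f -> smooth (D2 f).
Proof. intros; unfold D2; auto with sm. Qed.
#[global] Hint Resolve smooth_D1 smooth_D2 : sm.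
Lemma smooth_cS f : smooth f -> smooth (cS f).
Proof. intros; unfold cS; auto with sm. Qed.
#[global] Hint Resolve smooth_cS : sm.

Lemma del_del f : del (del f) = D2 f.
Proof. apply fun2_ext; intros; apply del2. Qed.
Lemma L0_D2 f : L0 f = fun s t => 2 * dS (dS f) s t + dT (dT f) s t - D2 f s t.
Proof. unfold L0. rewrite del_del. reflexivity. Qed.

Lemma L0_tau_mult f : smooth f -> L0 (fun s t => tau s t * f s t) = fun s t =>
  tau s t * L0 f s t + (2 * (s * cS f s t + t * (2 * dT f s t)) + 4 * f s t - D2 f s t).
Proof.
  intros Sf. rewrite !L0_D2. unfold cS.
  rewrite (dS_mult tau f), dS_tau, (dT_mult tau f), dT_tau by auto with sm.
  rewrite (dS_plus (fun s t => 2 * s * f s t)), (dT_plus (fun s t => 2 * t * f s t)) by auto 10 with sm.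
  rewrite (dS_mult (fun s _ => 2 * s) f), (dT_mult (fun _ t => 2 * t) f) by auto with sm.
  rewrite (dS_mult tau (dS f)), dS_tau, (dT_mult tau (dT f)), dT_tau by auto with sm.
  rewrite (dS_scal 2 (fun s _ => s)), dS_s, (dT_scal 2 (fun _ t => t)), dT_t by auto with sm.
  apply fun2_ext; intros s t. unfold D1, D2, sh, tau. field.
Qed.
Lemma L0_s_mult f : smooth f -> L0 (fun s t => s * f s t) = fun s t => s * L0 f s t + cS f s t.
Proof.
  intros Sf. rewrite !L0_D2. unfold cS.
  rewrite (dS_mult (fun s _ => s) f), dS_s, (dT_mult (fun s _ => s) f), dT_s by auto with sm.
  rewrite (dS_plus (fun s t => 1 * f s t)), (dS_scal 1 f), (dS_mult (fun s _ => s) (dS f)), dS_s by auto with sm.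
  replace (fun s t => 0 * f s t + s * dT f s t) with (fun s t => s * dT f s t) by (apply fun2_ext; intros; ring).
  rewrite (dT_mult (fun s _ => s) (dT f)), dT_s by auto with sm.
  apply fun2_ext; intros s t. unfold D1, D2, sh. ring.
Qed.
Lemma L0_t_mult f : smooth f -> L0 (fun s t => t * f s t) = fun s t => t * L0 f s t + 2 * dT f s t.
Proof.
  intros Sf. rewrite !L0_D2.
  rewrite (dT_mult (fun _ t => t) f), dT_t, (dS_mult (fun _ t => t) f), dS_t by auto with sm.
  rewrite (dT_plus (fun s t => 1 * f s t)), (dT_scal 1 f), (dT_mult (fun _ t => t) (dT f)), dT_t by auto with sm.
  replace (fun s t => 0 * f s t + t * dS f s t) with (fun s t => t * dS f s t) by (apply fun2_ext; intros; ring).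
  rewrite (dS_mult (fun _ t => t) (dS f)), dS_t by auto with sm.
  apply fun2_ext; intros s t. unfold D2, sh. ring.
Qed.
Lemma L0_D1 f : smooth f -> L0 (D1 f) = D1 (L0 f).
Proof. intros Sf. unfold D1. rewrite (L0_minus (sh 1 f) (sh (-1) f)), !L0_sh by auto with sm. reflexivity. Qed.
Lemma L0_D2_comm f : smooth f -> L0 (D2 f) = D2 (L0 f).
Proof.
  intros Sf. unfold D2. rewrite (L0_plus (fun s t => sh 1 f s t - 2 * f s t)), (L0_minus (sh 1 f)), (L0_scal 2 f), !L0_sh by auto with sm.
  reflexivity.
Qed.
Lemma L0_cS f : smooth f -> L0 (cS f) = cS (L0 f).
Proof.
  intros Sf. unfold cS. rewrite (L0_minus (fun s t => 4 * dS f s t)), (L0_scal 4 (dS f)), L0_D1, L0_dS by auto with sm.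
  reflexivity.
Qed.

(* For [eta = tau B], [HH eta = tau^2 (L0 B - (V - 1) del^2 B)]. *)
Definition HH (f : R -> R -> R) : R -> R -> R := fun s t =>
  tau s t * L0 f s t - 2 * (s * cS f s t + t * (2 * dT f s t)) + (4 * f s t - D2 f s t).

(** Multiplication by [tau] changes the sign of the first-order terms: those of [L0 (tau B)] cancel
    against those of [HH], and the zeroth-order remainder is the numerator of [V1] times the second
    difference. *)
Lemma HH_tau B s t : smooth B -> HH (fun s t => tau s t * B s t) s t = tau s t ^ 2 * (L0 B s t - V1 s t * D2 B s t).
Proof.
  intros SB. unfold HH. rewrite L0_tau_mult by auto. unfold cS.
  rewrite (dS_mult tau B), dS_tau, (dT_mult tau B), dT_tau by auto with sm.
  unfold V1, itau. assert (H := tau_ne s t).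
  replace (tau s t ^ 2 * (L0 B s t - (2 * (t * t) - 2 * (s * s) + 3 / 2) * (/ tau s t * / tau s t) * D2 B s t))
    with (tau s t ^ 2 * L0 B s t - (2 * (t * t) - 2 * (s * s) + 3 / 2) * D2 B s t) by (field; auto).
  unfold D1, D2, sh, tau. field.
Qed.

Lemma CC_eq f : smooth f -> CC f = fun s t => mu (dS f) s t - del f s t.
Proof. intros Sf. unfold CC. rewrite dS_mu by auto. reflexivity. Qed.
Lemma dS_CC f : smooth f -> dS (CC f) = CC (dS f).
Proof. intros Sf. rewrite !CC_eq by auto with sm. rewrite dS_minus, dS_mu, dS_del by auto with sm. reflexivity. Qed.
Lemma dS_cS f : smooth f -> dS (cS f) = cS (dS f).
Proof.
  intros Sf. unfold cS, D1. rewrite (dS_minus (fun s t => 4 * dS f s t)), (dS_scal 4 (dS f)), (dS_minus (sh 1 f)), !dS_sh by auto with sm.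
  reflexivity.
Qed.

(** An identity between operators with constant coefficients, hence between their symbols in [s] and
    [t]. It is grouped around [CC], whose square vanishes to sixth order at low frequency, so that
    this term decays fast enough for the energy estimate. *)
Lemma commutator_symbol f s t : smooth f ->
  8 * L0 f s t - 2 * D2 (L0 f) s t - 2 * (cS (cS f) s t + 2 * dT (fun s t => 2 * dT f s t) s t)
  = - 2 * (del (del (dT (dT f))) s t + 8 * CC (CC f) s t).
Proof.
  intros Sf. rewrite (dT_scal 2 (dT f)), del_del by auto with sm. unfold cS at 1. rewrite dS_cS by auto.
  rewrite (CC_eq (CC f)), dS_CC, !CC_eq by auto with sm. rewrite L0_D2. unfold cS, D1, D2, mu, del, sh.
  replace (s + 1 + -1) with s by ring. replace (s + -1 + 1) with s by ring.
  replace (s + / 2 + / 2) with (s + 1) by field. replace (s + - / 2 + - / 2) with (s + -1) by field.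
  replace (s + / 2 + - / 2) with s by field. replace (s + - / 2 + / 2) with s by field. field.
Qed.

(** The terms with coefficients [s] and [t] occur twice with opposite signs, once when [L0] passes
    [tau] and once from the first-order part of [HH]. What remains of them is a second commutator,
    with constant coefficients. *)
Lemma L0_HH f s t : smooth f -> L0 (HH f) s t =
  tau s t * L0 (L0 f) s t - 2 * (del (del (dT (dT f))) s t + 8 * CC (CC f) s t).
Proof.
  intros Sf. unfold HH.
  rewrite (L0_plus (fun s t => tau s t * L0 f s t - 2 * (s * cS f s t + t * (2 * dT f s t))) (fun s t => 4 * f s t - D2 f s t)) by auto 12 with sm.
  rewrite (L0_minus (fun s t => tau s t * L0 f s t) (fun s t => 2 * (s * cS f s t + t * (2 * dT f s t)))) by auto 12 with sm.
  rewrite (L0_scal 2 (fun s t => s * cS f s t + t * (2 * dT f s t))) by auto 12 with sm.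
  rewrite (L0_plus (fun s t => s * cS f s t) (fun s t => t * (2 * dT f s t))) by auto 12 with sm.
  rewrite (L0_minus (fun s t => 4 * f s t) (D2 f)), (L0_scal 4 f), L0_D2_comm by auto with sm.
  rewrite (L0_tau_mult (L0 f)), (L0_s_mult (cS f)), (L0_t_mult (fun s t => 2 * dT f s t)), L0_cS, (L0_scal 2 (dT f)), L0_dT by auto with sm.
  assert (E := commutator_symbol f s t Sf). lra.
Qed.

Lemma L0_zero : L0 (fun _ _ => 0) = fun _ _ => 0.
Proof. rewrite L0_D2, dS_const, dS_const, dT_const, dT_const. apply fun2_ext; intros; unfold D2, sh; ring. Qed.

Theorem fourth_order_eq B : smooth B -> (forall s t, L0 B s t = V1 s t * D2 B s t) -> forall s t,
  tau s t * L0 (L0 (fun s t => tau s t * B s t)) s t =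
  2 * (del (del (dT (dT (fun s t => tau s t * B s t)))) s t + 8 * CC (CC (fun s t => tau s t * B s t)) s t).
Proof.
  intros SB HB s t. assert (SE : smooth (fun s t => tau s t * B s t)) by auto with sm.
  assert (E := L0_HH _ s t SE).
  replace (HH (fun s t => tau s t * B s t)) with (fun _ _ : R => 0) in E.
  - rewrite L0_zero in E. lra.
  - apply fun2_ext; intros x y. rewrite HH_tau, HB by auto. ring.
Qed.

Lemma L0_affine a c : L0 (fun s t => a + 0 * s + c * t) = fun _ _ => 0.
Proof. rewrite L0_D2, dS_affine, dT_affine, dS_const, dT_const. apply fun2_ext; intros; unfold D2, sh; ring. Qed.
(** [L0] maps this cubic to an affine function, which it then annihilates; hence [L0 (L0 (eta r))]
    is the same for all [r]. *)
Lemma L0L0_tau_affine a c : L0 (L0 (fun s t => tau s t * (a + 0 * s + c * t))) = fun _ _ => 0.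
Proof.
  rewrite L0_tau_mult, L0_affine by auto with sm. unfold cS, D1, D2, sh. rewrite dS_affine, dT_affine.
  replace (fun s t => tau s t * 0 + (2 * (s * (4 * 0 - (a + 0 * (s + 1) + c * t - (a + 0 * (s + -1) + c * t))) + t * (2 * c))
     + 4 * (a + 0 * s + c * t) - (a + 0 * (s + 1) + c * t - 2 * (a + 0 * s + c * t) + (a + 0 * (s + -1) + c * t))))
    with (fun s t => 4 * a + 0 * s + 8 * c * t) by (apply fun2_ext; intros; ring).
  apply L0_affine.
Qed.

#[local] Hint Resolve smooth_br : sm.

Lemma SB_tau : SB 2 (fun _ => tau).
Proof.
  apply Sym_ext with (fun _ s t => / 4 + s * s + t * t).
  - intros; unfold tau; ring.
  - apply (SB_plus 2 (fun _ s t => / 4 + s * s) (fun _ s t => t * t)); [|apply SB_tt].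
    apply (SB_plus 2 (fun _ s t => / 4) (fun _ s t => s * s)); [|apply SB_ss]. apply (SB_le 0); [lia | apply SB_const].
Qed.

Lemma pd_tau_affine i j a c : (4 <= i + j)%nat -> pd i j (fun s t => tau s t * (a + 0 * s + c * t)) = fun _ _ => 0.
Proof.
  intros H.
  set (F := fun s t => tau s t * (a + 0 * s + c * t)).
  assert (SF : smooth F) by (unfold F; auto with sm).
  assert (E1 : dS F = fun s t => 2 * (s * (a + c * t))).
  { apply dS_unique; intros; unfold F, tau. auto_derive; auto. ring. }
  assert (E2 : dS (dS F) = fun s t => 2 * a + 0 * s + 2 * c * t).
  { rewrite E1. apply dS_unique; intros. auto_derive; auto. ring. }
  assert (T1 : dT F = fun s t => 2 * (t * (a + c * t)) + c * (/ 4 + s ^ 2 + t ^ 2)).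
  { apply dT_unique; intros; unfold F, tau. auto_derive; auto. ring. }
  assert (T2 : dT (dT F) = fun s t => 2 * a + 0 * s + 6 * c * t).
  { rewrite T1. apply dT_unique; intros. auto_derive; auto. ring. }
  destruct i as [|[|i]]; [| |rewrite !pd_S, E2 by auto with sm; apply pd_affine; lia].
  - destruct j as [|[|j]]; try lia. rewrite !pd_T, T2. apply pd_affine; lia.
  - destruct j as [|[|j]]; try lia. rewrite !pd_T, T2. apply pd_affine; lia.
Qed.

(** * Vanishing of the fourth derivatives of [tau b] *)

Section Rigidity.
Variable u : R -> R -> R.
Hypothesis Su : smooth u.
Hypothesis Eu : forall s t, LL u s t = zf u s t - sh (-1) (zf u) s t.
Hypothesis Du : SO 0 (fun _ => u).

Lemma b_eq s t : L0 (b u) s t = V1 s t * D2 (b u) s t.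
Proof.
  assert (E := LL_b u Su Eu Du s t). rewrite del_del in E. rewrite L0_D2. unfold LL in E. unfold VV in E. lra.
Qed.
Lemma br_eq r s t : L0 (br u r) s t = V1 s t * D2 (br u r) s t.
Proof.
  unfold br. rewrite (L0_minus (b u)), L0_affine, b_eq by auto with sm. unfold D2, sh. ring.
Qed.
(** [eta r] is normalized at the scale [r] and has growth o(r^3) on its ring; [etab] is the single
    function about which conclusions are drawn. They differ by [tau] times an affine function. *)
Definition eta (r : R) : R -> R -> R := fun s t => tau s t * br u r s t.
Definition etab : R -> R -> R := fun s t => tau s t * b u s t.
Lemma eta_etab r : eta r = fun s t => etab s t - tau s t * (b u r 0 + 0 * s + beta u r * t).
Proof. apply fun2_ext; intros; unfold eta, etab, br. ring. Qed.
Lemma smooth_etab : smooth etab.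
Proof. unfold etab; auto with sm. Qed.
Hint Resolve smooth_etab : sm.
Lemma SO_eta : SO 3 eta.
Proof. apply (SO_mult 2 1 (fun _ => tau) (br u)); [apply SB_tau | apply SO_br; auto]. Qed.
Lemma L0L0_eta r : L0 (L0 (eta r)) = L0 (L0 etab).
Proof.
  rewrite eta_etab, (L0_minus etab), (L0_minus (L0 etab)) by auto 10 with sm. rewrite L0L0_tau_affine.
  apply fun2_ext; intros; ring.
Qed.

Lemma etab_biharmonic s t : L0 (L0 etab) s t = 0.
Proof.
  set (g := L0 (L0 etab)). assert (Sg : smooth g) by (unfold g; auto with sm).
  assert (K := energy_tg eta SO_eta (fun r => fourth_order_eq (br u r) (smooth_br u Su Du r) (br_eq r))).
  assert (Z : forall s t, t ^ 2 * g s t ^ 2 = 0).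
  { intros x y. apply (I2_small_zero (fun s t => t ^ 2 * g s t ^ 2)).
    - auto with c0.
    - intros; apply Rmult_le_pos; apply pow2_ge_0.
    - intros e He. destruct (K e He) as (r0 & Hr0 & H). exists r0. intros r Hr. specialize (H r Hr).
      rewrite L0L0_eta in H. apply H. }
  assert (Z1 : forall x y, y <> 0 -> g x y = 0).
  { intros x y Hy. specialize (Z x y). apply Rmult_integral in Z. destruct Z as [Z|Z].
    - exfalso. apply (pow_nonzero y 2); auto.
    - destruct (Req_dec (g x y) 0) as [|Hg]; auto. exfalso. apply (pow_nonzero (g x y) 2); auto. }
  (* The weight [t^2] is silent on the line [t = 0], which is reached by continuity. *)
  destruct (Req_dec t 0) as [->|Ht]; [|apply Z1; auto].
  destruct (Req_dec (g s 0) 0) as [|Hg]; auto. exfalso. assert (P := Rabs_pos_lt _ Hg).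
  destruct (smooth_C0 _ Sg s 0 (mkposreal _ P)) as [d Hd]. simpl in Hd. assert (Hdp := cond_pos d).
  assert (Q := Hd s (d / 2)). rewrite Rminus_diag, Rabs_R0, Rminus_0_r, (Rabs_pos_eq (d / 2)) in Q by lra.
  specialize (Q Hdp ltac:(lra)). rewrite Z1 in Q by lra. rewrite Rminus_0_l, Rabs_Ropp in Q. lra.
Qed.

Lemma L0_pd i j f : smooth f -> L0 (pd i j f) = pd i j (L0 f).
Proof.
  intros Sf. rewrite !L0_D2.
  rewrite (pd_minus i j (fun s t => 2 * dS (dS f) s t + dT (dT f) s t) (D2 f)) by auto 10 with sm.
  change (fun s t => 2 * dS (dS f) s t + dT (dT f) s t) with (LL f). rewrite pd_LL by auto.
  rewrite <- !del_del, !pd_del by auto with sm. reflexivity.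
Qed.
(** Fourth derivatives are insensitive to the normalization and inherit the order [3 - 4 = -1].
    Liouville's theorem is used first for their image under [L0], of order -3, and then for the
    derivatives themselves. *)
Lemma pd_etab_zero i j : (i + j = 4)%nat -> forall s t, pd i j etab s t = 0.
Proof.
  intros H.
  assert (E : forall r, pd i j (eta r) = pd i j etab).
  { intros r. rewrite eta_etab, (pd_minus i j etab), pd_tau_affine by (auto with sm; lia). apply fun2_ext; intros; ring. }
  assert (LOw : LO (-1) (fun _ => pd i j etab)).
  { apply LO_ext with (fun r => pd i j (eta r)); [intros; rewrite E; auto|].
    replace (-1)%Z with (3 - Z.of_nat i - Z.of_nat j)%Z by lia. apply SO_eta. }
  assert (LO2 : LO (-3) (fun _ => L0 (pd i j etab))).
  { apply LO_ext with (fun r => pd i j (L0 (eta r))).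
    - intros. rewrite <- L0_pd, E; auto. apply (SO_sm _ _ SO_eta).
    - replace (-3)%Z with (3 - 2 - Z.of_nat i - Z.of_nat j)%Z by lia. apply (SO_L0 3 eta), SO_eta. }
  apply liouville_LO; auto with sm; [|apply (LO_weak (-1)); [lia | auto]].
  apply liouville_LO; auto with sm; [|apply (LO_weak (-3)); [lia | auto]].
  intros s t. rewrite !L0_pd by auto with sm. replace (L0 (L0 etab)) with (fun _ _ : R => 0).
  - rewrite pd_zero; auto.
  - apply fun2_ext; intros; rewrite etab_biharmonic; auto.
Qed.
End Rigidity.

#[local] Hint Resolve smooth_etab : sm.

(** * Polynomials of degree at most three and the kernel of [HH] *)

Lemma primitive_unique f p : smooth f -> smooth p -> dS f = dS p -> dT f = dT p -> exists c, f = fun s t => c + p s t.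
Proof.
  intros Sf Sp ES ET. exists (f 0 0 - p 0 0). apply fun2_ext; intros s t.
  set (g := fun s t => f s t - p s t).
  assert (Sg : smooth g) by (unfold g; auto with sm).
  assert (GS : forall x y, dS g x y = 0).
  { intros. unfold g. rewrite (dS_minus f p), ES by auto with sm. ring. }
  assert (GT : forall x y, dT g x y = 0).
  { intros. unfold g. rewrite (dT_minus f p), ET by auto with sm. ring. }
  assert (K := mvt_box g (Rabs s + Rabs t) 0 0 0 s t Sg).
  assert (A := Rabs_pos s). assert (B := Rabs_pos t).
  assert (E : Rabs (g s t - g 0 0) <= 0).
  { eapply Rle_trans; [apply K; try lra|lra]; try (rewrite Rabs_R0; lra).
    intros; rewrite GS, GT, Rabs_R0; lra. }
  assert (P := Rabs_pos (g s t - g 0 0)). assert (E0 : g s t - g 0 0 = 0).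
  { destruct (Req_dec (g s t - g 0 0) 0) as [|Hn]; auto. apply Rabs_pos_lt in Hn. lra. }
  unfold g in E0. lra.
Qed.

Lemma pd_dS_zero n f : smooth f -> (forall i j, (i + j = S n)%nat -> pd i j f = fun _ _ => 0) ->
  (forall i j, (i + j = n)%nat -> pd i j (dS f) = fun _ _ => 0) /\ (forall i j, (i + j = n)%nat -> pd i j (dT f) = fun _ _ => 0).
Proof.
  intros Sf H. split; intros i j Hij.
  - rewrite <- pd_S by auto. apply H; lia.
  - rewrite <- pd_T. apply H; lia.
Qed.
Lemma poly_deg0 f : smooth f -> (forall i j, (i + j = 1)%nat -> pd i j f = fun _ _ => 0) -> exists c, f = fun _ _ => c.
Proof.
  intros Sf H. destruct (primitive_unique f (fun _ _ => 0)) as [c E]; auto with sm.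
  - rewrite dS_const. apply (H 1 0)%nat; auto.
  - rewrite dT_const. apply (H 0 1)%nat; auto.
  - exists c. rewrite E. apply fun2_ext; intros; ring.
Qed.
Lemma poly_deg1 f : smooth f -> (forall i j, (i + j = 2)%nat -> pd i j f = fun _ _ => 0) ->
  exists a b c, f = fun s t => a + b * s + c * t.
Proof.
  intros Sf H. destruct (pd_dS_zero 1 f Sf H) as [H1 H2].
  destruct (poly_deg0 (dS f)) as [b Eb]; auto with sm. destruct (poly_deg0 (dT f)) as [c Ec]; auto with sm.
  destruct (primitive_unique f (fun s t => 0 + b * s + c * t)) as [a E]; auto with sm.
  - rewrite dS_affine; auto.
  - rewrite dT_affine; auto.
  - exists a, b, c. rewrite E. apply fun2_ext; intros; ring.
Qed.
Lemma poly_deg2 f : smooth f -> (forall i j, (i + j = 3)%nat -> pd i j f = fun _ _ => 0) ->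
  exists a0 a1 a2 a3 a4 a5, f = fun s t => a0 + a1 * s + a2 * t + a3 * s ^ 2 + a4 * (s * t) + a5 * t ^ 2.
Proof.
  intros Sf H. destruct (pd_dS_zero 2 f Sf H) as [H1 H2].
  destruct (poly_deg1 (dS f)) as (b0 & b1 & b2 & Eb); auto with sm.
  destruct (poly_deg1 (dT f)) as (c0 & c1 & c2 & Ec); auto with sm.
  assert (M : b2 = c1).
  { assert (Q := smooth_dS_dT f Sf). rewrite Eb, Ec, dS_affine, dT_affine in Q.
    symmetry. apply (f_equal (fun f => f 0 0) Q). }
  subst c1.
  set (p := fun s t : R => b0 * s + c0 * t + b1 / 2 * s ^ 2 + b2 * (s * t) + c2 / 2 * t ^ 2).
  destruct (primitive_unique f p) as [a E]; auto; [unfold p; auto 12 with sm | | |].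
  - rewrite Eb. symmetry. apply dS_unique; intros; unfold p. auto_derive; auto. field.
  - rewrite Ec. symmetry. apply dT_unique; intros; unfold p. auto_derive; auto. field.
  - exists a, b0, c0, (b1 / 2), b2, (c2 / 2). rewrite E. apply fun2_ext; intros; unfold p; ring.
Qed.
Lemma poly_deg3 f : smooth f -> (forall i j, (i + j = 4)%nat -> pd i j f = fun _ _ => 0) ->
  exists a0 a1 a2 a3 a4 a5 a6 a7 a8 a9, f = fun s t => a0 + a1 * s + a2 * t + a3 * s ^ 2 + a4 * (s * t) + a5 * t ^ 2
    + a6 * s ^ 3 + a7 * (s ^ 2 * t) + a8 * (s * t ^ 2) + a9 * t ^ 3.
Proof.
  intros Sf H. destruct (pd_dS_zero 3 f Sf H) as [H1 H2].
  destruct (poly_deg2 (dS f)) as (b0 & b1 & b2 & b3 & b4 & b5 & Eb); auto with sm.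
  destruct (poly_deg2 (dT f)) as (c0 & c1 & c2 & c3 & c4 & c5 & Ec); auto with sm.
  assert (M : forall s t, c1 + 2 * c3 * s + c4 * t = b2 + b4 * s + 2 * b5 * t).
  { assert (Q := smooth_dS_dT f Sf). rewrite Eb, Ec in Q.
    rewrite (dS_unique _ (fun s t => c1 + 2 * c3 * s + c4 * t)) in Q by (intros; auto_derive; auto; ring).
    rewrite (dT_unique _ (fun s t => b2 + b4 * s + 2 * b5 * t)) in Q by (intros; auto_derive; auto; ring).
    intros s t. apply (f_equal (fun f => f s t) Q). }
  assert (M0 := M 0 0). assert (M1 := M 1 0). assert (M2 := M 0 1). clear M.
  assert (C1 : c1 = b2) by lra. assert (C3 : c3 = b4 / 2) by lra. assert (C4 : c4 = 2 * b5) by lra.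
  subst c1 c3 c4.
  set (p := fun s t : R => b0 * s + c0 * t + b1 / 2 * s ^ 2 + b2 * (s * t) + c2 / 2 * t ^ 2
    + b3 / 3 * s ^ 3 + b4 / 2 * (s ^ 2 * t) + b5 * (s * t ^ 2) + c5 / 3 * t ^ 3).
  destruct (primitive_unique f p) as [a E]; auto; [unfold p; auto 15 with sm | | |].
  - rewrite Eb. symmetry. apply dS_unique; intros; unfold p. auto_derive; auto. field.
  - rewrite Ec. symmetry. apply dT_unique; intros; unfold p. auto_derive; auto. field.
  - exists a, b0, c0, (b1 / 2), b2, (c2 / 2), (b3 / 3), (b4 / 2), b5, (c5 / 3). rewrite E. apply fun2_ext; intros; unfold p; ring.
Qed.

Lemma HH_cubic_kernel f : smooth f -> (forall i j, (i + j = 4)%nat -> pd i j f = fun _ _ => 0) -> (forall s t, HH f s t = 0) ->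
  exists al be ga c1 c2, forall s t, f s t = tau s t * (ga + al * s + be * t) + (c1 * s + c2 * t).
Proof.
  intros Sf H4 HHf. destruct (poly_deg3 f Sf H4) as (a0 & a1 & a2 & a3 & a4 & a5 & a6 & a7 & a8 & a9 & E).
  assert (ES : dS f = fun s t => a1 + 2 * a3 * s + a4 * t + 3 * a6 * s ^ 2 + 2 * a7 * (s * t) + a8 * t ^ 2).
  { rewrite E. apply dS_unique; intros; auto_derive; auto; ring. }
  assert (ESS : dS (dS f) = fun s t => 2 * a3 + 6 * a6 * s + 2 * a7 * t).
  { rewrite ES. apply dS_unique; intros; auto_derive; auto; ring. }
  assert (ET : dT f = fun s t => a2 + a4 * s + 2 * a5 * t + a7 * s ^ 2 + 2 * a8 * (s * t) + 3 * a9 * t ^ 2).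
  { rewrite E. apply dT_unique; intros; auto_derive; auto; ring. }
  assert (ETT : dT (dT f) = fun s t => 2 * a5 + 2 * a8 * s + 6 * a9 * t).
  { rewrite ET. apply dT_unique; intros; auto_derive; auto; ring. }
  assert (K : forall s t, HH f s t = 0) by auto.
  unfold HH in K. rewrite L0_D2 in K. unfold cS, D1, D2 in K. rewrite ESS, ETT, ES, ET in K. unfold sh, tau in K. rewrite E in K.
  (* [HH] of a cubic is a polynomial; its values at a few lattice points give linear equations that
     fix the relations between the ten coefficients. *)
  assert (K00 := K 0 0). assert (K10 := K 1 0). assert (K20 := K 2 0). assert (Km0 := K (-1) 0).
  assert (K01 := K 0 1). assert (K02 := K 0 2). assert (K0m := K 0 (-1)). assert (K11 := K 1 1). assert (K1m := K 1 (-1)).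
  assert (K21 := K 2 1). assert (K12 := K 1 2). clear K.
  (* The corrections by a quarter come from the constant term of [tau], which multiplies
     [a6 s + a9 t]. *)
  exists a6, a9, a3, (a1 - a6 / 4), (a2 - a9 / 4). intros s t. rewrite E. unfold tau.
  assert (a4 = 0) by lra. assert (a5 = a3) by lra. assert (a0 = a3 / 4) by lra.
  assert (a8 = a6) by lra. assert (a7 = a9) by lra. subst. field.
Qed.

Lemma BO_LO_lt m n F : (m < n)%Z -> BO m F -> LO n F.
Proof.
  intros H HF k e He. destruct (HF k) as (C & r0 & HC & Hr0 & HB).
  exists (Rmax r0 (C / e)). split; [apply Rle_trans with r0; auto; apply Rmax_l|]. intros r s t Hr Hn.
  assert (L1 : r0 <= r) by (eapply Rle_trans; [apply Rmax_l | eauto]).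
  assert (L2 : C / e <= r) by (eapply Rle_trans; [apply Rmax_r | eauto]).
  eapply Rle_trans; [apply HB; auto|].
  assert (L3 : C <= e * r).
  { apply Rmult_le_compat_l with (r := e) in L2; [|lra]. replace (e * (C / e)) with C in L2 by (field; lra). auto. }
  apply Rle_trans with (e * r * powerRZ r m).
  - apply Rmult_le_compat_r; auto. apply Rlt_le, powerRZ_pos; lra.
  - replace (e * r * powerRZ r m) with (e * powerRZ r (1 + m)) by (rewrite powerRZ_plus by lra; simpl; ring).
    apply Rmult_le_compat_l; [lra|].
    replace n with ((1 + m) + (n - (1 + m)))%Z by lia. rewrite (powerRZ_plus r (1 + m)) by lra.
    assert (P := powerRZ_pos r (1 + m) ltac:(lra)).
    replace (n - (1 + m))%Z with (Z.of_nat (Z.to_nat (n - (1 + m)))) by lia. rewrite <- pow_powerRZ.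
    assert (1 <= r ^ Z.to_nat (n - (1 + m))) by (apply pow_R1_Rle; lra). nra.
Qed.

Section Conclusion.
Variable u : R -> R -> R.
Hypothesis Su : smooth u.
Hypothesis Eu : forall s t, LL u s t = zf u s t - sh (-1) (zf u) s t.
Hypothesis Hu : LO 0 (fun _ => u).

Theorem decaying_solution : exists c1 c2, forall s t,
  u s t = (c1 * (s + -1) + c2 * t) / tau (s + -1) t - (c1 * s + c2 * t) / tau s t.
Proof.
  assert (Du := SO_decay u Su Eu Hu).
  assert (Sb : smooth (etab u)) by auto with sm.
  destruct (HH_cubic_kernel (etab u) Sb) as (al & be & ga & c1 & c2 & E).
  - intros i j Hij. apply fun2_ext; intros. apply pd_etab_zero; auto.
  - intros s t. unfold etab. rewrite HH_tau by auto with sm. rewrite b_eq by auto. ring.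
  - assert (Eb : forall s t, b u s t = ga + al * s + be * t + (c1 * s + c2 * t) / tau s t).
    { intros s t. assert (Q := E s t). unfold etab in Q. assert (T := tau_ne s t).
      apply Rmult_eq_reg_l with (tau s t); auto. rewrite Q. field; auto. }
    assert (F : forall s t, u s t = - al + ((c1 * (s + -1) + c2 * t) / tau (s + -1) t - (c1 * s + c2 * t) / tau s t)).
    { intros s t. rewrite <- (b_diff u Su Du). unfold sh. rewrite !Eb. ring. }
    (* The difference [T^-1 - 1] turns the affine part of [b] into the constant [- al]. The
       fractions are O(1/r), so this constant is the limit of [u] at infinity. *)
    assert (Al : al = 0).
    { set (rr := fun s t => (c1 * s + c2 * t) * itau s t).
      assert (Lr : LO 0 (fun _ s t => sh (-1) rr s t - rr s t)).
      { assert (Lrr : LO 0 (fun _ => rr)).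
        { apply BO_LO_lt with (-1)%Z; [lia|]. apply (BO_mult 1 (-2) (fun _ s t => c1 * s + c2 * t) (fun _ => itau)).
          - apply BO_plus.
            + apply (BO_mult 0 1 (fun _ _ _ => c1) (fun _ s _ => s)); [apply BO_const | apply (Sym_B BO 1), SB_s].
            + apply (BO_mult 0 1 (fun _ _ _ => c2) (fun _ _ t => t)); [apply BO_const | apply (Sym_B BO 1), SB_t].
          - apply (Sym_B BO (-2)), SB_itau. }
        apply (LO_minus 0 (fun _ => sh (-1) rr) (fun _ => rr)); auto. apply (LO_sh 0 (-1) (fun _ => rr)); auto. }
      assert (La : LO 0 (fun _ s t => - al)).
      { apply LO_ext with (fun _ s t => u s t - (sh (-1) rr s t - rr s t)).
        - intros _ s t. rewrite F. unfold rr, sh, itau. field. split; apply tau_ne.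
        - apply (LO_minus 0 (fun _ => u) (fun _ s t => sh (-1) rr s t - rr s t)); auto. }
      destruct (Req_dec al 0) as [|Hn]; auto. exfalso. assert (P := Rabs_pos_lt _ Hn).
      destruct (proj1 (LO_c 0 (fun _ _ => - al)) La (Rabs al / 2)) as (r0 & Hr0 & B); [lra|].
      specialize (B r0 0). assert (Q := Nm_ge_s r0 0). rewrite Rabs_pos_eq in Q by lra. specialize (B Q).
      rewrite Rabs_Ropp in B. simpl in B. lra. }
    exists c1, c2. intros s t. rewrite F, Al. ring.
Qed.
End Conclusion.

(** * Back to the Toda lattice *)

Definition rescale (a c : R) (f : R -> R -> R) : R -> R -> R := fun s t => f (a * s) (c * t).
Lemma C0_rescale a c f : C0 f -> C0 (rescale a c f).
Proof.
  intros H. apply (C0_comp2 f (fun s _ => a * s) (fun _ t => c * t)); auto with c0.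
Qed.
Lemma isS_rescale a c f s t : diffS f -> is_derive (fun z => rescale a c f z t) s (a * rescale a c (dS f) s t).
Proof.
  intros H. unfold rescale. evar_last.
  - apply (is_derive_comp (fun z => f z (c * t)) (fun z => a * z)); [apply is_derive_dS; auto|].
    apply (is_derive_scal (fun z => z)), is_derive_lin1.
  - unfold scal; simpl; unfold mult; simpl; ring.
Qed.
Lemma isT_rescale a c f s t : diffT f -> is_derive (fun z => rescale a c f s z) t (c * rescale a c (dT f) s t).
Proof.
  intros H. unfold rescale. evar_last.
  - apply (is_derive_comp (fun z => f (a * s) z) (fun z => c * z)); [apply is_derive_dT; auto|].
    apply (is_derive_scal (fun z => z)), is_derive_lin1.
  - unfold scal; simpl; unfold mult; simpl; ring.
Qed.
Lemma dS_rescale a c f : diffS f -> dS (rescale a c f) = fun s t => a * rescale a c (dS f) s t.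
Proof. intros; apply dS_unique; intros; apply isS_rescale; auto. Qed.
Lemma dT_rescale a c f : diffT f -> dT (rescale a c f) = fun s t => c * rescale a c (dT f) s t.
Proof. intros; apply dT_unique; intros; apply isT_rescale; auto. Qed.
Lemma Ck_rescale n a c f : Ck n f -> Ck n (rescale a c f).
Proof.
  revert f; induction n; intros f Hf.
  - split; [apply C0_rescale, Hf | exact I].
  - destruct Hf as (f0 & f1 & f2 & f3 & f4). split; [apply C0_rescale; auto|]. repeat split.
    + eapply diffS_intro; intros; apply isS_rescale; auto.
    + eapply diffT_intro; intros; apply isT_rescale; auto.
    + rewrite dS_rescale by auto. apply Ck_scal; auto.
    + rewrite dT_rescale by auto. apply Ck_scal; auto.
Qed.

(** The right-hand side has exactly the regularity of [u], since it contains no derivative, and each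
    [regularity_step] gains one. *)
Lemma smooth_solution u : Ck 2 u -> (forall s t, LL u s t = zf u s t - sh (-1) (zf u) s t) -> smooth u.
Proof.
  intros H2 Eu. assert (Q : forall n, Ck (S (S n)) u).
  { induction n; auto. apply regularity_step; auto.
    replace (LL u) with (fun s t => zf u s t - sh (-1) (zf u) s t) by (apply fun2_ext; intros; rewrite Eu; auto).
    assert (Ck (S (S n)) (zf u)).
    { unfold zf, uD. apply Ck_mult; [apply smooth_VV|]. apply Ck_minus; auto. apply Ck_sh; auto. }
    apply Ck_minus; auto. apply Ck_sh; auto. }
  intros n. apply (Ck_le (S (S n))); auto.
Qed.

Lemma sqrt8_sq : (2 * sqrt 2) * (2 * sqrt 2) = 8.
Proof. assert (H := sqrt_sqrt 2 ltac:(lra)). nra. Qed.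
Lemma sqrt8_pos : 0 < 2 * sqrt 2.
Proof. assert (H := sqrt_lt_R0 2 ltac:(lra)). lra. Qed.

Lemma Q_tau n x y : Q n x y = ln (tau (IZR n + 2 * sqrt 2 * x + -1) (2 * y) / tau (IZR n + 2 * sqrt 2 * x) (2 * y)).
Proof. unfold Q, tau. f_equal. f_equal; [field | f_equal; field]. Qed.
(** The two quotients of translates of [tau] telescope into the potential of the scalar equation. *)
Lemma exp_Q_diff n x y : exp (Q n x y - Q (n + 1) x y) = VV (IZR n + 2 * sqrt 2 * x) (2 * y).
Proof.
  rewrite !Q_tau, VV_tau, plus_IZR. set (s := IZR n + 2 * sqrt 2 * x).
  replace (IZR n + 1 + 2 * sqrt 2 * x) with (s + 1) by (unfold s; ring).
  replace (s + 1 + -1) with s by ring.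
  assert (P0 := tau_pos s (2 * y)). assert (P1 := tau_pos (s + 1) (2 * y)). assert (Pm := tau_pos (s + -1) (2 * y)).
  unfold Rminus. rewrite exp_plus, exp_Ropp, !exp_ln by (apply Rdiv_lt_0_compat; auto). field. lra.
Qed.
Lemma d_x_Q n x y : d_x (Q n) x y = 2 * (2 * sqrt 2) *
  ((IZR n + 2 * sqrt 2 * x + -1) / tau (IZR n + 2 * sqrt 2 * x + -1) (2 * y) - (IZR n + 2 * sqrt 2 * x) / tau (IZR n + 2 * sqrt 2 * x) (2 * y)).
Proof.
  unfold d_x, partial_derive. simpl. apply is_derive_unique.
  apply (is_derive_ext (fun x => ln (tau (IZR n + 2 * sqrt 2 * x + -1) (2 * y)) - ln (tau (IZR n + 2 * sqrt 2 * x) (2 * y)))).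
  { intros z. rewrite Q_tau, ln_div; auto using tau_pos. }
  assert (P0 := tau_pos (IZR n + 2 * sqrt 2 * x) (2 * y)). assert (P1 := tau_pos (IZR n + 2 * sqrt 2 * x + -1) (2 * y)).
  unfold tau in *. auto_derive; [split; auto|]. simpl in *. field. lra.
Qed.
Lemma d_y_Q n x y : d_y (Q n) x y = 4 *
  (2 * y / tau (IZR n + 2 * sqrt 2 * x + -1) (2 * y) - 2 * y / tau (IZR n + 2 * sqrt 2 * x) (2 * y)).
Proof.
  unfold d_y, partial_derive. simpl. apply is_derive_unique.
  apply (is_derive_ext (fun y => ln (tau (IZR n + 2 * sqrt 2 * x + -1) (2 * y)) - ln (tau (IZR n + 2 * sqrt 2 * x) (2 * y)))).
  { intros z. rewrite Q_tau, ln_div; auto using tau_pos. }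
  assert (P0 := tau_pos (IZR n + 2 * sqrt 2 * x) (2 * y)). assert (P1 := tau_pos (IZR n + 2 * sqrt 2 * x + -1) (2 * y)).
  unfold tau in *. auto_derive; [split; auto|]. simpl in *. field. lra.
Qed.

Section Translation.
Variable U : Z -> R -> R -> R.
Hypothesis HU : linearized_Toda_solution U.
Hypothesis Hshift : forall (n : Z) (x y : R), U (n + 1)%Z x y = U n (x + 1 / (2 * sqrt 2)) y.
Hypothesis Hvan : forall n : Z, vanishes_at_infty (U n).

Definition profile : R -> R -> R := rescale (/ (2 * sqrt 2)) (/ 2) (U 0).

(** One lattice step is a translation of [x] by [1 / (2 sqrt 2)], hence of [s] by 1; the induction
    runs over [Z] in both directions. *)
Lemma U_profile n x y : U n x y = profile (IZR n + 2 * sqrt 2 * x) (2 * y).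
Proof.
  assert (P := sqrt8_pos).
  assert (E : forall n x y, U n x y = U 0%Z (x + IZR n / (2 * sqrt 2)) y).
  { intros m. induction m using Z.peano_ind; intros x' y'.
    - f_equal. field. lra.
    - replace (Z.succ m) with (m + 1)%Z by lia. rewrite Hshift, IHm, plus_IZR. f_equal. field. lra.
    - assert (A := Hshift (Z.pred m) (x' - 1 / (2 * sqrt 2)) y').
      replace (Z.pred m + 1)%Z with m in A by lia. replace (x' - 1 / (2 * sqrt 2) + 1 / (2 * sqrt 2)) with x' in A by ring.
      rewrite <- A, IHm. unfold Z.pred. rewrite plus_IZR. f_equal. field. lra. }
  rewrite E. unfold profile, rescale. f_equal; field; lra.
Qed.
Lemma Ck2_profile : Ck 2 profile.
Proof. apply Ck_rescale, ex_diff_n_Ck. apply HU. Qed.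
Lemma profile_eq s t : LL profile s t = zf profile s t - sh (-1) (zf profile) s t.
Proof.
  assert (P := sqrt8_pos). assert (C2 : Ck 2 (U 0%Z)) by (apply ex_diff_n_Ck, HU).
  set (x := / (2 * sqrt 2) * s). set (y := / 2 * t).
  assert (E := proj2 HU 0%Z x y).
  assert (EL : 1 / 4 * Laplacian (U 0%Z) x y = LL profile s t).
  { change (Laplacian (U 0%Z) x y) with (dS (dS (U 0%Z)) x y + dT (dT (U 0%Z)) x y).
    destruct C2 as (f0 & f1 & f2 & (g0 & g1 & g2 & _) & (h0 & h1 & h2 & _)).
    unfold LL, profile. rewrite dS_rescale, dT_rescale by auto.
    rewrite (dS_scal _ (rescale _ _ (dS (U 0%Z)))), (dT_scal _ (rescale _ _ (dT (U 0%Z)))).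
    - rewrite dS_rescale, dT_rescale by auto. unfold rescale. fold x y.
      replace (2 * (/ (2 * sqrt 2) * (/ (2 * sqrt 2) * dS (dS (U 0%Z)) x y))) with (2 * / ((2 * sqrt 2) * (2 * sqrt 2)) * dS (dS (U 0%Z)) x y) by (field; lra).
      rewrite sqrt8_sq. field.
    - eapply diffT_intro; intros; apply isT_rescale; auto.
    - eapply diffS_intro; intros; apply isS_rescale; auto. }
  (* The first coefficient contains [Q (0 - 1) - Q 0]; writing the second index as [-1 + 1] brings
     it to the form of [exp_Q_diff]. *)
  rewrite EL in E. rewrite E. replace 0%Z with (-1 + 1)%Z at 2 by lia. simpl (0 - 1)%Z.
  rewrite !exp_Q_diff, !U_profile. simpl (0 + 1)%Z.
  assert (X0 : IZR 0 + 2 * sqrt 2 * x = s) by (unfold x; simpl; field; lra).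
  assert (X1 : IZR 1 + 2 * sqrt 2 * x = s + 1) by (unfold x; simpl; field; lra).
  assert (Xm : IZR (-1) + 2 * sqrt 2 * x = s + -1) by (unfold x; simpl; field; lra).
  rewrite X0, X1, Xm. replace (2 * y) with t by (unfold y; field).
  unfold zf, uD, sh. replace (s + -1 + 1) with s by ring. ring.
Qed.
Lemma profile_LO : LO 0 (fun _ => profile).
Proof.
  apply LO_c. intros e He. assert (P := sqrt8_pos).
  assert (V := Hvan 0%Z _ (locally_ball 0 (mkposreal e He))).
  (* The rescaling gives [x^2 + y^2 = s^2 / 8 + t^2 / 4], at least an eighth of the squared norm;
     since the norm is at least 1, the radius [1 + 8 * Rabs M] is enough. *)
  destruct V as [M HM]. exists (1 + 8 * Rabs M). assert (A := Rabs_pos M). split; [lra|].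
  intros s t Hst. simpl. rewrite Rmult_1_r. unfold profile, rescale.
  set (x := / (2 * sqrt 2) * s). set (y := / 2 * t).
  assert (Hxy : M < x ^ 2 + y ^ 2).
  { assert (Ex : x ^ 2 = s ^ 2 / 8).
    { unfold x. rewrite <- sqrt8_sq. field. lra. }
    assert (Ey : y ^ 2 = t ^ 2 / 4) by (unfold y; field).
    rewrite Ex, Ey. assert (N := tau_Nm s t).
    assert (Nm s t ^ 2 <= s ^ 2 + t ^ 2).
    { unfold Nm, Rmax. assert (B := pow2_ge_0 s). assert (B' := pow2_ge_0 t).
      destruct (Rle_dec (Rabs s) (Rabs t)); rewrite pow2_abs; lra. }
    assert (B := pow2_ge_0 t). assert (RA := Rle_abs M). nra. }
  specialize (HM x y Hxy). simpl in HM. unfold ball in HM; simpl in HM. unfold AbsRing_ball, abs, minus, plus, opp in HM; simpl in HM.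
  rewrite Ropp_0, Rplus_0_r in HM. lra.
Qed.
End Translation.

Theorem theorem1 :
  forall U : Z -> R -> R -> R,
    linearized_Toda_solution U ->
    (forall (n : Z) (x y : R),
        U (n + 1)%Z x y = U n (x + 1 / (2 * sqrt 2)) y) ->
    (forall n : Z, vanishes_at_infty (U n)) ->
    exists c1 c2 : R,
      forall (n : Z) (x y : R),
        U n x y = c1 * d_x (Q n) x y + c2 * d_y (Q n) x y.
Proof.
  intros U HU Hshift Hvan. assert (P := sqrt8_pos).
  assert (Eu := profile_eq U HU Hshift).
  destruct (decaying_solution (profile U)) as (c1 & c2 & E); auto.
  - apply smooth_solution; auto. apply Ck2_profile; auto.
  - apply profile_LO; auto.
  (* The divisors undo the prefactors of [d_x_Q] and [d_y_Q]. *)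
  - exists (c1 / (2 * (2 * sqrt 2))), (c2 / 4). intros n x y.
    rewrite (U_profile U Hshift), E, d_x_Q, d_y_Q.
    set (s := IZR n + 2 * sqrt 2 * x). assert (T0 := tau_ne s (2 * y)). assert (T1 := tau_ne (s + -1) (2 * y)).
    field. repeat split; auto; lra.
Qed.
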